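(* Let $\mathcal{M}(x)=\sum_{p\leqslant x}H(p-1)$, the sum over primes $p\leqslant x$. Define $d_1=1$ and, for $m\geqslant 2$, $d_m=-\sum_{d>1}\mathcal{F}_{m-1}(d)/\varphi(d)$, and put $c_0=\sum_{m=1}^{\infty}d_m$. Then for every fixed $A\geqslant 2$, $$\mathcal{M}(x)=c_0\,\pi(x)+O_A\!\left(\frac{x}{(\log x)^A}\right),$$ where the implied constant depends only on $A$, and $c_0=1.7083\ldots$ (i.e. $1.7083\leqslant c_0<1.7084$).
   Context: For a natural number $n$, $H(n)$ is the height of its factorization tree, defined recursively by $H(1)=0$ and, for $n=p_1^{\alpha_1}\cdots p_k^{\alpha_k}>1$ with distinct primes $p_i$, $H(n)=1+\max_i H(\alpha_i)$. For $m\geqslant 0$ and $n\geqslant 1$ let $f_m(n)=1$ if $H(n)\leqslant m$ and $f_m(n)=0$ otherwise; the function $\mathcal{F}_m$ is defined by $f_m(n)=\sum_{d\mid n}\mathcal{F}_m(d)$ for all $n\geqslant1$ (i.e. $\mathcal{F}_m(n)=\sum_{d\mid n}\mu(n/d)f_m(d)$). $\varphi$ is Euler's function and $\pi(x)$ is the number of primes up to $x$. *)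

(* Defs.v *)
From Stdlib Require Import Reals.
From Coquelicot Require Import Coquelicot.
From mathcomp Require Import ssreflect ssrfun ssrbool eqtype ssrnat seq div prime bigop.
Local Open Scope nat_scope.

(* Height of the factorization tree.  For n = p_1^a_1 ... p_k^a_k > 1,
   H n = 1 + max_i H (a_i), and H 1 = 0.  The recursion is on the exponents,
   which are < n; we implement it with a fuel argument (fuel n suffices since
   every exponent a of n >= 2 satisfies a < n, so the fuel never runs out). *)
Fixpoint Hfuel (fuel n : nat) : nat :=
  match fuel with
  | 0 => 0
  | k.+1 => if n <= 1 then 0
            else (\max_(p <- primes n) Hfuel k (logn p n)).+1
  end.

Definition H (n : nat) : nat := Hfuel n n.

Definition f (m n : nat) : R := if H n <= m then 1%R else 0%R.

Definition squarefree (n : nat) : bool := all (fun p => logn p n <= 1) (primes n).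
Definition mu (n : nat) : R :=
  if (0 < n) && squarefree n then ((-1) ^ size (primes n))%R else 0%R.

Definition F (m n : nat) : R :=
  \big[Rplus/0%R]_(d <- divisors n) (mu (n %/ d) * f m d)%R.

Definition dterm (m k : nat) : R := (F m (k.+2) / INR (totient k.+2))%R.

Definition dcoef (m : nat) : R :=
  if m <= 1 then 1%R else (- Series (dterm m.-1))%R.

Definition c0 : R := Series (fun k => dcoef k.+1).

(* floor of a real, as a nat (0 for negative x) *)
Definition nfloor (x : R) : nat := Z.to_nat (Int_part x).

Definition primepi (x : R) : R :=
  \big[Rplus/0%R]_(p <- iota 0 (nfloor x).+1 | prime p) 1%R.

Definition Msum (x : R) : R :=
  \big[Rplus/0%R]_(p <- iota 0 (nfloor x).+1 | prime p) INR (H p.-1).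

(* Main.v *)
From HB Require Import structures.
From Stdlib Require Import Reals Ranalysis5 Lra Lia ZArith Classical_Prop.
From Coquelicot Require Import Coquelicot.
From mathcomp Require Import ssreflect ssrfun ssrbool eqtype ssrnat seq choice fintype div prime bigop.
From mathcomp Require Import zify_ssreflect.
Require Import Defs.

(* Summing f_m(p-1) = sum_(d | p-1) F_m(d) over primes reduces the mean of H(p-1) to the
   counts of primes p = 1 mod d.  The function F_m is multiplicative, bounded by 1 and, for
   m >= 1, supported on powerful numbers that are 1 or at least 2^(2^m); since the sum of
   1/phi(d) over powerful d > D is O(D^(-1/8)), moduli d > (ln x)^B are treated trivially and
   smaller ones by the Siegel-Walfisz theorem, uniformly in the O(ln x) relevant values of m.
   No prime number theorem is needed, because the main term is pi(x)/phi(d) itself.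

   The Siegel-Walfisz theorem is proved by real-variable means.  At s = 1 + 1/y + i t, with
   y = ln x, a lower bound y^(-c) for |L(s, chi)| comes from Mertens' inequality and from
   Siegel's theorem (in Estermann's form, through Taylor coefficients at s = 2); the Leibniz
   rule then bounds all derivatives of L'/L by powers of y smaller than the trivial ones, and
   a high derivative, a Fejer kernel and partial summation give the sum over primes.

   For the numerical value, d_(m+1) = 1 - prod_p (1 - sum_(H(a) >= m) p^(-a)). *)

Local Open Scope R_scope.

(** Dirichlet series are evaluated only where they converge absolutely; continuation past Re s = 1
    is replaced by partial summation and, on the real axis, by Taylor series at s = 2. The distance
    1/y from the line costs nothing over the primes up to exp y, as n^(1/y) stays bounded there. The
    estimates are expressed in z = y^(1/16), so that powers of logarithms and the bounds for L
    become powers of z. Each derivative of L costs a factor z and each division by L a factor z^13,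
    so the recursion for the k-th derivative of L'/L gives z^(14 (k + 1)), against z^(16 (k + 2))
    from absolute convergence. This gain of z^2 per derivative accumulates, so that a k of size 24 A
    beats the fixed power y^A, after the losses in the kernel and in partial summation. Siegel's
    theorem enters for real characters near t = 0; there the 3-4-1 inequality fails because the
    square of the character brings in the pole of zeta. *)

HB.instance Definition _ :=
  Monoid.isComLaw.Build R 0 Rplus
    (fun x y z => esym (Rplus_assoc x y z)) Rplus_comm Rplus_0_l.
HB.instance Definition _ :=
  Monoid.isComLaw.Build R 1 Rmult
    (fun x y z => esym (Rmult_assoc x y z)) Rmult_comm Rmult_1_l.
HB.instance Definition _ := Monoid.isMulLaw.Build R 0 Rmult Rmult_0_l Rmult_0_r.
HB.instance Definition _ :=
  Monoid.isAddLaw.Build R Rmult Rplus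
    (fun x y z => Rmult_plus_distr_r x y z) (fun x y z => Rmult_plus_distr_l x y z).

Lemma CplusA (x y z : C) : Cplus x (Cplus y z) = Cplus (Cplus x y) z.
Proof. by rewrite Cplus_assoc. Qed.
Lemma CmultA (x y z : C) : Cmult x (Cmult y z) = Cmult (Cmult x y) z.
Proof. by rewrite Cmult_assoc. Qed.

HB.instance Definition _ :=
  Monoid.isComLaw.Build C (RtoC 0) Cplus CplusA Cplus_comm Cplus_0_l.
HB.instance Definition _ :=
  Monoid.isComLaw.Build C (RtoC 1) Cmult CmultA Cmult_comm Cmult_1_l.
HB.instance Definition _ :=
  Monoid.isMulLaw.Build C (RtoC 0) Cmult Cmult_0_l Cmult_0_r.
HB.instance Definition _ :=
  Monoid.isAddLaw.Build C Cmult Cplus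
    (fun x y z => Cmult_plus_distr_r x y z) (fun x y z => Cmult_plus_distr_l x y z).

Notation "\rsum_ ( m <= i < n ) F" := (\big[Rplus/0%R]_(m%N <= i < n%N) F%R)
  (at level 41, F at level 41, i, m, n at level 50).
Notation "\rsum_ ( m <= i < n | P ) F" := (\big[Rplus/0%R]_(m%N <= i < n%N | P%B) F%R)
  (at level 41, F at level 41, i, m, n at level 50).
Notation "\rsum_ ( i <- r ) F" := (\big[Rplus/0%R]_(i <- r) F%R)
  (at level 41, F at level 41, i, r at level 50).
Notation "\rsum_ ( i <- r | P ) F" := (\big[Rplus/0%R]_(i <- r | P%B) F%R)
  (at level 41, F at level 41, i, r at level 50).
Notation "\csum_ ( m <= i < n ) F" := (\big[Cplus/RtoC 0]_(m%N <= i < n%N) F%C)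
  (at level 41, F at level 41, i, m, n at level 50).
Notation "\csum_ ( m <= i < n | P ) F" := (\big[Cplus/RtoC 0]_(m%N <= i < n%N | P%B) F%C)
  (at level 41, F at level 41, i, m, n at level 50).
Notation "\csum_ ( i <- r ) F" := (\big[Cplus/RtoC 0]_(i <- r) F%C)
  (at level 41, F at level 41, i, r at level 50).
Notation "\csum_ ( i <- r | P ) F" := (\big[Cplus/RtoC 0]_(i <- r | P%B) F%C)
  (at level 41, F at level 41, i, r at level 50).

(** * Finite sums over the reals and the complex numbers *)

Lemma rsum_le (I : eqType) (r : seq I) (P : pred I) (F G : I -> R) :
  (forall i, i \in r -> P i -> F i <= G i) ->
  \rsum_(i <- r | P i) F i <= \rsum_(i <- r | P i) G i.
Proof.
move=> h; rewrite big_seq_cond [X in _ <= X]big_seq_cond.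
elim/big_rec2: _ => [|i x y /andP[ir Pi] xy]; [lra | have := h i ir Pi; lra].
Qed.

Lemma rsum_ge0 (I : eqType) (r : seq I) (P : pred I) (F : I -> R) :
  (forall i, i \in r -> P i -> 0 <= F i) -> 0 <= \rsum_(i <- r | P i) F i.
Proof.
move=> h; rewrite big_seq_cond.
elim/big_ind: _ => [||i /andP[ir Pi]]; [lra | move=> *; lra | exact: h].
Qed.

Lemma rsum_nat_le m n (F G : nat -> R) :
  (forall i, (m <= i < n)%N -> F i <= G i) ->
  \rsum_(m <= i < n) F i <= \rsum_(m <= i < n) G i.
Proof. by move=> h; apply: rsum_le => i; rewrite mem_index_iota => hi _; apply: h. Qed.

Lemma rsum_nat_ge0 m n (F : nat -> R) :
  (forall i, (m <= i < n)%N -> 0 <= F i) -> 0 <= \rsum_(m <= i < n) F i.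
Proof. by move=> h; apply: rsum_ge0 => i; rewrite mem_index_iota => hi _; apply: h. Qed.

Lemma rsum_abs (I : Type) (r : seq I) (P : pred I) (F : I -> R) :
  Rabs (\rsum_(i <- r | P i) F i) <= \rsum_(i <- r | P i) Rabs (F i).
Proof.
elim/big_rec2: _ => [|i x y _ h]; first by rewrite Rabs_R0; lra.
by have := Rabs_triang (F i) y; lra.
Qed.

Lemma csum_mod (I : Type) (r : seq I) (P : pred I) (F : I -> C) :
  Cmod (\csum_(i <- r | P i) F i) <= \rsum_(i <- r | P i) Cmod (F i).
Proof.
elim/big_rec2: _ => [|i x y _ h]; first by rewrite Cmod_0; lra.
by have := Cmod_triangle (F i) y; lra.
Qed.

Lemma rsum_opp (I : Type) (r : seq I) (P : pred I) (F : I -> R) :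
  \rsum_(i <- r | P i) (- F i) = - \rsum_(i <- r | P i) F i.
Proof. by elim/big_rec2: _ => [|i x y _ ->]; ring. Qed.

Lemma rsum_sub (I : Type) (r : seq I) (P : pred I) (F G : I -> R) :
  \rsum_(i <- r | P i) (F i - G i) =
  \rsum_(i <- r | P i) F i - \rsum_(i <- r | P i) G i.
Proof. by rewrite /Rminus big_split rsum_opp. Qed.

Lemma csum_opp (I : Type) (r : seq I) (P : pred I) (F : I -> C) :
  \csum_(i <- r | P i) (- F i) = Copp (\csum_(i <- r | P i) F i).
Proof. by elim/big_rec2: _ => [|i x y _ ->]; ring. Qed.

Lemma csum_sub (I : Type) (r : seq I) (P : pred I) (F G : I -> C) :
  \csum_(i <- r | P i) (F i - G i) =
  Cminus (\csum_(i <- r | P i) F i) (\csum_(i <- r | P i) G i).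
Proof. by rewrite /Cminus big_split csum_opp. Qed.

Lemma csum_RtoC (I : Type) (r : seq I) (P : pred I) (F : I -> R) :
  \csum_(i <- r | P i) RtoC (F i) = RtoC (\rsum_(i <- r | P i) F i).
Proof. by elim/big_rec2: _ => [//|i x y _ ->]; rewrite RtoC_plus. Qed.

Lemma csum_Re (I : Type) (r : seq I) (P : pred I) (F : I -> C) :
  Re (\csum_(i <- r | P i) F i) = \rsum_(i <- r | P i) Re (F i).
Proof. by elim/big_rec2: _ => [//|i x y _ <-]. Qed.

Lemma csum_Im (I : Type) (r : seq I) (P : pred I) (F : I -> C) :
  Im (\csum_(i <- r | P i) F i) = \rsum_(i <- r | P i) Im (F i).
Proof. by elim/big_rec2: _ => [//|i x y _ <-]. Qed.

Lemma rsum_subset (I : eqType) (r : seq I) (P Q : pred I) (F : I -> R) :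
  (forall i, i \in r -> P i -> Q i) ->
  (forall i, i \in r -> Q i -> 0 <= F i) ->
  \rsum_(i <- r | P i) F i <= \rsum_(i <- r | Q i) F i.
Proof.
move=> PQ F0; rewrite [X in X <= _]big_mkcond [X in _ <= X]big_mkcond.
apply: rsum_le => i ir _; have := PQ i ir; have := F0 i ir.
by case: (P i); case: (Q i) => //= h1 h2; try lra; [have := h2 isT | have := h1 isT].
Qed.

Lemma rsum_nat_widen m n m' n' (F : nat -> R) :
  (m' <= m)%N -> (n <= n')%N -> (forall i, (m' <= i < n')%N -> 0 <= F i) ->
  \rsum_(m <= i < n) F i <= \rsum_(m' <= i < n') F i.
Proof.
move=> hm hn F0.
case: (leqP m n) => mn; last first.
  by rewrite big_geq ?(ltnW mn) //; apply: rsum_nat_ge0.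
rewrite [X in _ <= X](@big_cat_nat _ _ _ n) //=; last by lia.
rewrite [X in _ <= X + _](@big_cat_nat _ _ _ m) //=.
have h1 : 0 <= \rsum_(m' <= i < m) F i by apply: rsum_nat_ge0 => i hi; apply: F0; lia.
have h2 : 0 <= \rsum_(n <= i < n') F i by apply: rsum_nat_ge0 => i hi; apply: F0; lia.
lra.
Qed.

Lemma rsum_const m n (c : R) : \rsum_(m <= i < n) c = INR (n - m) * c.
Proof.
rewrite big_const_nat; elim: (n - m)%N => [|k IH]; first by rewrite /=; ring.
by rewrite iterS IH S_INR; ring.
Qed.

Lemma rsum_telescope m n (F : nat -> R) : (m <= n)%N ->
  \rsum_(m <= i < n) (F i.+1 - F i) = F n - F m.
Proof.
move=> /subnK <-; elim: (n - m)%N => [|k IH]; first by rewrite add0n big_geq //; ring.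
by rewrite addSn big_nat_recr /=; [rewrite IH; ring | lia].
Qed.

Lemma csum_telescope m n (F : nat -> C) : (m <= n)%N ->
  \csum_(m <= i < n) (F i.+1 - F i) = Cminus (F n) (F m).
Proof.
move=> /subnK <-; elim: (n - m)%N => [|k IH]; first by rewrite add0n big_geq //; ring.
by rewrite addSn big_nat_recr /=; [rewrite IH; ring | lia].
Qed.

Lemma sum_n_rsum (a : nat -> R) n : sum_n a n = \rsum_(0 <= i < n.+1) a i.
Proof.
elim: n => [|n IH]; first by rewrite sum_O big_nat1.
by rewrite sum_Sn IH [RHS]big_nat_recr.
Qed.

Lemma rsum_shift (a : nat -> R) n : \rsum_(1 <= i < n.+1) a i = \rsum_(0 <= i < n) a i.+1.
Proof. by rewrite big_add1. Qed.

Lemma is_series_rsum (a : nat -> R) (l : R) :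
  is_series a l <->
  (forall eps, 0 < eps -> exists N, forall n, (N <= n)%N ->
     Rabs (\rsum_(0 <= i < n) a i - l) < eps).
Proof.
split=> h.
- move=> eps e0.
  have /is_lim_seq_spec hl : is_lim_seq (sum_n a) l by [].
  have [N hN] := hl (mkposreal _ e0).
  exists N.+1 => -[//|n] Nn; rewrite -sum_n_rsum; apply: hN; lia.
- suff : is_lim_seq (sum_n a) l by [].
  apply/is_lim_seq_spec => eps.
  have [N hN] := h _ (cond_pos eps).
  by exists N => n nN; rewrite sum_n_rsum; apply: hN; lia.
Qed.

Lemma ex_series_bounded (a : nat -> R) M :
  (forall n, 0 <= a n) -> (forall n, \rsum_(0 <= i < n) a i <= M) -> ex_series a.
Proof.
move=> a0 aM.
have [l hl] : ex_finite_lim_seq (sum_n a).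
  apply: (ex_finite_lim_seq_incr _ M) => n; last by rewrite sum_n_rsum.
  by rewrite sum_Sn /plus /=; have := a0 n.+1; lra.
by exists l.
Qed.

(** * Absolutely convergent complex series *)

Lemma Re_Cmod (z : C) : Rabs (Re z) <= Cmod z.
Proof. by apply: Rle_trans (Rmax_Cmod z); apply: Rmax_l. Qed.
Lemma Im_Cmod (z : C) : Rabs (Im z) <= Cmod z.
Proof. by apply: Rle_trans (Rmax_Cmod z); apply: Rmax_r. Qed.
Lemma Cmod_ReIm (z : C) : Cmod z <= Rabs (Re z) + Rabs (Im z).
Proof.
have -> : z = (RtoC (Re z) + Ci * RtoC (Im z))%C.
  by case: z => x y; rewrite /Ci /RtoC /Cplus /Cmult /=; congr pair; ring.
apply: Rle_trans (Cmod_triangle _ _) _.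
rewrite Cmod_mult !Cmod_R Cmod_Ci /Ci /=; apply: Req_le.
by rewrite !(Rmult_0_l, Rmult_0_r, Rmult_1_l, Rplus_0_r, Rplus_0_l, Rminus_0_r) .
Qed.

(* The term with index 0 is ignored. *)
Definition tsum (a : nat -> C) : C :=
  (Series (fun n => Re (a n.+1)), Series (fun n => Im (a n.+1))).

(** Absolute convergence with an explicit bound. [Series], hence [tsum], has a default value on
    divergent series, so the rules for adding, scaling and convolving sums take such bounds as
    hypotheses. *)
Definition absum (a : nat -> C) (M : R) : Prop :=
  forall N, \rsum_(1 <= n < N) Cmod (a n) <= M.

Lemma absum_ge0 a M : absum a M -> 0 <= M.
Proof. by move=> /(_ 0%N); rewrite big_geq. Qed.

Lemma absum_le a b M : (forall n, (0 < n)%N -> Cmod (a n) <= Cmod (b n)) ->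
  absum b M -> absum a M.
Proof.
move=> ab hb N; apply: Rle_trans (hb N); apply: rsum_nat_le => n hn.
by apply: ab; lia.
Qed.

Lemma tsum_cvg a M : absum a M -> forall eps, 0 < eps ->
  exists N0, forall N, (N0 <= N)%N -> Cmod (\csum_(1 <= n < N) a n - tsum a)%C < eps.
Proof.
move=> aM eps e0.
have ex (p : C -> R) : (forall z, Rabs (p z) <= Cmod z) ->
    ex_series (fun n => p (a n.+1)).
  move=> hp; apply: (ex_series_le _ (fun n => Cmod (a n.+1))); first by move=> n; apply: hp.
  apply: (ex_series_bounded _ M) => n; first exact: Cmod_ge_0.
  by rewrite -(rsum_shift (fun n => Cmod (a n))); apply: aM.
have e2 : 0 < eps / 2 by lra.
have [N1 h1] := (is_series_rsum _ _).1 (Series_correct _ (ex Re Re_Cmod)) _ e2.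
have [N2 h2] := (is_series_rsum _ _).1 (Series_correct _ (ex Im Im_Cmod)) _ e2.
exists (N1 + N2).+1 => -[//|N] hN.
apply: Rle_lt_trans (Cmod_ReIm _) _.
rewrite /Cminus /Cplus /Copp /Re /Im /=.
move: (csum_Re _ (index_iota 1 N.+1) xpredT a) (csum_Im _ (index_iota 1 N.+1) xpredT a).
rewrite /Re /Im => -> ->; rewrite !rsum_shift.
have := h1 N ltac:(lia); have := h2 N ltac:(lia); rewrite /Re /Im /Rminus; lra.
Qed.

Lemma Cmod_le_eps (x y : C) : (forall eps, 0 < eps -> Cmod (x - y)%C <= eps) -> x = y.
Proof.
move=> h; have h0 : Cmod (x - y)%C = 0.
  have := Cmod_ge_0 (x - y)%C; case: (Rle_lt_dec (Cmod (x - y)%C) 0) => [|c0]; first lra.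
  by have := h _ (Rlt_gt _ _ (ltac:(lra) : 0 < Cmod (x - y)%C / 2)); lra.
move/Cmod_eq_0: h0 => h0.
have -> : x = (x - y + y)%C by ring.
by rewrite h0 Cplus_0_l.
Qed.

Lemma tsum_unique a M l : absum a M ->
  (forall eps, 0 < eps -> exists N0, forall N, (N0 <= N)%N ->
     Cmod (\csum_(1 <= n < N) a n - l)%C < eps) -> tsum a = l.
Proof.
move=> aM hl; apply: Cmod_le_eps => eps e0.
have [N1 h1] := tsum_cvg _ _ aM (eps / 2) ltac:(lra).
have [N2 h2] := hl (eps / 2) ltac:(lra).
have {}h1 := h1 (N1 + N2)%N ltac:(lia); have {}h2 := h2 (N1 + N2)%N ltac:(lia).
set S := bigop.body _ _ _ in h1 h2.
have -> : (tsum a - l = (S - l) + - (S - tsum a))%C by ring.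
by apply: Rle_trans (Cmod_triangle _ _) _; rewrite Cmod_opp; lra.
Qed.

Lemma tsum_mod_le a M K : absum a M ->
  (exists N0, forall N, (N0 <= N)%N -> Cmod (\csum_(1 <= n < N) a n)%C <= K) -> Cmod (tsum a) <= K.
Proof.
move=> aM [N0 h]; apply: le_epsilon => eps e0.
have [N1 h1] := tsum_cvg _ _ aM eps e0.
have {}h1 := h1 (N1 + N0)%N ltac:(lia); have {}h := h (N1 + N0)%N ltac:(lia).
set S := bigop.body _ _ _ in h h1.
have -> : (tsum a = S + - (S - tsum a))%C by ring.
by apply: Rle_trans (Cmod_triangle _ _) _; rewrite Cmod_opp; lra.
Qed.

Lemma tsum_abs_le a M : absum a M -> Cmod (tsum a) <= M.
Proof.
move=> aM; apply: (tsum_mod_le _ _ _ aM); exists 0%N => N _.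
exact: Rle_trans (csum_mod _ _ _ _) (aM N).
Qed.

Lemma absum_add a b M K : absum a M -> absum b K -> absum (fun n => a n + b n)%C (M + K).
Proof.
move=> aM bK N; apply: (Rle_trans _ (\rsum_(1 <= n < N) (Cmod (a n) + Cmod (b n)))).
  by apply: rsum_nat_le => n _; apply: Cmod_triangle.
by rewrite big_split /=; have := aM N; have := bK N; lra.
Qed.

Lemma absum_scal a c M : absum a M -> absum (fun n => c * a n)%C (Cmod c * M).
Proof.
move=> aM N; under eq_bigr do rewrite Cmod_mult.
by rewrite -big_distrr /=; apply: Rmult_le_compat_l; [apply: Cmod_ge_0 | apply: aM].
Qed.

Lemma tsum_add a b M K : absum a M -> absum b K ->
  tsum (fun n => a n + b n)%C = (tsum a + tsum b)%C.
Proof.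
move=> aM bK; apply: (tsum_unique _ _ _ (absum_add _ _ _ _ aM bK)) => eps e0.
have [N1 h1] := tsum_cvg _ _ aM (eps / 2) ltac:(lra).
have [N2 h2] := tsum_cvg _ _ bK (eps / 2) ltac:(lra).
exists (N1 + N2)%N => N hN; rewrite big_split /=.
have {}h1 := h1 N ltac:(lia); have {}h2 := h2 N ltac:(lia).
set S := (X in (X + _)%C); set S' := (X in (_ + X - _)%C).
have -> : (S + S' - (tsum a + tsum b) = (S - tsum a) + (S' - tsum b))%C by ring.
by apply: Rle_lt_trans (Cmod_triangle _ _) _; rewrite /S /S'; lra.
Qed.

Lemma tsum_scal a c M : absum a M -> tsum (fun n => c * a n)%C = (c * tsum a)%C.
Proof.
move=> aM; apply: (tsum_unique _ _ _ (absum_scal _ _ _ aM)) => eps e0.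
have c0 := Cmod_ge_0 c.
have [N1 h1] := tsum_cvg _ _ aM (eps / (Cmod c + 1)) ltac:(apply: Rdiv_lt_0_compat; lra).
exists N1 => N hN; rewrite -big_distrr /=.
set S := (X in (c * X - _)%C).
have -> : (c * S - c * tsum a = c * (S - tsum a))%C by ring.
rewrite Cmod_mult; have {}h1 := h1 N hN; rewrite -/S in h1.
have -> : eps = (Cmod c + 1) * (eps / (Cmod c + 1)) by field; lra.
have := Cmod_ge_0 (S - tsum a)%C; nra.
Qed.

Lemma tsum_ext a b : (forall n, (0 < n)%N -> a n = b n) -> tsum a = tsum b.
Proof. by move=> ab; rewrite /tsum; congr pair; apply: Series_ext => n; rewrite ab. Qed.

Lemma absum_ext a b M : (forall n, (0 < n)%N -> a n = b n) -> absum a M -> absum b M.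
Proof. by move=> ab; apply: absum_le => n n0; rewrite ab //; lra. Qed.

Lemma tsum_tail a M N : absum a M ->
  (tsum a - \csum_(1 <= n < N) a n)%C = tsum (fun n => if (n < N)%N then RtoC 0 else a n).
Proof.
move=> aM; symmetry; apply: (tsum_unique _ M) => [|eps e0].
  by apply: absum_le aM => n _; case: ifP => _; rewrite ?Cmod_0; [apply: Cmod_ge_0 | lra].
have [N1 h1] := tsum_cvg _ _ aM eps e0.
exists (N1 + N).+1 => K hK; have {}h1 := h1 K ltac:(lia).
case: N hK => [|N] hK.
  rewrite [X in (_ - (_ - X))%C]big_geq //.
  by rewrite /Cminus Copp_0 Cplus_0_r.
rewrite (@big_cat_nat _ _ _ N.+1) //=; last by lia.
rewrite big_nat big1 => [|i /andP[_ ->] //].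
rewrite [X in (_ + X)%C]big_nat (eq_bigr a) => [|i /andP[hi _]]; last first.
  by rewrite ltnNge hi.
rewrite -big_nat; move: h1; rewrite (@big_cat_nat _ _ _ N.+1) //=; last by lia.
move=> h1; apply: Rle_lt_trans h1; apply: Req_le; congr Cmod.
by rewrite Cplus_0_l; ring.
Qed.

Lemma tsum_RtoC (a : nat -> R) : tsum (fun n => RtoC (a n)) = RtoC (Series (fun n => a n.+1)).
Proof.
rewrite /tsum /RtoC /Re /Im /=; congr pair.
apply: is_series_unique; apply: is_lim_seq_ext (is_lim_seq_const 0) => n.
by rewrite sum_n_rsum big1.
Qed.

(** * Multiplicative functions *)

Section DivisorSums.
Variables (T : Type) (idx : T) (op : Monoid.com_law idx).

(** The divisor sum becomes a sum over the pairs with product n in a box of side N. The side does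
    not depend on n, so that a summation over n <= N can be exchanged with it. *)
Lemma big_divisors_pairs (G : nat -> nat -> T) n N : (0 < n <= N)%N ->
  \big[op/idx]_(d <- divisors n) G d (n %/ d)%N =
  \big[op/idx]_(1 <= d < N.+1) \big[op/idx]_(1 <= e < N.+1 | (d * e == n)%N) G d e.
Proof.
move=> /andP[n0 nN].
have -> : \big[op/idx]_(d <- divisors n) G d (n %/ d)%N =
          \big[op/idx]_(1 <= d < N.+1 | (d %| n)%N) G d (n %/ d)%N.
  rewrite -[RHS]big_filter; apply: perm_big; apply: uniq_perm.
  - exact: divisors_uniq.
  - by apply: filter_uniq; apply: iota_uniq.
  move=> d; rewrite -dvdn_divisors // mem_filter mem_index_iota.
  case: (boolP (d %| n)%N) => // dn; have := dvdn_leq n0 dn; have := dvdn_gt0 n0 dn; lia.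
rewrite big_mkcond; apply: eq_big_nat => d /andP[d0 dN].
case: (boolP (d %| n)%N) => [dn|dn]; last first.
  by rewrite big1 // => e /eqP de; case/negP: dn; rewrite -de dvdn_mulr.
have hd : (1 <= n %/ d < N.+1)%N.
  by rewrite divn_gt0 // (dvdn_leq n0 dn) ltnS (leq_trans (leq_div _ _) nN).
rewrite (@big_rem _ _ _ _ _ (n %/ d)%N) /=; last by rewrite mem_index_iota.
rewrite mulnC divnK // eqxx big1_seq ?Monoid.mulm1 // => e /andP[/eqP de].
rewrite mem_rem_uniq ?iota_uniq // inE => /andP[/eqP ne _].
by case: ne; rewrite -de mulKn.
Qed.

(** The divisors of m n correspond to pairs through d -> (gcd(d, m), gcd(d, n)), the inverse of the
    product. *)
Lemma big_divisors_coprime (G : nat -> T) m n : (0 < m)%N -> (0 < n)%N -> coprime m n ->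
  \big[op/idx]_(d <- divisors (m * n)) G d =
  \big[op/idx]_(d <- divisors m) \big[op/idx]_(e <- divisors n) G (d * e)%N.
Proof.
move=> m0 n0 cmn.
rewrite -(@big_allpairs_dep _ _ _ _ (fun=> nat) nat (fun d e => d * e)%N).
apply: perm_big; apply: uniq_perm; first exact: divisors_uniq.
- apply: allpairs_uniq; [exact: divisors_uniq | exact: divisors_uniq|].
  move=> [d e] [d' e'] /allpairsP[[x y] /= [+ + [-> ->]]] /allpairsP[[x' y'] /= [+ + [-> ->]]] /=.
  rewrite -!dvdn_divisors // => dm en dm' en' E.
  have xx : x = x'.
    apply/eqP; rewrite eqn_dvd; apply/andP; split.
    + rewrite -(@Gauss_dvdl x x' y').
        by rewrite -E dvdn_mulr.
      by apply: coprime_dvdl dm _; apply: coprime_dvdr en' _.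
    + rewrite -(@Gauss_dvdl x' x y).
        by rewrite E dvdn_mulr.
      by apply: coprime_dvdl dm' _; apply: coprime_dvdr en _.
  rewrite -xx in E *; congr pair; apply/eqP.
  by rewrite -(@eqn_pmul2l x) ?E // (dvdn_gt0 m0 dm).
- move=> d; rewrite -dvdn_divisors ?muln_gt0 ?m0 //.
  apply/idP/allpairsP => [dmn|[[x y] /= []]].
  + exists (gcdn d m, gcdn d n); rewrite /= -!dvdn_divisors // !dvdn_gcdr; split=> //.
    apply/eqP; rewrite eqn_dvd; apply/andP; split.
      by rewrite muln_gcdl !muln_gcdr !dvdn_gcd (dvdn_mulr d (dvdnn d)) (dvdn_mulr n (dvdnn d)) (dvdn_mull m (dvdnn d)) dmn.
    rewrite Gauss_dvd ?dvdn_gcdl //.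
    by apply: coprime_dvdl (dvdn_gcdr _ _) _; apply: coprime_dvdr (dvdn_gcdr _ _) _.
  + by rewrite -!dvdn_divisors // => xm yn ->; apply: dvdn_mul.
Qed.

Lemma big_divisors_prime_pow (G : nat -> T) p a : prime p ->
  \big[op/idx]_(d <- divisors (p ^ a)) G d = \big[op/idx]_(0 <= i < a.+1) G (p ^ i)%N.
Proof.
move=> pp; rewrite -(@big_map _ _ _ _ _ (fun i => p ^ i)%N _ xpredT G).
apply: perm_big; apply: uniq_perm; first exact: divisors_uniq.
  rewrite map_inj_uniq ?iota_uniq // => i j /eqP.
  by rewrite eqn_exp2l ?prime_gt1 // => /eqP.
move=> d; rewrite -dvdn_divisors ?expn_gt0 ?prime_gt0 //.
apply/idP/mapP => [/(dvdn_pfactor _ _ pp)[m ma ->]|[i + ->]].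
  by exists m => //; rewrite mem_index_iota.
by rewrite mem_index_iota => /andP[_ ia]; apply: dvdn_exp2l.
Qed.

Lemma sum_divisors_pairs (G : nat -> nat -> T) N :
  \big[op/idx]_(1 <= n < N.+1) \big[op/idx]_(d <- divisors n) G d (n %/ d)%N =
  \big[op/idx]_(1 <= d < N.+1) \big[op/idx]_(1 <= e < N.+1 | (d * e <= N)%N) G d e.
Proof.
rewrite (eq_big_nat _ _ (F2 := fun n => \big[op/idx]_(1 <= d < N.+1)
   \big[op/idx]_(1 <= e < N.+1 | (d * e == n)%N) G d e)); last first.
  by move=> n hn; apply: big_divisors_pairs; lia.
rewrite exchange_big /=; apply: eq_big_nat => d /andP[d0 dN].
under eq_bigr do rewrite big_mkcond.
rewrite exchange_big /= [RHS]big_mkcond /=; apply: eq_big_nat => e /andP[e0 eN].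
rewrite -big_mkcond /=; case: ifP => de.
  rewrite (@big_rem _ _ _ _ _ (d * e)%N) /=; last by rewrite mem_index_iota muln_gt0 d0 e0 ltnS.
  rewrite eqxx big1_seq ?Monoid.mulm1 // => n /andP[/eqP <-].
  by rewrite mem_rem_uniq ?iota_uniq // inE eqxx.
by rewrite big_nat_cond big1 // => n /andP[/andP[_ +] /eqP E]; rewrite ltnS -E de.
Qed.

End DivisorSums.

(** The induction splits off the full power of the smallest prime factor, which reduces
    multiplicative statements to prime powers. *)
Lemma nat_coprime_ind (P : nat -> Prop) : P 1%N ->
  (forall p a m, prime p -> (0 < a)%N -> (0 < m)%N -> ~~ (p %| m)%N -> P m -> P (p ^ a * m)%N) ->
  forall n, (0 < n)%N -> P n.
Proof.
move=> P1 PM n; elim/ltn_ind: n => n IH n0.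
case: (leqP n 1) => [n1|n1]; first by have -> : n = 1%N by lia.
have pp := pdiv_prime n1; set p := pdiv n in pp.
have [m cpm nE] := pfactor_coprime pp n0.
have a0 : (0 < logn p n)%N by rewrite logn_gt0 pi_pdiv.
have m0 : (0 < m)%N by case: m nE {cpm} => // nE; rewrite nE in n0.
rewrite nE mulnC; apply: PM => //; first by rewrite -prime_coprime.
apply: IH => //; rewrite [X in (_ < X)%N]nE -[X in (X < _)%N]muln1 ltn_pmul2l //.
by rewrite -{1}(expn0 p) ltn_exp2l ?prime_gt1.
Qed.

Definition mult (a : nat -> R) : Prop :=
  a 1%N = 1 /\ forall m n, (0 < m)%N -> (0 < n)%N -> coprime m n -> a (m * n)%N = a m * a n.

Lemma mult_ext a b : mult a -> mult b ->
  (forall p k, prime p -> (0 < k)%N -> a (p ^ k)%N = b (p ^ k)%N) ->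
  forall n, (0 < n)%N -> a n = b n.
Proof.
move=> [a1 aM] [b1 bM] ab; apply: nat_coprime_ind => [|p k m pp k0 m0 pm IH]; first by rewrite a1 b1.
have c : coprime (p ^ k) m by rewrite coprime_pexpl // prime_coprime.
have pk0 : (0 < p ^ k)%N by rewrite expn_gt0 prime_gt0.
by rewrite aM // bM // ab // IH.
Qed.

Lemma coprime_quot m n d e : coprime m n -> (d %| m)%N -> (e %| n)%N ->
  coprime (m %/ d) (n %/ e).
Proof.
move=> c dm en; apply: (@coprime_dvdl _ m); last apply: (@coprime_dvdr _ n) => //.
  by rewrite -{2}(divnK dm) dvdn_mulr.
by rewrite -{2}(divnK en) dvdn_mulr.
Qed.

Lemma mult_conv a b : mult a -> mult b ->
  mult (fun n => \rsum_(d <- divisors n) (a (n %/ d)%N * b d)).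
Proof.
move=> [a1 aM] [b1 bM]; split; first by rewrite big_seq1 a1 b1; ring.
move=> m n m0 n0 c; rewrite big_divisors_coprime // big_distrlr /=.
rewrite !big_seq; apply: eq_bigr => d; rewrite -dvdn_divisors // => dm.
rewrite !big_seq; apply: eq_bigr => e; rewrite -dvdn_divisors // => en.
have d0 := dvdn_gt0 m0 dm; have e0 := dvdn_gt0 n0 en.
have -> : ((m * n) %/ (d * e))%N = ((m %/ d) * (n %/ e))%N.
  by rewrite -{1}(divnK dm) -{1}(divnK en) mulnACA mulnK // muln_gt0 d0.
rewrite aM ?divn_gt0 ?(dvdn_leq m0 dm) ?(dvdn_leq n0 en) //; last exact: coprime_quot.
rewrite bM //; last by apply: coprime_dvdl dm _; apply: coprime_dvdr en _.
ring.
Qed.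

(** Both sides are multiplicative, so only prime powers matter, and there the divisor sum
    telescopes. *)
Lemma mult_telescope a b : mult a -> mult b ->
  (forall p k, prime p -> (0 < k)%N -> b (p ^ k)%N = a (p ^ k)%N - a (p ^ k.-1)%N) ->
  forall n, (0 < n)%N -> \rsum_(d <- divisors n) b d = a n.
Proof.
move=> ma mb ab n n0.
have m1 : mult (fun=> 1) by split=> // *; ring.
have mc := mult_conv _ _ m1 mb.
transitivity (\rsum_(d <- divisors n) (1 * b d)); first by apply: eq_bigr => d _; ring.
move: n n0; apply: (mult_ext _ _ mc ma) => p k pp k0.
rewrite big_divisors_prime_pow // big_nat_recl //= expn0.
under eq_big_nat => i /andP[_ ik] do rewrite Rmult_1_l ab // /=.
rewrite (rsum_telescope 0 k (fun i => a (p ^ i)%N)) // expn0.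
by case: ma => -> _; case: mb => -> _; ring.
Qed.

(** The von Mangoldt function: [primes n] is a singleton exactly at the prime powers above 1. *)
Definition vonM (n : nat) : R := if primes n is [:: p] then ln (INR p) else 0.

Lemma ln_INR_ge0 n : (0 < n)%N -> 0 <= ln (INR n).
Proof.
move=> n0; rewrite -ln_1; apply: ln_le; first lra.
by rewrite -[1]/(INR 1); apply: le_INR; lia.
Qed.

Lemma INR_gt0 n : (0 < n)%N -> 0 < INR n.
Proof. by move=> n0; apply: (lt_INR 0); lia. Qed.

Lemma INR_ge1 n : (0 < n)%N -> 1 <= INR n.
Proof. by move=> n0; apply: (le_INR 1); lia. Qed.

Lemma vonM_ge0 n : 0 <= vonM n.
Proof.
rewrite /vonM; case E: (primes n) => [|p [|q s]]; try lra.
have : p \in primes n by rewrite E inE.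
by rewrite mem_primes => /andP[pp _]; apply: ln_INR_ge0; apply: prime_gt0.
Qed.

Lemma vonM_le_ln n : (0 < n)%N -> vonM n <= ln (INR n).
Proof.
move=> n0; have ln0 := ln_INR_ge0 _ n0.
rewrite /vonM; case E: (primes n) => [|p [|q s]] //.
have : p \in primes n by rewrite E inE.
rewrite mem_primes => /and3P[pp _ pn]; apply: ln_le; last by apply: le_INR; have := dvdn_leq n0 pn; lia.
by apply: INR_gt0; apply: prime_gt0.
Qed.

Lemma vonM_prime_pow p k : prime p -> (0 < k)%N -> vonM (p ^ k) = ln (INR p).
Proof. by move=> pp k0; rewrite /vonM primesX // primes_prime. Qed.

Lemma ln_INR_mul m n : (0 < m)%N -> (0 < n)%N -> ln (INR (m * n)) = ln (INR m) + ln (INR n).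
Proof. by move=> m0 n0; rewrite mult_INR ln_mult //; apply: INR_gt0. Qed.

Lemma ln_INR_exp p k : (0 < p)%N -> ln (INR (p ^ k)) = INR k * ln (INR p).
Proof.
move=> p0; elim: k => [|k IH]; first by rewrite expn0 /= ln_1; ring.
by rewrite expnS ln_INR_mul ?expn_gt0 ?p0 // IH S_INR; ring.
Qed.

Lemma vonM_coprime d e : (1 < d)%N -> (1 < e)%N -> coprime d e -> vonM (d * e) = 0.
Proof.
move=> d1 e1 c; have pd := pdiv_prime d1; have pe := pdiv_prime e1.
have nq : pdiv d != pdiv e.
  apply/eqP => E; have := coprime_dvdl (pdiv_dvd d) (coprime_dvdr (pdiv_dvd e) c).
  by rewrite E /coprime gcdnn => /eqP h; rewrite h in pe.
have h1 : pdiv d \in primes (d * e).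
  by rewrite mem_primes pd muln_gt0 (ltnW d1) (ltnW e1) dvdn_mulr ?pdiv_dvd.
have h2 : pdiv e \in primes (d * e).
  by rewrite mem_primes pe muln_gt0 (ltnW d1) (ltnW e1) dvdn_mull ?pdiv_dvd.
rewrite /vonM; case: (primes (d * e)) h1 h2 => [|p [|q s]] //.
by rewrite !inE => /eqP h1 /eqP h2; case/eqP: nq; rewrite h1 h2.
Qed.

Lemma sum_vonM n : (0 < n)%N -> \rsum_(d <- divisors n) vonM d = ln (INR n).
Proof.
move: n; apply: nat_coprime_ind => [|p a m pp a0 m0 pm IH].
  by rewrite big_seq1 /= ln_1.
have c : coprime (p ^ a) m by rewrite coprime_pexpl // prime_coprime.
have pa0 : (0 < p ^ a)%N by rewrite expn_gt0 prime_gt0.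
rewrite big_divisors_coprime // big_divisors_prime_pow //.
rewrite big_nat_recl //= expn0.
under eq_bigr do rewrite mul1n.
rewrite IH ln_INR_mul // ln_INR_exp ?prime_gt0 //.
(* Among the divisors p^(i+1) e only those with e = 1 contribute, the others not being prime powers.
   The a values ln p complete ln m to ln (p^a m). *)
rewrite (eq_big_nat _ _ (F2 := fun=> ln (INR p))); last first.
  move=> i /andP[_ ia].
  rewrite (@big_rem _ _ _ _ _ 1%N) /=; last by rewrite divisor1.
  rewrite muln1 vonM_prime_pow // big1_seq ?Rplus_0_r // => e /andP[_].
  rewrite mem_rem_uniq ?divisors_uniq // inE -dvdn_divisors // => /andP[/eqP e1 em].
  have e0 := dvdn_gt0 m0 em.
  apply: vonM_coprime; [|lia|].
    by rewrite -{1}(expn0 p) ltn_exp2l ?prime_gt1.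
  by apply: coprime_dvdr em _; rewrite coprime_pexpl // prime_coprime.
by rewrite rsum_const subn0; ring.
Qed.

Definition conv (a b : nat -> C) (n : nat) : C :=
  \csum_(d <- divisors n) (a d * b (n %/ d)%N)%C.

(** * Dirichlet series *)

Lemma absum_tail_small a M : absum a M -> forall eps, 0 < eps ->
  exists K, (0 < K)%N /\ forall N, \rsum_(K <= n < N) Cmod (a n) <= eps.
Proof.
move=> aM eps e0; pose u n := \rsum_(1 <= i < n.+1) Cmod (a i).
have [l hl] : ex_finite_lim_seq u.
  apply: (ex_finite_lim_seq_incr _ M) => n; last exact: aM.
  by rewrite /u [X in _ <= X]big_nat_recr //=; have := Cmod_ge_0 (a n.+1); lra.
move/is_lim_seq_spec: hl => hl; have [K hK] := hl (mkposreal (eps / 2) ltac:(lra)).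
exists K.+1; split=> // N; case: (leqP N K.+1) => [NK|KN]; first by rewrite big_geq //; lra.
case: N KN => // N KN.
have h1 := hK K ltac:(lia); have h2 := hK N ltac:(lia); rewrite /= in h1 h2.
have E : u N = u K + \rsum_(K.+1 <= n < N.+1) Cmod (a n) by rewrite /u (@big_cat_nat _ _ _ K.+1) //=; lia.
move: h1 h2; rewrite E; split_Rabs; lra.
Qed.

Lemma absum_conv a b M K : absum a M -> absum b K -> absum (conv a b) (M * K).
Proof.
move=> aM bK [|N]; first by rewrite big_geq //; apply: Rmult_le_pos; [exact: (absum_ge0 _ _ aM) | exact: (absum_ge0 _ _ bK)].
apply: (Rle_trans _ (\rsum_(1 <= n < N.+1) \rsum_(d <- divisors n) (Cmod (a d) * Cmod (b (n %/ d)%N)))).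
  apply: rsum_nat_le => n _; apply: Rle_trans (csum_mod _ _ _ _) _.
  by under eq_bigr do rewrite Cmod_mult; lra.
rewrite (sum_divisors_pairs _ _ _ (fun d e => Cmod (a d) * Cmod (b e))).
apply: (Rle_trans _ (\rsum_(1 <= d < N.+1) (Cmod (a d) * K))).
  apply: rsum_nat_le => d _; rewrite -big_distrr /=; apply: Rmult_le_compat_l; first exact: Cmod_ge_0.
  apply: Rle_trans (bK N.+1); apply: rsum_subset => // e _ _; exact: Cmod_ge_0.
rewrite -big_distrl /=; apply: Rmult_le_compat_r; [exact: (absum_ge0 _ _ bK) | exact: aM].
Qed.

(** For N >= (Ka + Kb)^2 the region d e <= N contains the box d < Ka, e < Kb. The product of the
    partial sums and the partial sum of the convolution then differ by pairs with a large
    coordinate, which the two tails control. *)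
Lemma tsum_conv a b M K : absum a M -> absum b K -> tsum (conv a b) = (tsum a * tsum b)%C.
Proof.
move=> aM bK; apply: (tsum_unique _ _ _ (absum_conv _ _ _ _ aM bK)) => eps e0.
have M0 := absum_ge0 _ _ aM; have K0 := absum_ge0 _ _ bK.
pose dl := eps / (M + K + K + M + 1).
have d0 : 0 < dl by apply: Rdiv_lt_0_compat; lra.
have [Na hNa] := tsum_cvg _ _ aM dl d0.
have [Nb hNb] := tsum_cvg _ _ bK dl d0.
have [Ka [Ka0 hKa]] := absum_tail_small _ _ aM dl d0.
have [Kb [Kb0 hKb]] := absum_tail_small _ _ bK dl d0.
pose L := (Ka + Kb)%N.
exists (Na + Nb + L * L).+1 => -[//|N] hN.
rewrite /conv (sum_divisors_pairs _ _ _ (fun d e => a d * b e)%C).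
have {}hNa := hNa N.+1 ltac:(lia); have {}hNb := hNb N.+1 ltac:(lia).
set A := (\csum_(1 <= n < N.+1) a n)%C in hNa *; set B := (\csum_(1 <= n < N.+1) b n)%C in hNb *.
set S := (X in (X - _)%C).
have hA : Cmod A <= M by apply: Rle_trans (csum_mod _ _ _ _) (aM _).
have hB : Cmod (tsum b) <= K by apply: (tsum_abs_le _ _ bK).
have h1 : Cmod (A * B - S)%C <= dl * K + M * dl.
  rewrite /A /B /S big_distrlr /= -csum_sub.
  apply: Rle_trans (csum_mod _ _ _ _) _.
  apply: (Rle_trans _ (\rsum_(1 <= d < N.+1) \rsum_(1 <= e < N.+1)
      ((if (Ka <= d)%N then Cmod (a d) else 0) * Cmod (b e) +
       Cmod (a d) * (if (Kb <= e)%N then Cmod (b e) else 0)))).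
    apply: rsum_nat_le => d /andP[d1 dN].
    rewrite [X in (_ - X)%C]big_mkcond -csum_sub.
    apply: Rle_trans (csum_mod _ _ _ _) _; apply: rsum_nat_le => e /andP[e1 eN].
    have ha := Cmod_ge_0 (a d); have hb := Cmod_ge_0 (b e).
    have hab := Rmult_le_pos _ _ ha hb.
    case: ifP => de.
      have -> : (a d * b e - a d * b e)%C = RtoC 0 by ring.
      by rewrite Cmod_0; case: ifP => _; case: ifP => _; nra.
    have -> : (a d * b e - RtoC 0)%C = (a d * b e)%C by ring.
    rewrite Cmod_mult; case: (leqP Ka d) => ka; case: (leqP Kb e) => kb; try nra.
    exfalso; move/negP: de; apply; have : (d * e <= L * L)%N by apply: leq_mul; rewrite /L; lia.
    lia.
  rewrite (eq_bigr (fun d => \rsum_(1 <= e < N.+1) ((if (Ka <= d)%N then Cmod (a d) else 0) * Cmod (b e)) +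
      \rsum_(1 <= e < N.+1) (Cmod (a d) * (if (Kb <= e)%N then Cmod (b e) else 0)))); last first.
    by move=> d _; rewrite big_split.
  rewrite big_split /= -!big_distrlr /=.
  have tl (c : nat -> C) Kc : (0 < Kc)%N -> (forall N, \rsum_(Kc <= n < N) Cmod (c n) <= dl) ->
      \rsum_(1 <= d < N.+1) (if (Kc <= d)%N then Cmod (c d) else 0) <= dl.
    move=> Kc0 hc; case: (leqP Kc N.+1) => KN.
      rewrite (@big_cat_nat _ _ _ Kc) //= big_nat big1 => [|i /andP[_ hi]]; last by rewrite leqNgt hi.
      rewrite Rplus_0_l big_nat (eq_bigr (fun n => Cmod (c n))) -?big_nat; first exact: hc.
      by move=> i /andP[-> _].
    rewrite big_nat big1 => [|i /andP[_ hi]]; first lra.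
    by case: ifP => // ?; lia.
  have ta := tl a Ka Ka0 hKa; have tb := tl b Kb Kb0 hKb.
  have sa := aM N.+1; have sb := bK N.+1.
  have sa0 : 0 <= \rsum_(1 <= n < N.+1) Cmod (a n) by apply: rsum_nat_ge0 => *; apply: Cmod_ge_0.
  have sb0 : 0 <= \rsum_(1 <= n < N.+1) Cmod (b n) by apply: rsum_nat_ge0 => *; apply: Cmod_ge_0.
  apply: Rplus_le_compat; first by nra.
  by apply: Rmult_le_compat => //; apply: rsum_nat_ge0 => i _; case: ifP => _; [apply: Cmod_ge_0 | lra].
have -> : (S - tsum a * tsum b = - (A * B - S) + (A * (B - tsum b) + (A - tsum a) * tsum b))%C by ring.
apply: Rle_lt_trans (Cmod_triangle _ _) _; rewrite Cmod_opp.
apply: (Rle_lt_trans _ (dl * K + M * dl + (M * dl + dl * K))).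
  apply: Rplus_le_compat; first exact: h1.
  apply: Rle_trans (Cmod_triangle _ _) _; rewrite !Cmod_mult.
  have := Cmod_ge_0 A; have := Cmod_ge_0 (tsum b); have := Cmod_ge_0 (B - tsum b)%C.
  have := Cmod_ge_0 (A - tsum a)%C; nra.
have -> : eps = (M + K + K + M + 1) * dl by rewrite /dl; field; lra.
nra.
Qed.

Lemma absum_sum (A : nat -> nat -> C) (B : nat -> R) m k : (forall i, absum (A i) (B i)) ->
  absum (fun n => \csum_(m <= i < k) A i n)%C (\rsum_(m <= i < k) B i).
Proof.
move=> AB N; apply: (Rle_trans _ (\rsum_(1 <= n < N) \rsum_(m <= i < k) Cmod (A i n))).
  by apply: rsum_nat_le => n _; apply: csum_mod.
by rewrite exchange_big /=; apply: rsum_nat_le => i _; apply: AB.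
Qed.

Lemma tsum_sum (A : nat -> nat -> C) (B : nat -> R) m k : (forall i, absum (A i) (B i)) ->
  tsum (fun n => \csum_(m <= i < k) A i n)%C = (\csum_(m <= i < k) tsum (A i))%C.
Proof.
move=> AB; case: (leqP m k) => mk; last first.
  rewrite [RHS]big_geq ?(ltnW mk) //.
  apply: (tsum_unique _ 0) => [N|eps e0].
    by rewrite big1 => [|i _]; [lra | rewrite big_geq ?(ltnW mk) // Cmod_0].
  exists 0%N => N _; rewrite big1 => [|i _]; last by rewrite big_geq ?(ltnW mk).
  by rewrite /Cminus Copp_0 Cplus_0_r Cmod_0.
rewrite -(subnKC mk); elim: (k - m)%N => [|j IH].
  rewrite addn0 [RHS]big_geq //.
  apply: (tsum_unique _ 0) => [N|eps e0].
    by rewrite big1 => [|i _]; [lra | rewrite big_geq // Cmod_0].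
  exists 0%N => N _; rewrite big1 => [|i _]; last by rewrite big_geq.
  by rewrite /Cminus Copp_0 Cplus_0_r Cmod_0.
rewrite addnS [RHS]big_nat_recr /=; last by lia.
rewrite -IH -(tsum_add _ _ _ _ (absum_sum _ _ _ _ AB) (AB _)).
by apply: tsum_ext => n _; rewrite big_nat_recr //=; lia.
Qed.

(* Normalised logarithm powers, for which the Leibniz rule has no binomial coefficients. *)
Definition lnf (k n : nat) : R := ln (INR n) ^ k / INR (Factorial.fact k).

Lemma lnf_ge0 k n : (0 < n)%N -> 0 <= lnf k n.
Proof.
move=> n0; apply: Rdiv_le_0_compat; first by apply: pow_le; apply: ln_INR_ge0.
exact: INR_fact_lt_0.
Qed.

Lemma lnf0 n : lnf 0 n = 1.
Proof. by rewrite /lnf /=; field. Qed.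

Lemma lnfS k n : INR k.+1 * lnf k.+1 n = ln (INR n) * lnf k n.
Proof.
rewrite /lnf fact_simpl mult_INR -tech_pow_Rmult.
by field; split; [apply: INR_fact_neq_0 | apply: not_0_INR].
Qed.

Lemma lnfM k m n : (0 < m)%N -> (0 < n)%N ->
  lnf k (m * n) = \rsum_(0 <= i < k.+1) (lnf i m * lnf (k - i) n).
Proof.
move=> m0 n0; rewrite /lnf ln_INR_mul // binomial -sum_n_Reals sum_n_rsum /Rdiv big_distrl /=.
apply: eq_big_nat => i /andP[_ ik]; rewrite /Binomial.C minusE.
by field; split; [|split]; apply: INR_fact_neq_0.
Qed.

Lemma pow_fact_le_exp x k : 0 <= x -> x ^ k / INR (Factorial.fact k) <= exp x.
Proof.
move=> x0; apply: Rle_trans (exp_ge_taylor x k x0); rewrite -sum_n_Reals sum_n_rsum big_nat_recr //=.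
rewrite -[X in X <= _]Rplus_0_l; apply: Rplus_le_compat_r; apply: rsum_nat_ge0 => i _.
by apply: Rdiv_le_0_compat; [apply: pow_le | apply: INR_fact_lt_0].
Qed.

Lemma exp_le x y : x <= y -> exp x <= exp y.
Proof. by move=> [/exp_increasing|->]; lra. Qed.

(** This is exp(-i th), with the sign that makes n^(-i t) equal to [cis (t * ln n)]. *)
Definition cis (th : R) : C := (cos th, - sin th).

(* The value of n^(-s) at s = sg + i t. *)
Definition npow (sg t : R) (n : nat) : C :=
  Cmult (RtoC (exp (- sg * ln (INR n)))) (cis (t * ln (INR n))).

Lemma Cmod_unit th : Cmod (cis th) = 1.
Proof.
rewrite /cis /Cmod /= -[RHS]sqrt_1; congr sqrt.
by have := sin2_cos2 th; rewrite /Rsqr; lra.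
Qed.

Lemma Cmod_npow sg t n : Cmod (npow sg t n) = exp (- sg * ln (INR n)).
Proof. by rewrite /npow Cmod_mult Cmod_unit Cmod_R Rabs_pos_eq ?Rmult_1_r //; apply: Rlt_le (exp_pos _). Qed.

Definition cmult (g : nat -> C) : Prop :=
  g 1%N = RtoC 1 /\ forall m n, (0 < m)%N -> (0 < n)%N -> g (m * n)%N = (g m * g n)%C.

Lemma cmult_npow sg t : cmult (npow sg t).
Proof.
split; first by rewrite /npow /cis /= ln_1 !Rmult_0_r exp_0 cos_0 sin_0 /RtoC /Cmult /=; congr pair; ring.
move=> m n m0 n0; rewrite /npow /cis ln_INR_mul // !Rmult_plus_distr_l exp_plus cos_plus sin_plus.
by rewrite /RtoC /Cmult /=; congr pair; ring.
Qed.

Lemma cmult_mul g h : cmult g -> cmult h -> cmult (fun n => g n * h n)%C.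
Proof.
move=> [g1 gM] [h1 hM]; split; first by rewrite g1 h1; ring.
by move=> m n m0 n0; rewrite gM // hM //; ring.
Qed.

(* The coefficients of L' = - L * (the Dirichlet series of [g * vonM]), differentiated [k] times. *)
Lemma log_derivative_identity g k (B B' : nat -> R) : cmult g ->
  (forall j, absum (fun n => g n * RtoC (lnf j n))%C (B j)) ->
  (forall j, absum (fun n => g n * RtoC (vonM n * lnf j n))%C (B' j)) ->
  (RtoC (INR k.+1) * tsum (fun n => g n * RtoC (lnf k.+1 n)) =
   \csum_(0 <= i < k.+1) (tsum (fun n => g n * RtoC (vonM n * lnf i n)) *
                          tsum (fun n => g n * RtoC (lnf (k - i) n))))%C.
Proof.
move=> [g1 gM] hB hB'.
rewrite -(tsum_scal _ _ _ (hB k.+1)).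
rewrite (eq_bigr (fun i => tsum (conv (fun n => g n * RtoC (vonM n * lnf i n))%C
   (fun n => g n * RtoC (lnf (k - i) n))%C))); last by move=> i _; rewrite (tsum_conv _ _ _ _ (hB' i) (hB (k - i)%N)).
rewrite -(tsum_sum _ (fun i => B' i * B (k - i)%N)); last by move=> i; apply: absum_conv.
apply: tsum_ext => n n0; rewrite /conv exchange_big /=.
transitivity (\csum_(d <- divisors n) (g n * RtoC (lnf k n) * RtoC (vonM d)))%C.
  rewrite -big_distrr /= csum_RtoC sum_vonM //.
  have -> : (RtoC (INR k.+1) * (g n * RtoC (lnf k.+1 n)) = g n * RtoC (INR k.+1 * lnf k.+1 n))%C.
    by rewrite RtoC_mult; ring.
  by rewrite lnfS RtoC_mult; ring.
rewrite !big_seq; apply: eq_bigr => d; rewrite -dvdn_divisors // => dn.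
have d0 := dvdn_gt0 n0 dn; have nd0 : (0 < n %/ d)%N by rewrite divn_gt0 // dvdn_leq.
have nE : n = (d * (n %/ d))%N by rewrite mulnC divnK.
rewrite [X in g X](nE) [X in lnf k X](nE) gM // lnfM // -csum_RtoC !big_distrr /= big_distrl /=.
by apply: eq_bigr => i _; rewrite !RtoC_mult; ring.
Qed.

Lemma ln_succ_diff n : (0 < n)%N -> / INR n.+1 <= ln (INR n.+1) - ln (INR n) <= / INR n.
Proof.
move=> n0; have p0 := INR_gt0 _ n0; have p1 := INR_gt0 n.+1 isT.
have key x y : 0 < x -> 0 < y -> ln x - ln y <= (x - y) / y.
  move=> x0 y0; rewrite -ln_div //.
  have := exp_ineq1_le (ln (x / y)); rewrite exp_ln; last exact: Rdiv_lt_0_compat.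
  by have -> : (x - y) / y = x / y - 1 by [field; lra]; lra.
split.
  have := key _ _ p0 p1; rewrite S_INR in p1 *.
  have -> : (INR n - (INR n + 1)) / (INR n + 1) = - / (INR n + 1) by field; lra.
  lra.
have := key _ _ p1 p0; rewrite S_INR in p1 *.
by have -> : (INR n + 1 - INR n) / INR n = / INR n by [field; lra]; lra.
Qed.

(** The right side is the integral of u^(-1 - dl) over [n, n + 1], in a form that telescopes. *)
Lemma zeta_term dl n : 0 < dl -> (0 < n)%N ->
  exp (- (1 + dl) * ln (INR n.+1)) <=
  / dl * exp (- dl * ln (INR n)) - / dl * exp (- dl * ln (INR n.+1)).
Proof.
move=> d0 n0; have id := Rinv_0_lt_compat _ d0.
have p1 := INR_gt0 n.+1 isT; have [l1 _] := ln_succ_diff n n0.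
have -> : - (1 + dl) * ln (INR n.+1) = - ln (INR n.+1) + - dl * ln (INR n.+1) by ring.
rewrite exp_plus exp_Ropp exp_ln //.
have -> : - dl * ln (INR n) = - dl * ln (INR n.+1) + dl * (ln (INR n.+1) - ln (INR n)) by ring.
rewrite exp_plus; set E := exp (- dl * ln (INR n.+1)).
have E0 : 0 < E := exp_pos _.
set X := dl * _.
have hX : 1 + X <= exp X := exp_ineq1_le X.
have hX' : dl * / INR n.+1 <= X by apply: Rmult_le_compat_l; lra.
have -> : / dl * (E * exp X) - / dl * E = E * (/ dl * (exp X - 1)) by ring.
rewrite Rmult_comm; apply: Rmult_le_compat_l; first lra.
have -> : / INR n.+1 = / dl * (dl * / INR n.+1) by field; lra.
apply: Rmult_le_compat_l; lra.
Qed.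

Lemma zeta_tail_le dl M N : 0 < dl -> (0 < M)%N ->
  \rsum_(M.+1 <= n < N) exp (- (1 + dl) * ln (INR n)) <= / dl * exp (- dl * ln (INR M)).
Proof.
move=> d0 M0; have id := Rinv_0_lt_compat _ d0.
have pM := exp_pos (- dl * ln (INR M)).
case: (leqP N M) => NM; first by rewrite big_geq; [apply: Rmult_le_pos; lra | lia].
case: N NM => // N MN; pose G n := - (/ dl * exp (- dl * ln (INR n))).
rewrite big_add1 -[N.+1.-1]/N.
apply: (Rle_trans _ (\rsum_(M <= n < N) (G n.+1 - G n))).
  apply: rsum_nat_le => n hn; have := zeta_term dl n d0 ltac:(lia); rewrite /G; lra.
rewrite rsum_telescope; last by lia.
by have := Rmult_lt_0_compat _ _ id (exp_pos (- dl * ln (INR N))); rewrite /G; lra.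
Qed.

Lemma zeta_partial_le dl N : 0 < dl ->
  \rsum_(1 <= n < N) exp (- (1 + dl) * ln (INR n)) <= 1 + / dl.
Proof.
move=> d0; have id := Rinv_0_lt_compat _ d0.
case: N => [|[|N]]; try (rewrite big_geq //; lra).
rewrite big_ltn // -[X in ln X]/1 ln_1 Rmult_0_r exp_0; apply: Rplus_le_compat_l.
by apply: Rle_trans (zeta_tail_le _ 1 _ d0 isT) _; rewrite [INR 1]/= ln_1 Rmult_0_r exp_0; lra.
Qed.

Lemma lnf_le_exp k n eta : (0 < n)%N -> 0 < eta ->
  lnf k n <= / eta ^ k * exp (eta * ln (INR n)).
Proof.
move=> n0 e0; have l0 := ln_INR_ge0 _ n0.
have := pow_fact_le_exp (eta * ln (INR n)) k ltac:(nra).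
have ek : 0 < eta ^ k by apply: pow_lt.
rewrite Rpow_mult_distr /lnf => h.
apply: (Rmult_le_reg_l (eta ^ k)) => //.
rewrite -[X in _ <= X]Rmult_assoc Rinv_r; last lra.
by rewrite Rmult_1_l; apply: Rle_trans h; apply: Req_le; rewrite /Rdiv; ring.
Qed.

(** Half of the excess dl absorbs the power of the logarithm: (ln n)^k / k! is at most (2/dl)^k
    n^(dl/2). *)
Lemma lnf_sum_le k dl N : 0 < dl ->
  \rsum_(1 <= n < N) (exp (- (1 + dl) * ln (INR n)) * lnf k n) <= (2 / dl) ^ k * (1 + 2 / dl).
Proof.
move=> d0; apply: (Rle_trans _ (\rsum_(1 <= n < N) ((2 / dl) ^ k * exp (- (1 + dl / 2) * ln (INR n))))).
  apply: rsum_nat_le => n /andP[n0 _].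
  have h := lnf_le_exp k n (dl / 2) n0 ltac:(lra).
  have -> : - (1 + dl / 2) * ln (INR n) = - (1 + dl) * ln (INR n) + dl / 2 * ln (INR n) by field.
  rewrite exp_plus.
  have E0 := exp_pos (- (1 + dl) * ln (INR n)).
  have -> : (2 / dl) ^ k = / (dl / 2) ^ k.
    by rewrite -pow_inv; congr pow; field; lra.
  nra.
rewrite -big_distrr /=; apply: Rmult_le_compat_l.
  by apply: pow_le; apply: Rlt_le; apply: Rdiv_lt_0_compat; lra.
by apply: Rle_trans (zeta_partial_le _ _ _) _; [lra | apply: Req_le; field; lra].
Qed.

Lemma absum_lnf g k dl : 0 < dl ->
  (forall n, (0 < n)%N -> Cmod (g n) <= exp (- (1 + dl) * ln (INR n))) ->
  absum (fun n => g n * RtoC (lnf k n))%C ((2 / dl) ^ k * (1 + 2 / dl)).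
Proof.
move=> d0 hg N; apply: Rle_trans (lnf_sum_le k dl N d0); apply: rsum_nat_le => n /andP[n0 _].
rewrite Cmod_mult Cmod_R Rabs_pos_eq; last exact: lnf_ge0.
by apply: Rmult_le_compat_r; [apply: lnf_ge0 | apply: hg].
Qed.

Lemma absum_vonM g k dl : 0 < dl ->
  (forall n, (0 < n)%N -> Cmod (g n) <= exp (- (1 + dl) * ln (INR n))) ->
  absum (fun n => g n * RtoC (vonM n * lnf k n))%C (INR k.+1 * ((2 / dl) ^ k.+1 * (1 + 2 / dl))).
Proof.
move=> d0 hg N.
apply: (Rle_trans _ (\rsum_(1 <= n < N) (INR k.+1 * (exp (- (1 + dl) * ln (INR n)) * lnf k.+1 n)))).
  apply: rsum_nat_le => n /andP[n0 _].
  have l0 := lnf_ge0 k n n0; have v0 := vonM_ge0 n; have vl := vonM_le_ln n n0.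
  rewrite Cmod_mult Cmod_R Rabs_pos_eq; last by apply: Rmult_le_pos.
  have -> : INR k.+1 * (exp (- (1 + dl) * ln (INR n)) * lnf k.+1 n) =
    exp (- (1 + dl) * ln (INR n)) * (INR k.+1 * lnf k.+1 n) by ring.
  rewrite lnfS; apply: Rmult_le_compat; [exact: Cmod_ge_0 | exact: Rmult_le_pos | exact: hg |].
  exact: Rmult_le_compat_r.
rewrite -big_distrr /=; apply: Rmult_le_compat_l; first exact: (pos_INR k.+1).
exact: lnf_sum_le.
Qed.

(** * Partial summation and upper bounds for L-functions *)

Definition bounded_sums (a : nat -> C) (Q : R) : Prop :=
  forall m, Cmod (\csum_(0 <= n < m) a n) <= Q.

Lemma bounded_sums_ge0 a Q : bounded_sums a Q -> 0 <= Q.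
Proof. by move=> /(_ 0%N); rewrite big_geq // Cmod_0. Qed.

Lemma abel_bound a g Q M N : bounded_sums a Q -> (M <= N)%N ->
  Cmod (\csum_(M <= n < N) (a n * g n))%C <=
  Q * (Cmod (g M) + Cmod (g N) + \rsum_(M <= n < N) Cmod (g n.+1 - g n)%C).
Proof.
move=> aQ MN; have Q0 := bounded_sums_ge0 _ _ aQ.
pose A m := (\csum_(0 <= n < m) a n)%C.
have E : (\csum_(M <= n < N) (a n * g n))%C =
   (A N * g N - A M * g M - \csum_(M <= n < N) (A n.+1 * (g n.+1 - g n)))%C.
  have hA n : a n = (A n.+1 - A n)%C by rewrite /A big_nat_recr //=; ring.
  rewrite -(csum_telescope M N (fun n => A n * g n)%C) // -csum_sub.
  by apply: eq_bigr => n _; rewrite hA; ring.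
rewrite E; apply: Rle_trans (Cmod_triangle _ _) _; rewrite Cmod_opp.
have h1 : Cmod (A N * g N - A M * g M)%C <= Q * (Cmod (g M) + Cmod (g N)).
  apply: Rle_trans (Cmod_triangle _ _) _; rewrite Cmod_opp !Cmod_mult.
  have := aQ N; have := aQ M; rewrite -/(A N) -/(A M).
  by have := Cmod_ge_0 (g N); have := Cmod_ge_0 (g M); nra.
have h2 : Cmod (\csum_(M <= n < N) (A n.+1 * (g n.+1 - g n)))%C <=
    Q * \rsum_(M <= n < N) Cmod (g n.+1 - g n)%C.
  apply: Rle_trans (csum_mod _ _ _ _) _; rewrite big_distrr /=; apply: rsum_nat_le => n _.
  by rewrite Cmod_mult; apply: Rmult_le_compat_r; [apply: Cmod_ge_0 | apply: aQ].
lra.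
Qed.

Lemma abs_sin_le x : Rabs (sin x) <= Rabs x.
Proof.
have pos y : 0 <= y -> Rabs (sin y) <= y.
  move=> y0; have h := SIN_bound y; case: (Rle_lt_dec y 1) => y1; last by split_Rabs; lra.
  case: (Req_dec y 0) => [->|yn]; first by rewrite sin_0 Rabs_R0; lra.
  have h1 := sin_lt_x y ltac:(lra).
  have h2 : 0 < sin y by apply: sin_gt_0; have := PI2_3_2; lra.
  by rewrite Rabs_pos_eq; lra.
case: (Rle_lt_dec 0 x) => x0; first by rewrite [X in _ <= X]Rabs_pos_eq //; apply: pos.
by rewrite -(Rabs_Ropp x) -(Rabs_Ropp (sin x)) -sin_neg [X in _ <= X]Rabs_pos_eq; [apply: pos|]; lra.
Qed.

Lemma cos_ge_quadratic x : 1 - x ^ 2 / 2 <= cos x.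
Proof.
have -> : cos x = 1 - 2 * sin (x / 2) * sin (x / 2).
  by rewrite -cos_2a_sin; congr cos; field.
have := abs_sin_le (x / 2); move: (sin (x / 2)) => s h.
have : s * s <= (x / 2) * (x / 2); last by nra.
by apply: Rsqr_le_abs_1.
Qed.

Lemma Cmod_le_sq z r : 0 <= r -> Re z ^ 2 + Im z ^ 2 <= r ^ 2 -> Cmod z <= r.
Proof.
move=> r0 h; rewrite /Cmod -(sqrt_pow2 r) //.
by apply: sqrt_le_1_alt; rewrite /Re /Im in h.
Qed.

Lemma Cmod_cis_diff a b :
  Cmod (cis a - cis b)%C <= Rabs (a - b).
Proof.
apply: Cmod_le_sq; first exact: Rabs_pos.
rewrite pow2_abs /=; have := cos_ge_quadratic (a - b); rewrite cos_minus.
have := sin2_cos2 a; have := sin2_cos2 b; rewrite /Rsqr; nra.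
Qed.

Lemma exp_diff_le x y : 0 <= y <= x -> Rabs (exp (- x) - exp (- y)) <= exp (- y) * (x - y).
Proof.
move=> [y0 yx]; have -> : - x = - y + - (x - y) by ring.
rewrite exp_plus; have e0 := exp_pos (- y).
have h1 := exp_ineq1_le (- (x - y)).
have h2 : exp (- (x - y)) <= 1 by rewrite -exp_0; apply: exp_le; lra.
have -> : exp (- y) * exp (- (x - y)) - exp (- y) = - (exp (- y) * (1 - exp (- (x - y)))) by ring.
rewrite Rabs_Ropp Rabs_pos_eq; nra.
Qed.

Lemma pow_diff_le v w j : 0 <= v <= w -> w ^ j.+1 - v ^ j.+1 <= INR j.+1 * (w - v) * w ^ j.
Proof.
move=> [v0 vw]; elim: j => [|j IH]; first by rewrite /=; lra.
have vj : v ^ j.+1 <= w ^ j.+1 by apply: pow_incr.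
rewrite S_INR -(tech_pow_Rmult w j.+1) -(tech_pow_Rmult v j.+1).
rewrite -(tech_pow_Rmult w j) in IH vj *; nra.
Qed.

Lemma exp_neg_ln n : (0 < n)%N -> exp (- ln (INR n)) = / INR n.
Proof. by move=> n0; rewrite exp_Ropp exp_ln //; apply: INR_gt0. Qed.

Lemma exp_half_succ n : (0 < n)%N ->
  exp (/ 2 * ln (INR n.+1)) <= 2 * exp (/ 2 * ln (INR n)).
Proof.
move=> n0; have [_ h] := ln_succ_diff n n0.
have i1 : / INR n <= 1 by rewrite -Rinv_1; apply: Rinv_le_contravar; [lra | apply: INR_ge1].
have : exp (/ 2 * ln (INR n.+1)) <= exp (/ 2 + / 2 * ln (INR n)) by apply: exp_le; lra.
rewrite exp_plus.
have : exp (/ 2) <= 2.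
  have e : exp (/ 2) * exp (/ 2) = exp 1 by rewrite -exp_plus; congr exp; field.
  by have := exp_le_3; have := exp_pos (/ 2); nra.
have := exp_pos (/ 2 * ln (INR n)); nra.
Qed.

Lemma lnf_half j n : (0 < n)%N -> lnf j n <= 2 ^ j * exp (/ 2 * ln (INR n)).
Proof. by move=> n0; have := lnf_le_exp j n (/ 2) n0 ltac:(lra); rewrite -pow_inv Rinv_inv. Qed.

Lemma lnf_diff j n : (0 < n)%N ->
  0 <= lnf j n.+1 - lnf j n <= / INR n * (2 ^ j.+1 * exp (/ 2 * ln (INR n))).
Proof.
move=> n0; have [h1 h2] := ln_succ_diff n n0; have l0 := ln_INR_ge0 n n0.
have p1 := Rinv_0_lt_compat _ (INR_gt0 n.+1 isT).
have p0 := Rinv_0_lt_compat _ (INR_gt0 n n0).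
have e0 := exp_pos (/ 2 * ln (INR n)).
case: j => [|j].
  rewrite !lnf0; split; first lra.
  by have : 0 <= / INR n * (2 ^ 1 * exp (/ 2 * ln (INR n))); [apply: Rmult_le_pos; lra | lra].
split.
  have : lnf j.+1 n <= lnf j.+1 n.+1; last lra.
  apply: Rmult_le_compat_r; first by apply: Rlt_le; apply: Rinv_0_lt_compat; apply: INR_fact_lt_0.
  by apply: pow_incr; lra.
apply: (Rle_trans _ (/ INR n * lnf j n.+1)).
  rewrite /lnf fact_simpl mult_INR.
  have f0 := INR_fact_lt_0 j; have j0 := INR_gt0 j.+1 isT.
  have hd := pow_diff_le (ln (INR n)) (ln (INR n.+1)) j ltac:(lra).
  have wj : 0 <= ln (INR n.+1) ^ j by apply: pow_le; lra.
  apply: (Rmult_le_reg_l (INR j.+1 * INR (Factorial.fact j))); first exact: Rmult_lt_0_compat.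
  have -> : INR j.+1 * INR (Factorial.fact j) * (ln (INR n.+1) ^ j.+1 / (INR j.+1 * INR (Factorial.fact j)) -
     ln (INR n) ^ j.+1 / (INR j.+1 * INR (Factorial.fact j))) = ln (INR n.+1) ^ j.+1 - ln (INR n) ^ j.+1.
    by field; lra.
  have -> : INR j.+1 * INR (Factorial.fact j) * (/ INR n * (ln (INR n.+1) ^ j / INR (Factorial.fact j))) =
    INR j.+1 * / INR n * ln (INR n.+1) ^ j by have ? := INR_gt0 n n0; field; lra.
  apply: Rle_trans hd _; apply: Rmult_le_compat_r => //; apply: Rmult_le_compat_l; lra.
apply: Rmult_le_compat_l; first lra.
apply: Rle_trans (lnf_half _ _ _) _ => //; have := exp_half_succ n n0.
have : 0 < 2 ^ j by apply: pow_lt; lra.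
rewrite -tech_pow_Rmult -tech_pow_Rmult; nra.
Qed.

Lemma exp_neg_sg sg n : 1 <= sg -> (0 < n)%N -> exp (- sg * ln (INR n)) <= / INR n.
Proof.
by move=> s1 n0; rewrite -exp_neg_ln //; apply: exp_le; have := ln_INR_ge0 n n0; nra.
Qed.

(** Modulus, phase and logarithm power are varied one at a time. Each variation is O((1 + |t|) /
    n^2) up to the power of the logarithm, which is traded for n^(1/2); the exponent 3/2 left over
    is summable. *)
Lemma npow_lnf_diff j sg t n : 1 <= sg <= 2 -> (0 < n)%N ->
  Cmod (npow sg t n.+1 * RtoC (lnf j n.+1) - npow sg t n * RtoC (lnf j n))%C <=
  (4 + Rabs t) * 2 ^ j.+1 * exp (- (1 + / 2) * ln (INR n)).
Proof.
move=> s12 n0; have [h1 h2] := ln_succ_diff n n0; have l0 := ln_INR_ge0 n n0.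
have p1 := Rinv_0_lt_compat _ (INR_gt0 n.+1 isT).
have p0 := Rinv_0_lt_compat _ (INR_gt0 n n0).
have e0 := exp_pos (/ 2 * ln (INR n)).
set v := ln (INR n) in h1 h2 l0 e0 *; set w := ln (INR n.+1) in h1 h2 *.
set X := lnf j n.+1; set Y := lnf j n.
have hX : 0 <= X <= 2 ^ j.+1 * exp (/ 2 * v).
  split; first exact: lnf_ge0.
  apply: Rle_trans (lnf_half _ _ _) _ => //; have := exp_half_succ n n0; rewrite -/v -/w.
  have : 0 < 2 ^ j by apply: pow_lt; lra.
  rewrite -tech_pow_Rmult; nra.
have hXY : 0 <= X - Y <= / INR n * (2 ^ j.+1 * exp (/ 2 * v)) := lnf_diff j n n0.
set S := 2 ^ j.+1 * exp (/ 2 * v) in hX hXY.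
have S0 : 0 < S by apply: Rmult_lt_0_compat => //; apply: pow_lt; lra.
set E := exp (- sg * v); set E' := exp (- sg * w).
have hE : 0 < E <= / INR n by split; [apply: exp_pos | apply: exp_neg_sg; [lra|]].
have hEE : Rabs (E' - E) <= E * (2 * / INR n).
  rewrite /E' /E !Ropp_mult_distr_l_reverse; apply: Rle_trans (exp_diff_le _ _ _) _; first by nra.
  apply: Rmult_le_compat_l; first exact: Rlt_le (exp_pos _).
  nra.
set u := cis (t * v); set u' := cis (t * w).
have hu : Cmod (u' - u)%C <= Rabs t * / INR n.
  apply: Rle_trans (Cmod_cis_diff _ _) _.
  rewrite -Rmult_minus_distr_l Rabs_mult (Rabs_pos_eq (w - v)); last lra.
  by apply: Rmult_le_compat_l; [apply: Rabs_pos | lra].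
have -> : (npow sg t n.+1 * RtoC X - npow sg t n * RtoC Y =
   RtoC (E' - E) * u' * RtoC X + RtoC E * (u' - u) * RtoC X + RtoC E * u * RtoC (X - Y))%C.
  by rewrite /npow -/v -/w -/E -/E' -/u -/u' !RtoC_minus; ring.
apply: Rle_trans (Cmod_triangle _ _) _.
apply: Rle_trans (Rplus_le_compat_r _ _ _ (Cmod_triangle _ _)) _.
rewrite !Cmod_mult !Cmod_R !Cmod_unit (Rabs_pos_eq E) ?(Rabs_pos_eq X) ?(Rabs_pos_eq (X - Y)); try lra.
have -> : exp (- (1 + / 2) * v) = / INR n * / INR n * exp (/ 2 * v).
  rewrite -exp_neg_ln // -/v -!exp_plus; congr exp; field.
have t0 := Rabs_pos t; set T := Rabs t in hu t0 *.
have -> : (4 + T) * 2 ^ j.+1 * (/ INR n * / INR n * exp (/ 2 * v)) = (4 + T) * (/ INR n * / INR n) * S.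
  by rewrite /S; ring.
set I := / INR n in p0 h2 hXY hE hEE hu *.
have A1 : Rabs (E' - E) * 1 * X <= 2 * (I * I) * S.
  have := Rabs_pos (E' - E) => ?.
  apply: Rmult_le_compat; [lra | lra | nra | lra].
have A2 : E * Cmod (u' - u)%C * X <= T * (I * I) * S.
  have u0 := Cmod_ge_0 (u' - u)%C.
  apply: Rmult_le_compat; [nra | lra | | lra].
  have := Rmult_le_compat _ _ _ _ (Rlt_le _ _ hE.1) u0 hE.2 hu; lra.
have A3 : E * 1 * (X - Y) <= (I * I) * S.
  have := Rmult_le_compat _ _ _ _ (Rlt_le _ _ hE.1) hXY.1 hE.2 hXY.2; nra.
have : 0 <= (I * I) * S by apply: Rmult_le_pos; nra.
lra.
Qed.

(** Partial summation turns the bound on the coefficient sums into a tail of order M^(-1/2),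
    uniformly down to sg = 1. Absolute convergence would lose a factor 1/(sg - 1). *)
Lemma L_tail a Q j sg t M N : bounded_sums a Q -> 1 <= sg <= 2 -> (0 < M)%N ->
  Cmod (\csum_(M.+1 <= n < N) (a n * (npow sg t n * RtoC (lnf j n))))%C <=
  Q * ((4 + Rabs t) * 2 ^ (j + 3) * exp (- / 2 * ln (INR M))).
Proof.
move=> aQ s12 M0; have Q0 := bounded_sums_ge0 _ _ aQ; have t0 := Rabs_pos t.
have j0 : 0 < 2 ^ j by apply: pow_lt; lra.
have eM := exp_pos (- / 2 * ln (INR M)).
case: (leqP N M) => NM.
  rewrite big_geq ?Cmod_0; last by lia.
  apply: Rmult_le_pos => //; apply: Rmult_le_pos; last lra.
  by apply: Rmult_le_pos; [lra | apply: pow_le; lra].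
apply: Rle_trans (abel_bound _ _ _ _ _ aQ _) _ => //.
apply: Rmult_le_compat_l => //.
have hg n : (M <= n)%N -> Cmod (npow sg t n * RtoC (lnf j n))%C <= 2 ^ j * exp (- / 2 * ln (INR M)).
  move=> Mn; have n0 : (0 < n)%N by lia.
  rewrite Cmod_mult Cmod_npow Cmod_R Rabs_pos_eq; last exact: lnf_ge0.
  apply: (Rle_trans _ (exp (- ln (INR n)) * (2 ^ j * exp (/ 2 * ln (INR n))))).
    apply: Rmult_le_compat; [exact: Rlt_le (exp_pos _) | exact: lnf_ge0 | | exact: lnf_half].
    by rewrite exp_neg_ln //; apply: exp_neg_sg; [lra|].
  have -> : exp (- ln (INR n)) * (2 ^ j * exp (/ 2 * ln (INR n))) = 2 ^ j * exp (- / 2 * ln (INR n)).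
    by rewrite -Rmult_assoc (Rmult_comm (exp _)) Rmult_assoc -exp_plus; congr Rmult; congr exp; field.
  apply: Rmult_le_compat_l; first lra.
  apply: exp_le; have : ln (INR M) <= ln (INR n); last lra.
  by apply: ln_le; [apply: INR_gt0 | apply: le_INR; lia].
have g1 := hg M.+1 ltac:(lia); have g2 := hg N ltac:(lia).
have g3 : \rsum_(M.+1 <= n < N) Cmod (npow sg t n.+1 * RtoC (lnf j n.+1) - npow sg t n * RtoC (lnf j n))%C <=
   (4 + Rabs t) * 2 ^ j.+1 * (2 * exp (- / 2 * ln (INR M))).
  apply: (Rle_trans _ (\rsum_(M.+1 <= n < N) ((4 + Rabs t) * 2 ^ j.+1 * exp (- (1 + / 2) * ln (INR n))))).
    by apply: rsum_nat_le => n hn; apply: npow_lnf_diff => //; lia.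
  have K0 : 0 <= (4 + Rabs t) * 2 ^ j.+1 by apply: Rmult_le_pos; [lra | apply: pow_le; lra].
  move: (_ * 2 ^ j.+1) K0 => K K0; rewrite -big_distrr /=; apply: Rmult_le_compat_l => //.
  have := zeta_tail_le (/ 2) M N ltac:(lra) M0.
  by rewrite Rinv_inv.
rewrite -tech_pow_Rmult in g3; rewrite pow_add /=.
set e := exp _ in eM g1 g2 g3 *.
have P0 := Rmult_lt_0_compat _ _ j0 eM; have P1 := Rmult_le_pos _ _ t0 (Rlt_le _ _ P0).
lra.
Qed.

Lemma nat_between r : 1 <= r -> exists M : nat, (0 < M)%N /\ r <= INR M <= 2 * r.
Proof.
move=> r1; have [n [h1 h2]] := nfloor_ex r ltac:(lra).
by exists n.+1; split=> //; rewrite S_INR; lra.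
Qed.

(** Any power of the logarithm of a number polynomial in z costs one factor z, by u^m / m! <= exp u
    at u = (1 + ln M) / K. *)
Lemma ln_pow_bound m K : (0 < K)%N -> exists Cst, 0 < Cst /\
  forall z M, 1 <= z -> (0 < M)%N -> INR M <= 2 * z ^ K -> (1 + ln (INR M)) ^ m <= Cst * z.
Proof.
move=> K0; have k0 := INR_gt0 K K0; have ik := Rinv_0_lt_compat _ k0.
have k1 : / INR K <= 1 by rewrite -Rinv_1; apply: Rinv_le_contravar; [lra | apply: INR_ge1].
exists (INR (Factorial.fact m) * INR K ^ m * exp 2); split.
  apply: Rmult_lt_0_compat (exp_pos _); apply: Rmult_lt_0_compat; [exact: INR_fact_lt_0 | exact: pow_lt].
move=> z M z1 M0 Mz; have l0 := ln_INR_ge0 M M0.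
have := pow_fact_le_exp (/ INR K * (1 + ln (INR M))) m ltac:(nra).
have f0 := INR_fact_lt_0 m; have km : 0 < INR K ^ m by apply: pow_lt.
rewrite Rpow_mult_distr pow_inv => h.
have hl : ln (INR M) <= 1 + INR K * ln z.
  have zk : 0 < z ^ K by apply: pow_lt; lra.
  apply: (Rle_trans _ (ln (2 * z ^ K))); first by apply: ln_le => //; apply: INR_gt0.
  rewrite ln_mult //; last lra; rewrite ln_pow; last lra.
  have l2 := exp_ineq1_le (ln 2); rewrite exp_ln in l2; lra.
have he : exp (/ INR K * (1 + ln (INR M))) <= exp 2 * z.
  rewrite -[X in _ <= _ * X](exp_ln z); last lra.
  rewrite -exp_plus; apply: exp_le.
  have -> : 2 + ln z = 2 + / INR K * (INR K * ln z) by field; lra.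
  nra.
apply: (Rmult_le_reg_l (/ INR K ^ m / INR (Factorial.fact m))).
  by apply: Rdiv_lt_0_compat => //; apply: Rinv_0_lt_compat.
have -> : / INR K ^ m / INR (Factorial.fact m) * (INR (Factorial.fact m) * INR K ^ m * exp 2 * z) = exp 2 * z.
  by field; lra.
by apply: Rle_trans he; apply: Rle_trans h; apply: Req_le; rewrite /Rdiv; ring.
Qed.

Lemma harmonic_le M : (0 < M)%N -> \rsum_(1 <= n < M.+1) / INR n <= 1 + ln (INR M).
Proof.
move=> M0; rewrite big_ltn // -[INR 1]/1 Rinv_1; apply: Rplus_le_compat_l.
rewrite big_add1 -[M.+1.-1]/M.
apply: (Rle_trans _ (\rsum_(1 <= n < M) (ln (INR n.+1) - ln (INR n)))).
  by apply: rsum_nat_le => n /andP[n0 _]; case: (ln_succ_diff n n0).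
by rewrite (rsum_telescope _ _ (fun n => ln (INR n))) // -[INR 1]/1 ln_1; lra.
Qed.

(* [DSL a sg t 0] is the Dirichlet series of [a] at [sg + i t]; [DSL a sg t j] is,
   up to the factor [(-1)^j / j!], its [j]-th derivative. *)
Definition DSL (a : nat -> C) (sg t : R) (j : nat) : C :=
  tsum (fun n => a n * npow sg t n * RtoC (lnf j n))%C.

Lemma absum_DSL a sg t j : 1 < sg -> (forall n, Cmod (a n) <= 1) ->
  absum (fun n => a n * npow sg t n * RtoC (lnf j n))%C
    ((2 / (sg - 1)) ^ j * (1 + 2 / (sg - 1))).
Proof.
move=> s1 a1; apply: (absum_lnf (fun n => a n * npow sg t n)%C) => [|n n0]; first lra.
rewrite Cmod_mult Cmod_npow; have -> : 1 + (sg - 1) = sg by ring.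
by have := exp_pos (- sg * ln (INR n)); have := a1 n; nra.
Qed.

Lemma lnf_mono j m n : (0 < m)%N -> (m <= n)%N -> lnf j m <= (1 + ln (INR n)) ^ j.
Proof.
move=> m0 mn; have l0 := ln_INR_ge0 m m0.
have lmn : ln (INR m) <= ln (INR n) by apply: ln_le; [apply: INR_gt0 | apply: le_INR; lia].
apply: (Rle_trans _ (ln (INR m) ^ j)); last by apply: pow_incr; lra.
have p0 : 0 <= ln (INR m) ^ j by apply: pow_le.
have f1 : 1 <= INR (Factorial.fact j) by apply: (le_INR 1); apply: lt_O_fact.
rewrite /lnf /Rdiv -[X in _ <= X]Rmult_1_r; apply: Rmult_le_compat_l => //.
by rewrite -[X in _ <= X]Rinv_1; apply: Rinv_le_contravar; lra.
Qed.

Lemma DSL_head a sg t j M : 1 <= sg -> (forall n, Cmod (a n) <= 1) -> (0 < M)%N ->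
  Cmod (\csum_(1 <= n < M.+1) (a n * npow sg t n * RtoC (lnf j n)))%C <= (1 + ln (INR M)) ^ j.+1.
Proof.
move=> s1 a1 M0; apply: Rle_trans (csum_mod _ _ _ _) _.
have l0 := ln_INR_ge0 M M0; have lj : 0 <= (1 + ln (INR M)) ^ j by apply: pow_le; lra.
rewrite -tech_pow_Rmult.
apply: (Rle_trans _ (\rsum_(1 <= n < M.+1) (/ INR n * (1 + ln (INR M)) ^ j))).
  apply: rsum_nat_le => n /andP[n0 nM].
  rewrite 2!Cmod_mult Cmod_npow Cmod_R Rabs_pos_eq; last exact: lnf_ge0.
  apply: Rmult_le_compat; [| exact: lnf_ge0 | | exact: lnf_mono].
    by apply: Rmult_le_pos; [apply: Cmod_ge_0 | apply: Rlt_le; apply: exp_pos].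
  have := exp_neg_sg sg n s1 n0; have := a1 n; have := Cmod_ge_0 (a n).
  have := exp_pos (- sg * ln (INR n)); nra.
by rewrite -big_distrl /=; apply: Rmult_le_compat_r => //; apply: harmonic_le.
Qed.

Lemma exp_half_le_inv z k M : 1 <= z -> (0 < M)%N -> z ^ (2 * k) <= INR M ->
  exp (- / 2 * ln (INR M)) <= / z ^ k.
Proof.
move=> z1 M0 h; have zk : 0 < z ^ k by apply: pow_lt; lra.
rewrite -(exp_ln (/ z ^ k)); last exact: Rinv_0_lt_compat.
apply: exp_le; rewrite ln_Rinv // .
have : ln (z ^ (2 * k)) <= ln (INR M) by apply: ln_le => //; apply: pow_lt; lra.
by rewrite mulnC pow_mult (ln_pow (z ^ k)) // /=; lra.
Qed.

Lemma DSL_tail a Q j sg t M N z B : bounded_sums a Q -> 1 <= sg <= 2 -> (0 < M)%N ->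
  1 <= z -> Q <= z ^ B -> Rabs t <= z ^ B ->
  Cmod (\csum_(M.+1 <= n < N) (a n * npow sg t n * RtoC (lnf j n)))%C <=
  5 * 2 ^ (j + 3) * z ^ (2 * B) * exp (- / 2 * ln (INR M)).
Proof.
move=> aQ s12 M0 z1 Qz tz; have Q0 := bounded_sums_ge0 _ _ aQ; have t0 := Rabs_pos t.
have z1B : 1 <= z ^ B by apply: pow_R1_Rle.
rewrite (eq_bigr (fun n => a n * (npow sg t n * RtoC (lnf j n)))%C); last by move=> n _; ring.
apply: Rle_trans (L_tail _ _ _ _ _ _ _ aQ s12 M0) _.
have p2 : 0 < 2 ^ (j + 3) by apply: pow_lt; lra.
have e0 := exp_pos (- / 2 * ln (INR M)).
have -> : Q * ((4 + Rabs t) * 2 ^ (j + 3) * exp (- / 2 * ln (INR M))) =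
  Q * (4 + Rabs t) * (2 ^ (j + 3) * exp (- / 2 * ln (INR M))) by ring.
have -> : 5 * 2 ^ (j + 3) * z ^ (2 * B) * exp (- / 2 * ln (INR M)) =
  5 * z ^ (2 * B) * (2 ^ (j + 3) * exp (- / 2 * ln (INR M))) by ring.
apply: Rmult_le_compat_r; first by apply: Rlt_le; apply: Rmult_lt_0_compat.
rewrite mulnC pow_mult /=; nra.
Qed.

Lemma tsum_split_le a K M h e : absum a K ->
  Cmod (\csum_(1 <= n < M.+1) a n) <= h ->
  (forall N, Cmod (\csum_(M.+1 <= n < N) a n) <= e) -> Cmod (tsum a) <= h + e.
Proof.
move=> aK hh he; apply: (tsum_mod_le _ _ _ aK); exists M.+1 => N MN.
rewrite (@big_cat_nat _ _ _ M.+1) //=.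
by apply: Rle_trans (Cmod_triangle _ _) _; have := he N; lra.
Qed.

Lemma L_bound j B : exists Cst, 0 < Cst /\
  forall z a Q sg t, 1 <= z -> bounded_sums a Q -> (forall n, Cmod (a n) <= 1) ->
    Q <= z ^ B -> Rabs t <= z ^ B -> 1 < sg <= 2 -> Cmod (DSL a sg t j) <= Cst * z.
Proof.
have [C1 [C10 hC1]] := ln_pow_bound j.+1 (2 * (2 * B).+1) ltac:(lia).
have p2 : 0 < 2 ^ (j + 3) by apply: pow_lt; lra.
exists (C1 + 5 * 2 ^ (j + 3)); split; first by lra.
move=> z a Q sg t z1 aQ a1 Qz tz s12.
(* The head up to M is a power of 1 + ln M, hence O(z). The exponent makes M^(-1/2) at most z^(-2B -
   1), which absorbs the factor z^(2B) coming from Q and t in the tail. *)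
have [M [M0 [M1 M2]]] := nat_between (z ^ (2 * (2 * B).+1)) ltac:(apply: pow_R1_Rle; lra).
have h1 := hC1 z M z1 M0 M2.
apply: (Rle_trans _ (C1 * z + 5 * 2 ^ (j + 3))); last nra.
apply: (tsum_split_le _ _ M _ _ (absum_DSL a sg t j (proj1 s12) a1)).
  by apply: Rle_trans (DSL_head _ _ _ _ _ _ _ _) h1 => //; lra.
move=> N; apply: Rle_trans (DSL_tail _ _ _ _ _ _ _ _ _ aQ _ M0 z1 Qz tz) _; first lra.
have h2 := exp_half_le_inv z (2 * B).+1 M z1 M0 M1.
have zb : 1 <= z ^ (2 * B) by apply: pow_R1_Rle; lra.
have h3 : z ^ (2 * B) * exp (- / 2 * ln (INR M)) <= 1.
  apply: (Rle_trans _ (z ^ (2 * B) * / z ^ (2 * B).+1)); first by apply: Rmult_le_compat_l; lra.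
  rewrite -tech_pow_Rmult Rinv_mult.
  have -> : z ^ (2 * B) * (/ z * / z ^ (2 * B)) = / z by field; lra.
  by rewrite -Rinv_1; apply: Rinv_le_contravar; lra.
nra.
Qed.

Lemma exp_diff_abs c x y : 0 <= x -> 0 <= y -> c <= x -> c <= y ->
  Rabs (exp (- x) - exp (- y)) <= exp (- c) * Rabs (x - y).
Proof.
have key u v : 0 <= v <= u -> c <= v -> Rabs (exp (- u) - exp (- v)) <= exp (- c) * Rabs (u - v).
  move=> [v0 vu] cv; apply: Rle_trans (exp_diff_le _ _ _) _ => //; rewrite Rabs_pos_eq; last lra.
  by apply: Rmult_le_compat_r; [lra | apply: exp_le; lra].
move=> x0 y0 cx cy; case: (Rle_lt_dec y x) => h; first by apply: key.
rewrite Rabs_minus_sym (Rabs_minus_sym x); apply: key; lra.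
Qed.

Lemma npow_diff_head sg sg' t n : 1 <= sg -> 1 <= sg' -> (0 < n)%N ->
  Cmod (npow sg t n - npow sg' 0 n)%C <= (Rabs (sg - sg') + Rabs t) * ln (INR n) * / INR n.
Proof.
move=> s1 s1' n0; have l0 := ln_INR_ge0 n n0; rewrite /npow; set v := ln (INR n) in l0 *.
have -> : (RtoC (exp (- sg * v)) * cis (t * v) - RtoC (exp (- sg' * v)) * cis (0 * v) =
  RtoC (exp (- sg * v) - exp (- sg' * v)) * cis (t * v) + RtoC (exp (- sg' * v)) * (cis (t * v) - cis (0 * v)))%C.
  by rewrite RtoC_minus; ring.
apply: Rle_trans (Cmod_triangle _ _) _; rewrite !Cmod_mult !Cmod_R Cmod_unit.
have h1 : Rabs (exp (- sg * v) - exp (- sg' * v)) <= / INR n * (Rabs (sg - sg') * v).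
  rewrite -exp_neg_ln // -/v !Ropp_mult_distr_l_reverse.
  apply: Rle_trans (exp_diff_abs v _ _ _ _ _ _) _; try nra.
  by rewrite -Rmult_minus_distr_r Rabs_mult (Rabs_pos_eq v); lra.
have h2 : Cmod (cis (t * v) - cis (0 * v))%C <= Rabs t * v.
  by apply: Rle_trans (Cmod_cis_diff _ _) _; rewrite -Rmult_minus_distr_r Rminus_0_r Rabs_mult (Rabs_pos_eq v); lra.
have h3 := exp_neg_sg sg' n s1' n0; rewrite -/v in h3.
rewrite (Rabs_pos_eq (exp _)); last exact: Rlt_le (exp_pos _).
have h4 := Rmult_le_compat _ _ _ _ (Rlt_le _ _ (exp_pos (- sg' * v))) (Cmod_ge_0 _) h3 h2.
lra.
Qed.

(** This carries the lower bound at s = 1 to the points sg + i t with small t. The first summand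
    comes from the terms n <= M, through the variation of n^(-s), and the second from the tails. *)
Lemma L_diff B : exists Cst, 0 < Cst /\
  forall z a Q sg sg' t, 1 <= z -> bounded_sums a Q -> (forall n, Cmod (a n) <= 1) ->
    Q <= z ^ B -> Rabs t <= 1 -> 1 < sg <= 2 -> 1 < sg' <= 2 ->
    Cmod (DSL a sg t 0 - DSL a sg' 0 0)%C <= Cst * (z * (Rabs (sg - sg') + Rabs t) + / z ^ 2).
Proof.
have [C1 [C10 hC1]] := ln_pow_bound 2 (2 * (2 * B + 2)) ltac:(lia).
exists (C1 + 80); split; first lra.
move=> z a Q sg sg' t z1 aQ a1 Qz t1 s12 s12'.
have [M [M0 [M1 M2]]] := nat_between (z ^ (2 * (2 * B + 2))) ltac:(apply: pow_R1_Rle; lra).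
have h1 := hC1 z M z1 M0 M2.
have A1 := absum_DSL a sg t 0 (proj1 s12) a1.
have A2 := absum_DSL a sg' 0 0 (proj1 s12') a1.
have E : (DSL a sg t 0 - DSL a sg' 0 0 = tsum (fun n => a n * npow sg t n * RtoC (lnf 0 n) +
     - RtoC 1 * (a n * npow sg' 0 n * RtoC (lnf 0 n))))%C.
  rewrite (tsum_add _ _ _ _ A1 (absum_scal _ (- RtoC 1)%C _ A2)) (tsum_scal _ _ _ A2) /DSL; ring.
rewrite E.
set dd := Rabs (sg - sg') + Rabs t.
have dd0 : 0 <= dd by have := Rabs_pos (sg - sg'); have := Rabs_pos t; rewrite /dd; lra.
have iz : 0 < / z ^ 2 by apply: Rinv_0_lt_compat; apply: pow_lt; lra.
apply: (Rle_trans _ (C1 * z * dd + 80 * / z ^ 2)); last nra.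
apply: (tsum_split_le _ _ M _ _ (absum_add _ _ _ _ A1 (absum_scal _ (- RtoC 1)%C _ A2))).
  apply: Rle_trans (csum_mod _ _ _ _) _.
  apply: (Rle_trans _ (\rsum_(1 <= n < M.+1) (/ INR n * (dd * ln (INR M))))).
    apply: rsum_nat_le => n /andP[n0 nM].
    have -> : (a n * npow sg t n * RtoC (lnf 0 n) + - RtoC 1 * (a n * npow sg' 0 n * RtoC (lnf 0 n)) =
       a n * (npow sg t n - npow sg' 0 n))%C by rewrite lnf0; ring.
    rewrite Cmod_mult; have h := npow_diff_head sg sg' t n ltac:(lra) ltac:(lra) n0; rewrite -/dd in h.
    have in0 := Rinv_0_lt_compat _ (INR_gt0 n n0).
    have ll : ln (INR n) <= ln (INR M) by apply: ln_le; [apply: INR_gt0 | apply: le_INR; lia].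
    apply: (Rle_trans _ (1 * (dd * ln (INR n) * / INR n))).
      by apply: Rmult_le_compat => //; exact: Cmod_ge_0.
    have : dd * ln (INR n) <= dd * ln (INR M) by apply: Rmult_le_compat_l.
    nra.
  rewrite -big_distrl /=; have l0 := ln_INR_ge0 M M0; have hh := harmonic_le M M0.
  apply: (Rle_trans _ ((1 + ln (INR M)) * (dd * ln (INR M)))).
    by apply: Rmult_le_compat_r => //; apply: Rmult_le_pos.
  rewrite /= in h1; nra.
move=> N; rewrite big_split /= -big_distrr /=.
apply: Rle_trans (Cmod_triangle _ _) _; rewrite Cmod_mult Cmod_opp Cmod_1 Rmult_1_l.
have zB1 : 1 <= z ^ B by apply: pow_R1_Rle.
have h2 := DSL_tail a Q 0 sg t M N z B aQ ltac:(lra) M0 z1 Qz ltac:(lra).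
have h3 := DSL_tail a Q 0 sg' 0 M N z B aQ ltac:(lra) M0 z1 Qz ltac:(rewrite Rabs_R0; lra).
have h4 := exp_half_le_inv z (2 * B + 2) M z1 M0 M1.
have zb : 1 <= z ^ (2 * B) by apply: pow_R1_Rle; lra.
have h5 : z ^ (2 * B) * exp (- / 2 * ln (INR M)) <= / z ^ 2.
  apply: (Rle_trans _ (z ^ (2 * B) * / z ^ (2 * B + 2))); first by apply: Rmult_le_compat_l; lra.
  by apply: Req_le; rewrite (pow_add z (2 * B) 2); field; lra.
move: h2 h3; rewrite add0n /=; rewrite /= in h5; lra.
Qed.

(** * Dirichlet characters and L-functions *)

Lemma sin_sub_le y : Rabs (sin y - y) <= y ^ 2.
Proof.
have pos x : 0 <= x -> Rabs (sin x - x) <= x ^ 2.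
  move=> x0; case: (Req_dec x 0) => [->|xn]; first by rewrite sin_0 Rminus_0_r Rabs_R0 /=; lra.
  have [c [hc [c0 cx]]] := MVT_cor2 sin cos 0 x ltac:(lra) (fun u _ => derivable_pt_lim_sin u).
  rewrite sin_0 !Rminus_0_r in hc; rewrite hc.
  have := cos_ge_quadratic c; have := COS_bound c => h1 h2.
  have -> : cos c * x - x = - ((1 - cos c) * x) by ring.
  rewrite Rabs_Ropp Rabs_pos_eq; last by nra.
  have h3 : 1 - cos c <= x by case: (Rle_lt_dec c 2) => h; nra.
  by have := Rmult_le_compat_r x _ _ x0 h3; rewrite /=; lra.
case: (Rle_lt_dec 0 y) => y0; first exact: pos.
have := pos (- y) ltac:(lra); rewrite sin_neg -Rabs_Ropp.
have -> : - (- sin y - - y) = sin y - y by ring.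
by have -> : (- y) ^ 2 = y ^ 2 by ring.
Qed.

Lemma cexp_taylor x y : 0 <= x ->
  Cmod (RtoC 1 - RtoC (exp (- x)) * cis y - (x, y))%C <= 4 * (x ^ 2 + y ^ 2).
Proof.
move=> x0; apply: Rle_trans (Cmod_ReIm _) _.
have -> : Re (RtoC 1 - RtoC (exp (- x)) * cis y - (x, y))%C = (1 - exp (- x) - x) + exp (- x) * (1 - cos y).
  by rewrite /cis /RtoC /Cminus /Cmult /Cplus /Copp /Re /=; ring.
have -> : Im (RtoC 1 - RtoC (exp (- x)) * cis y - (x, y))%C = exp (- x) * (sin y - y) + (exp (- x) - 1) * y.
  by rewrite /cis /RtoC /Cminus /Cmult /Cplus /Copp /Im /=; ring.
have e0 := exp_pos (- x); have e1 := exp_ineq1_le (- x).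
have e2 : exp (- x) <= 1 by rewrite -exp_0; apply: exp_le; lra.
have e3 : exp (- x) <= 1 - x + x ^ 2.
  have h : exp (- x) * (1 + x) <= 1.
    rewrite -[X in _ <= X]exp_0 -(Rplus_opp_l x) exp_plus; apply: Rmult_le_compat_l; first lra.
    exact: exp_ineq1_le.
  have : (1 + x) * (1 - x + x ^ 2) >= 1 by have : 0 <= x ^ 3 by [apply: pow_le]; lra.
  nra.
have c1 := cos_ge_quadratic y; have c2 := COS_bound y; have s1 := sin_sub_le y.
have r1 : Rabs (1 - exp (- x) - x + exp (- x) * (1 - cos y)) <= x ^ 2 + y ^ 2 / 2.
  have : 0 <= exp (- x) * (1 - cos y) <= y ^ 2 / 2 by nra.
  by have : 0 <= x ^ 2 by [apply: pow2_ge_0]; split_Rabs; lra.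
have r2 : Rabs (exp (- x) * (sin y - y) + (exp (- x) - 1) * y) <= y ^ 2 + x * Rabs y.
  apply: Rle_trans (Rabs_triang _ _) _; rewrite !Rabs_mult.
  have a1 : Rabs (exp (- x)) * Rabs (sin y - y) <= y ^ 2.
    by rewrite Rabs_pos_eq; [have := Rabs_pos (sin y - y); nra | lra].
  have a2 : Rabs (exp (- x) - 1) * Rabs y <= x * Rabs y.
    by apply: Rmult_le_compat_r; [apply: Rabs_pos | split_Rabs; lra].
  lra.
have : x * Rabs y <= x ^ 2 + y ^ 2.
  rewrite -(pow2_abs y); have := Rabs_pos y; nra.
have := pow2_ge_0 x; have := pow2_ge_0 y; lra.
Qed.

Lemma npow_shift sg t n : (0 < n)%N -> npow sg t n = (npow (sg - 1) t n * RtoC (/ INR n))%C.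
Proof.
move=> n0; rewrite /npow -exp_neg_ln //.
have -> : - sg * ln (INR n) = - (sg - 1) * ln (INR n) + - ln (INR n) by ring.
by rewrite exp_plus RtoC_mult; ring.
Qed.

(** First-order Taylor expansion of the increment of n^(1 - s), with a summable error. Summed over
    n, it expresses (s - 1) times a piece of zeta(s) by boundary terms, in place of analytic
    continuation. *)
Lemma npow_step sg t n : 1 < sg <= 2 -> (0 < n)%N ->
  let s1 := ((sg - 1, t) : C) in
  Cmod (npow (sg - 1) t n - npow (sg - 1) t n.+1 - s1 * npow sg t n)%C <=
  Cmod s1 * (4 * Cmod s1 + 1) * exp (- (1 + 1) * ln (INR n)).
Proof.
move=> s12 n0 s1; have [h1 h2] := ln_succ_diff n n0; have l0 := ln_INR_ge0 n n0.
have p0 := Rinv_0_lt_compat _ (INR_gt0 n n0).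
set dl := ln (INR n.+1) - ln (INR n) in h1 h2.
have dl0 : 0 <= dl by have := Rinv_0_lt_compat _ (INR_gt0 n.+1 isT); lra.
have El : ln (INR n.+1) = ln (INR n) + dl by rewrite /dl; ring.
clearbody dl.
have E : npow (sg - 1) t n.+1 = (npow (sg - 1) t n * (RtoC (exp (- ((sg - 1) * dl))) * cis (t * dl)))%C.
  rewrite /npow El.
  have -> : - ((sg - 1) * dl) = - (sg - 1) * dl by ring.
  rewrite !Rmult_plus_distr_l exp_plus /cis cos_plus sin_plus.
  by rewrite /RtoC /Cmult /=; congr pair; ring.
have s10 := Cmod_ge_0 s1.
have hs : Cmod (((sg - 1) * dl, t * dl) : C) = Cmod s1 * dl.
  have -> : (((sg - 1) * dl, t * dl) : C) = (s1 * RtoC dl)%C by rewrite /RtoC /Cmult /s1 /=; congr pair; ring.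
  by rewrite Cmod_mult Cmod_R Rabs_pos_eq.
have key := cexp_taylor ((sg - 1) * dl) (t * dl) ltac:(apply: Rmult_le_pos; lra).
have q : ((sg - 1) * dl) ^ 2 + (t * dl) ^ 2 = (Cmod s1 * dl) ^ 2.
  have := pow2_ge_0 ((sg - 1) * dl); have := pow2_ge_0 (t * dl) => ? ?.
  by rewrite -hs /Cmod [fst _]/= [snd _]/= pow2_sqrt //; lra.
have es : (((sg - 1) * dl, t * dl) : C) = (s1 * RtoC dl)%C by rewrite /RtoC /Cmult /s1 /=; congr pair; ring.
rewrite q es in key.
rewrite E (npow_shift sg) //; set G := npow (sg - 1) t n.
have G1 : Cmod G <= 1.
  by rewrite Cmod_npow -[X in _ <= X]exp_0; apply: exp_le; nra.
have -> : (G - G * (RtoC (exp (- ((sg - 1) * dl))) * cis (t * dl)) - s1 * (G * RtoC (/ INR n)) =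
   G * ((RtoC 1 - RtoC (exp (- ((sg - 1) * dl))) * cis (t * dl) - s1 * RtoC dl) +
     s1 * RtoC (dl - / INR n)))%C.
  by rewrite RtoC_minus; ring.
rewrite Cmod_mult.
have -> : exp (- (1 + 1) * ln (INR n)) = / INR n * / INR n.
  by rewrite -exp_neg_ln // -exp_plus; congr exp; ring.
set I := / INR n in h2 p0 *.
have hI : Rabs (dl - I) <= I * I.
  have : I - / INR n.+1 <= I * I.
    have pn := INR_gt0 n n0; rewrite /I S_INR.
    have -> : / INR n - / (INR n + 1) = / INR n * / (INR n + 1) by field; lra.
    by apply: Rmult_le_compat_l; [exact: Rlt_le | apply: Rinv_le_contravar; lra].
  by split_Rabs; lra.
apply: (Rle_trans _ (1 * (4 * (Cmod s1 * I) ^ 2 + Cmod s1 * (I * I)))); last first.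
  by apply: Req_le; rewrite /=; ring.
apply: Rmult_le_compat => //; try exact: Cmod_ge_0.
apply: Rle_trans (Cmod_triangle _ _) _; apply: Rplus_le_compat.
  apply: Rle_trans key _; apply: Rmult_le_compat_l; first lra.
  apply: pow_incr; split; first exact: Rmult_le_pos.
  by apply: Rmult_le_compat_l; lra.
by rewrite Cmod_mult Cmod_R; apply: Rmult_le_compat_l.
Qed.

(** The constant coefficients have unbounded sums, so the tail is multiplied by s - 1 and telescoped
    with [npow_step]. Dividing by s - 1 costs z^3, because |s - 1| >= |t| >= z^(-3). *)
Lemma zeta_bound B : exists Cst, 0 < Cst /\ forall z sg t, 1 <= z -> 1 < sg <= 2 ->
  Rabs t <= z ^ B -> / z ^ 3 <= Rabs t -> Cmod (DSL (fun=> RtoC 1) sg t 0) <= Cst * z ^ 3.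
Proof.
have [C1 [C10 hC1]] := ln_pow_bound 1 B.+1 ltac:(lia).
exists (C1 + 12); split; first lra.
move=> z sg t z1 s12 tz zt.
have z3 : 0 < z ^ 3 by apply: pow_lt; lra.
have z13 : z <= z ^ 3 by rewrite /=; nra.
have [M [M0 [M1 M2]]] := nat_between (z ^ B.+1) ltac:(apply: pow_R1_Rle; lra).
have h1 := hC1 z M z1 M0 M2.
have a1 : nat -> Cmod (RtoC 1) <= 1 by move=> _; rewrite Cmod_1; lra.
apply: (Rle_trans _ (C1 * z + 12 * z ^ 3)); last nra.
have ab := absum_DSL (fun=> RtoC 1) sg t 0 (proj1 s12) a1.
apply: (tsum_split_le _ _ M _ _ ab).
  by apply: Rle_trans (DSL_head (fun=> RtoC 1) _ _ _ _ _ a1 _) h1 => //; lra.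
move=> N; case: (leqP N M) => MN; first by rewrite big_geq ?Cmod_0; [nra | lia].
pose s1 : C := (sg - 1, t).
have zB : 1 <= z ^ B by apply: pow_R1_Rle.
have s1t : Rabs t <= Cmod s1 by apply: (Im_Cmod s1).
have s1T : Cmod s1 <= 1 + z ^ B.
  by apply: Rle_trans (Cmod_ReIm _) _; rewrite /s1 /Re /Im /= Rabs_pos_eq; lra.
have iz3 : 0 < / z ^ 3 by apply: Rinv_0_lt_compat.
set S := bigop.body _ _ _.
have SE : S = (\csum_(M.+1 <= n < N) npow sg t n)%C.
  by apply: eq_bigr => n _; rewrite lnf0; ring.
pose G n := npow (sg - 1) t n.
have G1 n : (0 < n)%N -> Cmod (G n) <= 1.
  by move=> n0; rewrite Cmod_npow -[X in _ <= X]exp_0; apply: exp_le; have := ln_INR_ge0 n n0; nra.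
have ib : / INR M <= / z ^ B.
  by apply: Rinv_le_contravar; [lra|]; apply: Rle_trans M1; rewrite -tech_pow_Rmult; nra.
have key : Cmod (s1 * S)%C <= 2 + Cmod s1 * (4 * Cmod s1 + 1) * / INR M.
  have -> : (s1 * S = (G M.+1 - G N) - \csum_(M.+1 <= n < N) (G n - G n.+1 - s1 * npow sg t n))%C.
    rewrite csum_sub -big_distrr /= -SE.
    rewrite (eq_bigr (fun n => - (G n.+1 - G n))%C); last by move=> n _; ring.
    by rewrite csum_opp csum_telescope //; ring.
  apply: Rle_trans (Cmod_triangle _ _) _; rewrite Cmod_opp; apply: Rplus_le_compat.
    apply: Rle_trans (Cmod_triangle _ _) _; rewrite Cmod_opp.
    by have := G1 M.+1 isT; have := G1 N ltac:(lia); lra.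
  apply: Rle_trans (csum_mod _ _ _ _) _.
  apply: (Rle_trans _ (\rsum_(M.+1 <= n < N) (Cmod s1 * (4 * Cmod s1 + 1) * exp (- (1 + 1) * ln (INR n))))).
    by apply: rsum_nat_le => n hn; apply: npow_step => //; lia.
  have c0 := Cmod_ge_0 s1.
  rewrite -big_distrr /=; apply: Rmult_le_compat_l; first by apply: Rmult_le_pos; lra.
  apply: Rle_trans (zeta_tail_le 1 M N _ M0) _; first lra.
  have -> : - (1) * ln (INR M) = - ln (INR M) by ring.
  by rewrite Rinv_1 Rmult_1_l exp_neg_ln //; lra.
rewrite Cmod_mult in key.
have s1pos : 0 < Cmod s1 by lra.
have h4 : (4 * Cmod s1 + 1) * / INR M <= 9.
  apply: (Rle_trans _ ((9 * z ^ B) * / z ^ B)); last by apply: Req_le; field; lra.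
  by apply: Rmult_le_compat => //; [lra | apply: Rlt_le; apply: Rinv_0_lt_compat; apply: INR_gt0 | lra].
have h5 : 2 <= Cmod s1 * (2 * z ^ 3).
  have : / z ^ 3 * (2 * z ^ 3) <= Cmod s1 * (2 * z ^ 3) by apply: Rmult_le_compat_r; lra.
  by have -> : / z ^ 3 * (2 * z ^ 3) = 2 by field; lra.
have : Cmod s1 * Cmod S <= Cmod s1 * (2 * z ^ 3 + 9).
  rewrite Rmult_plus_distr_l.
  have : Cmod s1 * ((4 * Cmod s1 + 1) * / INR M) <= Cmod s1 * 9 by apply: Rmult_le_compat_l; lra.
  lra.
move/(Rmult_le_reg_l _ _ _ s1pos) => h6.
nra.
Qed.

Record dchar (q : nat) (chi : nat -> C) : Prop := DChar {
  dchar1 : chi 1%N = RtoC 1;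
  dcharM : forall m n, chi (m * n)%N = (chi m * chi n)%C;
  dcharD : forall n, chi (n + q)%N = chi n;
  dchar0 : forall n, ~~ coprime n q -> chi n = RtoC 0;
  dcharU : forall n, coprime n q -> Cmod (chi n) = 1 }.

Definition nonprincipal (q : nat) (chi : nat -> C) : Prop :=
  exists a, coprime a q /\ chi a <> RtoC 1.

Lemma dchar_le1 q chi : dchar q chi -> forall n, Cmod (chi n) <= 1.
Proof.
move=> hc n; case: (boolP (coprime n q)) => h; first by rewrite (dcharU _ _ hc) //; lra.
by rewrite (dchar0 _ _ hc) // Cmod_0; lra.
Qed.

Lemma dchar_cmult q chi : dchar q chi -> cmult chi.
Proof. by move=> hc; split=> [|m n _ _]; [apply: (dchar1 _ _ hc) | apply: (dcharM _ _ hc)]. Qed.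

Lemma dchar_mod q chi : dchar q chi -> forall n, chi (n %% q)%N = chi n.
Proof.
move=> hc n; rewrite [in RHS](divn_eq n q) addnC.
by elim: (n %/ q)%N => [|k IH]; [rewrite mul0n addn0 | rewrite mulSn (addnC q) addnA (dcharD _ _ hc)].
Qed.

Lemma dchar_prod q q' chi chi' : dchar q chi -> dchar q' chi' ->
  dchar (q * q') (fun n => chi n * chi' n)%C.
Proof.
move=> h h'; split.
- by rewrite (dchar1 _ _ h) (dchar1 _ _ h'); ring.
- by move=> m n; rewrite (dcharM _ _ h) (dcharM _ _ h'); ring.
- move=> n; rewrite -(dchar_mod _ _ h) -(dchar_mod _ _ h').
  by rewrite -modnDmr modnMr addn0 -[X in chi' X]modnDmr modnMl addn0 (dchar_mod _ _ h) (dchar_mod _ _ h').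
- move=> n; rewrite coprimeMr negb_and => /orP[] hn.
    by rewrite (dchar0 _ _ h) // Cmult_0_l.
  by rewrite (dchar0 _ _ h') // Cmult_0_r.
- by move=> n; rewrite coprimeMr => /andP[c c']; rewrite Cmod_mult (dcharU _ _ h) // (dcharU _ _ h') // Rmult_1_l.
Qed.

(** Unlike the general product in [dchar_prod], the square keeps the modulus q. *)
Lemma dchar_sq q chi : dchar q chi -> dchar q (fun n => chi n * chi n)%C.
Proof.
move=> h; split.
- by rewrite (dchar1 _ _ h); ring.
- by move=> m n; rewrite (dcharM _ _ h); ring.
- by move=> n; rewrite (dcharD _ _ h).
- by move=> n hn; rewrite (dchar0 _ _ h) // Cmult_0_l.
- by move=> n c; rewrite Cmod_mult (dcharU _ _ h) // Rmult_1_l.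
Qed.

Lemma dchar_period_sum q chi : (0 < q)%N -> dchar q chi -> nonprincipal q chi ->
  (\csum_(0 <= n < q) chi n)%C = RtoC 0.
Proof.
move=> q0 hc [a [ca na]]; set S := bigop.body _ _ _.
(* Multiplication by a permutes the residues modulo q, so S = chi(a) S. *)
pose r := [seq (a * n) %% q | n <- index_iota 0 q]%N.
have ur : uniq r.
  rewrite map_inj_in_uniq ?iota_uniq //.
  have key m n : (m <= n)%N -> (n < q)%N -> ((a * m) %% q = (a * n) %% q)%N -> m = n.
    move=> mn nq /eqP; rewrite eq_sym eqn_mod_dvd ?leq_mul // -mulnBr.
    rewrite Gauss_dvdr; last by rewrite coprime_sym.
    by case: (posnP (n - m)) => [|p /(dvdn_leq p)]; lia.
  move=> m n; rewrite !mem_index_iota => /andP[_ mq] /andP[_ nq] E.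
  by case: (leqP m n) => h; [apply: key | symmetry; apply: key => //; apply: ltnW].
have pr : perm_eq (index_iota 0 q) r.
  have sub : {subset r <= index_iota 0 q}.
    by move=> _ /mapP[n _ ->]; rewrite mem_index_iota ltn_mod.
  have [_ e] := uniq_min_size ur sub ltac:(by rewrite size_map).
  by apply: uniq_perm => //; apply: iota_uniq.
have E : S = (chi a * S)%C.
  rewrite /S big_distrr /= [LHS](perm_big r) //= /r big_map; apply: eq_bigr => n _.
  by rewrite (dchar_mod _ _ hc) (dcharM _ _ hc).
have h : ((chi a - RtoC 1) * S)%C = RtoC 0.
  have -> : ((chi a - RtoC 1) * S = chi a * S - S)%C by ring.
  by rewrite -E; ring.
have h0 : (chi a - RtoC 1)%C <> RtoC 0.
  move=> h0; apply: na; have -> : chi a = (chi a - RtoC 1 + RtoC 1)%C by ring.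
  by rewrite h0 Cplus_0_l.
have : (/ (chi a - RtoC 1) * ((chi a - RtoC 1) * S))%C = RtoC 0 by rewrite h Cmult_0_r.
by rewrite CmultA Cinv_l // Cmult_1_l.
Qed.

Lemma periodic_bounded_sums a q : (0 < q)%N -> (forall n, a (n + q)%N = a n) ->
  (forall n, Cmod (a n) <= 1) -> (\csum_(0 <= n < q) a n)%C = RtoC 0 -> bounded_sums a (INR q).
Proof.
move=> q0 aq a1 aS; elim/ltn_ind => m IH; case: (leqP q m) => qm.
  rewrite (@big_cat_nat _ _ _ q) //= aS Cplus_0_l.
  rewrite -{1}(add0n q) big_addn (eq_bigr a) => [|n _]; last exact: aq.
  by apply: IH; lia.
apply: Rle_trans (csum_mod _ _ _ _) _.
apply: (Rle_trans _ (\rsum_(0 <= n < m) 1)); first by apply: rsum_nat_le.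
by rewrite rsum_const subn0 Rmult_1_r; apply: le_INR; lia.
Qed.

(** * Euler products of completely multiplicative functions *)

Lemma tsum_single k (c : C) : (0 < k)%N ->
  absum (fun n => if n == k then c else RtoC 0) (Cmod c) /\
  tsum (fun n => if n == k then c else RtoC 0) = c.
Proof.
move=> k0.
have hs (T : Type) (idx : T) (op : Monoid.com_law idx) (x : T) N : (k < N)%N ->
    \big[op/idx]_(1 <= n < N) (if n == k then x else idx) = x.
  move=> kN; rewrite (@big_rem _ _ _ _ _ k) /=; last by rewrite mem_index_iota k0.
  rewrite eqxx big1_seq ?Monoid.mulm1 // => n /andP[_].
  by rewrite mem_rem_uniq ?iota_uniq // inE => /andP[/negPf -> _].
have ab : absum (fun n => if n == k then c else RtoC 0) (Cmod c).
  move=> N; apply: (Rle_trans _ (\rsum_(1 <= n < N + k.+1) (if n == k then Cmod c else 0))).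
    apply: (Rle_trans _ (\rsum_(1 <= n < N) (if n == k then Cmod c else 0))).
      by apply: rsum_nat_le => n _; case: ifP => _; rewrite ?Cmod_0; lra.
    apply: rsum_nat_widen => // [|i _]; first by lia.
    by case: ifP => _; [apply: Cmod_ge_0 | lra].
  by rewrite hs; [lra | lia].
split=> //; apply: (tsum_unique _ _ _ ab) => eps e0; exists k.+1 => N kN.
by rewrite hs // /Cminus Cplus_opp_r Cmod_0.
Qed.

Lemma cmult_remove p g : prime p -> cmult g ->
  cmult (fun n => if (p %| n)%N then RtoC 0 else g n).
Proof.
move=> pp [g1 gM]; split; first by rewrite dvdn1; case: eqP => // E; rewrite E in pp.
move=> m n m0 n0; rewrite Euclid_dvdM //; case: (p %| m)%N => /=; first by ring.
by case: (p %| n)%N; [ring | apply: gM].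
Qed.

(** Convolution with the single coefficient g(p) at p is g on the multiples of p and 0 elsewhere; it
    is then subtracted. *)
Lemma tsum_remove p g M : prime p -> cmult g -> absum g M ->
  tsum (fun n => if (p %| n)%N then RtoC 0 else g n) = ((RtoC 1 - g p) * tsum g)%C.
Proof.
move=> pp [g1 gM] aM; have p0 := prime_gt0 pp.
have [dA dT] := tsum_single p (g p) p0.
have -> : ((RtoC 1 - g p) * tsum g = tsum g + - RtoC 1 * (g p * tsum g))%C by ring.
have e := tsum_conv _ _ _ _ dA aM; rewrite dT in e; rewrite -e.
rewrite -(tsum_scal _ _ _ (absum_conv _ _ _ _ dA aM)).
rewrite -(tsum_add _ _ _ _ aM (absum_scal _ _ _ (absum_conv _ _ _ _ dA aM))).
apply: tsum_ext => n n0; rewrite /conv; case: ifP => pn.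
  rewrite (@big_rem _ _ _ _ _ p) /=; last by rewrite -dvdn_divisors.
  rewrite eqxx big1_seq => [|d /andP[_]]; last first.
    by rewrite mem_rem_uniq ?divisors_uniq // inE => /andP[/negPf -> _]; rewrite Cmult_0_l.
  have nE : n = (p * (n %/ p))%N by rewrite mulnC divnK.
  rewrite {1}nE gM ?divn_gt0 ?(dvdn_leq n0 pn) // Cplus_0_r; ring.
rewrite big1_seq => [|d /andP[_]]; first by rewrite Cmult_0_r Cplus_0_r.
rewrite -dvdn_divisors // => dn; case: eqP => [E|_]; last by rewrite Cmult_0_l.
by rewrite E pn in dn.
Qed.

(** For completely multiplicative g the sieved series is that of g times the factors 1 - g(p). Euler
    products are handled as finite products, through a series that tends to 1. *)
Definition sieve (ps : seq nat) (g : nat -> C) (n : nat) : C :=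
  if has (fun p => p %| n)%N ps then RtoC 0 else g n.

Lemma absum_sieve ps g M : absum g M -> absum (sieve ps g) M.
Proof.
apply: absum_le => n _; rewrite /sieve; case: ifP => _; last lra.
by rewrite Cmod_0; apply: Cmod_ge_0.
Qed.

Lemma tsum_sieve ps g M : all prime ps -> uniq ps -> cmult g -> absum g M ->
  cmult (sieve ps g) /\
  tsum (sieve ps g) = (\big[Cmult/RtoC 1]_(p <- ps) (RtoC 1 - g p) * tsum g)%C.
Proof.
move=> + + cg aM; elim: ps => [|p ps IH] /=.
  by rewrite big_nil Cmult_1_l; split=> //; apply: tsum_ext.
move=> /andP[pp aps] /andP[pps ups]; have [c1 t1] := IH aps ups.
have E n : sieve (p :: ps) g n = if (p %| n)%N then RtoC 0 else sieve ps g n.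
  by rewrite /sieve /=; case: (p %| n)%N.
split.
  have [h1 h2] := cmult_remove p _ pp c1.
  by split=> [|m n m0 n0]; rewrite !E //; apply: h2.
rewrite (tsum_ext _ _ (fun n _ => E n)) (tsum_remove _ _ _ pp c1 (absum_sieve _ _ _ aM)) t1.
have -> : sieve ps g p = g p.
  rewrite /sieve; case: ifP => // /hasP[r rps rp]; case/negP: pps.
  have pr : prime r by move/allP: aps => /(_ r rps).
  by move: rp; rewrite dvdn_prime2 // => /eqP <-.
by rewrite big_cons; ring.
Qed.

Definition primes_below (P : nat) : seq nat := [seq p <- iota 0 P | prime p].

Lemma primes_below_prime P : all prime (primes_below P).
Proof. by apply/allP => p; rewrite mem_filter => /andP[]. Qed.

Lemma primes_below_uniq P : uniq (primes_below P).
Proof. by apply: filter_uniq; apply: iota_uniq. Qed.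

Lemma has_primes_below P n : (1 < n < P)%N -> has (fun p => p %| n)%N (primes_below P).
Proof.
move=> /andP[n1 nP]; apply/hasP; exists (pdiv n); last exact: pdiv_dvd.
rewrite mem_filter pdiv_prime // mem_iota /= add0n.
by have := dvdn_leq (ltnW n1) (pdiv_dvd n); lia.
Qed.

(** Only the terms n = 1 and n >= P are left, and the latter are dominated by a tail of g. Applied
    to sieved series, this is the convergence of an Euler product. *)
Lemma tsum_near_one a g M eps : absum g M -> 0 < eps -> (forall P, a P 1%N = RtoC 1) ->
  (forall P n, (1 < n < P)%N -> a P n = RtoC 0) ->
  (forall P n, (0 < n)%N -> Cmod (a P n) <= Cmod (g n)) ->
  exists P0, forall P, (P0 <= P)%N -> Cmod (tsum (a P) - RtoC 1)%C <= eps.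
Proof.
move=> gM e0 a1 a0 ag; have [K [K0 hK]] := absum_tail_small _ _ gM eps e0.
exists K => P KP; have aM : absum (a P) M by apply: absum_le gM => n; apply: ag.
have -> : RtoC 1 = (\csum_(1 <= n < 2) a P n)%C by rewrite big_nat1 a1.
rewrite (tsum_tail _ _ _ aM); apply: tsum_abs_le => N.
apply: Rle_trans (hK N); case: (leqP K N) => KN; last first.
  rewrite [X in _ <= X]big_geq ?(ltnW KN) // big_nat big1; first lra.
  by move=> i hi; case: ifP => // i2; rewrite ?Cmod_0 // a0 ?Cmod_0 //; lia.
rewrite (@big_cat_nat _ _ _ K) //=.
rewrite big_nat big1 => [|i hi]; last first.
  by case: ifP => // i2; rewrite ?Cmod_0 // a0 ?Cmod_0 //; lia.
rewrite Rplus_0_l; apply: rsum_nat_le => i hi; case: ifP => _; last by apply: ag; lia.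
by rewrite Cmod_0; apply: Cmod_ge_0.
Qed.

(** The exponents are twice 3, 4, 1, so that the moduli occur as squares, polynomials in r and c =
    Re u. By 1 + x <= exp x the product is at most exp(5 r^2 - 4 r (1 + c)^2). *)
Lemma local_341 r u : 0 <= r <= 1 -> Cmod u = 1 ->
  Cmod (RtoC 1 - RtoC r)%C ^ 6 * Cmod (RtoC 1 - RtoC r * u)%C ^ 8 *
  Cmod (RtoC 1 - RtoC r * (u * u))%C ^ 2 <= exp (5 * (r * r)).
Proof.
move=> r01; case: u => c s hu.
have {}hu : c ^ 2 + s ^ 2 = 1.
  have h : 0 <= c ^ 2 + s ^ 2 by have := pow2_ge_0 c; have := pow2_ge_0 s; lra.
  by rewrite -(pow2_sqrt _ h); have := hu; rewrite /Cmod /fst /snd => ->; ring.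
have sq (z : C) : Cmod z ^ 2 = Re z ^ 2 + Im z ^ 2.
  have := pow2_ge_0 (fst z); have := pow2_ge_0 (snd z) => ? ?.
  by rewrite /Cmod pow2_sqrt //; lra.
have -> (x y w : R) : x ^ 6 * y ^ 8 * w ^ 2 = x ^ 6 * (y ^ 2) ^ 4 * w ^ 2 by ring.
rewrite -RtoC_minus Cmod_R Rabs_pos_eq; last lra.
rewrite !sq.
have -> : Re (RtoC 1 - RtoC r * (c, s))%C ^ 2 + Im (RtoC 1 - RtoC r * (c, s))%C ^ 2 =
   1 + (- 2 * r * c + r ^ 2).
  transitivity (1 - 2 * r * c + r ^ 2 * (c ^ 2 + s ^ 2)); last by rewrite hu; ring.
  by rewrite /Re /Im /RtoC /=; ring.
have -> : Re (RtoC 1 - RtoC r * ((c, s) * (c, s)))%C ^ 2 + Im (RtoC 1 - RtoC r * ((c, s) * (c, s)))%C ^ 2 =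
   1 + (2 * r + r ^ 2 - 4 * r * c ^ 2).
  have s2 : s ^ 2 = 1 - c ^ 2 by lra.
  transitivity (1 - 2 * r * (c ^ 2 - s ^ 2) + r ^ 2 * (c ^ 2 + s ^ 2) ^ 2).
    by rewrite /Re /Im /RtoC /=; ring.
  by rewrite hu s2; ring.
have e1 : 1 - r <= exp (- r) by have := exp_ineq1_le (- r); lra.
have e2 := exp_ineq1_le (- 2 * r * c + r ^ 2).
have e3 := exp_ineq1_le (2 * r + r ^ 2 - 4 * r * c ^ 2).
have c1 : c ^ 2 <= 1 by have := pow2_ge_0 s; lra.
have p2 : 0 <= 1 + (- 2 * r * c + r ^ 2).
  have -> : 1 + (- 2 * r * c + r ^ 2) = (r - c) ^ 2 + (1 - c ^ 2) by ring.
  by have := pow2_ge_0 (r - c); lra.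
have p3 : 0 <= 1 + (2 * r + r ^ 2 - 4 * r * c ^ 2).
  by have := pow2_ge_0 (1 - r); have : r * c ^ 2 <= r * 1 by [apply: Rmult_le_compat_l; lra]; lra.
have expn (x : R) n : exp x ^ n = exp (INR n * x).
  by elim: n => [|n IH]; [rewrite Rmult_0_l exp_0 | rewrite -tech_pow_Rmult IH -exp_plus S_INR; congr exp; ring].
apply: (Rle_trans _ (exp (- r) ^ 6 * exp (- 2 * r * c + r ^ 2) ^ 4 * exp (2 * r + r ^ 2 - 4 * r * c ^ 2))).
  apply: Rmult_le_compat => //; first by apply: Rmult_le_pos; apply: pow_le; lra.
  by apply: Rmult_le_compat; try (apply: pow_le; lra); apply: pow_incr; lra.
rewrite !expn -!exp_plus; apply: exp_le.
have -> : INR 6 = 6 by rewrite /=; ring.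
have -> : INR 4 = 4 by rewrite /=; ring.
have : 0 <= r * (1 + c) ^ 2 by apply: Rmult_le_pos; [lra | apply: pow2_ge_0].
lra.
Qed.

Lemma mul_682_ge0 x y w : 0 <= x -> 0 <= y -> 0 <= w -> 0 <= x ^ 6 * y ^ 8 * w ^ 2.
Proof.
move=> x0 y0 w0; apply: Rmult_le_pos; last exact: pow_le.
by apply: Rmult_le_pos; apply: pow_le.
Qed.

Lemma cprod_mod (ps : seq nat) (h : nat -> C) :
  Cmod (\big[Cmult/RtoC 1]_(p <- ps) h p) = \big[Rmult/1]_(p <- ps) Cmod (h p).
Proof. by elim/big_rec2: _ => [|p x y _ <-]; rewrite ?Cmod_1 ?Cmod_mult. Qed.

Lemma cmult_chi_npow q chi sg t : dchar q chi -> cmult (fun n => chi n * npow sg t n)%C.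
Proof. by move=> hc; apply: cmult_mul; [apply: (dchar_cmult _ _ hc) | apply: cmult_npow]. Qed.

Lemma DSL0 a sg t : DSL a sg t 0 = tsum (fun n => a n * npow sg t n)%C.
Proof. by apply: tsum_ext => n _; rewrite lnf0; ring. Qed.

Lemma absum_DSL0 a sg t : 1 < sg -> (forall n, Cmod (a n) <= 1) ->
  absum (fun n => a n * npow sg t n)%C (1 + 2 / (sg - 1)).
Proof.
move=> s1 a1; have := absum_DSL a sg t 0 s1 a1; rewrite Rmult_1_l.
by apply: absum_ext => n _; rewrite lnf0; ring.
Qed.

Lemma one_le_of_powers n v : 0 <= v -> (forall eps, 0 < eps < 1 -> (1 - eps) ^ n <= v) -> 1 <= v.
Proof.
move=> v0 h; apply: Rnot_lt_le => lt.
have n0 := pos_INR n.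
pose e := (1 - v) / (2 * (INR n + 1)).
have ev : e * (2 * (INR n + 1)) = 1 - v by rewrite /e; field; lra.
have e0 : 0 < e by apply: Rdiv_lt_0_compat; lra.
have e1 : e < 1 by nra.
have b k : 1 - INR k * e <= (1 - e) ^ k.
  elim: k => [|k IH]; first by rewrite /=; lra.
  by rewrite S_INR -tech_pow_Rmult; have := pow_le (1 - e) k ltac:(lra); have := pos_INR k; nra.
by have := Rle_trans _ _ _ (b n) (h e (conj e0 e1)); nra.
Qed.

(* Mertens' inequality 3 + 4 cos u + cos 2u >= 0, factor by factor on the Euler products. *)
Lemma three_four_one q chi sg t : dchar q chi -> 1 < sg ->
  exp (- 10) <= Cmod (DSL (fun=> RtoC 1) sg 0 0) ^ 6 * Cmod (DSL chi sg t 0) ^ 8 *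
                Cmod (DSL (fun n => chi n * chi n)%C sg (2 * t) 0) ^ 2.
Proof.
move=> hc s1; have hc2 := dchar_sq _ _ hc.
have h1 : nat -> Cmod (RtoC 1) <= 1 by move=> _; rewrite Cmod_1; lra.
rewrite !DSL0.
set g1 := (fun n : nat => RtoC 1 * npow sg 0 n)%C.
set g2 := (fun n : nat => chi n * npow sg t n)%C.
set g3 := (fun n : nat => chi n * chi n * npow sg (2 * t) n)%C.
have A1 : absum g1 _ := absum_DSL0 (fun=> RtoC 1) sg 0 s1 h1.
have A2 : absum g2 _ := absum_DSL0 chi sg t s1 (dchar_le1 _ _ hc).
have A3 : absum g3 _ := absum_DSL0 _ sg (2 * t) s1 (dchar_le1 _ _ hc2).
have M1 : cmult g1.
  by split=> [|m n m0 n0]; rewrite /g1; have [e1 eM] := cmult_npow sg 0; rewrite ?e1 ?eM //; ring.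
have M2 : cmult g2 := cmult_chi_npow _ _ _ _ hc.
have M3 : cmult g3 := cmult_chi_npow _ _ _ _ hc2.
have cl (g : nat -> C) K : cmult g -> absum g K -> forall eps, 0 < eps -> exists P0, forall P, (P0 <= P)%N ->
    Cmod (tsum (sieve (primes_below P) g)) >= 1 - eps.
  move=> [e1 eM] aK eps e0.
  have [P0 hP] := tsum_near_one (fun P => sieve (primes_below P) g) g K eps aK e0
     ltac:(move=> P; rewrite /sieve; case: ifP => // /hasP[p]; rewrite mem_filter dvdn1 => /andP[+ _] /eqP pe; by rewrite pe)
     ltac:(by move=> P n hn; rewrite /sieve has_primes_below)
     ltac:(by move=> P n n0; rewrite /sieve; case: ifP => _; [rewrite Cmod_0; apply: Cmod_ge_0 | lra]).
  exists P0 => P /hP; have := Cmod_triangle (tsum (sieve (primes_below P) g)) (RtoC 1 - tsum (sieve (primes_below P) g)).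
  have -> : (tsum (sieve (primes_below P) g) + (RtoC 1 - tsum (sieve (primes_below P) g)) = RtoC 1)%C by ring.
  rewrite Cmod_1 -(Cmod_opp (RtoC 1 - _)).
  have -> : (- (RtoC 1 - tsum (sieve (primes_below P) g)) = tsum (sieve (primes_below P) g) - RtoC 1)%C by ring.
  lra.
set X := _ * _; have X0 : 0 <= X.
  by apply: mul_682_ge0; apply: Cmod_ge_0.
(* Each of the three sieved series is at least 1 - eps in modulus once enough primes are removed; 16
   = 6 + 8 + 2. *)
suff key eps : 0 < eps < 1 -> (1 - eps) ^ 16 <= exp 10 * X.
  have e10 := exp_pos 10; have e10' := exp_pos (- 10).
  have E : exp (- 10) * exp 10 = 1 by rewrite -exp_plus Rplus_opp_l exp_0.
  have : 1 <= exp 10 * X by apply: (one_le_of_powers 16) key; apply: Rmult_le_pos; lra.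
  by move=> h; have := Rmult_le_compat_l _ _ _ (Rlt_le _ _ e10') h; rewrite -Rmult_assoc E; lra.
move=> [e0 e1].
have [P1 hP1] := cl _ _ M1 A1 eps e0; have [P2 hP2] := cl _ _ M2 A2 eps e0; have [P3 hP3] := cl _ _ M3 A3 eps e0.
pose P := (P1 + P2 + P3)%N; pose ps := primes_below P.
have {}hP1 := hP1 P ltac:(rewrite /P; lia); have {}hP2 := hP2 P ltac:(rewrite /P; lia).
have {}hP3 := hP3 P ltac:(rewrite /P; lia).
have [_ T1] := tsum_sieve ps g1 _ (primes_below_prime P) (primes_below_uniq P) M1 A1.
have [_ T2] := tsum_sieve ps g2 _ (primes_below_prime P) (primes_below_uniq P) M2 A2.
have [_ T3] := tsum_sieve ps g3 _ (primes_below_prime P) (primes_below_uniq P) M3 A3.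
rewrite -/ps T1 Cmod_mult cprod_mod in hP1; rewrite -/ps T2 Cmod_mult cprod_mod in hP2.
rewrite -/ps T3 Cmod_mult cprod_mod in hP3.
set B1 := \big[Rmult/1]_(p <- ps) _ in hP1; set B2 := \big[Rmult/1]_(p <- ps) _ in hP2.
set B3 := \big[Rmult/1]_(p <- ps) _ in hP3.
(* By [local_341] the product is at most exp(5 sum_p p^(-2)), and the sum is at most 2; hence the
   constant 10. *)
have BB : 0 <= B1 ^ 6 * B2 ^ 8 * B3 ^ 2 <= exp 10.
  have -> : B1 ^ 6 * B2 ^ 8 * B3 ^ 2 = \big[Rmult/1]_(p <- ps)
     (Cmod (RtoC 1 - g1 p)%C ^ 6 * Cmod (RtoC 1 - g2 p)%C ^ 8 * Cmod (RtoC 1 - g3 p)%C ^ 2).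
    rewrite /B1 /B2 /B3; elim: (ps) => [|p s IH]; rewrite ?big_nil ?big_cons; first by ring.
    by rewrite -IH; ring.
  have loc p : prime p -> 0 <= Cmod (RtoC 1 - g1 p)%C ^ 6 * Cmod (RtoC 1 - g2 p)%C ^ 8 * Cmod (RtoC 1 - g3 p)%C ^ 2
      <= exp (5 * exp (- (1 + 1) * ln (INR p))).
    move=> pp; have p0 := prime_gt0 pp; split.
      by apply: mul_682_ge0; apply: Cmod_ge_0.
    set r := exp (- sg * ln (INR p)).
    have r01 : 0 <= r <= 1.
      split; first exact: Rlt_le (exp_pos _).
      by rewrite -exp_0; apply: exp_le; have := ln_INR_ge0 p p0; nra.
    have rr : r * r <= exp (- (1 + 1) * ln (INR p)).
      by rewrite -exp_plus; apply: exp_le; have := ln_INR_ge0 p p0; nra.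
    apply: (Rle_trans _ (exp (5 * (r * r)))); last by apply: exp_le; lra.
    have E1 : g1 p = RtoC r.
      by rewrite /g1 /npow -/r /cis Rmult_0_l cos_0 sin_0 Ropp_0 -[(1, 0)]/(RtoC 1); ring.
    have E2 : g2 p = (RtoC r * (chi p * cis (t * ln (INR p))))%C by rewrite /g2 /npow -/r; ring.
    have E3 : g3 p = (RtoC r * ((chi p * cis (t * ln (INR p))) * (chi p * cis (t * ln (INR p)))))%C.
      rewrite /g3 /npow -/r.
      have -> : cis (2 * t * ln (INR p)) = (cis (t * ln (INR p)) * cis (t * ln (INR p)))%C.
        have -> : 2 * t * ln (INR p) = t * ln (INR p) + t * ln (INR p) by ring.
        by rewrite /cis cos_plus sin_plus /Cmult /=; congr pair; ring.
      ring.
    rewrite E1 E2 E3.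
    case: (boolP (coprime p q)) => cp.
      by apply: local_341 => //; rewrite Cmod_mult Cmod_unit (dcharU _ _ hc) // Rmult_1_l.
    rewrite (dchar0 _ _ hc) // !Cmult_0_l !Cmult_0_r.
    have -> : (RtoC 1 - RtoC 0)%C = RtoC 1 by ring.
    rewrite Cmod_1 !pow1 !Rmult_1_r -RtoC_minus Cmod_R Rabs_pos_eq; last lra.
    apply: (Rle_trans _ 1); first by rewrite -(pow1 6); apply: pow_incr; lra.
    by rewrite -exp_0; apply: exp_le; nra.
  have : all prime ps := primes_below_prime P.
  have bnd : \rsum_(p <- ps) exp (- (1 + 1) * ln (INR p)) <= 2.
    rewrite /ps /primes_below big_filter.
    apply: (Rle_trans _ (\rsum_(1 <= n < P) exp (- (1 + 1) * ln (INR n)))); last first.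
      by have := zeta_partial_le 1 P ltac:(lra); rewrite Rinv_1; lra.
    case: (P) => [|P']; first by rewrite big_nil big_geq //; lra.
    rewrite big_cons /= /index_iota subn1 /=; apply: (rsum_subset _ _ prime xpredT) => // i _ _.
    exact: Rlt_le (exp_pos _).
  move=> aps.
  suff [h1' h2'] : 0 <= \big[Rmult/1]_(p <- ps) (Cmod (RtoC 1 - g1 p)%C ^ 6 * Cmod (RtoC 1 - g2 p)%C ^ 8 *
       Cmod (RtoC 1 - g3 p)%C ^ 2) <= exp (5 * \rsum_(p <- ps) exp (- (1 + 1) * ln (INR p))).
    by split=> //; apply: Rle_trans h2' _; apply: exp_le; lra.
  elim: (ps) aps => [_|p s IH /= /andP[pp ap]]; first by rewrite !big_nil Rmult_0_r exp_0; lra.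
  rewrite !big_cons Rmult_plus_distr_l exp_plus; have := loc p pp; have := IH ap => {loc}.
  by move=> [i1 i2] [j1 j2]; split; [apply: Rmult_le_pos | apply: Rmult_le_compat].
have XE : B1 ^ 6 * B2 ^ 8 * B3 ^ 2 * X = (B1 * Cmod (tsum g1)) ^ 6 * (B2 * Cmod (tsum g2)) ^ 8 * (B3 * Cmod (tsum g3)) ^ 2.
  by rewrite /X; ring.
apply: (Rle_trans _ (B1 ^ 6 * B2 ^ 8 * B3 ^ 2 * X)); last by apply: Rmult_le_compat_r; lra.
rewrite XE; have -> : (1 - eps) ^ 16 = (1 - eps) ^ 6 * (1 - eps) ^ 8 * (1 - eps) ^ 2 by ring.
apply: Rmult_le_compat; [| apply: pow_le; lra | | apply: pow_incr; lra].
  by apply: Rmult_le_pos; apply: pow_le; lra.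
by apply: Rmult_le_compat; try (apply: pow_le; lra); apply: pow_incr; lra.
Qed.

(** * Siegel's theorem *)

Lemma conv_pairs a b n N : (0 < n <= N)%N ->
  conv a b n = \csum_(1 <= d < N.+1) \csum_(1 <= e < N.+1 | (d * e == n)%N) (a d * b e)%C.
Proof. exact: (big_divisors_pairs _ _ _ (fun d e => a d * b e)%C). Qed.

Lemma convC a b n : (0 < n)%N -> conv a b n = conv b a n.
Proof.
move=> n0; rewrite !(conv_pairs _ _ n n) ?n0 ?leqnn //.
under eq_bigr do rewrite big_mkcond; rewrite exchange_big /=; apply: eq_bigr => e _.
rewrite [RHS]big_mkcond; apply: eq_bigr => d _; rewrite mulnC; case: ifP => // _; ring.
Qed.

(** The sum over d e g = n treats the three factors alike, whence associativity. *)
Lemma conv_triple a b c n : (0 < n)%N -> conv (conv a b) c n =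
  (\csum_(1 <= d < n.+1) \csum_(1 <= e < n.+1) \csum_(1 <= g < n.+1)
    (if (d * e * g == n)%N then a d * b e * c g else RtoC 0))%C.
Proof.
move=> n0; rewrite (conv_pairs _ _ n n) ?n0 ?leqnn //.
transitivity (\csum_(1 <= k < n.+1) \csum_(1 <= g < n.+1) \csum_(1 <= d < n.+1) \csum_(1 <= e < n.+1)
   (if (d * e == k)%N && (k * g == n)%N then a d * b e * c g else RtoC 0))%C.
  apply: eq_big_nat => k hk; rewrite big_mkcond; apply: eq_bigr => g _.
  case: ifP => kg; last first.
    by rewrite big1 // => d _; rewrite big1 // => e _; rewrite andbF.
  rewrite (conv_pairs _ _ k n) ?hk // big_distrl /=; apply: eq_bigr => d _.
  rewrite big_distrl /= big_mkcond /=; apply: eq_bigr => e _; rewrite andbT; case: ifP => // _; ring.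
rewrite exchange_big /=; under eq_bigr do rewrite exchange_big /=.
under eq_bigr do under eq_bigr do rewrite exchange_big /=.
rewrite exchange_big /=; apply: eq_big_nat => d /andP[d0 dn].
rewrite exchange_big /=; apply: eq_big_nat => e /andP[e0 en]; apply: eq_bigr => g _.
case: (leqP (d * e) n) => den.
  rewrite (@big_rem _ _ _ _ _ (d * e)%N) /=; last by rewrite mem_index_iota muln_gt0 d0 e0.
  rewrite eqxx /= big1_seq ?Cplus_0_r // => k /andP[_].
  by rewrite mem_rem_uniq ?iota_uniq // inE eq_sym => /andP[/negPf -> _].
rewrite big_nat big1 => [|k hk]; last by case: eqP => //= kE; lia.
case: eqP => // E; case: (posnP g) => g0; [lia | have : (d * e <= d * e * g)%N by rewrite leq_pmulr].
by lia.
Qed.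

Lemma convA a b c n : (0 < n)%N -> conv (conv a b) c n = conv a (conv b c) n.
Proof.
move=> n0; rewrite (convC a) // !conv_triple //.
transitivity (\csum_(1 <= d < n.+1) \csum_(1 <= e < n.+1) \csum_(1 <= g < n.+1)
  (if (e * g * d == n)%N then b e * c g * a d else RtoC 0))%C.
  apply: eq_bigr => d _; apply: eq_bigr => e _; apply: eq_bigr => g _.
  by rewrite -mulnA (mulnC d); case: ifP => // _; ring.
rewrite exchange_big /=; apply: eq_bigr => e _; exact: exchange_big.
Qed.

Lemma conv_ext a a' b b' n : (forall m, (0 < m)%N -> a m = a' m) ->
  (forall m, (0 < m)%N -> b m = b' m) -> (0 < n)%N -> conv a b n = conv a' b' n.
Proof.
move=> ha hb n0; rewrite /conv !big_seq; apply: eq_bigr => d; rewrite -dvdn_divisors // => dn.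
by rewrite ha ?hb // ?divn_gt0 ?(dvdn_gt0 n0 dn) // (dvdn_leq n0 dn).
Qed.

Lemma convDr a b c n : conv a (fun m => b m + c m)%C n = (conv a b n + conv a c n)%C.
Proof. by rewrite /conv -big_split; apply: eq_bigr => d _; rewrite /=; ring. Qed.

(* [A] is the logarithmic derivative of [a] for the derivation [a -> a * ln]. *)
Definition log_deriv (a A : nat -> C) : Prop :=
  forall n, (0 < n)%N -> (RtoC (ln (INR n)) * a n)%C = conv a A n.

Lemma log_deriv_cmult g : cmult g -> log_deriv g (fun n => g n * RtoC (vonM n))%C.
Proof.
move=> [g1 gM] n n0; rewrite convC // /conv.
rewrite (eq_big_seq (fun d => g n * RtoC (vonM d))%C) => [|d].
  by rewrite -big_distrr /= csum_RtoC sum_vonM //; ring.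
rewrite -dvdn_divisors // => dn; have d0 := dvdn_gt0 n0 dn.
have nd : (0 < n %/ d)%N by rewrite divn_gt0 // dvdn_leq.
have nE : n = (d * (n %/ d))%N by rewrite mulnC divnK.
by rewrite {2}nE gM //; ring.
Qed.

Lemma log_deriv_conv a A b B : log_deriv a A -> log_deriv b B ->
  log_deriv (conv a b) (fun n => A n + B n)%C.
Proof.
move=> ha hb n n0.
have E1 : conv a (conv b B) n = conv a (fun m => RtoC (ln (INR m)) * b m)%C n.
  by apply: conv_ext => // m m0; rewrite hb.
have E2 : conv (conv a A) b n = conv (fun m => RtoC (ln (INR m)) * a m)%C b n.
  by apply: conv_ext => // m m0; rewrite ha.
have E3 : conv (conv a b) A n = conv (conv a A) b n.
  rewrite convA // [RHS]convA //; apply: conv_ext => // m m0; exact: convC.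
rewrite convDr E3 (convA a b B) // E1 E2 /conv big_distrr /= -big_split /= !big_seq; apply: eq_bigr => d.
rewrite -dvdn_divisors // => dn; have d0 := dvdn_gt0 n0 dn.
have nd : (0 < n %/ d)%N by rewrite divn_gt0 // dvdn_leq.
have -> : ln (INR n) = ln (INR d) + ln (INR (n %/ d)).
  by rewrite -ln_INR_mul // mulnC divnK.
by rewrite RtoC_plus; ring.
Qed.

Definition nonneg (z : C) : Prop := Im z = 0 /\ 0 <= Re z.

Lemma nonneg_mul x y : nonneg x -> nonneg y -> nonneg (x * y)%C.
Proof.
move=> [x1 x2] [y1 y2]; rewrite /nonneg /Re /Im /Cmult /=; rewrite /Re /Im in x1 x2 y1 y2.
by rewrite x1 y1; split; [ring | nra].
Qed.

Lemma nonneg_csum (I : eqType) (r : seq I) (P : pred I) (G : I -> C) :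
  (forall i, i \in r -> P i -> nonneg (G i)) -> nonneg (\csum_(i <- r | P i) G i).
Proof.
move=> h; rewrite /nonneg csum_Re csum_Im big_seq_cond; split.
  by rewrite big1 // => i /andP[ir Pi]; case: (h i ir Pi).
by apply: rsum_ge0 => i ir Pi; case: (h i ir Pi).
Qed.

(** Induction on n: ln n * a(n) is the sum of a(d) A(n/d) over d | n, and d = n drops out because
    A(1) = 0. This stands for exponentiating the logarithm of an Euler product with nonnegative
    coefficients. *)
Lemma log_deriv_nonneg a A : log_deriv a A -> a 1%N = RtoC 1 ->
  (forall n, (0 < n)%N -> nonneg (A n)) -> A 1%N = RtoC 0 -> forall n, (0 < n)%N -> nonneg (a n).
Proof.
move=> ha a1 hA A1; elim/ltn_ind => n IH n0.
case: (leqP n 1) => n1.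
  have -> : n = 1%N by lia.
  by rewrite a1 /nonneg /=; lra.
have l0 : 0 < ln (INR n).
  by rewrite -ln_1; apply: ln_increasing; [lra | apply: (lt_INR 1); lia].
have h : nonneg (RtoC (ln (INR n)) * a n)%C.
  rewrite ha // /conv; apply: nonneg_csum => d; rewrite -dvdn_divisors // => dn _.
  have d0 := dvdn_gt0 n0 dn; have nd : (0 < n %/ d)%N by rewrite divn_gt0 // dvdn_leq.
  case: (ltngtP d n) => dn'; last 1 first.
  - by rewrite dn' divnn n0 A1 Cmult_0_r /nonneg /=; lra.
  - by apply: nonneg_mul; [apply: IH | apply: hA].
  - by have := dvdn_leq n0 dn; lia.
have -> : a n = (RtoC (/ ln (INR n)) * (RtoC (ln (INR n)) * a n))%C.
  by rewrite CmultA -RtoC_mult Rinv_l; [ring | lra].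
apply: nonneg_mul h; rewrite /nonneg /=; split=> //.
by apply: Rlt_le; apply: Rinv_0_lt_compat.
Qed.

Definition summable_at (sg t : R) (a : nat -> C) : Prop :=
  exists B : nat -> R, forall m, absum (fun n => a n * npow sg t n * RtoC (lnf m n))%C (B m).

Lemma summable_bounded sg t a : 1 < sg -> (forall n, Cmod (a n) <= 1) -> summable_at sg t a.
Proof. by move=> s1 a1; eexists => m; apply: absum_DSL. Qed.

Lemma conv_lnf sg t a b m n : (0 < n)%N ->
  (conv a b n * npow sg t n * RtoC (lnf m n) =
   \csum_(0 <= i < m.+1) conv (fun n => a n * npow sg t n * RtoC (lnf i n))
                               (fun n => b n * npow sg t n * RtoC (lnf (m - i) n)) n)%C.
Proof.
move=> n0; rewrite /conv exchange_big /= !big_distrl /= !big_seq; apply: eq_bigr => d.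
rewrite -dvdn_divisors // => dn; have d0 := dvdn_gt0 n0 dn.
have nd : (0 < n %/ d)%N by rewrite divn_gt0 // dvdn_leq.
have nE : n = (d * (n %/ d))%N by rewrite mulnC divnK.
have [_ pM] := cmult_npow sg t.
rewrite [X in npow sg t X](nE) [X in lnf m X](nE) pM // lnfM // -csum_RtoC !big_distrr /=.
by apply: eq_bigr => i _; rewrite RtoC_mult; ring.
Qed.

Lemma DSL_conv sg t a b : summable_at sg t a -> summable_at sg t b ->
  summable_at sg t (conv a b) /\
  forall m, DSL (conv a b) sg t m = (\csum_(0 <= i < m.+1) (DSL a sg t i * DSL b sg t (m - i)))%C.
Proof.
move=> [B hB] [B' hB'].
have ab m i : absum (conv (fun n => a n * npow sg t n * RtoC (lnf i n))%C
   (fun n => b n * npow sg t n * RtoC (lnf (m - i) n))%C) (B i * B' (m - i)%N).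
  exact: absum_conv.
split.
  exists (fun m => \rsum_(0 <= i < m.+1) (B i * B' (m - i)%N)) => m.
  by apply: (absum_ext _ _ _ (fun n n0 => esym (conv_lnf sg t a b m n n0))); apply: absum_sum.
move=> m; rewrite /DSL (tsum_ext _ _ (conv_lnf sg t a b m)) (tsum_sum _ _ _ _ (ab m)).
by apply: eq_bigr => i _; rewrite (tsum_conv _ _ _ _ (hB i) (hB' (m - i)%N)).
Qed.

(** * Taylor coefficients of Dirichlet series at s = 2 *)

Lemma exp_pow x n : exp x ^ n = exp (INR n * x).
Proof.
elim: n => [|n IH]; first by rewrite Rmult_0_l exp_0.
by rewrite -tech_pow_Rmult IH -exp_plus S_INR; congr exp; ring.
Qed.

Lemma pow_exp_root m v : (0 < m)%N -> (v * exp (- (2 * v / INR m))) ^ m = v ^ m * exp (- 2 * v).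
Proof.
move=> m0; have p := INR_gt0 m m0; rewrite Rpow_mult_distr exp_pow; congr Rmult; congr exp; field; lra.
Qed.

(** The function v^m exp(-2 v) peaks at v = m / 2. Taking m-th roots, as in [pow_exp_root], reduces
    its monotonicity to 1 + x <= exp x. *)
Lemma pow_exp_up m v w : 0 <= v <= w -> 2 * w <= INR m ->
  v ^ m * exp (- 2 * v) <= w ^ m * exp (- 2 * w).
Proof.
move=> [v0 vw]; case: m => [|m] wm.
  have -> : v = w by rewrite /= in wm; lra.
  lra.
rewrite -!pow_exp_root //; have p := INR_gt0 m.+1 isT; move: (INR m.+1) p wm => M p wm.
apply: pow_incr; split; first by apply: Rmult_le_pos => //; apply: Rlt_le (exp_pos _).
have -> : - (2 * v / M) = - (2 * w / M) + 2 * (w - v) / M by field; lra.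
rewrite exp_plus (Rmult_comm (exp _)) -Rmult_assoc; apply: Rmult_le_compat_r; first exact: Rlt_le (exp_pos _).
set dl := 2 * (w - v) / M.
have h : exp (- dl) * exp dl = 1 by rewrite -exp_plus Rplus_opp_l exp_0.
have h1 := exp_ineq1_le (- dl); have e0 := exp_pos dl.
have h2 : v <= w * (1 + - dl).
  have : w * dl <= w - v; last lra.
  have -> : w * dl = (2 * w) * ((w - v) / M) by rewrite /dl; field; lra.
  have q : 0 <= (w - v) / M by apply: Rdiv_le_0_compat; lra.
  have e : w - v = M * ((w - v) / M) by field; lra.
  by have := Rmult_le_compat_r _ _ _ q wm; lra.
have h3 : v <= w * exp (- dl) by nra.
have : v * exp dl <= w * exp (- dl) * exp dl by apply: Rmult_le_compat_r; lra.
by rewrite Rmult_assoc h; lra.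
Qed.

Lemma pow_exp_down m v w : 0 <= v <= w -> INR m <= 2 * v ->
  w ^ m * exp (- 2 * w) <= v ^ m * exp (- 2 * v).
Proof.
move=> [v0 vw]; case: m => [|m] wm.
  by rewrite /= !Rmult_1_l; apply: exp_le; lra.
rewrite -!pow_exp_root //; have p := INR_gt0 m.+1 isT; move: (INR m.+1) p wm => M p wm.
apply: pow_incr; split; first by apply: Rmult_le_pos; [lra | apply: Rlt_le (exp_pos _)].
have -> : - (2 * v / M) = - (2 * w / M) + 2 * (w - v) / M by field; lra.
rewrite exp_plus (Rmult_comm (exp _)) -Rmult_assoc; apply: Rmult_le_compat_r; first exact: Rlt_le (exp_pos _).
set dl := 2 * (w - v) / M.
have h1 := exp_ineq1_le dl.
have : w - v <= v * dl; last by nra.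
have -> : v * dl = (2 * v) * ((w - v) / M) by rewrite /dl; field; lra.
have q : 0 <= (w - v) / M by apply: Rdiv_le_0_compat; lra.
have e : w - v = M * ((w - v) / M) by field; lra.
by have := Rmult_le_compat_r _ _ _ q wm; lra.
Qed.

(** The rise, the cell k that contains the peak, and the fall contribute at most G each. *)
Lemma unimodal_variation (g d : nat -> R) G k N : (0 < k)%N ->
  (forall n, (0 < n)%N -> 0 <= g n <= G) ->
  (forall n, (0 < n < k)%N -> d n <= g n.+1 - g n) -> d k <= G ->
  (forall n, (k < n)%N -> d n <= g n - g n.+1) -> (forall n, (0 < n)%N -> 0 <= d n) ->
  \rsum_(1 <= n < N) d n <= 3 * G.
Proof.
move=> k0 gG up dk down d0.
apply: (Rle_trans _ (\rsum_(1 <= n < N + k.+1) d n)).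
  by apply: rsum_nat_widen => // [|i hi]; [lia | apply: d0; lia].
rewrite (@big_cat_nat _ _ _ k) //=; last by lia.
rewrite (@big_cat_nat _ _ _ k.+1 k) //=; last by lia.
rewrite big_nat1.
have h1 : \rsum_(1 <= n < k) d n <= G.
  apply: (Rle_trans _ (\rsum_(1 <= n < k) (g n.+1 - g n))); first by apply: rsum_nat_le.
  by rewrite rsum_telescope //; have := gG k k0; have := gG 1%N isT; lra.
have h2 : \rsum_(k.+1 <= n < N + k.+1) d n <= G.
  apply: (Rle_trans _ (\rsum_(k.+1 <= n < N + k.+1) - (g n.+1 - g n))).
    by apply: rsum_nat_le => n hn; have := down n ltac:(lia); lra.
  rewrite rsum_opp rsum_telescope; last by lia.
  by have := gG k.+1 isT; have := gG (N + k.+1)%N ltac:(lia); lra.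
lra.
Qed.

(** At u = n this is the n-th term of the m-th Taylor coefficient of zeta at s = 2; real arguments
    allow the comparison with an integral. *)
Definition gR (m : nat) (u : R) : R := exp (- 2 * ln u) * (ln u ^ m / INR (Factorial.fact m)).

Lemma gR_le m u : 1 <= u -> 0 <= gR m u <= / 2 ^ m.
Proof.
move=> u1; have l0 : 0 <= ln u by rewrite -ln_1; apply: ln_le; lra.
have f0 := INR_fact_lt_0 m; have p2 : 0 < 2 ^ m by apply: pow_lt; lra.
have p : 0 <= ln u ^ m / INR (Factorial.fact m) by apply: Rdiv_le_0_compat => //; apply: pow_le.
split; first by apply: Rmult_le_pos => //; apply: Rlt_le (exp_pos _).
have := pow_fact_le_exp (2 * ln u) m ltac:(lra); rewrite Rpow_mult_distr => h.
have e0 := exp_pos (- 2 * ln u).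
have ee : exp (- 2 * ln u) * exp (2 * ln u) = 1 by rewrite -exp_plus -[RHS]exp_0; congr exp; ring.
apply: (Rmult_le_reg_l (2 ^ m)) => //; rewrite Rinv_r; last lra.
rewrite -ee /gR.
have -> : 2 ^ m * (exp (- 2 * ln u) * (ln u ^ m / INR (Factorial.fact m))) =
   exp (- 2 * ln u) * (2 ^ m * ln u ^ m / INR (Factorial.fact m)) by field; lra.
by apply: Rmult_le_compat_l; lra.
Qed.

Lemma gR_peak m : exists k, (0 < k)%N /\
  (forall u v, 1 <= u <= v -> v <= INR k -> gR m u <= gR m v) /\
  (forall u v, INR k.+1 <= u <= v -> gR m v <= gR m u).
Proof.
have e1 : 1 <= exp (INR m / 2).
  by rewrite -exp_0; apply: exp_le; have := pos_INR m; lra.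
have [k [k1 k2]] := nfloor_ex (exp (INR m / 2)) ltac:(lra).
have f0 := INR_fact_lt_0 m.
have E u : gR m u = (ln u ^ m * exp (- 2 * ln u)) * / INR (Factorial.fact m) by rewrite /gR /Rdiv; ring.
exists k; split; [|split] => [|u v uv vk|u v [ku uv]].
- by case: k k2 {k1} => //= k2; lra.
- rewrite !E; apply: Rmult_le_compat_r; first exact: Rlt_le (Rinv_0_lt_compat _ f0).
  apply: pow_exp_up; first by split; [rewrite -ln_1; apply: ln_le | apply: ln_le]; lra.
  have : ln v <= ln (exp (INR m / 2)) by apply: ln_le; lra.
  by rewrite ln_exp; lra.
- rewrite !E; apply: Rmult_le_compat_r; first exact: Rlt_le (Rinv_0_lt_compat _ f0).
  rewrite S_INR in ku; have p := pos_INR k.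
  apply: pow_exp_down; first by split; [rewrite -ln_1; apply: ln_le | apply: ln_le]; lra.
  have : ln (exp (INR m / 2)) <= ln u by apply: ln_le; [apply: exp_pos | lra].
  by rewrite ln_exp; lra.
Qed.

Lemma npow20 n : npow 2 0 n = RtoC (exp (- 2 * ln (INR n))).
Proof. by rewrite /npow /cis Rmult_0_l cos_0 sin_0 Ropp_0 -[(1, 0)]/(RtoC 1) Cmult_1_r. Qed.

Lemma npow_lnf_gR m n : (npow 2 0 n * RtoC (lnf m n))%C = RtoC (gR m (INR n)).
Proof. by rewrite npow20 -RtoC_mult. Qed.

Lemma gR_variation m N :
  \rsum_(1 <= n < N) Rabs (gR m (INR n.+1) - gR m (INR n)) <= 3 * / 2 ^ m.
Proof.
have [k [k0 [up down]]] := gR_peak m.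
have b n : (0 < n)%N -> 0 <= gR m (INR n) <= / 2 ^ m by move=> n0; apply: gR_le; apply: INR_ge1.
apply: (unimodal_variation (fun n => gR m (INR n)) _ _ k) => //.
- move=> n hn; have := up (INR n) (INR n.+1) ltac:(split; [apply: INR_ge1; lia | apply: le_INR; lia]) ltac:(apply: le_INR; lia).
  by move=> h; rewrite Rabs_pos_eq; lra.
- by have := b k k0; have := b k.+1 isT; split_Rabs; lra.
- move=> n hn; have := down (INR n) (INR n.+1) ltac:(split; apply: le_INR; lia).
  by move=> h; rewrite Rabs_left1; lra.
- by move=> n _; apply: Rabs_pos.
Qed.

(** The weight n^(-2) (ln n)^m / m! is unimodal with values at most 2^(-m), so its variation is
    small. Absolute convergence would give O(1) only; the decay 2^(-m) lets the Taylor series in 2 -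
    s converge up to 2, beyond s = 1. *)
Lemma taylor_bound a Q m : bounded_sums a Q -> (forall n, Cmod (a n) <= 1) ->
  Cmod (DSL a 2 0 m) <= 5 * Q * / 2 ^ m.
Proof.
move=> aQ a1; have Q0 := bounded_sums_ge0 _ _ aQ.
apply: (tsum_mod_le _ _ _ (absum_DSL a 2 0 m ltac:(lra) a1)); exists 1%N => N N1.
rewrite (eq_bigr (fun n => a n * RtoC (gR m (INR n)))%C); last by move=> n _; rewrite -npow_lnf_gR; ring.
apply: Rle_trans (abel_bound _ _ _ _ _ aQ N1) _.
have -> : 5 * Q * / 2 ^ m = Q * (/ 2 ^ m + / 2 ^ m + 3 * / 2 ^ m) by ring.
apply: Rmult_le_compat_l => //.
have b n : (0 < n)%N -> Cmod (RtoC (gR m (INR n))) <= / 2 ^ m.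
  by move=> n0; rewrite Cmod_R; have [? ?] := gR_le m (INR n) (INR_ge1 n n0); rewrite Rabs_pos_eq.
have := b 1%N isT; have := b N N1; have := gR_variation m N.
rewrite (eq_bigr (fun n => Cmod (RtoC (gR m (INR n.+1)) - RtoC (gR m (INR n)))%C)); first lra.
by move=> n _; rewrite -RtoC_minus Cmod_R.
Qed.

(** [KR m (ln u)] is minus a primitive of [gR m], and [KR m 0] = 1 is the integral of [gR m] from 1
    to infinity. *)
Definition KR (m : nat) (v : R) : R := exp (- v) * \rsum_(0 <= i < m.+1) (v ^ i / INR (Factorial.fact i)).

Lemma KR_derive m v : is_derive (KR m) v (- (exp (- v) * (v ^ m / INR (Factorial.fact m)))).
Proof.
elim: m => [|m IH].
  apply: (is_derive_ext (fun v => exp (- v))).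
    by move=> w; rewrite /KR big_nat1 /=; field.
  by auto_derive => //; rewrite /=; field.
apply: (is_derive_ext (fun v => KR m v + exp (- v) * (v ^ m.+1 / INR (Factorial.fact m.+1)))).
  by move=> w; rewrite /KR [in RHS]big_nat_recr //=; ring.
have f0 := INR_fact_neq_0 m; have m0 : INR m.+1 <> 0 by apply: not_0_INR.
have -> : - (exp (- v) * (v ^ m.+1 / INR (Factorial.fact m.+1))) =
   - (exp (- v) * (v ^ m / INR (Factorial.fact m))) +
   (- exp (- v) * (v ^ m.+1 / INR (Factorial.fact m.+1)) + exp (- v) * (v ^ m / INR (Factorial.fact m))).
  by ring.
apply: (is_derive_plus _ _ _ _ _ IH).
have -> : v ^ m / INR (Factorial.fact m) = INR m.+1 * v ^ m / INR (Factorial.fact m.+1).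
  by rewrite fact_simpl mult_INR; field.
move: (INR_fact_neq_0 m.+1); move: (INR (Factorial.fact m.+1)) => F0 hF.
by auto_derive => //; rewrite -/(INR m.+1) -tech_pow_Rmult; field.
Qed.

Lemma KR_step m n : (0 < n)%N -> exists u, INR n <= u <= INR n.+1 /\
  KR m (ln (INR n)) - KR m (ln (INR n.+1)) = gR m u.
Proof.
move=> n0; have p := INR_gt0 n n0.
have nn : INR n < INR n.+1 by apply: lt_INR; lia.
pose df u := - (exp (- ln u) * (ln u ^ m / INR (Factorial.fact m))) * / u.
have dd u : 0 < u -> is_derive (fun u => KR m (ln u)) u (df u).
  move=> u0; have := is_derive_comp (KR m) ln u _ _ (KR_derive m (ln u)) (is_derive_ln u u0).
  suff -> : df u = scal (/ u) (- (exp (- ln u) * (ln u ^ m / INR (Factorial.fact m)))) by [].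
  by rewrite /df /scal /= /Hierarchy.mult /=; ring.
have [c [hc E]] := MVT_gen (fun u => KR m (ln u)) (INR n) (INR n.+1) df
   ltac:(rewrite Rmin_left ?Rmax_right; try lra; move=> x hx; apply: dd; lra)
   ltac:(rewrite Rmin_left ?Rmax_right; try lra; move=> x hx; apply/continuity_pt_filterlim;
         apply: (ex_derive_continuous (fun u => KR m (ln u))); eexists; apply: dd; lra).
rewrite Rmin_left ?Rmax_right in hc; try lra.
exists c; split => //.
have -> : gR m c = - df c.
  rewrite /df /gR; have -> : - 2 * ln c = - ln c + - ln c by ring.
  by rewrite exp_plus (exp_Ropp (ln c)) exp_ln; [have := INR_fact_lt_0 m => ?; field; lra | lra].
have ed : INR n.+1 - INR n = 1 by rewrite S_INR; ring.
by rewrite ed Rmult_1_r in E; lra.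
Qed.

Lemma KR_lim m eps : 0 < eps -> exists N0, forall N, (N0 <= N)%N -> 0 <= KR m (ln (INR N)) <= eps.
Proof.
move=> e0; pose A := \rsum_(0 <= i < m.+1) 2 ^ i.
have A0 : 0 < A.
  rewrite /A big_nat_recl //; have h : 0 <= \rsum_(0 <= i < m) 2 ^ i.+1.
    by apply: rsum_nat_ge0 => i _; apply: pow_le; lra.
  by rewrite /= in h *; lra.
have [N0 hN0] := nfloor_ex ((A / eps) ^ 2 + 1) ltac:(have := pow2_ge_0 (A / eps); lra).
exists N0.+1 => N hN.
have NR : (A / eps) ^ 2 + 1 <= INR N.
  by apply: (Rle_trans _ (INR N0.+1)); [rewrite S_INR; lra | apply: le_INR; lia].
have n0 : (0 < N)%N by lia.
have v0 := ln_INR_ge0 N n0; set v := ln (INR N) in v0 *.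
have e1 := exp_pos (- v).
have s0 : 0 <= \rsum_(0 <= i < m.+1) (v ^ i / INR (Factorial.fact i)).
  by apply: rsum_nat_ge0 => i _; apply: Rdiv_le_0_compat; [apply: pow_le | apply: INR_fact_lt_0].
split; first by apply: Rmult_le_pos; lra.
have h : \rsum_(0 <= i < m.+1) (v ^ i / INR (Factorial.fact i)) <= A * exp (/ 2 * v).
  rewrite /A big_distrl /=; apply: rsum_nat_le => i _; exact: lnf_half.
apply: (Rle_trans _ (exp (- v) * (A * exp (/ 2 * v)))); first by apply: Rmult_le_compat_l; lra.
have -> : exp (- v) * (A * exp (/ 2 * v)) = A * exp (- / 2 * v).
  by rewrite (Rmult_comm A) -Rmult_assoc -exp_plus Rmult_comm; congr Rmult; congr exp; field.
have q : 0 < A / eps by apply: Rdiv_lt_0_compat.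
have : exp (- / 2 * v) <= / (A / eps).
  rewrite -(exp_ln (/ (A / eps))); last exact: Rinv_0_lt_compat.
  apply: exp_le; rewrite ln_Rinv //.
  have : ln ((A / eps) ^ 2) <= v by apply: ln_le; [apply: pow_lt | lra].
  by rewrite ln_pow //=; lra.
move=> h'; have -> : eps = A * / (A / eps) by field; lra.
by apply: Rmult_le_compat_l; lra.
Qed.

(** The Taylor coefficients of 1 / (s - 1) in powers of 2 - s are all 1. They are the integrals of
    [gR m], and the sum and the integral of a unimodal function differ by no more than its variation
    allows. *)
Lemma taylor_zeta m : Cmod (DSL (fun=> RtoC 1) 2 0 m - RtoC 1)%C <= 4 * / 2 ^ m.
Proof.
have h1 : nat -> Cmod (RtoC 1) <= 1 by move=> _; rewrite Cmod_1; lra.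
have [k [k0 [up down]]] := gR_peak m.
have b n : (0 < n)%N -> 0 <= gR m (INR n) <= / 2 ^ m by move=> n0; apply: gR_le; apply: INR_ge1.
pose d n := Rabs (gR m (INR n) - (KR m (ln (INR n)) - KR m (ln (INR n.+1)))).
have hd N : \rsum_(1 <= n < N) d n <= 3 * / 2 ^ m.
  apply: (unimodal_variation (fun n => gR m (INR n)) _ _ k) => //.
  - move=> n hn; have [u [[u1 u2] E]] := KR_step m n ltac:(lia).
    have i1 := INR_ge1 n ltac:(lia); have i2 : INR n.+1 <= INR k by apply: le_INR; lia.
    have h2 := up (INR n) u ltac:(lra) ltac:(lra).
    have h3 := up u (INR n.+1) ltac:(lra) ltac:(lra).
    by rewrite /d E; split_Rabs; lra.
  - have [u [[u1 u2] E]] := KR_step m k k0; have i1 := INR_ge1 k k0.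
    by rewrite /d E; have := b k k0; have := gR_le m u ltac:(lra); split_Rabs; lra.
  - move=> n hn; have [u [[u1 u2] E]] := KR_step m n ltac:(lia).
    have i2 : INR k.+1 <= INR n by apply: le_INR; lia.
    have h2 := down (INR n) u ltac:(lra); have h3 := down u (INR n.+1) ltac:(lra).
    by rewrite /d E; split_Rabs; lra.
  - by move=> n _; apply: Rabs_pos.
have p2 : 0 < / 2 ^ m by apply: Rinv_0_lt_compat; apply: pow_lt; lra.
have K1 : KR m (ln (INR 1)) = 1.
  rewrite -[INR 1]/1 ln_1 /KR Ropp_0 exp_0 big_nat_recl //= big1 => [|i _]; first by field.
  by rewrite /Rdiv !Rmult_0_l.
have ab := absum_DSL (fun=> RtoC 1) 2 0 m ltac:(lra) h1.
have [N1 hN1] := tsum_cvg _ _ ab (/ 2 ^ m / 2) ltac:(lra).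
have [N2 hN2] := KR_lim m (/ 2 ^ m / 2) ltac:(lra).
pose N := (N1 + N2).+1; have {}hN1 := hN1 N ltac:(rewrite /N; lia); have {}hN2 := hN2 N ltac:(rewrite /N; lia).
rewrite -/(DSL (fun=> RtoC 1) 2 0 m) in hN1.
rewrite (eq_bigr (fun n => RtoC (gR m (INR n)))) in hN1; last by move=> n _; rewrite -npow_lnf_gR; ring.
rewrite csum_RtoC in hN1.
set S := \rsum_(1 <= n < N) _ in hN1.
have hS : Rabs (S - (1 - KR m (ln (INR N)))) <= 3 * / 2 ^ m.
  have E : 1 - KR m (ln (INR N)) = \rsum_(1 <= n < N) (KR m (ln (INR n)) - KR m (ln (INR n.+1))).
    rewrite (eq_bigr (fun n => - (KR m (ln (INR n.+1)) - KR m (ln (INR n))))) => [|n _]; last by ring.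
    by rewrite rsum_opp (rsum_telescope 1 N (fun n => KR m (ln (INR n)))) // K1; ring.
  by rewrite E /S -rsum_sub; apply: Rle_trans (rsum_abs _ _ _ _) (hd N).
have -> : (DSL (fun=> RtoC 1) 2 0 m - RtoC 1 =
   - (RtoC S - DSL (fun=> RtoC 1) 2 0 m) + RtoC (S - 1))%C by rewrite RtoC_minus; ring.
apply: Rle_trans (Cmod_triangle _ _) _; rewrite Cmod_opp Cmod_R.
have : Rabs (S - 1) <= 3 * / 2 ^ m + / 2 ^ m / 2 by move: hS; split_Rabs; lra.
lra.
Qed.

Lemma DSL_real a sg m : (forall n, Im (a n) = 0) -> Im (DSL a sg 0 m) = 0.
Proof.
move=> a0; rewrite /DSL /tsum /Im /=; apply: is_series_unique.
apply: is_lim_seq_ext (is_lim_seq_const 0) => n; rewrite sum_n_rsum big1 // => i _.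
have : Im (a i.+1) = 0 := a0 i.+1.
rewrite /npow /cis Rmult_0_l sin_0 Ropp_0 /Im /Cmult /RtoC /= => ->; ring.
Qed.

Lemma geo_sum_le x M N : 0 <= x < 1 -> \rsum_(M <= i < N) x ^ i <= x ^ M / (1 - x).
Proof.
move=> [x0 x1]; have xM : 0 <= x ^ M by apply: pow_le.
have ix : 0 < / (1 - x) by apply: Rinv_0_lt_compat; lra.
case: (leqP N M) => NM; first by rewrite big_geq //; apply: Rdiv_le_0_compat; lra.
have E : x ^ M - x ^ N = (1 - x) * \rsum_(M <= i < N) x ^ i.
  rewrite big_distrr /= -[LHS]Ropp_minus_distr -(rsum_telescope M N (fun i => x ^ i)) ?(ltnW NM) //.
  by rewrite -rsum_opp; apply: eq_bigr => i _; rewrite -tech_pow_Rmult; ring.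
have xN : 0 <= x ^ N by apply: pow_le.
apply: (Rmult_le_reg_l (1 - x)); first lra.
have e : x ^ M = (1 - x) * (x ^ M / (1 - x)) by field; lra.
by rewrite -E -e; lra.
Qed.

Lemma geo_conv r s A B (a b : nat -> R) m : 0 < r < s ->
  (forall i, Rabs (a i) <= A * r ^ i) -> (forall i, Rabs (b i) <= B * s ^ i) ->
  Rabs (\rsum_(0 <= i < m.+1) (a i * b (m - i)%N)) <= A * B * (s / (s - r)) * s ^ m.
Proof.
move=> [r0 rs] ha hb; apply: Rle_trans (rsum_abs _ _ _ _) _.
have A0 : 0 <= A by have := ha 0%N; rewrite /= Rmult_1_r; have := Rabs_pos (a 0%N); lra.
have B0 : 0 <= B by have := hb 0%N; rewrite /= Rmult_1_r; have := Rabs_pos (b 0%N); lra.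
have sm : 0 < s ^ m by apply: pow_lt; lra.
apply: (Rle_trans _ (\rsum_(0 <= i < m.+1) (A * B * s ^ m * (r / s) ^ i))).
  apply: rsum_nat_le => i /andP[_ im].
  have E : A * B * s ^ m * (r / s) ^ i = A * r ^ i * (B * s ^ (m - i)).
    have {1}-> : m = (i + (m - i))%N by lia.
    rewrite (pow_add s i) Rpow_mult_distr pow_inv; have : 0 < s ^ i by apply: pow_lt; lra.
    by move=> h; field; lra.
  by rewrite E Rabs_mult; apply: Rmult_le_compat => //; apply: Rabs_pos.
have q : 0 <= r / s < 1.
  split; first by apply: Rdiv_le_0_compat; lra.
  by apply: (Rmult_lt_reg_r s); [lra | have -> : r / s * s = r by [field; lra]; lra].
rewrite -big_distrr /=; have := geo_sum_le (r / s) 0 m.+1 q.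
have -> : (r / s) ^ 0 / (1 - r / s) = s / (s - r) by rewrite /=; field; lra.
have : 0 <= A * B * s ^ m by apply: Rmult_le_pos; [apply: Rmult_le_pos | lra].
nra.
Qed.

Lemma is_series_lim a l : is_series a l -> is_lim_seq (fun N => \rsum_(0 <= i < N) a i) l.
Proof.
move=> h; apply/is_lim_seq_incr_1; apply: (is_lim_seq_ext (sum_n a)) => [n|]; last exact: h.
exact: sum_n_rsum.
Qed.

Lemma series_tail_geo a l Q r M : 0 < r < 1 -> (forall i, Rabs (a i) <= Q * r ^ i) ->
  is_series a l -> Rabs (l - \rsum_(0 <= i < M) a i) <= Q * (r ^ M / (1 - r)).
Proof.
move=> r01 ha /is_series_rsum hl; apply: le_epsilon => eps e0.
have [N hN] := hl eps e0; have {}hN := hN (N + M)%N ltac:(lia).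
rewrite (@big_cat_nat _ _ _ M) //= in hN; last by lia.
have Q0 : 0 <= Q by have := ha 0%N; rewrite /= Rmult_1_r; have := Rabs_pos (a 0%N); lra.
have : Rabs (\rsum_(M <= i < N + M) a i) <= Q * (r ^ M / (1 - r)).
  apply: Rle_trans (rsum_abs _ _ _ _) _.
  apply: (Rle_trans _ (\rsum_(M <= i < N + M) (Q * r ^ i))); first by apply: rsum_nat_le.
  by rewrite -big_distrr /=; apply: Rmult_le_compat_l => //; apply: geo_sum_le; lra.
by move: hN; split_Rabs; lra.
Qed.

(* Estermann's argument for Siegel's theorem: [p] and [1 + zc] are the Taylor coefficients
   in [2 - s] of an entire function and of zeta, and [lam] is the residue of the product
   at [s = 1]; [P] is the value of the entire function at [1 - dl]. *)
Lemma estermann (p zc : nat -> R) (Q dl P lam : R) : 1 <= Q ->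
  (forall m, Rabs (p m) <= Q * (7 / 10) ^ m) -> (forall m, Rabs (zc m) <= 4 * (1 / 2) ^ m) ->
  (forall m, 0 <= \rsum_(0 <= i < m.+1) ((1 + zc i) * p (m - i)%N)) -> 1 <= (1 + zc 0%N) * p 0%N ->
  0 < dl <= 1 / 10 -> is_series (fun m => p m * (1 + dl) ^ m) P -> is_series p lam -> 0 <= P ->
  dl / 2 * exp (- (dl * (31 + 5 * ln Q))) <= lam.
Proof.
move=> Q1 hp hz b0 b1 dl01 hP hlam P0.
pose h := 1 + dl; pose w m := \rsum_(0 <= i < m.+1) (zc i * p (m - i)%N).
pose T N := \rsum_(0 <= i < N) p i.
have h1 : 1 < h <= 11 / 10 by rewrite /h; lra.
have hpos n : 0 < h ^ n by apply: pow_lt; lra.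
have bE m : \rsum_(0 <= i < m.+1) ((1 + zc i) * p (m - i)%N) = T m.+1 + w m.
  rewrite /T /w [X in _ = X + _]big_nat_rev /= -big_split /=; apply: eq_big_nat => i /andP[_ im].
  by rewrite subSS; ring.
have w_le m : Rabs (w m) <= 14 * Q * (7 / 10) ^ m.
  have := geo_conv (1 / 2) (7 / 10) 4 Q zc p m ltac:(lra) hz hp.
  by have -> : 4 * Q * (7 / 10 / (7 / 10 - 1 / 2)) = 14 * Q by field.
have T_le N : Rabs (lam - T N) <= Q * ((7 / 10) ^ N / (1 - 7 / 10)).
  by apply: series_tail_geo => //; lra.
(* The coefficients of the product after removal of its polar part lam / (s - 1), whose coefficients
   are all lam. What is left has no pole, whence the geometric decay in [e_le]. *)
pose e m := T m.+1 + w m - lam.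
have r0 m : 0 < (7 / 10) ^ m by apply: pow_lt; lra.
have e_le m : Rabs (e m) <= 17 * Q * (7 / 10) ^ m.
  have := w_le m; have := T_le m.+1; rewrite -tech_pow_Rmult.
  have -> : Q * (7 / 10 * (7 / 10) ^ m / (1 - 7 / 10)) = 7 / 3 * (Q * (7 / 10) ^ m) by field.
  have : 0 <= Q * (7 / 10) ^ m by apply: Rmult_le_pos; [lra | apply: Rlt_le].
  by rewrite /e; split_Rabs; lra.
have geom x : 0 <= x < 1 -> is_lim_seq (pow x) 0.
  by move=> hx; apply: is_lim_seq_geom; rewrite Rabs_pos_eq; lra.
have abs_ex (a : nat -> R) A r : 0 <= r < 1 -> (forall m, Rabs (a m) <= A * r ^ m) ->
    ex_series (fun m => Rabs (a m)).
  move=> hr ha; apply: (ex_series_le _ (fun m => A * r ^ m)).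
    by move=> m; rewrite /norm /= /abs /= Rabs_Rabsolu.
  by apply: (ex_series_scal A); apply: ex_series_geom; rewrite Rabs_pos_eq; lra.
have hzh m : Rabs (zc m * h ^ m) <= 4 * (55 / 100) ^ m.
  rewrite Rabs_mult (Rabs_pos_eq (h ^ m)); last exact: Rlt_le.
  apply: (Rle_trans _ (4 * (1 / 2) ^ m * (11 / 10) ^ m)).
    by apply: Rmult_le_compat => //; [apply: Rabs_pos | apply: Rlt_le | apply: pow_incr; lra].
  by rewrite Rmult_assoc -Rpow_mult_distr; apply: Req_le; congr (_ * _ ^ _); field.
have hph m : Rabs (p m * h ^ m) <= Q * (77 / 100) ^ m.
  rewrite Rabs_mult (Rabs_pos_eq (h ^ m)); last exact: Rlt_le.
  apply: (Rle_trans _ (Q * (7 / 10) ^ m * (11 / 10) ^ m)).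
    by apply: Rmult_le_compat => //; [apply: Rabs_pos | apply: Rlt_le | apply: pow_incr; lra].
  by rewrite Rmult_assoc -Rpow_mult_distr; apply: Req_le; congr (_ * _ ^ _); field.
have exz : ex_series (fun m => zc m * h ^ m).
  by apply: ex_series_Rabs; apply: (abs_ex _ 4 (55 / 100)) => //; lra.
pose Z := Series (fun m => zc m * h ^ m).
have hZ : is_series (fun m => zc m * h ^ m) Z by apply: Series_correct.
(* Z - 1/dl is zeta(1 - dl), so this says that zeta is not positive there. It holds because |Z| <= 4
   / (1 - 55/100) < 10 <= 1/dl. *)
have Z_le : Z <= / dl.
  have : Rabs (Z - \rsum_(0 <= i < 0) (zc i * h ^ i)) <= 4 * ((55 / 100) ^ 0 / (1 - 55 / 100)).
    by apply: series_tail_geo => //; lra.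
  rewrite big_geq // Rminus_0_r /=.
  have : 10 <= / dl by rewrite -[10]Rinv_inv; apply: Rinv_le_contravar; lra.
  by split_Rabs; lra.
have hW : is_lim_seq (fun N => \rsum_(0 <= m < N) (w m * h ^ m)) (Z * P).
  apply: is_series_lim.
  have := is_series_mult _ _ _ _ hZ hP (abs_ex _ 4 (55 / 100) ltac:(lra) hzh) (abs_ex _ Q (77 / 100) ltac:(lra) hph).
  apply: is_series_ext => m; rewrite -sum_n_Reals sum_n_rsum /w big_distrl /=.
  apply: eq_big_nat => i /andP[_ im]; rewrite minusE.
  have -> : h ^ m = h ^ i * h ^ (m - i) by rewrite -pow_add; congr pow; lia.
  by rewrite /h; ring.
have hPN : is_lim_seq (fun N => \rsum_(0 <= m < N) (p m * h ^ m)) P by apply: is_series_lim.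
have hT0 : is_lim_seq (fun N => (lam - T N) * h ^ N) 0.
  apply: (is_lim_seq_le_le (fun N => - (Q * (10 / 3) * (77 / 100) ^ N)) _ (fun N => Q * (10 / 3) * (77 / 100) ^ N)).
  - move=> N; have : Rabs ((lam - T N) * h ^ N) <= Q * (10 / 3) * (77 / 100) ^ N.
      rewrite Rabs_mult (Rabs_pos_eq (h ^ N)); last exact: Rlt_le.
      apply: (Rle_trans _ (Q * ((7 / 10) ^ N / (1 - 7 / 10)) * (11 / 10) ^ N)).
        by apply: Rmult_le_compat => //; [apply: Rabs_pos | apply: Rlt_le | apply: pow_incr; lra].
      have -> : (77 / 100) ^ N = (7 / 10) ^ N * (11 / 10) ^ N.
        by rewrite -Rpow_mult_distr; congr pow; field.
      by apply: Req_le; field.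
    by split_Rabs; lra.
  - have := is_lim_seq_scal_l _ (- (Q * (10 / 3))) _ (geom (77 / 100) ltac:(lra)).
    by rewrite /= Rmult_0_r; apply: is_lim_seq_ext => n; ring.
  - have := is_lim_seq_scal_l _ (Q * (10 / 3)) _ (geom (77 / 100) ltac:(lra)).
    by rewrite /= Rmult_0_r; apply: is_lim_seq_ext => n; ring.
pose P_ N := \rsum_(0 <= m < N) (p m * h ^ m); pose W_ N := \rsum_(0 <= m < N) (w m * h ^ m).
pose S N := \rsum_(0 <= m < N) (e m * h ^ m).
have SE N : S N = W_ N + / dl * (lam - P_ N - (lam - T N) * h ^ N).
  have key : \rsum_(0 <= m < N) ((T m.+1 - lam) * h ^ m) = / dl * (lam - P_ N - (lam - T N) * h ^ N).
    elim: N => [|N IH]; first by rewrite /P_ /T !big_geq //=; field; lra.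
    rewrite big_nat_recr //= IH /P_ /T !(big_nat_recr N) //= -/(T N).
    by move: (\big[_/_]_(0 <= i < N) _) (h ^ N) => X Y; rewrite /h; field; lra.
  by rewrite -key /S /W_ -big_split /=; apply: eq_bigr => m _; rewrite /e; ring.
(* At s = 1 - dl the polar part is -lam / dl, so the limit is zeta(1 - dl) P + lam / dl. It is at
   most lam / dl, since P >= 0. *)
have hS : is_lim_seq S (Z * P + / dl * (lam - P - 0)).
  apply: (is_lim_seq_ext (fun N => W_ N + / dl * (lam - P_ N - (lam - T N) * h ^ N))) => [N|]; first by rewrite SE.
  apply: is_lim_seq_plus' => //.
  apply: (is_lim_seq_scal_l _ (/ dl) (lam - P - 0)).
  apply: is_lim_seq_minus' => //.
  by apply: is_lim_seq_minus' => //; apply: is_lim_seq_const.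
(* The first M terms are bounded below because the coefficients of the product are nonnegative and
   the first is at least 1; the later ones by their geometric decay. *)
have SM M N : (0 < M)%N -> (M <= N)%N -> 1 - lam * ((h ^ M - 1) / dl) - 74 * Q * (77 / 100) ^ M <= S N.
  move=> M0 MN; rewrite /S (@big_cat_nat _ _ _ M) //=.
  have a1 : - (74 * Q * (77 / 100) ^ M) <= \rsum_(M <= m < N) (e m * h ^ m).
    have : Rabs (\rsum_(M <= m < N) (e m * h ^ m)) <= 17 * Q * ((77 / 100) ^ M / (1 - 77 / 100)).
      apply: Rle_trans (rsum_abs _ _ _ _) _.
      apply: (Rle_trans _ (\rsum_(M <= m < N) (17 * Q * (77 / 100) ^ m))).
        apply: rsum_nat_le => m _; rewrite Rabs_mult (Rabs_pos_eq (h ^ m)); last exact: Rlt_le.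
        apply: (Rle_trans _ (17 * Q * (7 / 10) ^ m * (11 / 10) ^ m)).
          by apply: Rmult_le_compat => //; [apply: Rabs_pos | apply: Rlt_le | apply: pow_incr; lra].
        by rewrite Rmult_assoc -Rpow_mult_distr; apply: Req_le; congr (_ * _ ^ _); field.
      by rewrite -big_distrr /=; apply: Rmult_le_compat_l; [lra | apply: geo_sum_le; lra].
    have : 0 <= Q * (77 / 100) ^ M by apply: Rmult_le_pos; [lra | apply: pow_le; lra].
    have -> : 17 * Q * ((77 / 100) ^ M / (1 - 77 / 100)) = 1700 / 23 * (Q * (77 / 100) ^ M) by field.
    by split_Rabs; lra.
  have a2 : 1 - lam * ((h ^ M - 1) / dl) <= \rsum_(0 <= m < M) (e m * h ^ m).
    have hM : (h ^ M - 1) / dl = \rsum_(0 <= m < M) h ^ m.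
      have : \rsum_(0 <= m < M) (h ^ m.+1 - h ^ m) = h ^ M - 1 by rewrite (rsum_telescope 0 M (pow h)).
      move=> <-; rewrite /Rdiv big_distrl /=; apply: eq_bigr => m _; rewrite {1}/h; field; lra.
    rewrite hM; case: M M0 {MN a1 hM} => // M _.
    rewrite !big_nat_recl //= Rmult_1_r.
    have e0 : 1 - lam <= e 0%N.
      by have bE0 := bE 0%N; rewrite big_nat1 subnn in bE0; rewrite /e; lra.
    have : - (lam * \rsum_(0 <= i < M) (h * h ^ i)) <= \rsum_(0 <= i < M) (e i.+1 * (h * h ^ i)).
      rewrite big_distrr /= -rsum_opp; apply: rsum_nat_le => i _.
      have := b0 i.+1; rewrite bE => bi; have := hpos i.+1; rewrite -tech_pow_Rmult => hi.
      have : - lam <= e i.+1 by rewrite /e; lra.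
      nra.
    lra.
  lra.
have l0 := ln_le 1 Q ltac:(lra) Q1; rewrite ln_1 in l0.
(* As 77/100 <= exp(-1/5) and exp 6 >= 148, this M makes 74 Q (77/100)^M at most 1/2. The price is
   (1 + dl)^M <= exp(dl (31 + 5 ln Q)), the loss in the conclusion. *)
have [M' [M1 M2]] := nfloor_ex (5 * (6 + ln Q)) ltac:(lra).
pose M := M'.+1.
have MR : 5 * (6 + ln Q) <= INR M <= 31 + 5 * ln Q by rewrite /M S_INR; lra.
have fin : 1 - lam * ((h ^ M - 1) / dl) - 74 * Q * (77 / 100) ^ M <= Z * P + / dl * (lam - P - 0).
  apply: (is_lim_seq_le (fun=> 1 - lam * ((h ^ M - 1) / dl) - 74 * Q * (77 / 100) ^ M) (fun N => S (N + M)%N)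
    (Rbar.Finite (1 - lam * ((h ^ M - 1) / dl) - 74 * Q * (77 / 100) ^ M)) (Rbar.Finite (Z * P + / dl * (lam - P - 0)))).
  - by move=> N; apply: SM; rewrite ?leq_addl.
  - exact: is_lim_seq_const.
  - by apply: (is_lim_seq_incr_n S M _).1.
have idl : 0 < / dl by apply: Rinv_0_lt_compat; lra.
have ZP : Z * P <= / dl * P by apply: Rmult_le_compat_r.
have small : 74 * Q * (77 / 100) ^ M <= 1 / 2.
  have q : 77 / 100 <= exp (- (1 / 5)).
    have e4 : exp (- (1 / 5)) = / exp (1 / 5) by rewrite exp_Ropp.
    have ub : exp (1 / 5) <= 100 / 77.
      have h4 : exp (1 / 5) ^ 5 = exp 1 by rewrite exp_pow; congr exp; rewrite /=; field.
      case: (Rle_lt_dec (exp (1 / 5)) (100 / 77)) => // lt.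
      have : (100 / 77) ^ 5 <= exp (1 / 5) ^ 5 by apply: pow_incr; lra.
      by have := exp_le_3; rewrite h4 /=; lra.
    rewrite e4 -[77 / 100]Rinv_inv; apply: Rinv_le_contravar; first exact: exp_pos.
    by apply: Rle_trans ub _; apply: Req_le; field.
  have : (77 / 100) ^ M <= exp (- (6 + ln Q)).
    apply: (Rle_trans _ (exp (- (1 / 5)) ^ M)); first by apply: pow_incr; lra.
    by rewrite exp_pow; apply: exp_le; lra.
  rewrite Ropp_plus_distr exp_plus exp_Ropp exp_Ropp exp_ln; last lra.
  move=> h7; have e6 : 148 <= exp 6.
    have h4 : exp 6 = exp 1 ^ 6 by rewrite exp_pow; congr exp; rewrite /=; ring.
    have h5 : 24 / 10 <= exp 1 by have := exp_ge_taylor 1 3 ltac:(lra); rewrite /=; lra.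
    have : (24 / 10) ^ 6 <= exp 1 ^ 6 by apply: pow_incr; lra.
    by rewrite -h4 /=; lra.
  apply: (Rle_trans _ (74 * Q * (/ exp 6 * / Q))); first by apply: Rmult_le_compat_l; lra.
  have -> : 74 * Q * (/ exp 6 * / Q) = 74 * / exp 6 by field; split; [have := exp_pos 6; lra | lra].
  have : / exp 6 <= / 148 by apply: Rinv_le_contravar; lra.
  lra.
have main : 1 / 2 <= lam * (h ^ M / dl).
  have : lam * ((h ^ M - 1) / dl) + / dl * lam = lam * (h ^ M / dl) by field; lra.
  lra.
have hMe : h ^ M <= exp (dl * (31 + 5 * ln Q)).
  apply: (Rle_trans _ (exp dl ^ M)).
    by apply: pow_incr; split; [lra | rewrite /h; exact: exp_ineq1_le].
  by rewrite exp_pow Rmult_comm; apply: exp_le; apply: Rmult_le_compat_l; lra.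
have lam0 : 0 < lam.
  apply: Rnot_le_lt => neg; have : lam * (h ^ M / dl) <= 0; last by lra.
  have : 0 < h ^ M / dl by apply: Rdiv_lt_0_compat => //; lra.
  nra.
set E := dl * (31 + 5 * ln Q) in hMe *; rewrite exp_Ropp; have eE := exp_pos E.
apply: (Rmult_le_reg_r (exp E)) => //.
have -> : dl / 2 * / exp E * exp E = dl * (1 / 2) by field; lra.
have : dl * (1 / 2) <= dl * (lam * (h ^ M / dl)) by apply: Rmult_le_compat_l; lra.
have -> : dl * (lam * (h ^ M / dl)) = lam * h ^ M by field; lra.
have := Rmult_le_compat_l lam _ _ (Rlt_le _ _ lam0) hMe; lra.
Qed.

(** * Real characters and the value of L at 1 *)

Definition rchar (q : nat) (chi : nat -> C) : Prop := dchar q chi /\ forall n, Im (chi n) = 0.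

(* Taylor coefficients of the Dirichlet series of [a] at [s = 2], in powers of [2 - s]. *)
Definition lR (a : nat -> C) (m : nat) : R := Re (DSL a 2 0 m).

Lemma DSL_lR a m : (forall n, Im (a n) = 0) -> DSL a 2 0 m = RtoC (lR a m).
Proof.
move=> h; have := DSL_real a 2 m h; rewrite /lR /RtoC /Re /Im.
by case: (DSL a 2 0 m) => x y /= ->.
Qed.

Lemma nonprincipal_bounded_sums q chi : (0 < q)%N -> dchar q chi -> nonprincipal q chi ->
  bounded_sums chi (INR q).
Proof.
move=> q0 hc hn; apply: periodic_bounded_sums => //.
- exact: (dcharD _ _ hc).
- exact: (dchar_le1 _ _ hc).
- exact: (dchar_period_sum q).
Qed.

Lemma lR_bound q chi m : (0 < q)%N -> dchar q chi -> nonprincipal q chi ->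
  Rabs (lR chi m) <= 5 * INR q * (1 / 2) ^ m.
Proof.
move=> q0 hc hn; apply: Rle_trans (Re_Cmod _) _.
have := taylor_bound chi (INR q) m (nonprincipal_bounded_sums _ _ q0 hc hn) (dchar_le1 _ _ hc).
by have -> : (1 / 2) ^ m = / 2 ^ m by rewrite -pow_inv; congr pow; field.
Qed.

(** As x^i / i! <= exp(c x) c^(-i), the remainder is dominated by a geometric series. *)
Lemma exp_taylor_tail x c M : 0 <= x -> 1 < c ->
  Rabs (exp x - \rsum_(0 <= m < M) (x ^ m / INR (Factorial.fact m))) <= exp (c * x) * ((/ c) ^ M / (1 - / c)).
Proof.
move=> x0 c1; have ic : 0 < / c < 1.
  by split; [apply: Rinv_0_lt_compat; lra | rewrite -Rinv_1; apply: Rinv_lt_contravar; lra].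
apply: series_tail_geo => //.
- move=> i; have f0 := INR_fact_lt_0 i.
  rewrite Rabs_pos_eq; last by apply: Rdiv_le_0_compat => //; apply: pow_le.
  have := pow_fact_le_exp (c * x) i ltac:(nra); rewrite Rpow_mult_distr pow_inv => h.
  have ci : 0 < c ^ i by apply: pow_lt; lra.
  apply: (Rmult_le_reg_l (c ^ i)) => //.
  have -> : c ^ i * (exp (c * x) * / c ^ i) = exp (c * x) by field; lra.
  by apply: Rle_trans h; apply: Req_le; field; lra.
- have := is_exp_Reals x; apply: is_series_ext => n.
  by rewrite /scal /= /Hierarchy.mult /= pow_n_pow.
Qed.

Lemma DSL_series a sg : 1 < sg < 2 -> (forall n, Cmod (a n) <= 1) ->
  is_series (fun m => lR a m * (2 - sg) ^ m) (Re (DSL a sg 0 0)).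
Proof.
move=> s12 a1; set h := 2 - sg; have h01 : 0 < h < 1 by rewrite /h; lra.
(* Any c strictly between 1 and 1/h serves: the remainder of exp(h ln n) then decays like c^(-M),
   while n^(-2 + c h) is still summable. Here c h is halfway between h and 1. *)
pose c := (1 + / h) / 2.
have ih : 1 < / h by rewrite -Rinv_1; apply: Rinv_lt_contravar; lra.
have c1 : 1 < c by rewrite /c; lra.
have ch : c * h = (1 + h) / 2 by rewrite /c; field; lra.
have ic : 0 < / c < 1.
  by split; [apply: Rinv_0_lt_compat; lra | rewrite -Rinv_1; apply: Rinv_lt_contravar; lra].
pose K := (1 + / ((1 - h) / 2)) / (1 - / c).
have K0 : 0 <= K.
  apply: Rdiv_le_0_compat; last lra.
  by have : 0 < / ((1 - h) / 2) by [apply: Rinv_0_lt_compat; lra]; lra.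
have bnd M : Rabs (\rsum_(0 <= m < M) (lR a m * h ^ m) - Re (DSL a sg 0 0)) <= K * (/ c) ^ M.
  pose g m n := (RtoC (h ^ m) * (a n * npow 2 0 n * RtoC (lnf m n)))%C.
  have A2 m := absum_DSL a 2 0 m ltac:(lra) a1.
  have gA m := absum_scal _ (RtoC (h ^ m)) _ (A2 m).
  have As := absum_DSL0 a sg 0 (proj1 s12) a1.
  have E1 : (\csum_(0 <= m < M) (RtoC (h ^ m) * DSL a 2 0 m) = tsum (fun n => \csum_(0 <= m < M) g m n))%C.
    rewrite (tsum_sum _ _ _ _ gA); apply: eq_bigr => m _; rewrite /g (tsum_scal _ _ _ (A2 m)) //.
  have E2 : (\csum_(0 <= m < M) (RtoC (h ^ m) * DSL a 2 0 m) - DSL a sg 0 0 =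
     tsum (fun n => \csum_(0 <= m < M) g m n + - RtoC 1 * (a n * npow sg 0 n)))%C.
    rewrite (tsum_add _ _ _ _ (absum_sum _ _ _ _ gA) (absum_scal _ (- RtoC 1)%C _ As)) -E1.
    by rewrite (tsum_scal _ _ _ As) DSL0; ring.
  have E3 : \rsum_(0 <= m < M) (lR a m * h ^ m) - Re (DSL a sg 0 0) =
     Re (\csum_(0 <= m < M) (RtoC (h ^ m) * DSL a 2 0 m) - DSL a sg 0 0)%C.
    rewrite (_ : Re (_ - _)%C = Re (\csum_(0 <= m < M) (RtoC (h ^ m) * DSL a 2 0 m))%C - Re (DSL a sg 0 0)); last first.
      by rewrite /Re /Cminus /Cplus /Copp /=; ring.
    rewrite csum_Re; congr (_ - _); apply: eq_bigr => m _.
    by rewrite /lR /Re /Cmult /RtoC /=; ring.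
  rewrite E3 E2; apply: Rle_trans (Re_Cmod _) _; apply: tsum_abs_le => N.
  apply: (Rle_trans _ (\rsum_(1 <= n < N) ((/ c) ^ M / (1 - / c) * exp (- (1 + (1 - h) / 2) * ln (INR n))))).
    apply: rsum_nat_le => n /andP[n0 _]; have l0 := ln_INR_ge0 n n0; set l := ln (INR n) in l0 *.
    have -> : (\csum_(0 <= m < M) g m n + - RtoC 1 * (a n * npow sg 0 n) =
       a n * RtoC (exp (- 2 * l) * - (exp (h * l) - \rsum_(0 <= m < M) ((h * l) ^ m / INR (Factorial.fact m)))))%C.
      have -> : npow sg 0 n = RtoC (exp (- 2 * l) * exp (h * l)).
        rewrite /npow /cis Rmult_0_l cos_0 sin_0 Ropp_0 -[(1, 0)]/(RtoC 1) Cmult_1_r -/l -exp_plus.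
        by congr RtoC; congr exp; rewrite /h; ring.
      have -> : (\csum_(0 <= m < M) g m n)%C =
          (a n * RtoC (exp (- 2 * l) * \rsum_(0 <= m < M) ((h * l) ^ m / INR (Factorial.fact m))))%C.
        rewrite RtoC_mult -csum_RtoC !big_distrr /=; apply: eq_bigr => m _.
        rewrite /g npow20 -/l Rpow_mult_distr /lnf -/l /Rdiv !RtoC_mult; ring.
      set S := \big[_/_]_(0 <= m < M) _.
      have -> : exp (- 2 * l) * - (exp (h * l) - S) = exp (- 2 * l) * S - exp (- 2 * l) * exp (h * l) by ring.
      by rewrite RtoC_minus; ring.
    rewrite Cmod_mult Cmod_R Rabs_mult Rabs_Ropp (Rabs_pos_eq (exp _)); last exact: Rlt_le (exp_pos _).
    have t := exp_taylor_tail (h * l) c M ltac:(nra) c1.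
    have -> : exp (- (1 + (1 - h) / 2) * l) = exp (- 2 * l) * exp (c * (h * l)).
      by rewrite -exp_plus -Rmult_assoc ch; congr exp; field.
    have an := a1 n; have e2 := exp_pos (- 2 * l).
    apply: (Rle_trans _ (1 * (exp (- 2 * l) * (exp (c * (h * l)) * ((/ c) ^ M / (1 - / c)))))).
      apply: Rmult_le_compat => //; first exact: Cmod_ge_0.
        by apply: Rmult_le_pos; [lra | apply: Rabs_pos].
      by apply: Rmult_le_compat_l; lra.
    by apply: Req_le; ring.
  have p : 0 <= (/ c) ^ M / (1 - / c) by apply: Rdiv_le_0_compat; [apply: pow_le |]; lra.
  rewrite -big_distrr /=; apply: (Rle_trans _ ((/ c) ^ M / (1 - / c) * (1 + / ((1 - h) / 2)))).
    by apply: Rmult_le_compat_l => //; apply: zeta_partial_le; lra.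
  by apply: Req_le; rewrite /K; field; repeat split; lra.
apply/is_series_rsum => eps e0.
have hl : is_lim_seq (pow (/ c)) 0 by apply: is_lim_seq_geom; rewrite Rabs_pos_eq; lra.
move/is_lim_seq_spec: hl => hl.
have q : 0 < eps / (K + 1) by apply: Rdiv_lt_0_compat; lra.
have [N hN] := hl (mkposreal _ q).
exists N => M NM; apply: Rle_lt_trans (bnd M) _.
have := hN M ltac:(lia); rewrite /= Rminus_0_r Rabs_pos_eq; last by apply: pow_le; lra.
move=> hM; have -> : eps = (K + 1) * (eps / (K + 1)) by field; lra.
have : 0 <= (/ c) ^ M by apply: pow_le; lra.
nra.
Qed.

Lemma ex_lR_series a Q x : 0 <= x <= 11 / 10 -> (forall m, Rabs (a m) <= Q * (1 / 2) ^ m) ->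
  ex_series (fun m => a m * x ^ m).
Proof.
move=> x01 ha; apply: ex_series_Rabs; apply: (ex_series_le _ (fun m => Q * (55 / 100) ^ m)).
  move=> m; rewrite /norm /= /abs /= Rabs_Rabsolu Rabs_mult (Rabs_pos_eq (x ^ m)); last by apply: pow_le; lra.
  have -> : (55 / 100) ^ m = (1 / 2) ^ m * (11 / 10) ^ m by rewrite -Rpow_mult_distr; congr pow; field.
  rewrite -Rmult_assoc; apply: Rmult_le_compat => //; [exact: Rabs_pos | by apply: pow_le; lra |].
  by apply: pow_incr; lra.
by apply: (ex_series_scal Q); apply: ex_series_geom; rewrite Rabs_pos_eq; lra.
Qed.

Lemma lR_lipschitz a Q x y : 0 <= Q -> (forall m, Rabs (a m) <= Q * (1 / 2) ^ m) ->
  0 <= x <= 11 / 10 -> 0 <= y <= 11 / 10 ->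
  Rabs (Series (fun m => a m * x ^ m) - Series (fun m => a m * y ^ m)) <= 20 * Q * Rabs (x - y).
Proof.
move=> Q0 ha.
have key u v : 0 <= v <= u -> u <= 11 / 10 ->
    Rabs (Series (fun m => a m * u ^ m) - Series (fun m => a m * v ^ m)) <= 20 * Q * (u - v).
  move=> [v0 vu] u1.
  rewrite -Series_minus; try by apply: (ex_lR_series _ Q) => //; lra.
  (* In 154/100 the factor 11/10 bounds u, and 14/10 absorbs the factor m of the derivative. Against
     the decay 1/2 of [a] this leaves 77/100. *)
  have pd m : 0 <= u ^ m - v ^ m <= 4 * (154 / 100) ^ m * (u - v).
    split; first by have := pow_incr v u m ltac:(lra); lra.
    case: m => [|m]; first by rewrite /=; lra.
    apply: Rle_trans (pow_diff_le v u m ltac:(lra)) _.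
    rewrite Rmult_assoc (Rmult_comm (u - v)) -Rmult_assoc; apply: Rmult_le_compat_r; first lra.
    have -> : (154 / 100) ^ m.+1 = (14 / 10) ^ m.+1 * (11 / 10) ^ m.+1 by rewrite -Rpow_mult_distr; congr pow; field.
    rewrite -Rmult_assoc; apply: Rmult_le_compat; [exact: pos_INR | by apply: pow_le; lra | |].
      elim: m => [|m IH]; first by rewrite /=; lra.
      rewrite S_INR -(tech_pow_Rmult _ m.+1); have : 1 <= (14 / 10) ^ m.+1 by apply: pow_R1_Rle; lra.
      lra.
    apply: (Rle_trans _ ((11 / 10) ^ m)); first by apply: pow_incr; lra.
    by rewrite -tech_pow_Rmult; have : 0 <= (11 / 10) ^ m by [apply: pow_le; lra]; lra.
  have td m : Rabs (a m * u ^ m - a m * v ^ m) <= Q * (4 * (u - v)) * (77 / 100) ^ m.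
    rewrite -Rmult_minus_distr_l Rabs_mult (Rabs_pos_eq (u ^ m - v ^ m)); last by case: (pd m).
    have -> : (77 / 100) ^ m = (1 / 2) ^ m * (154 / 100) ^ m by rewrite -Rpow_mult_distr; congr pow; field.
    have -> : Q * (4 * (u - v)) * ((1 / 2) ^ m * (154 / 100) ^ m) = Q * (1 / 2) ^ m * (4 * (154 / 100) ^ m * (u - v)) by ring.
    by apply: Rmult_le_compat; [apply: Rabs_pos | case: (pd m) | apply: ha | case: (pd m)].
  have ex : ex_series (fun m => a m * u ^ m - a m * v ^ m).
    have e1 := ex_lR_series a Q u ltac:(lra) ha; have e2 := ex_lR_series a Q v ltac:(lra) ha.
    exact: (ex_series_minus _ _ e1 e2).
  have := series_tail_geo _ _ _ (77 / 100) 0 ltac:(lra) td (Series_correct _ ex).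
  rewrite big_geq // Rminus_0_r /=; set S := Series _; move=> hS; apply: Rle_trans hS _.
  have -> : Q * (4 * (u - v)) * (1 / (1 - 77 / 100)) = 400 / 23 * (Q * (u - v)) by field.
  by have : 0 <= Q * (u - v) by [apply: Rmult_le_pos; lra]; lra.
move=> hx hy; case: (Rle_lt_dec y x) => h.
  by rewrite (Rabs_pos_eq (x - y)); [apply: key |]; lra.
rewrite Rabs_minus_sym (Rabs_minus_sym x) (Rabs_pos_eq (y - x)); last lra.
by apply: key; lra.
Qed.

(* [L(1, chi)], as the value at [s = 1] of the Taylor expansion at [s = 2]. *)
Definition L1 (chi : nat -> C) : R := Series (lR chi).

Lemma L1_series chi : L1 chi = Series (fun m => lR chi m * 1 ^ m).
Proof. by apply: Series_ext => m; rewrite pow1; ring. Qed.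

Lemma L1_lim q chi sg : (0 < q)%N -> dchar q chi -> nonprincipal q chi -> 1 < sg < 2 ->
  Rabs (Re (DSL chi sg 0 0) - L1 chi) <= 100 * INR q * (sg - 1).
Proof.
move=> q0 hc hn s12; rewrite -(is_series_unique _ _ (DSL_series chi sg s12 (dchar_le1 _ _ hc))) L1_series.
have := lR_lipschitz (lR chi) (5 * INR q) (2 - sg) 1 ltac:(have := pos_INR q; lra)
   (fun m => lR_bound q chi m q0 hc hn) ltac:(lra) ltac:(lra).
by rewrite (Rabs_left (2 - sg - 1)); lra.
Qed.

Lemma absum_ge a B : absum a B -> (forall n, (0 < n)%N -> 0 <= Re (a n)) ->
  forall N, \rsum_(1 <= n < N) Re (a n) <= Re (tsum a).
Proof.
move=> aB a0 N; apply: le_epsilon => eps e0.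
have [N1 h1] := tsum_cvg _ _ aB eps e0; have {}h1 := h1 (N + N1)%N ltac:(lia).
have mono : \rsum_(1 <= n < N) Re (a n) <= \rsum_(1 <= n < N + N1) Re (a n).
  by apply: rsum_nat_widen => // [|i hi]; [lia | apply: a0; lia].
have := Re_Cmod (\csum_(1 <= n < N + N1) a n - tsum a)%C.
have -> : Re (\csum_(1 <= n < N + N1) a n - tsum a)%C = Re (\csum_(1 <= n < N + N1) a n)%C - Re (tsum a).
  by rewrite /Re /Cminus /Cplus /Copp /=; ring.
by rewrite csum_Re; split_Rabs; lra.
Qed.

Lemma lR_ge a m N : summable_at 2 0 a -> (forall n, (0 < n)%N -> nonneg (a n)) ->
  \rsum_(1 <= n < N) (Re (a n) * gR m (INR n)) <= lR a m.
Proof.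
move=> [B hB] a0; have E n : Re (a n * npow 2 0 n * RtoC (lnf m n))%C = Re (a n) * gR m (INR n).
  by rewrite -CmultA npow_lnf_gR /Re /Cmult /RtoC /=; ring.
rewrite -(eq_bigr _ (fun n _ => E n)).
apply: (absum_ge _ _ (hB m)) => n n0; rewrite E.
by apply: Rmult_le_pos; [case: (a0 n n0) | case: (gR_le m (INR n) (INR_ge1 n n0))].
Qed.

Definition zc (m : nat) : R := lR (fun=> RtoC 1) m - 1.

Lemma zc_bound m : Rabs (zc m) <= 4 * (1 / 2) ^ m.
Proof.
have -> : (1 / 2) ^ m = / 2 ^ m by rewrite -pow_inv; congr pow; field.
apply: Rle_trans (taylor_zeta m); apply: Rle_trans (Re_Cmod _); exact: Req_le.
Qed.

Lemma lR_conv a b m : summable_at 2 0 a -> summable_at 2 0 b ->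
  (forall n, Im (a n) = 0) -> (forall n, Im (b n) = 0) ->
  lR (conv a b) m = \rsum_(0 <= i < m.+1) (lR a i * lR b (m - i)).
Proof.
move=> ha hb a0 b0; have [_ h] := DSL_conv 2 0 a b ha hb.
rewrite {1}/lR h csum_Re; apply: eq_bigr => i _; rewrite !DSL_lR //.
by rewrite -RtoC_mult.
Qed.

Lemma conv_real a b n : (forall n, Im (a n) = 0) -> (forall n, Im (b n) = 0) -> Im (conv a b n) = 0.
Proof.
by move=> a0 b0; rewrite /conv csum_Im big1 // => d _; have := a0 d; have := b0 (n %/ d)%N; rewrite /Im /Cmult /= => -> ->; ring.
Qed.

Lemma rchar_val q chi n : rchar q chi -> Re (chi n) = 0 \/ Re (chi n) = 1 \/ Re (chi n) = -1.
Proof.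
move=> [hc hr]; have I0 := hr n.
have E : chi n = RtoC (Re (chi n)) by move: I0; rewrite /RtoC /Re /Im; case: (chi n) => x y /= ->.
case: (boolP (coprime n q)) => c; last by left; rewrite (dchar0 _ _ hc).
by right; have := dcharU _ _ hc n c; rewrite E Cmod_R /=; split_Rabs; lra.
Qed.

Lemma rchar_mod1 q chi n : rchar q chi -> nonneg (RtoC 1 + chi n)%C.
Proof.
move=> hr; have [_ I0] := hr; have I0n := I0 n; rewrite /nonneg.
rewrite /Im /Re /RtoC /Cplus /=; rewrite /Im in I0n; rewrite I0n; split; first by ring.
by have := rchar_val q chi n hr; rewrite /Re; lra.
Qed.

Definition one_ : nat -> C := fun _ => RtoC 1.

Lemma one_real n : Im (one_ n : C) = 0. Proof. by []. Qed.
Lemma one_le1 (n : nat) : Cmod (one_ n) <= 1. Proof. by rewrite Cmod_1; lra. Qed.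
Lemma one_cmult : cmult one_. Proof. by split=> // *; rewrite /one_; ring. Qed.

Lemma lR_one m : lR one_ m = 1 + zc m.
Proof. by rewrite /zc -/one_; ring. Qed.

Lemma conv_at1 a b : conv a b 1%N = (a 1%N * b 1%N)%C.
Proof. by rewrite /conv big_seq1. Qed.

Lemma log_deriv_dchar q chi : dchar q chi -> log_deriv chi (fun n => chi n * RtoC (vonM n))%C.
Proof. by move=> hc; apply: log_deriv_cmult; apply: (dchar_cmult _ _ hc). Qed.

Lemma conv_one_nonneg q chi : rchar q chi -> forall n, (0 < n)%N -> nonneg (conv one_ chi n).
Proof.
move=> hr; have [hc _] := hr.
apply: (log_deriv_nonneg _ _ (log_deriv_conv _ _ _ _ (log_deriv_cmult _ one_cmult) (log_deriv_dchar _ _ hc))).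
- by rewrite conv_at1 (dchar1 _ _ hc) /one_; ring.
- move=> n n0; have -> : (one_ n * RtoC (vonM n) + chi n * RtoC (vonM n) = (RtoC 1 + chi n) * RtoC (vonM n))%C by rewrite /one_; ring.
  by apply: nonneg_mul; [apply: rchar_mod1 hr | split=> //=; apply: vonM_ge0].
- by rewrite /vonM /=; ring.
Qed.

(** By multiplicativity k may be a prime power p^a. The value at p^(2 a) is then 1 + x + ... + x^(2
    a) with x = chi(p) in {0, 1, -1}; the number of terms is odd, so it is at least 1. *)
Lemma conv_one_square q chi k : rchar q chi -> (0 < k)%N -> 1 <= Re (conv one_ chi (k * k)%N).
Proof.
move=> hr; have [hc hi] := hr.
pose rr n := \rsum_(d <- divisors n) (1 * Re (chi d)).
have E n : (0 < n)%N -> Re (conv one_ chi n) = rr n.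
  move=> n0; rewrite convC // /conv csum_Re; apply: eq_bigr => d _.
  by rewrite /Re /Cmult /=; ring.
have mr : mult rr.
  apply: (mult_conv (fun=> 1) (fun n => Re (chi n))); first by split=> // *; ring.
  split; first by rewrite (dchar1 _ _ hc).
  move=> m n _ _ _; rewrite (dcharM _ _ hc) /Re /Cmult /=.
  by have := hi m; rewrite /Im => ->; ring.
move: k; apply: nat_coprime_ind => [|p a m pp a0 m0 pm IH].
  by rewrite conv_at1 (dchar1 _ _ hc) /Re /Cmult /=; lra.
have p0 := prime_gt0 pp; have pa0 : (0 < p ^ a)%N by rewrite expn_gt0 p0.
have -> : (p ^ a * m * (p ^ a * m) = p ^ (a + a) * (m * m))%N by rewrite expnD mulnACA.
have paa0 : (0 < p ^ (a + a))%N by rewrite expn_gt0 p0.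
rewrite E ?muln_gt0 ?paa0 ?m0 //; case: mr => _ mrM; rewrite mrM // ?muln_gt0 ?m0 //; last first.
  by rewrite coprime_pexpl ?addn_gt0 ?a0 // coprimeMr !prime_coprime // pm.
rewrite -(E (m * m)%N) ?muln_gt0 ?m0 //.
suff h : 1 <= rr (p ^ (a + a))%N by nra.
rewrite /rr big_divisors_prime_pow //.
have hx i : Re (chi (p ^ i)%N) = Re (chi p) ^ i.
  elim: i => [|i IHi]; first by rewrite expn0 (dchar1 _ _ hc).
  rewrite expnS (dcharM _ _ hc) -tech_pow_Rmult -IHi /Re /Cmult /=.
  by have := hi p; rewrite /Im => ->; ring.
rewrite (eq_bigr (fun i => Re (chi p) ^ i)) => [|i _]; last by rewrite hx; ring.
have := rchar_val q chi p hr; move: (Re (chi p)) => x hv.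
elim: (a) => [|b IHb]; first by rewrite big_nat1 /=; lra.
rewrite addSn addnS !(big_nat_recr (_.+1)) //= in IHb *.
have : 0 <= x * x ^ (b + b) + x * (x * x ^ (b + b)).
  have : 0 <= x ^ (b + b) by rewrite pow_add; apply: Rle_0_sqr.
  by case: hv => [->|[->|->]]; lra.
lra.
Qed.

Lemma summable_char q chi : dchar q chi -> summable_at 2 0 chi.
Proof. by move=> hc; apply: summable_bounded; [lra | exact: (dchar_le1 _ _ hc)]. Qed.

Lemma summable_one : summable_at 2 0 one_.
Proof. by apply: summable_bounded; [lra | exact: one_le1]. Qed.

Lemma lR_conv_one a m : summable_at 2 0 a -> (forall n, Im (a n) = 0) ->
  lR (conv one_ a) m = \rsum_(0 <= i < m.+1) ((1 + zc i) * lR a (m - i)%N).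
Proof.
move=> sa ia; rewrite (lR_conv _ _ _ summable_one sa one_real ia).
by apply: eq_bigr => i _; rewrite lR_one.
Qed.

Lemma sum_squares_le (u : nat -> R) K : (forall n, (0 < n)%N -> 0 <= u n) ->
  \rsum_(1 <= k < K) u (k * k)%N <= \rsum_(1 <= n < K * K) u n.
Proof.
move=> u0; elim: K => [|[|K] IH]; try by rewrite !big_geq //; lra.
rewrite big_nat_recr //= [X in _ <= X](@big_cat_nat _ _ _ (K.+1 * K.+1)%N) /=; try by lia.
apply: Rplus_le_compat => //.
rewrite [X in _ <= X](@big_ltn _ _ _ (K.+1 * K.+1)%N) /=; last by lia.
have : 0 <= \rsum_((K.+1 * K.+1).+1 <= n < K.+2 * K.+2) u n; last by lra.
by apply: rsum_nat_ge0 => i hi; apply: u0; lia.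
Qed.

(** If L(1, chi) = 0, the product zeta(s) L(s, chi) loses its pole, and its Taylor coefficients,
    then O((6/10)^m), bound the Dirichlet series of [conv one_ chi] at s = 1/2. The coefficients of
    that series are nonnegative, and at least 1 at squares, so it dominates the harmonic series. *)
Lemma L1_pos q chi : (0 < q)%N -> rchar q chi -> nonprincipal q chi -> 0 < L1 chi.
Proof.
move=> q0 hr hn; have [hc hi] := hr.
have sc := summable_char _ _ hc.
have [sf _] := DSL_conv 2 0 one_ chi summable_one sc.
have fp := conv_one_nonneg _ _ hr.
pose b m := lR (conv one_ chi) m.
have q1 := INR_ge1 q q0.
pose w m := \rsum_(0 <= i < m.+1) (zc i * lR chi (m - i)%N).
have lb m := lR_bound q chi m q0 hc hn.
have bE m : b m = \rsum_(0 <= i < m.+1) lR chi i + w m.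
  rewrite /b lR_conv_one // /w [X in _ = X + _]big_nat_rev /= -big_split /=; apply: eq_big_nat => i /andP[_ im].
  by rewrite subSS; ring.
have h56 m : (1 / 2) ^ m <= (6 / 10) ^ m by apply: pow_incr; lra.
have wb m : Rabs (w m) <= 120 * INR q * (6 / 10) ^ m.
  have := geo_conv (1 / 2) (6 / 10) 4 (5 * INR q) zc (lR chi) m ltac:(lra) zc_bound
    ltac:(move=> i; apply: Rle_trans (lb i) _; apply: Rmult_le_compat_l; [lra | exact: h56]).
  by have -> : 4 * (5 * INR q) * (6 / 10 / (6 / 10 - 1 / 2)) = 120 * INR q by field.
have hL : is_series (lR chi) (L1 chi).
  apply: Series_correct; have := ex_lR_series (lR chi) _ 1 ltac:(lra) lb.
  by apply: ex_series_ext => m; rewrite pow1 Rmult_1_r.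
have bl m : Rabs (b m - L1 chi) <= 125 * INR q * (6 / 10) ^ m.
  have := series_tail_geo _ _ _ (1 / 2) m.+1 ltac:(lra) lb hL; rewrite -tech_pow_Rmult.
  have -> : 5 * INR q * (1 / 2 * (1 / 2) ^ m / (1 - 1 / 2)) = 5 * INR q * (1 / 2) ^ m by field.
  have := wb m; rewrite bE; have : 5 * INR q * (1 / 2) ^ m <= 5 * INR q * (6 / 10) ^ m.
    by apply: Rmult_le_compat_l; [lra | apply: h56].
  by split_Rabs; lra.
have b0 m : 0 <= b m by have := lR_ge (conv one_ chi) m 1 sf fp; rewrite big_geq.
have Lge : 0 <= L1 chi.
  apply: Rnot_lt_le => lt.
  have hl : is_lim_seq (pow (6 / 10)) 0 by apply: is_lim_seq_geom; rewrite Rabs_pos_eq; lra.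
  have pq : 0 < - L1 chi / (125 * INR q) by apply: Rdiv_lt_0_compat; lra.
  move/is_lim_seq_spec: hl => /(_ (mkposreal _ pq)) [N hN].
  have := hN N (Nat.le_refl _); rewrite /= Rminus_0_r Rabs_pos_eq; last by apply: pow_le; lra.
  move=> h; have : 125 * INR q * (6 / 10) ^ N < 125 * INR q * (- L1 chi / (125 * INR q)).
    by apply: Rmult_lt_compat_l; lra.
  have -> : 125 * INR q * (- L1 chi / (125 * INR q)) = - L1 chi by field; lra.
  by have := bl N; have := b0 N; split_Rabs; lra.
case: (Req_dec (L1 chi) 0) => [L0|]; last by lra.
exfalso; pose A := 1250 * INR q.
(* At s = 1/2 the Taylor variable 2 - s is 3/2, and (6/10)(3/2) = 9/10 < 1. M is taken so large that
   the truncated exponential keeps at least half of each term with n < N. *)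
have up N : \rsum_(1 <= n < N) (Re (conv one_ chi n) * (exp (- / 2 * ln (INR n)) / 2)) <= A.
  case: (posnP N) => [->|N0]; first by rewrite big_geq // /A; lra.
  pose X := 3 / 2 * ln (INR N); have X0 : 0 <= X by have := ln_INR_ge0 N N0; rewrite /X; lra.
  have hl : is_lim_seq (pow (/ 2)) 0 by apply: is_lim_seq_geom; rewrite Rabs_pos_eq; lra.
  have pq : 0 < / 4 * exp (- (2 * X)) by apply: Rmult_lt_0_compat; [lra | apply: exp_pos].
  move/is_lim_seq_spec: hl => /(_ (mkposreal _ pq)) [M hM].
  have {hM} := hM M (Nat.le_refl _); rewrite /= Rminus_0_r Rabs_pos_eq; last by apply: pow_le; lra.
  move=> hM.
  apply: (Rle_trans _ (\rsum_(0 <= m < M) (b m * (3 / 2) ^ m))); last first.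
    apply: (Rle_trans _ (\rsum_(0 <= m < M) (125 * INR q * (9 / 10) ^ m))).
      apply: rsum_nat_le => m _; have h := bl m; rewrite L0 Rminus_0_r Rabs_pos_eq in h; last exact: b0.
      have -> : (9 / 10) ^ m = (6 / 10) ^ m * (3 / 2) ^ m by rewrite -Rpow_mult_distr; congr pow; field.
      have p3 : 0 <= (3 / 2) ^ m by apply: pow_le; lra.
      by have := Rmult_le_compat_r _ _ _ p3 h; lra.
    rewrite -big_distrr /=; have := geo_sum_le (9 / 10) 0 M ltac:(lra).
    move=> hg; apply: (Rle_trans _ (125 * INR q * ((9 / 10) ^ 0 / (1 - 9 / 10)))).
      by apply: Rmult_le_compat_l; lra.
    by rewrite /A /=; apply: Req_le; field.
  apply: (Rle_trans _ (\rsum_(0 <= m < M) ((3 / 2) ^ m * \rsum_(1 <= n < N) (Re (conv one_ chi n) * gR m (INR n))))); last first.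
    apply: rsum_nat_le => m _; rewrite Rmult_comm; apply: Rmult_le_compat_r; [by apply: pow_le; lra | exact: lR_ge].
  under [X in _ <= X]eq_bigr do rewrite big_distrr /=.
  rewrite exchange_big /=; apply: rsum_nat_le => n /andP[n0 nN].
  rewrite [X in _ <= X](eq_bigr (fun m => Re (conv one_ chi n) * (gR m (INR n) * (3 / 2) ^ m))); last by move=> m _; ring.
  rewrite -big_distrr /=; apply: Rmult_le_compat_l; first by case: (fp n n0).
  have l0 := ln_INR_ge0 n n0; set l := ln (INR n) in l0 *.
  have lX : 3 / 2 * l <= X.
    by apply: Rmult_le_compat_l; [lra | apply: ln_le; [apply: INR_gt0 | apply: le_INR; lia]].
  have -> : \rsum_(0 <= m < M) (gR m (INR n) * (3 / 2) ^ m) =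
     exp (- 2 * l) * \rsum_(0 <= m < M) ((3 / 2 * l) ^ m / INR (Factorial.fact m)).
    rewrite big_distrr /=; apply: eq_bigr => m _.
    by rewrite /gR -/l Rpow_mult_distr /Rdiv; ring.
  have := exp_taylor_tail (3 / 2 * l) 2 M ltac:(lra) ltac:(lra).
  set S := \big[_/_]_(0 <= m < M) _ => hS.
  have e1 : exp (2 * (3 / 2 * l)) <= exp (2 * X) by apply: exp_le; lra.
  have e2 : exp (2 * X) * exp (- (2 * X)) = 1 by rewrite -exp_plus Rplus_opp_r exp_0.
  have pM : 0 <= (/ 2) ^ M by apply: pow_le; lra.
  have e3 : exp (2 * (3 / 2 * l)) * ((/ 2) ^ M / (1 - / 2)) <= 1 / 2.
    apply: (Rle_trans _ (exp (2 * X) * (2 * (/ 4 * exp (- (2 * X)))))).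
      apply: Rmult_le_compat; [exact: Rlt_le (exp_pos _) | | exact: e1 |].
        by apply: Rdiv_le_0_compat; lra.
      by have -> : (/ 2) ^ M / (1 - / 2) = 2 * (/ 2) ^ M by [field]; lra.
    by have -> : exp (2 * X) * (2 * (/ 4 * exp (- (2 * X)))) = / 2 * (exp (2 * X) * exp (- (2 * X))) by [field]; lra.
  have e4 : 1 <= exp (3 / 2 * l) by rewrite -[X in X <= _]exp_0; apply: exp_le; lra.
  have e5 : exp (3 / 2 * l) / 2 <= S by split_Rabs; lra.
  have -> : exp (- / 2 * l) / 2 = exp (- 2 * l) * (exp (3 / 2 * l) / 2).
    by have -> : - / 2 * l = - 2 * l + 3 / 2 * l by [field]; rewrite exp_plus; field.
  by apply: Rmult_le_compat_l => //; apply: Rlt_le (exp_pos _).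
(* At n = k^2 the weight is 1/(2 k), so the squares below K0^2 contribute at least (ln K0) / 2 >= A
   + 1/2, against the bound A. *)
have [K' [K1' K2']] := nfloor_ex (exp (2 * A + 1)) ltac:(exact: Rlt_le (exp_pos _)).
pose K0 := K'.+1; have K0R : exp (2 * A + 1) <= INR K0 by rewrite /K0 S_INR; lra.
have := up (K0 * K0)%N.
have := sum_squares_le (fun n => Re (conv one_ chi n) * (exp (- / 2 * ln (INR n)) / 2)) K0.
move=> /(_ ltac:(move=> n n0; apply: Rmult_le_pos; [by case: (fp n n0) | by have := exp_pos (- / 2 * ln (INR n)); lra])).
have lowr : (2 * A + 1) / 2 <= \rsum_(1 <= k < K0) (Re (conv one_ chi (k * k)%N) * (exp (- / 2 * ln (INR (k * k))) / 2)).
  apply: (Rle_trans _ (\rsum_(1 <= k < K0) ((ln (INR k.+1) - ln (INR k)) / 2))).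
    rewrite /Rdiv -big_distrl /= (rsum_telescope 1 K0 (fun n => ln (INR n))) // -[INR 1]/1 ln_1.
    have : ln (exp (2 * A + 1)) <= ln (INR K0) by apply: ln_le => //; apply: exp_pos.
    by rewrite ln_exp; lra.
  apply: rsum_nat_le => k /andP[k0 kK]; have [_ lk] := ln_succ_diff k k0.
  have -> : exp (- / 2 * ln (INR (k * k))) = / INR k.
    by rewrite -exp_neg_ln // ln_INR_mul //; congr exp; field.
  have := conv_one_square q chi k hr k0; have := Rinv_0_lt_compat _ (INR_gt0 k k0); nra.
lra.
Qed.

Lemma geo_weaken (a : nat -> R) A r s : 0 <= r <= s -> (forall m, Rabs (a m) <= A * r ^ m) ->
  forall m, Rabs (a m) <= A * s ^ m.
Proof.
move=> rs ha m; apply: Rle_trans (ha m) _; apply: Rmult_le_compat_l.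
  by have := ha 0%N; rewrite /= Rmult_1_r; have := Rabs_pos (a 0%N); lra.
by apply: pow_incr; lra.
Qed.

(** The hypothesis on the series says that L(1 - dl, chi) >= 0. In [estermann] the factor of zeta is
    L(s, chi) itself, with Q = 5 q. *)
Lemma siegel_one q chi dl : (0 < q)%N -> rchar q chi -> nonprincipal q chi -> 0 < dl <= 1 / 10 ->
  0 <= Series (fun m => lR chi m * (1 + dl) ^ m) ->
  dl / 2 * exp (- (dl * (31 + 5 * ln (5 * INR q)))) <= L1 chi.
Proof.
move=> q0 hr hn dl01 hP; have [hc hi] := hr; have sc := summable_char _ _ hc.
have [sf _] := DSL_conv 2 0 one_ chi summable_one sc.
have fp := conv_one_nonneg _ _ hr; have q1 := INR_ge1 q q0.
have lb m := lR_bound q chi m q0 hc hn.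
apply: (estermann (lR chi) zc (5 * INR q) dl (Series (fun m => lR chi m * (1 + dl) ^ m))) => //.
- lra.
- by apply: (geo_weaken _ _ (1 / 2)) => //; lra.
- exact: zc_bound.
- by move=> m; rewrite -lR_conv_one //; have := lR_ge (conv one_ chi) m 1 sf fp; rewrite big_geq.
- have := lR_ge (conv one_ chi) 0 2 sf fp; rewrite lR_conv_one // !big_nat1 subnn conv_at1 (dchar1 _ _ hc).
  by rewrite /gR -[INR 1]/1 ln_1 Rmult_0_r exp_0 /one_ /Re /Cmult /=; lra.
- by apply: Series_correct; apply: (ex_lR_series _ (5 * INR q)) => //; lra.
- apply: Series_correct; have := ex_lR_series (lR chi) _ 1 ltac:(lra) lb.
  by apply: ex_series_ext => m; rewrite pow1 Rmult_1_r.
Qed.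

Lemma cauchy_series (a b : nat -> R) A B r s h x y : 0 <= h -> 0 <= r -> 0 <= s -> r * h < 1 -> s * h < 1 ->
  (forall m, Rabs (a m) <= A * r ^ m) -> (forall m, Rabs (b m) <= B * s ^ m) ->
  is_series (fun m => a m * h ^ m) x -> is_series (fun m => b m * h ^ m) y ->
  is_series (fun m => (\rsum_(0 <= i < m.+1) (a i * b (m - i)%N)) * h ^ m) (x * y).
Proof.
move=> h0 r0 s0 rh sh ha hb hx hy.
have ab c K t : 0 <= t -> t * h < 1 -> (forall m, Rabs (c m) <= K * t ^ m) ->
    ex_series (fun m => Rabs (c m * h ^ m)).
  move=> t0 th hc; apply: (ex_series_le _ (fun m => K * (t * h) ^ m)).
    move=> m; rewrite /norm /= /abs /= Rabs_Rabsolu Rabs_mult (Rabs_pos_eq (h ^ m)); last exact: pow_le.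
    rewrite Rpow_mult_distr -Rmult_assoc; apply: Rmult_le_compat_r; [exact: pow_le | exact: hc].
  by apply: (ex_series_scal K); apply: ex_series_geom; rewrite Rabs_pos_eq //; apply: Rmult_le_pos.
have := is_series_mult _ _ _ _ hx hy (ab _ _ _ r0 rh ha) (ab _ _ _ s0 sh hb).
apply: is_series_ext => m; rewrite -sum_n_Reals sum_n_rsum big_distrl /=.
apply: eq_big_nat => i /andP[_ im]; rewrite minusE.
have -> : h ^ m = h ^ i * h ^ (m - i) by rewrite -pow_add; congr pow; lia.
by ring.
Qed.

(* Estermann's argument for L(s, c1) L(s, c2) L(s, c1 c2), multiplied by zeta(s). *)
Lemma siegel_pair q1 q2 c1 c2 dl : (0 < q1)%N -> (0 < q2)%N -> rchar q1 c1 -> rchar q2 c2 ->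
  nonprincipal q1 c1 -> nonprincipal q2 c2 ->
  nonprincipal (q1 * q2) (fun n => c1 n * c2 n)%C -> 0 < dl <= 1 / 10 ->
  Series (fun m => lR c1 m * (1 + dl) ^ m) = 0 ->
  dl / 2 * exp (- (dl * (31 + 5 * ln (2625 * INR q1 ^ 2 * INR q2 ^ 2)))) <=
  L1 c1 * (L1 c2 * L1 (fun n => c1 n * c2 n)%C).
Proof.
move=> q10 q20 r1 r2 n1 n2 n12 dl01 hP.
have [hc1 hi1] := r1; have [hc2 hi2] := r2.
set c12 := fun n => (c1 n * c2 n)%C in n12 *.
have hc12 : dchar (q1 * q2) c12 := dchar_prod _ _ _ _ hc1 hc2.
have hi12 n : Im (c12 n) = 0.
  by rewrite /c12; have := hi1 n; have := hi2 n; rewrite /Im /Cmult /= => -> ->; ring.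
have q120 : (0 < q1 * q2)%N by rewrite muln_gt0 q10.
have s1 := summable_char _ _ hc1; have s2 := summable_char _ _ hc2; have s12 := summable_char _ _ hc12.
pose g := conv c2 c12; pose e := conv c1 g; pose F := conv one_ e.
have [sg _] := DSL_conv 2 0 c2 c12 s2 s12.
have [se _] := DSL_conv 2 0 c1 g s1 sg.
have [sF _] := DSL_conv 2 0 one_ e summable_one se.
have ig n : Im (g n) = 0 by apply: conv_real.
have ie n : Im (e n) = 0 by apply: conv_real.
have Q1 := INR_ge1 q1 q10; have Q2 := INR_ge1 q2 q20.
have F1 : F 1%N = RtoC 1.
  by rewrite /F conv_at1 /e conv_at1 /g conv_at1 /c12 (dchar1 _ _ hc1) (dchar1 _ _ hc2) /one_; ring.
have Fp : forall n, (0 < n)%N -> nonneg (F n).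
  apply: (log_deriv_nonneg _ _ (log_deriv_conv _ _ _ _ (log_deriv_cmult _ one_cmult)
    (log_deriv_conv _ _ _ _ (log_deriv_dchar _ _ hc1) (log_deriv_conv _ _ _ _
      (log_deriv_dchar _ _ hc2) (log_deriv_dchar _ _ hc12))))) => //.
  - move=> n n0.
    have -> : (one_ n * RtoC (vonM n) + (c1 n * RtoC (vonM n) + (c2 n * RtoC (vonM n) + c12 n * RtoC (vonM n))) =
       (RtoC 1 + c1 n) * ((RtoC 1 + c2 n) * RtoC (vonM n)))%C by rewrite /one_ /c12; ring.
    apply: nonneg_mul; first exact: (rchar_mod1 q1).
    apply: nonneg_mul; first exact: (rchar_mod1 q2).
    by split=> //=; apply: vonM_ge0.
  - by rewrite /vonM /=; ring.
have lb1 m := lR_bound q1 c1 m q10 hc1 n1; have lb2 m := lR_bound q2 c2 m q20 hc2 n2.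
have lb12 m := lR_bound _ c12 m q120 hc12 n12; rewrite mult_INR in lb12.
have gE m : lR g m = \rsum_(0 <= i < m.+1) (lR c2 i * lR c12 (m - i)%N) by apply: lR_conv.
have eE m : lR e m = \rsum_(0 <= i < m.+1) (lR c1 i * lR g (m - i)%N) by apply: lR_conv.
(* The rate moves from 1/2 to 6/10 and then 7/10, as [geo_conv] asks for distinct rates and
   [estermann] for 7/10. The constants are 25 * 6 = 150 and 750 * 7/2 = 2625. *)
have gb m : Rabs (lR g m) <= 150 * INR q1 * INR q2 ^ 2 * (6 / 10) ^ m.
  rewrite gE; have := geo_conv (1 / 2) (6 / 10) _ _ (lR c2) (lR c12) m ltac:(lra) lb2
    (geo_weaken _ _ (1 / 2) (6 / 10) ltac:(lra) lb12).
  by have -> : 5 * INR q2 * (5 * (INR q1 * INR q2)) * (6 / 10 / (6 / 10 - 1 / 2)) = 150 * INR q1 * INR q2 ^ 2 by field.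
have eb m : Rabs (lR e m) <= 2625 * INR q1 ^ 2 * INR q2 ^ 2 * (7 / 10) ^ m.
  rewrite eE; have := geo_conv (1 / 2) (7 / 10) _ _ (lR c1) (lR g) m ltac:(lra) lb1
    (geo_weaken _ _ (6 / 10) (7 / 10) ltac:(lra) gb).
  by have -> : 5 * INR q1 * (150 * INR q1 * INR q2 ^ 2) * (7 / 10 / (7 / 10 - 1 / 2)) = 2625 * INR q1 ^ 2 * INR q2 ^ 2 by field.
have ser h : 0 <= h <= 11 / 10 -> is_series (fun m => lR e m * h ^ m)
    (Series (fun m => lR c1 m * h ^ m) * (Series (fun m => lR c2 m * h ^ m) * Series (fun m => lR c12 m * h ^ m))).
  move=> h01; apply: (is_series_ext (fun m => (\rsum_(0 <= i < m.+1) (lR c1 i * lR g (m - i)%N)) * h ^ m)).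
    by move=> m; rewrite eE.
  apply: (cauchy_series _ _ _ _ (1 / 2) (6 / 10) _ _ _ _ _ _ _ _ lb1 gb); try lra.
    by apply: Series_correct; apply: (ex_lR_series _ _ _ h01 lb1).
  apply: (is_series_ext (fun m => (\rsum_(0 <= i < m.+1) (lR c2 i * lR c12 (m - i)%N)) * h ^ m)).
    by move=> m; rewrite gE.
  apply: (cauchy_series _ _ _ _ (1 / 2) (1 / 2) _ _ _ _ _ _ _ _ lb2 lb12); try lra.
    by apply: Series_correct; apply: (ex_lR_series _ _ _ h01 lb2).
  by apply: Series_correct; apply: (ex_lR_series _ _ _ h01 lb12).
have q1s : 1 <= INR q1 ^ 2 by apply: pow_R1_Rle.
have q2s : 1 <= INR q2 ^ 2 by apply: pow_R1_Rle.
apply: (estermann (lR e) zc _ dl 0) => //.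
- nra.
- exact: zc_bound.
- by move=> m; rewrite -lR_conv_one //; have := lR_ge F m 1 sF Fp; rewrite big_geq.
- have := lR_ge F 0 2 sF Fp; rewrite lR_conv_one // !big_nat1 subnn F1.
  by rewrite /gR -[INR 1]/1 ln_1 Rmult_0_r exp_0 /Re /RtoC /=; lra.
- by have := ser (1 + dl) ltac:(lra); rewrite hP Rmult_0_l.
- have := ser 1 ltac:(lra); rewrite -!L1_series; apply: is_series_ext => m.
  by rewrite pow1 Rmult_1_r.
- lra.
Qed.

(** The extreme case is the run of consecutive integers a, a + 1, ..., for which the product
    telescopes to the left side. *)
Lemma prod_one_minus_inv (s : seq nat) a : (1 < a)%N -> path.sorted ltn s -> all (leq a) s ->
  (INR a - 1) / (INR a - 1 + INR (size s)) <= \big[Rmult/1]_(p <- s) (1 - / INR p).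
Proof.
elim: s a => [|p s IH] a a1 /=.
  move=> _ _; rewrite big_nil; have : 1 < INR a by apply: (lt_INR 1); lia.
  by move=> h; apply: Req_le; field; lra.
move=> srt /andP[ap al]; rewrite big_cons.
have a1' : 1 < INR a by apply: (lt_INR 1); lia.
have ap' : INR a <= INR p by apply: le_INR; lia.
have s0 := pos_INR (size s).
have al' : all (leq p.+1) s.
  exact: (path.order_path_min ltn_trans srt).
have := IH p.+1 ltac:(lia) (path.path_sorted srt) al'.
rewrite -/(INR (size s).+1) !S_INR => h.
apply: (Rle_trans _ ((1 - / INR p) * ((INR p + 1 - 1) / (INR p + 1 - 1 + INR (size s))))).
  have -> : (1 - / INR p) * ((INR p + 1 - 1) / (INR p + 1 - 1 + INR (size s))) = (INR p - 1) / (INR p + INR (size s)).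
    by field; lra.
  apply: (Rmult_le_reg_r ((INR a - 1 + (INR (size s) + 1)) * (INR p + INR (size s)))); first nra.
  have -> : (INR a - 1) / (INR a - 1 + (INR (size s) + 1)) * ((INR a - 1 + (INR (size s) + 1)) * (INR p + INR (size s))) =
    (INR a - 1) * (INR p + INR (size s)) by field; lra.
  have -> : (INR p - 1) / (INR p + INR (size s)) * ((INR a - 1 + (INR (size s) + 1)) * (INR p + INR (size s))) =
    (INR p - 1) * (INR a + INR (size s)) by field; lra.
  nra.
apply: Rmult_le_compat_l => //; have : / INR p <= 1 by rewrite -Rinv_1; apply: Rinv_le_contravar; lra.
lra.
Qed.

Lemma exp2_size_primes_le n : (0 < n)%N -> (2 ^ size (primes n) <= n)%N.
Proof.
move: n; apply: nat_coprime_ind => // p a m pp a0 m0 pm IH.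
have pa0 : (0 < p ^ a)%N by rewrite expn_gt0 prime_gt0.
have : perm_eq (primes (p ^ a * m)) (p :: primes m).
  apply: uniq_perm; first exact: primes_uniq.
    by rewrite /= primes_uniq mem_primes pp m0 /= pm.
  by move=> r; rewrite primesM // primesX // primes_prime // !inE.
move/perm_size => /= ->; rewrite expnS leq_mul //.
by apply: leq_trans (prime_gt1 pp) _; rewrite -{1}(expn1 p) leq_pexp2l // prime_gt0.
Qed.

Lemma prod_primes_lower n : (0 < n)%N ->
  / (1 + INR (size (primes n))) <= \big[Rmult/1]_(p <- primes n) (1 - / INR p).
Proof.
move=> n0; have := prod_one_minus_inv (primes n) 2 isT (sorted_primes n).
have -> : all (leq 2) (primes n).
  by apply/allP => p; rewrite mem_primes => /andP[/prime_gt1].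
by have -> : INR 2 = 2 by [rewrite /=; ring]; move=> /(_ isT); have := pos_INR (size (primes n)) => ? h; apply: Rle_trans h; apply: Req_le; field; lra.
Qed.

Lemma has_primes_coprime n q : (0 < n)%N -> (0 < q)%N ->
  has (fun p => p %| n)%N (primes q) = ~~ coprime n q.
Proof.
move=> n0 q0; rewrite coprime_has_primes // negbK; apply: eq_in_has => p.
by move=> pq; move: (pq); rewrite !mem_primes => /and3P[-> _ _]; rewrite n0.
Qed.

Lemma all_prime_primes n : all prime (primes n).
Proof. by apply/allP => p; rewrite mem_primes => /andP[]. Qed.

Lemma prod_one_minus_inv_ge0 (s : seq nat) : all prime s ->
  0 <= \big[Rmult/1]_(p <- s) (1 - / INR p).
Proof.
elim: s => [|p s IH] /= => [_|/andP[pp ap]]; first by rewrite big_nil; lra.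
rewrite big_cons; apply: Rmult_le_pos; last exact: IH.
have : / INR p <= 1 by rewrite -Rinv_1; apply: Rinv_le_contravar; [lra | apply: INR_ge1; apply: prime_gt0].
lra.
Qed.

Lemma cmod_prod_bounds (s : seq nat) (g : nat -> C) : all prime s ->
  (forall p, prime p -> Cmod (g p) <= / INR p) ->
  \big[Rmult/1]_(p <- s) (1 - / INR p) <= Cmod (\big[Cmult/RtoC 1]_(p <- s) (RtoC 1 - g p)%C) <= 2 ^ size s.
Proof.
move=> + hg; rewrite cprod_mod; elim: s => [|p s IH] /= => [_|/andP[pp ap]]; first by rewrite !big_nil; lra.
rewrite !big_cons; have [i1 i2] := IH ap; have h := hg p pp.
have p1 : / INR p <= / 2.
  apply: Rinv_le_contravar; first lra.
  by apply: (Rle_trans _ (INR 2)); [rewrite /=; lra | apply: le_INR; have := prime_gt1 pp; lia].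
have t1 : Cmod (RtoC 1 - g p)%C <= 2.
  by apply: Rle_trans (Cmod_triangle _ _) _; rewrite Cmod_opp Cmod_1; lra.
have t2 : 1 - / INR p <= Cmod (RtoC 1 - g p)%C.
  have := Cmod_triangle (RtoC 1 - g p)%C (g p).
  have -> : (RtoC 1 - g p + g p = RtoC 1)%C by ring.
  by rewrite Cmod_1; lra.
have q0 : 0 <= \big[Rmult/1]_(p0 <- s) (1 - / INR p0).
  exact: prod_one_minus_inv_ge0.
by split; apply: Rmult_le_compat => //; lra.
Qed.

Lemma dirichlet_real_mod q chi sg : (0 < q)%N -> rchar q chi -> nonprincipal q chi -> 1 < sg < 2 ->
  Rabs (Cmod (DSL chi sg 0 0) - L1 chi) <= 100 * INR q * (sg - 1).
Proof.
move=> q0 hr hn s12; have [hc hi] := hr.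
have I0 := DSL_real chi sg 0 hi; have := L1_lim q chi sg q0 hc hn s12; have := L1_pos q chi q0 hr hn.
move: I0; rewrite /Re /Im; case: (DSL chi sg 0 0) => x y /= ->.
by rewrite -[(x, 0)]/(RtoC x) Cmod_R; split_Rabs; lra.
Qed.

Lemma le_of_approx a b K : (forall eta, 0 < eta < 1 -> a <= b + K * eta) -> a <= b.
Proof.
move=> h; apply: le_epsilon => eps e0.
have K1 : 0 < Rabs K + 1 by have := Rabs_pos K; lra.
pose eta := Rmin (1 / 2) (eps / (Rabs K + 1)).
have q : 0 < eps / (Rabs K + 1) by apply: Rdiv_lt_0_compat.
have e1 : 0 < eta < 1.
  split; first by apply: Rmin_glb_lt; lra.
  by apply: (Rle_lt_trans _ (1 / 2)); [apply: Rmin_l | lra].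
have := h eta e1; have : K * eta <= eps; last lra.
have e2 : eta <= eps / (Rabs K + 1) by apply: Rmin_r.
have -> : eps = (Rabs K + 1) * (eps / (Rabs K + 1)) by field; lra.
have := Rle_abs K; have := Rabs_pos K; nra.
Qed.

Lemma L1_upper B : exists Cst, 0 < Cst /\ forall q chi z, (0 < q)%N -> dchar q chi -> nonprincipal q chi ->
  1 <= z -> INR q <= z ^ B -> L1 chi <= Cst * z.
Proof.
have [C1 [C10 hC1]] := L_bound 0 B.
exists C1; split=> // q chi z q0 hc hn z1 qz.
apply: (le_of_approx _ _ (100 * INR q)) => eta e01.
have := L1_lim q chi (1 + eta) q0 hc hn ltac:(lra).
have := hC1 z chi (INR q) (1 + eta) 0 z1 (nonprincipal_bounded_sums _ _ q0 hc hn) (dchar_le1 _ _ hc) qz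
   ltac:(rewrite Rabs_R0; apply: pow_le; lra) ltac:(lra).
have := Re_Cmod (DSL chi (1 + eta) 0 0); split_Rabs; lra.
Qed.

(** With the primes of both moduli sieved out, the two series coincide. The sieving costs the Euler
    factors at these primes, bounded on both sides by [cmod_prod_bounds]; then sg tends to 1. *)
Lemma L1_same_character q1 q2 c1 c2 : (0 < q1)%N -> (0 < q2)%N -> rchar q1 c1 -> rchar q2 c2 ->
  nonprincipal q1 c1 -> nonprincipal q2 c2 ->
  (forall n, coprime n (q1 * q2) -> c1 n = c2 n) ->
  L1 c1 * / (1 + INR (size (primes q2))) <= 2 ^ size (primes q1) * L1 c2.
Proof.
move=> q10 q20 r1 r2 n1 n2 h12; have [hc1 _] := r1; have [hc2 _] := r2.
set a := / _; set b := 2 ^ _.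
have b0 : 0 < b by apply: pow_lt; lra.
have a0 : 0 < a by apply: Rinv_0_lt_compat; have := pos_INR (size (primes q2)); lra.
apply: (le_of_approx _ _ (100 * INR q1 * a + b * (100 * INR q2))) => eta e01.
pose sg := 1 + eta; have s12 : 1 < sg < 2 by rewrite /sg; lra.
have A1 := dirichlet_real_mod q1 c1 sg q10 r1 n1 s12.
have A2 := dirichlet_real_mod q2 c2 sg q20 r2 n2 s12.
pose g1 n := (c1 n * npow sg 0 n)%C; pose g2 n := (c2 n * npow sg 0 n)%C.
have ab1 := absum_DSL0 c1 sg 0 (proj1 s12) (dchar_le1 _ _ hc1).
have ab2 := absum_DSL0 c2 sg 0 (proj1 s12) (dchar_le1 _ _ hc2).
have [_ T1] := tsum_sieve (primes q2) g1 _ (all_prime_primes q2) (primes_uniq q2) (cmult_chi_npow _ _ _ _ hc1) ab1.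
have [_ T2] := tsum_sieve (primes q1) g2 _ (all_prime_primes q1) (primes_uniq q1) (cmult_chi_npow _ _ _ _ hc2) ab2.
have E : tsum (sieve (primes q2) g1) = tsum (sieve (primes q1) g2).
  apply: tsum_ext => n n0; rewrite /sieve !has_primes_coprime // /g1 /g2.
  case: (boolP (coprime n q1)) => k1; case: (boolP (coprime n q2)) => k2 //=.
  - by rewrite h12 // coprimeMr k1.
  - by rewrite (dchar0 _ _ hc2) // Cmult_0_l.
  - by rewrite (dchar0 _ _ hc1) // Cmult_0_l.
have small c q (hc : dchar q c) p : prime p -> Cmod (c p * npow sg 0 p)%C <= / INR p.
  move=> pp; rewrite Cmod_mult Cmod_npow; have p0 := prime_gt0 pp.
  have := exp_neg_sg sg p ltac:(lra) p0; have := dchar_le1 _ _ hc p; have := Cmod_ge_0 (c p).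
  have := exp_pos (- sg * ln (INR p)); nra.
have [B1 _] := cmod_prod_bounds (primes q2) g1 (all_prime_primes q2) (small _ _ hc1).
have [_ B2] := cmod_prod_bounds (primes q1) g2 (all_prime_primes q1) (small _ _ hc2).
have B3 := prod_primes_lower q2 q20; rewrite -/a in B3.
have M : Cmod (tsum g1) * a <= b * Cmod (tsum g2).
  apply: (Rle_trans _ (Cmod (tsum (sieve (primes q2) g1)))).
    rewrite T1 Cmod_mult Rmult_comm; apply: Rmult_le_compat_r; [exact: Cmod_ge_0 | lra].
  by rewrite E T2 Cmod_mult; apply: Rmult_le_compat_r; [exact: Cmod_ge_0 | exact: B2].
rewrite !DSL0 -/g1 -/g2 in A1 A2.
have eq1 : sg - 1 = eta by rewrite /sg; ring.
rewrite eq1 in A1 A2.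
have h1 : L1 c1 * a <= (Cmod (tsum g1) + 100 * INR q1 * eta) * a.
  by apply: Rmult_le_compat_r; [lra | move: A1; split_Rabs; lra].
have h2 : b * Cmod (tsum g2) <= b * (L1 c2 + 100 * INR q2 * eta).
  by apply: Rmult_le_compat_l; [lra | move: A2; split_Rabs; lra].
lra.
Qed.

Lemma rchar_eq_of_prod q1 q2 c1 c2 n : rchar q1 c1 -> rchar q2 c2 -> (c1 n * c2 n)%C = RtoC 1 -> c1 n = c2 n.
Proof.
move=> r1 r2; have := rchar_val _ _ n r1; have := rchar_val _ _ n r2; have [_ h1] := r1; have [_ h2] := r2.
have E c : Im (c n) = 0 -> c n = RtoC (Re (c n)) by rewrite /RtoC /Re /Im; case: (c n) => x y /= ->.
rewrite (E c1) // (E c2) // /= -RtoC_mult => v2 v1 /RtoC_inj h.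
by congr RtoC; case: v1 h => [->|[->|->]]; case: v2 => [->|[->|->]]; lra.
Qed.

(** Either no real L is negative at 1 - dl, and [siegel_one] applies to every character, or a
    character with negative value is fixed, and the zero that it forces near 1 serves the others
    through [siegel_pair]. The constant depends on this unknown character and so is not
    effective. *)
Theorem siegel B : (0 < B)%N -> exists Cst, 0 < Cst /\ forall q chi z, (0 < q)%N -> rchar q chi ->
  nonprincipal q chi -> 1 <= z -> INR q <= z ^ B -> Cst / z <= L1 chi.
Proof.
move=> B0; have Bp := INR_ge1 B B0.
(* Estermann's loss is q^(5 dl) for one character and q^(10 dl) for a pair; with this dl the latter
   is at most z^(1/2). The remaining z^(1/2) is spent on the upper bound for L(1, c1 c2). *)
pose dl := / (20 * INR B).
have d0 : 0 < dl by apply: Rinv_0_lt_compat; lra.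
have Bd : INR B * dl = / 20 by rewrite /dl; field; lra.
have d1 : dl <= 1 / 20 by nra.
have zl z : 1 <= z -> 0 <= ln z by move=> z1; rewrite -ln_1; apply: ln_le; lra.
have lnq q z : (0 < q)%N -> 1 <= z -> INR q <= z ^ B -> 0 <= ln (INR q) <= INR B * ln z.
  move=> q0 z1 qz; split; first exact: ln_INR_ge0.
  by rewrite -ln_pow; [apply: ln_le; [exact: INR_gt0 | exact: qz] | lra].
have l5 : 0 <= ln 5 by apply: zl; lra.
case: (Classical_Prop.classic (forall q chi, (0 < q)%N -> rchar q chi -> nonprincipal q chi ->
   0 <= Series (fun m => lR chi m * (1 + dl) ^ m))) => [hA|hA].
  exists (dl / 2 * exp (- (dl * (31 + 5 * ln 5)))); split.
    by apply: Rmult_lt_0_compat; [lra | apply: exp_pos].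
  move=> q chi z q0 hr hn z1 qz.
  apply: Rle_trans (siegel_one q chi dl q0 hr hn ltac:(lra) (hA q chi q0 hr hn)).
  have [lq0 lq1] := lnq q z q0 z1 qz; have lz := zl z z1.
  rewrite /Rdiv Rmult_assoc; apply: Rmult_le_compat_l; first lra.
  rewrite -(exp_ln (/ z)); last by apply: Rinv_0_lt_compat; lra.
  rewrite -exp_plus; apply: exp_le; rewrite ln_Rinv; last lra.
  rewrite ln_mult; [|lra|exact: INR_gt0].
  have : dl * ln (INR q) <= dl * (INR B * ln z) by apply: Rmult_le_compat_l; lra.
  have -> : dl * (INR B * ln z) = / 20 * ln z by rewrite -Bd; ring.
  lra.
have [q1 [c1 [q10 [r1 [n1 neg]]]]] : exists q chi, (0 < q)%N /\ rchar q chi /\ nonprincipal q chi /\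
    Series (fun m => lR chi m * (1 + dl) ^ m) < 0.
  apply: Classical_Prop.NNPP => h; apply: hA => q chi q0 hr hn; apply: Rnot_lt_le => lt.
  by apply: h; exists q, chi.
have [hc1 hi1] := r1; have Lp1 := L1_pos q1 c1 q10 r1 n1; have Q1 := INR_ge1 q1 q10.
have lb1 m := lR_bound q1 c1 m q10 hc1 n1.
pose G x := - Series (fun m => lR c1 m * x ^ m).
(* G x is -L(2 - x, c1): negative at x = 1 by [L1_pos], positive at 1 + dl by the choice of c1. The
   zero in between gives the vanishing hypothesis of [siegel_pair]. *)
have [x0 [[x1 x2] Gx]] : { x | 1 <= x <= 1 + dl /\ G x = 0 }.
  apply: IVT_interv; rewrite /G.
  - move=> a a12; apply: continuity_pt_opp.
    move=> eps e0; exists (Rmin (1 / 20) (eps / (100 * INR q1 + 1))).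
    have p1 : 0 < eps / (100 * INR q1 + 1) by apply: Rdiv_lt_0_compat; lra.
    split; first by apply: Rmin_glb_lt; lra.
    move=> y [_]; rewrite /= /R_dist => hy.
    have hy1 := Rlt_le_trans _ _ _ hy (Rmin_l _ _); have hy2 := Rlt_le_trans _ _ _ hy (Rmin_r _ _).
    have := lR_lipschitz (lR c1) (5 * INR q1) y a ltac:(lra) lb1 ltac:(move: hy1; split_Rabs; lra) ltac:(lra).
    have := Rabs_pos (y - a) => ya h; apply: (Rle_lt_trans _ _ _ h).
    have -> : eps = (100 * INR q1 + 1) * (eps / (100 * INR q1 + 1)) by field; lra.
    nra.
  - lra.
  - by rewrite -L1_series; lra.
  - lra.
have xn1 : x0 <> 1 by move=> E; move: Gx; rewrite /G E -L1_series; lra.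
pose d := x0 - 1; have dd : 0 < d <= dl by rewrite /d; lra.
have hP : Series (fun m => lR c1 m * (1 + d) ^ m) = 0.
  by have -> : 1 + d = x0 by [rewrite /d; ring]; rewrite /G in Gx; lra.
have [C2 [C20 hC2]] := L1_upper (2 * B).
pose cA := d / 2 * exp (- (d * (31 + 5 * ln (2625 * INR q1 ^ 2)))) / (L1 c1 * (C2 * INR q1)).
pose cB := L1 c1 / (2 ^ size (primes q1) * (1 + 2 * INR B)).
have cA0 : 0 < cA.
  apply: Rdiv_lt_0_compat; first by apply: Rmult_lt_0_compat; [lra | apply: exp_pos].
  by apply: Rmult_lt_0_compat => //; apply: Rmult_lt_0_compat; lra.
have p2 : 0 < 2 ^ size (primes q1) by apply: pow_lt; lra.
have cB0 : 0 < cB by apply: Rdiv_lt_0_compat => //; apply: Rmult_lt_0_compat; lra.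
exists (Rmin cA cB); split; first exact: Rmin_glb_lt.
move=> q2 c2 z q20 r2 n2 z1 qz; have [hc2 _] := r2.
have iz : 0 < / z by apply: Rinv_0_lt_compat; lra.
have lz := zl z z1; have [lq0 lq1] := lnq q2 z q20 z1 qz.
have Lp2 := L1_pos q2 c2 q20 r2 n2.
case: (Classical_Prop.classic (nonprincipal (q1 * q2) (fun n => c1 n * c2 n)%C)) => n12.
  apply: (Rle_trans _ (cA / z)).
    by apply: Rmult_le_compat_r; [lra | apply: Rmin_l].
  have key := siegel_pair q1 q2 c1 c2 d q10 q20 r1 r2 n1 n2 n12 ltac:(lra) hP.
  pose rz := exp (ln z / 2).
  have rz1 : 1 <= rz by rewrite -exp_0; apply: exp_le; lra.
  have rzz : rz * rz = z by rewrite -exp_plus; have -> : ln z / 2 + ln z / 2 = ln z by [field]; rewrite exp_ln; lra.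
  have up : L1 (fun n => c1 n * c2 n)%C <= C2 * (INR q1 * rz).
    apply: (hC2 (q1 * q2)%N) => //; first by rewrite muln_gt0 q10.
    - exact: dchar_prod.
    - nra.
    rewrite mult_INR Rpow_mult_distr; apply: Rmult_le_compat; [lra | exact: pos_INR | |].
      rewrite -[X in X <= _]pow_1; apply: Rle_pow => //; lia.
    rewrite (pow_mult rz 2 B); have -> : rz ^ 2 = z by rewrite /= Rmult_1_r.
    exact: qz.
  have low : d / 2 * exp (- (d * (31 + 5 * ln (2625 * INR q1 ^ 2)))) / rz <=
     d / 2 * exp (- (d * (31 + 5 * ln (2625 * INR q1 ^ 2 * INR q2 ^ 2)))).
    rewrite /Rdiv Rmult_assoc; apply: Rmult_le_compat_l; first lra.
    rewrite /rz -exp_Ropp -exp_plus; apply: exp_le.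
    have q1p : 0 < INR q1 ^ 2 by apply: pow_lt; lra.
    have Q2 := INR_gt0 q2 q20.
    rewrite (ln_mult (2625 * INR q1 ^ 2)); [|lra|exact: pow_lt].
    rewrite (ln_pow (INR q2)) //.
    have : d * ln (INR q2) <= dl * (INR B * ln z) by apply: Rmult_le_compat; lra.
    have -> : dl * (INR B * ln z) = / 20 * ln z by rewrite -Bd; ring.
    rewrite /=; lra.
  have : d / 2 * exp (- (d * (31 + 5 * ln (2625 * INR q1 ^ 2)))) / rz <= L1 c1 * (L1 c2 * (C2 * (INR q1 * rz))).
    apply: Rle_trans low _; apply: Rle_trans key _; apply: Rmult_le_compat_l; first lra.
    by apply: Rmult_le_compat_l; lra.
  move=> fin; rewrite /cA.
  have den : 0 < L1 c1 * (C2 * INR q1) * rz.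
    by apply: Rmult_lt_0_compat; [apply: Rmult_lt_0_compat => //; apply: Rmult_lt_0_compat |]; lra.
  apply: (Rmult_le_reg_l _ _ _ den).
  rewrite -rzz; move: fin; set N := d / 2 * _; move=> fin.
  have -> : L1 c1 * (C2 * INR q1) * rz * (N / (L1 c1 * (C2 * INR q1)) / (rz * rz)) = N / rz by field; lra.
  by apply: Rle_trans fin _; apply: Req_le; ring.
(* When c1 c2 is principal, c1 and c2 agree away from q1 q2, and L(1, c2) is compared with the fixed
   L(1, c1). The loss 1 + omega(q2) is O(z), because 2^omega(q2) <= q2 <= z^B. *)
apply: (Rle_trans _ (cB / z)).
  by apply: Rmult_le_compat_r; [lra | apply: Rmin_r].
have same n : coprime n (q1 * q2) -> c1 n = c2 n.
  move=> cn; apply: (rchar_eq_of_prod q1 q2) => //.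
  by apply: Classical_Prop.NNPP => h; apply: n12; exists n.
have key := L1_same_character q1 q2 c1 c2 q10 q20 r1 r2 n1 n2 same.
have sz : 1 + INR (size (primes q2)) <= (1 + 2 * INR B) * z.
  have h2 : INR (2 ^ size (primes q2)) <= INR q2 by apply: le_INR; have := exp2_size_primes_le q2 q20; lia.
  have h3 : INR (size (primes q2)) * ln 2 <= INR B * ln z.
    have <- : ln (INR (2 ^ size (primes q2))) = INR (size (primes q2)) * ln 2 by rewrite ln_INR_exp.
    apply: Rle_trans lq1; apply: ln_le => //; apply: INR_gt0; by rewrite expn_gt0.
  have h4 : ln z <= z.
    by have := exp_ineq1_le (ln z); rewrite exp_ln; lra.
  have := ln_lt_2; have := pos_INR (size (primes q2)) => s0 l2.
  have : INR (size (primes q2)) * / 2 <= INR B * z.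
    apply: (Rle_trans _ (INR (size (primes q2)) * ln 2)); first by apply: Rmult_le_compat_l; lra.
    by apply: Rle_trans h3 _; apply: Rmult_le_compat_l; lra.
  nra.
have s1 : 0 < 1 + INR (size (primes q2)) by have := pos_INR (size (primes q2)); lra.
have k2 : L1 c1 * / ((1 + 2 * INR B) * z) <= 2 ^ size (primes q1) * L1 c2.
  apply: Rle_trans key; apply: Rmult_le_compat_l; first lra.
  by apply: Rinv_le_contravar.
rewrite /cB; apply: (Rmult_le_reg_l (2 ^ size (primes q1))) => //.
by apply: Rle_trans k2; apply: Req_le; field; lra.
Qed.

(** * Derivatives of the logarithmic derivative of L *)

(** The indicator of the integers coprime to q is its mean plus a periodic function of mean zero.
    The mean contributes a multiple of zeta, and the rest obeys [L_bound]. *)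
Lemma sq_principal_bound B : exists Cst, 0 < Cst /\ forall q chi z sg t, (0 < q)%N -> dchar q chi ->
  ~ nonprincipal q chi -> 1 <= z -> INR q <= z ^ B -> Rabs t <= z ^ B -> / z ^ 3 <= Rabs t ->
  1 < sg <= 2 -> Cmod (DSL chi sg t 0) <= Cst * z ^ 4.
Proof.
have [C1 [C10 hC1]] := L_bound 0 B; have [C2 [C20 hC2]] := zeta_bound B.
exists (C1 + C2); split; first lra.
move=> q chi z sg t q0 hc hn z1 qz tz zt s12.
have Q1 := INR_ge1 q q0.
have pr n : coprime n q -> chi n = RtoC 1 by move=> cn; apply: NNPP => h; apply: hn; exists n.
pose u n := if coprime n q then 1 else 0.
have hu n : chi n = RtoC (u n).
  by rewrite /u; case: (boolP (coprime n q)) => c; [apply: pr | rewrite (dchar0 _ _ hc)].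
pose S := \rsum_(0 <= n < q) u n.
have S01 : 0 <= S <= INR q.
  split; first by apply: rsum_nat_ge0 => n _; rewrite /u; case: ifP => _; lra.
  apply: (Rle_trans _ (\rsum_(0 <= n < q) 1)).
    by apply: rsum_nat_le => n _; rewrite /u; case: ifP => _; lra.
  by rewrite rsum_const subn0; lra.
pose kap := S / INR q.
have k01 : 0 <= kap <= 1.
  split; first by apply: Rdiv_le_0_compat; lra.
  apply: (Rmult_le_reg_r (INR q)); first lra.
  by rewrite /kap; have -> : S / INR q * INR q = S by [field; lra]; lra.
pose a n := RtoC (u n - kap).
have a1 n : Cmod (a n) <= 1.
  by rewrite /a Cmod_R /u; case: ifP => _; split_Rabs; lra.
have ap n : a (n + q)%N = a n.
  rewrite /a /u; congr RtoC; congr (_ - _).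
  by rewrite -(coprime_modl (n + q)) modnDr coprime_modl.
have a0 : (\csum_(0 <= n < q) a n)%C = RtoC 0.
  rewrite /a csum_RtoC rsum_sub rsum_const subn0; congr RtoC.
  by rewrite -/S /kap; field; lra.
have aQ := periodic_bounded_sums a q q0 ap a1 a0.
have A1 := absum_DSL a sg t 0 (proj1 s12) a1.
have one1 : nat -> Cmod (RtoC 1) <= 1 by move=> _; rewrite Cmod_1; lra.
have A2 := absum_DSL (fun=> RtoC 1) sg t 0 (proj1 s12) one1.
have E : (DSL chi sg t 0 = DSL a sg t 0 + RtoC kap * DSL (fun=> RtoC 1) sg t 0)%C.
  rewrite /DSL -(tsum_scal _ _ _ A2) -(tsum_add _ _ _ _ A1 (absum_scal _ (RtoC kap) _ A2)).
  by apply: tsum_ext => n _; rewrite hu /a RtoC_minus; ring.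
rewrite E; apply: Rle_trans (Cmod_triangle _ _) _; rewrite Cmod_mult Cmod_R (Rabs_pos_eq kap); last lra.
have h1 := hC1 z a (INR q) sg t z1 aQ a1 qz tz s12.
have h2 := hC2 z sg t z1 s12 tz zt.
have c0 := Cmod_ge_0 (DSL (fun=> RtoC 1) sg t 0).
have z3 : 1 <= z ^ 3 by apply: pow_R1_Rle.
rewrite (_ : z ^ 4 = z * z ^ 3); last by rewrite /=; ring.
have : z <= z * z ^ 3 by nra.
have : z ^ 3 <= z * z ^ 3 by nra.
nra.
Qed.

Lemma zeta_sigma_le sg : 1 < sg -> Cmod (DSL (fun=> RtoC 1) sg 0 0) <= 1 + / (sg - 1).
Proof.
move=> s1; have one1 : nat -> Cmod (RtoC 1) <= 1 by move=> _; rewrite Cmod_1; lra.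
rewrite DSL0; apply: tsum_abs_le => N; have := zeta_partial_le (sg - 1) N ltac:(lra).
apply: Rle_trans; apply: rsum_nat_le => n _; rewrite Cmod_mult Cmod_1 Cmod_npow Rmult_1_l.
by have -> : 1 + (sg - 1) = sg by [ring]; lra.
Qed.

(** The inequality c^8 <= c for c <= 1 stands for an eighth root. The factor 64 is the 2^6 of
    zeta(sg)^6 <= (2 z^16)^6. *)
Lemma root8 c X e Cst : 0 <= X -> 1 <= Cst -> 0 < e <= 1 -> e <= 64 * X ^ 8 * Cst ^ 2 -> c = e / (128 * Cst ^ 2) -> c <= X.
Proof.
move=> X0 C1 e01 h cE; have C2 : 1 <= Cst ^ 2 by apply: pow_R1_Rle.
have c01 : 0 < c <= 1.
  split; first by rewrite cE; apply: Rdiv_lt_0_compat; lra.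
  apply: (Rmult_le_reg_r (128 * Cst ^ 2)); first lra.
  by rewrite cE; have -> : e / (128 * Cst ^ 2) * (128 * Cst ^ 2) = e by [field; lra]; lra.
apply: Rnot_lt_le => lt.
have : X ^ 8 <= c ^ 8 by apply: pow_incr; lra.
have : c ^ 8 <= c.
  have : c ^ 7 <= 1 by rewrite -(pow1 7); apply: pow_incr; lra.
  by rewrite -(tech_pow_Rmult c 7); nra.
move=> h1 h2; have : 64 * X ^ 8 * Cst ^ 2 <= 64 * c * Cst ^ 2 by apply: Rmult_le_compat_r; lra.
have -> : 64 * c * Cst ^ 2 = e / 2 by rewrite cE; field; lra.
lra.
Qed.

(* For complex [chi], or [t] away from 0, this is [three_four_one]; the remaining case is Siegel's theorem. *)
Lemma L_lower B : exists c z0, 0 < c /\ 2 <= z0 /\ forall z q chi t, z0 <= z -> (0 < q)%N -> dchar q chi ->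
  nonprincipal q chi -> INR q <= z ^ B -> Rabs t <= z ^ B ->
  c / z ^ 13 <= Cmod (DSL chi (1 + / z ^ 16) t 0).
Proof.
have [C1 [C10 hC1]] := L_bound 0 B.+1; have [C2 [C20 hC2]] := sq_principal_bound B.+1.
have [C3 [C30 hC3]] := L_diff B; have [c4 [c40 hc4]] := siegel B.+1 isT.
pose Cst := 1 + C1 + C2; have Cst1 : 1 <= Cst by rewrite /Cst; lra.
pose e := exp (- 10); have e01 : 0 < e <= 1.
  by split; [apply: exp_pos | rewrite /e -exp_0; apply: exp_le; lra].
pose c := e / (128 * Cst ^ 2).
have c0 : 0 < c by apply: Rdiv_lt_0_compat; [lra | have : 1 <= Cst ^ 2 by [apply: pow_R1_Rle]; lra].
(* From this z0 on, the error 3 C3 z^(-2) of the transfer from s = 1 is at most half of Siegel's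
   bound c4 / z. *)
exists (Rmin c (c4 / 2)), (2 + 6 * C3 / c4); split; first by apply: Rmin_glb_lt; lra.
have q6 : 0 < 6 * C3 / c4 by apply: Rdiv_lt_0_compat; lra.
split; first lra.
move=> z q chi t zz0 q0 hc hn qz tz.
have z2 : 2 <= z by lra.
have z1 : 1 <= z by lra.
have zB : 1 <= z ^ B by apply: pow_R1_Rle.
have z13 : 1 <= z ^ 13 by apply: pow_R1_Rle.
have z16 : 1 <= z ^ 16 by apply: pow_R1_Rle.
have zn n : 0 < z ^ n by apply: pow_lt; lra.
have i13 : 0 < / z ^ 13 by apply: Rinv_0_lt_compat.
set sg := 1 + / z ^ 16.
have isg : 0 < / z ^ 16 <= 1.
  by split; [apply: Rinv_0_lt_compat | rewrite -Rinv_1; apply: Rinv_le_contravar; lra].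
have s12 : 1 < sg <= 2 by rewrite /sg; lra.
set X := Cmod (DSL chi sg t 0); have X0 : 0 <= X := Cmod_ge_0 _.
have qzS : INR q <= z ^ B.+1 by rewrite -tech_pow_Rmult; nra.
have t2z : Rabs (2 * t) <= z ^ B.+1.
  by rewrite Rabs_mult (Rabs_pos_eq 2) -?tech_pow_Rmult; [have := Rabs_pos t; nra | lra].
have main : Cmod (DSL (fun n => chi n * chi n)%C sg (2 * t) 0) <= Cst * z ^ 4 -> Rmin c (c4 / 2) / z ^ 13 <= X.
  move=> h2; apply: (Rle_trans _ (c / z ^ 13)).
    by apply: Rmult_le_compat_r; [lra | apply: Rmin_l].
  have h341 := three_four_one q chi sg t hc (proj1 s12).
  have hz : Cmod (DSL (fun=> RtoC 1) sg 0 0) <= 2 * z ^ 16.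
    apply: Rle_trans (zeta_sigma_le sg (proj1 s12)) _.
    by have -> : sg - 1 = / z ^ 16 by [rewrite /sg; ring]; rewrite Rinv_inv; lra.
  have : c <= X * z ^ 13.
    apply: (root8 c _ e Cst) => //; first by apply: Rmult_le_pos; lra.
    apply: Rle_trans h341 _.
    (* The powers of z balance, as 8 * 13 = 6 * 16 + 2 * 4; this is the origin of the exponent
       13. *)
    have -> : 64 * (X * z ^ 13) ^ 8 * Cst ^ 2 = (2 * z ^ 16) ^ 6 * X ^ 8 * (Cst * z ^ 4) ^ 2 by ring.
    rewrite -/X; apply: Rmult_le_compat; [| by apply: pow_le; apply: Cmod_ge_0 | |].
    - by apply: Rmult_le_pos; apply: pow_le => //; apply: Cmod_ge_0.
    - apply: Rmult_le_compat_r; first exact: pow_le.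
      by apply: pow_incr; split; [apply: Cmod_ge_0 | exact: hz].
    - by apply: pow_incr; split; [apply: Cmod_ge_0 | exact: h2].
  move=> h; apply: (Rmult_le_reg_r (z ^ 13)); first lra.
  by have -> : c / z ^ 13 * z ^ 13 = c by [field; lra].
have hc2 := dchar_sq _ _ hc.
have z14 : 1 <= z ^ 3 by apply: pow_R1_Rle.
case: (classic (nonprincipal q (fun n => chi n * chi n)%C)) => n2.
  apply: main.
  have := hC1 z _ (INR q) sg (2 * t) z1 (nonprincipal_bounded_sums _ _ q0 hc2 n2) (dchar_le1 _ _ hc2) qzS t2z s12.
  have : C1 * z <= Cst * z ^ 4.
    apply: Rmult_le_compat; [lra | lra | by rewrite /Cst; lra |].
    by rewrite (_ : z ^ 4 = z * z ^ 3); [nra | rewrite /=; ring].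
  lra.
case: (Rle_lt_dec (/ z ^ 3) (Rabs (2 * t))) => ht.
  apply: main.
  have := hC2 q _ z sg (2 * t) q0 hc2 n2 z1 qzS t2z ht s12.
  have : C2 * z ^ 4 <= Cst * z ^ 4 by apply: Rmult_le_compat_r; [apply: Rlt_le | rewrite /Cst; lra].
  lra.
(* As the square of chi is principal, its values on units are square roots of 1. *)
have hr : rchar q chi.
  split=> // n; case: (boolP (coprime n q)) => cn; last by rewrite (dchar0 _ _ hc).
  have sq : (chi n * chi n)%C = RtoC 1 by apply: NNPP => h; apply: n2; exists n.
  have := f_equal Im sq; have := f_equal Re sq; rewrite /Re /Im /Cmult /RtoC /=.
  by case: (chi n) => x y /=; nra.
have Ls := hc4 q chi z q0 hr hn z1 qzS.
apply: (Rle_trans _ (c4 / 2 / z)).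
  apply: Rmult_le_compat; [by apply: Rmin_glb; lra | by lra | exact: Rmin_r |].
  by apply: Rinv_le_contravar; [lra | rewrite -(tech_pow_Rmult z 12); have : 1 <= z ^ 12 by [apply: pow_R1_Rle]; nra].
have t1 : Rabs t <= / z ^ 3 / 2.
  by move: ht; rewrite Rabs_mult (Rabs_pos_eq 2); lra.
have i3 : / z ^ 3 <= 1 by rewrite -Rinv_1; apply: Rinv_le_contravar; lra.
have iz2 : 0 < / z ^ 2 by apply: Rinv_0_lt_compat.
have zi3 : z * / z ^ 3 = / z ^ 2 by rewrite -(tech_pow_Rmult z 2); field; lra.
have i163 : / z ^ 16 <= / z ^ 3.
  apply: Rinv_le_contravar => //; rewrite (_ : 16%N = (3 + 13)%N) // pow_add; nra.
(* Both sg - 1 and |t| are at most z^(-3), so passing from 1 + eta to sg + i t by [L_diff], with eta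
   tending to 0, costs O(z^(-2)). *)
have key : L1 chi <= X + 3 * C3 * / z ^ 2.
  apply: (le_of_approx _ _ (100 * INR q + C3 * z)) => eta e1.
  have s12' : 1 < 1 + eta < 2 by lra.
  have a1 := dirichlet_real_mod q chi (1 + eta) q0 hr hn s12'.
  have a2 := hC3 z chi (INR q) sg (1 + eta) t z1 (nonprincipal_bounded_sums _ _ q0 hc hn) (dchar_le1 _ _ hc) qz
     ltac:(lra) s12 ltac:(lra).
  have a3 : Cmod (DSL chi (1 + eta) 0 0) <= X + Cmod (DSL chi sg t 0 - DSL chi (1 + eta) 0 0)%C.
    have -> : (DSL chi (1 + eta) 0 0 = DSL chi sg t 0 + - (DSL chi sg t 0 - DSL chi (1 + eta) 0 0))%C by ring.
    by apply: Rle_trans (Cmod_triangle _ _) _; rewrite Cmod_opp -/X; apply: Req_le; congr (_ + Cmod _); ring.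
  have a4 : Rabs (sg - (1 + eta)) + Rabs t <= 2 * / z ^ 3 + eta.
    by rewrite /sg; move: t1; split_Rabs; lra.
  have a5 : z * (Rabs (sg - (1 + eta)) + Rabs t) <= 2 * / z ^ 2 + z * eta.
    apply: (Rle_trans _ (z * (2 * / z ^ 3 + eta))); first by apply: Rmult_le_compat_l; lra.
    by rewrite -zi3; lra.
  have a6 : C3 * (z * (Rabs (sg - (1 + eta)) + Rabs t) + / z ^ 2) <= C3 * (3 * / z ^ 2 + z * eta).
    by apply: Rmult_le_compat_l; lra.
  by move: a1; rewrite (_ : 1 + eta - 1 = eta); [split_Rabs; lra | ring].
have fin : 3 * C3 * / z ^ 2 <= c4 / 2 / z.
  have h6 : 6 * C3 <= c4 * z.
    have : c4 * (6 * C3 / c4) <= c4 * z by apply: Rmult_le_compat_l; lra.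
    by have -> : c4 * (6 * C3 / c4) = 6 * C3 by [field; lra].
  apply: (Rmult_le_reg_r (z ^ 2)) => //.
  have -> : 3 * C3 * / z ^ 2 * z ^ 2 = 3 * C3 by field; lra.
  have -> : c4 / 2 / z * z ^ 2 = c4 * z / 2 by field; lra.
  lra.
by rewrite /Rdiv in fin Ls *; lra.
Qed.

Lemma L_bound_upto J B : exists Cst, 0 < Cst /\
  forall j z a Q sg t, (j <= J)%N -> 1 <= z -> bounded_sums a Q -> (forall n, Cmod (a n) <= 1) ->
    Q <= z ^ B -> Rabs t <= z ^ B -> 1 < sg <= 2 -> Cmod (DSL a sg t j) <= Cst * z.
Proof.
elim: J => [|J [C1 [C10 h1]]].
  have [C1 [C10 h1]] := L_bound 0 B; exists C1; split=> // j z a Q sg t.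
  by rewrite leqn0 => /eqP ->; apply: h1.
have [C2 [C20 h2]] := L_bound J.+1 B.
exists (C1 + C2); split; first lra.
move=> j z a Q sg t jJ z1 aQ a1 Qz tz s12.
have : C1 * z <= (C1 + C2) * z by nra.
have : C2 * z <= (C1 + C2) * z by nra.
case: (ltngtP j J.+1) jJ => // hj _.
  by have := h1 j z a Q sg t ltac:(lia) z1 aQ a1 Qz tz s12; lra.
by rewrite hj; have := h2 z a Q sg t z1 aQ a1 Qz tz s12; lra.
Qed.

Definition VL (chi : nat -> C) (sg t : R) (k : nat) : C :=
  tsum (fun n => chi n * npow sg t n * RtoC (vonM n * lnf k n))%C.

(* Solving [log_derivative_identity] recursively for the highest term, divided by L. *)
Lemma VL_bound B K : exists Cst z0, 0 < Cst /\ 2 <= z0 /\ forall k z q chi t, (k <= K)%N -> z0 <= z ->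
  (0 < q)%N -> dchar q chi -> nonprincipal q chi -> INR q <= z ^ B -> Rabs t <= z ^ B ->
  Cmod (VL chi (1 + / z ^ 16) t k) <= Cst * z ^ (14 * k.+1).
Proof.
have [c [z0 [c0 [z02 hL]]]] := L_lower B.
have [C1 [C10 hM]] := L_bound_upto K.+1 B.
suff step k0 : (k0 <= K.+1)%N -> exists Cst, 0 < Cst /\ forall k z q chi t, (k < k0)%N -> z0 <= z ->
    (0 < q)%N -> dchar q chi -> nonprincipal q chi -> INR q <= z ^ B -> Rabs t <= z ^ B ->
    Cmod (VL chi (1 + / z ^ 16) t k) <= Cst * z ^ (14 * k.+1).
  by have [Cst [C0 h]] := step K.+1 (leqnn _); exists Cst, z0; split=> //; split=> // k z q chi t kK; apply: h.
elim: k0 => [|k IH] kK; first by exists 1; split; [lra|].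
have [C2 [C20 h2]] := IH ltac:(lia).
pose Cst := C2 + (INR k.+1 * C1 + INR k * (C2 * C1)) / c.
have k0 := pos_INR k; have k1 := INR_gt0 k.+1 isT.
have p1 : 0 < INR k.+1 * C1 by apply: Rmult_lt_0_compat.
have p2 : 0 <= INR k * (C2 * C1) by apply: Rmult_le_pos => //; apply: Rmult_le_pos; lra.
have p3 : 0 < (INR k.+1 * C1 + INR k * (C2 * C1)) / c by apply: Rdiv_lt_0_compat; lra.
exists Cst; split; first by rewrite /Cst; lra.
move=> j z q chi t jk zz0 q0 hc hn qz tz.
have z1 : 1 <= z by lra.
have zn n : 1 <= z ^ n by apply: pow_R1_Rle.
have {jk} [jk|->] : (j < k)%N \/ j = k by lia.
  apply: Rle_trans (h2 j z q chi t jk zz0 q0 hc hn qz tz) _.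
  by apply: Rmult_le_compat_r; [have := zn (14 * j.+1)%N; lra | rewrite /Cst; lra].
set sg := 1 + / z ^ 16.
have isg : 0 < / z ^ 16 <= 1.
  by split; [apply: Rinv_0_lt_compat; have := zn 16%N; lra | rewrite -Rinv_1; apply: Rinv_le_contravar; [lra | apply: zn]].
have s12 : 1 < sg <= 2 by rewrite /sg; lra.
have hLz := hL z q chi t zz0 q0 hc hn qz tz; rewrite -/sg in hLz.
have hMz m : (m <= K.+1)%N -> Cmod (DSL chi sg t m) <= C1 * z.
  by move=> mK; apply: (hM m z chi (INR q)) => //; [apply: nonprincipal_bounded_sums | exact: (dchar_le1 _ _ hc)].
have gb n : (0 < n)%N -> Cmod (chi n * npow sg t n)%C <= exp (- (1 + (sg - 1)) * ln (INR n)).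
  move=> n0; rewrite Cmod_mult Cmod_npow (_ : 1 + (sg - 1) = sg); last ring.
  by have := dchar_le1 _ _ hc n; have := exp_pos (- sg * ln (INR n)); nra.
have id := log_derivative_identity (fun n => chi n * npow sg t n)%C k _ _ (cmult_chi_npow _ _ _ _ hc)
  (fun j => absum_lnf _ j (sg - 1) ltac:(lra) gb) (fun j => absum_vonM _ j (sg - 1) ltac:(lra) gb).
rewrite -/(DSL chi sg t k.+1) in id.
rewrite (eq_bigr (fun i => VL chi sg t i * DSL chi sg t (k - i))%C) // big_nat_recr //= subnn in id.
set S := bigop.body _ _ _ in id.
have S_le : Cmod S <= INR k * (C2 * C1 * z ^ (14 * k + 1)).
  apply: Rle_trans (csum_mod _ _ _ _) _.
  apply: (Rle_trans _ (\rsum_(0 <= i < k) (C2 * C1 * z ^ (14 * k + 1)))); last first.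
    by rewrite rsum_const subn0; lra.
  apply: rsum_nat_le => i /andP[_ ik]; rewrite Cmod_mult.
  have a1 := h2 i z q chi t ik zz0 q0 hc hn qz tz; rewrite -/sg in a1.
  have a2 := hMz (k - i)%N ltac:(lia).
  have a3 : z ^ (14 * i.+1) <= z ^ (14 * k) by apply: Rle_pow => //; lia.
  rewrite pow_add pow_1.
  apply: (Rle_trans _ (C2 * z ^ (14 * k) * (C1 * z))); last by apply: Req_le; ring.
  apply: Rmult_le_compat => //; try exact: Cmod_ge_0.
  by apply: Rle_trans a1 _; apply: Rmult_le_compat_l; lra.
have main : Cmod (VL chi sg t k) * Cmod (DSL chi sg t 0) <= (INR k.+1 * C1 + INR k * (C2 * C1)) * z ^ (14 * k + 1).
  rewrite -Cmod_mult.
  have -> : (VL chi sg t k * DSL chi sg t 0 = RtoC (INR k.+1) * DSL chi sg t k.+1 - S)%C by rewrite id; ring.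
  apply: Rle_trans (Cmod_triangle _ _) _; rewrite Cmod_opp Cmod_mult Cmod_R (Rabs_pos_eq (INR k.+1)); last lra.
  have a1 : INR k.+1 * Cmod (DSL chi sg t k.+1) <= INR k.+1 * (C1 * z).
    by apply: Rmult_le_compat_l; [lra | apply: hMz; lia].
  have a2 : z <= z ^ (14 * k + 1) by rewrite pow_add pow_1; have := zn (14 * k)%N; nra.
  have a3 : INR k.+1 * (C1 * z) <= INR k.+1 * C1 * z ^ (14 * k + 1).
    by rewrite -Rmult_assoc; apply: Rmult_le_compat_l; lra.
  lra.
have V0 := Cmod_ge_0 (VL chi sg t k).
have : Cmod (VL chi sg t k) * (c / z ^ 13) <= (INR k.+1 * C1 + INR k * (C2 * C1)) * z ^ (14 * k + 1).
  by apply: Rle_trans main; apply: Rmult_le_compat_l.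
move=> fin; set D := INR k.+1 * C1 + INR k * (C2 * C1) in p3 fin Cst *.
apply: (Rle_trans _ (D / c * z ^ (14 * k.+1))); last first.
  by apply: Rmult_le_compat_r; [have := zn (14 * k.+1)%N; lra | rewrite /Cst; lra].
have zz : 0 < z ^ 13 by have := zn 13%N; lra.
apply: (Rmult_le_reg_r (c / z ^ 13)); first exact: Rdiv_lt_0_compat.
apply: Rle_trans fin _; apply: Req_le.
(* The derivatives of L contribute the extra z and the division by L contributes z^13. *)
have -> : (14 * k.+1 = (14 * k + 1) + 13)%N by lia.
by rewrite (pow_add z (14 * k + 1) 13); field; lra.
Qed.

(** * Fejer kernel *)

Definition fejer_int (T u t : R) : R := (1 - t / T) * cos (t * u).

(* Half of the Fejer kernel, written as a Fourier integral. *)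
Definition fejer (T u : R) : R := RInt (fejer_int T u) 0 T.

Lemma fejer_int_continuous T u t : T <> 0 -> continuous (fejer_int T u) t.
Proof.
by move=> T0; apply: (ex_derive_continuous (fejer_int T u)); rewrite /fejer_int; auto_derive.
Qed.

Lemma ex_fejer T u : T <> 0 -> ex_RInt (fejer_int T u) 0 T.
Proof. by move=> T0; apply: ex_RInt_continuous => t _; apply: fejer_int_continuous. Qed.

Lemma fejer_closed T u : 0 < T -> u <> 0 -> fejer T u = (1 - cos (T * u)) / (T * u ^ 2).
Proof.
move=> T0 u0.
pose G t := (1 - t / T) * (sin (t * u) / u) - cos (t * u) / (T * u ^ 2).
have h : is_RInt (fejer_int T u) 0 T (minus (G T) (G 0)).
  apply: is_RInt_derive => t _; last by apply: fejer_int_continuous; lra.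
  by rewrite /G /fejer_int; auto_derive => //; field; lra.
rewrite /fejer (is_RInt_unique _ _ _ _ h) /minus /plus /opp /= /G.
by rewrite !Rmult_0_l sin_0 cos_0; field; lra.
Qed.

Lemma fejer_ge0 T u : 0 < T -> 0 <= fejer T u.
Proof.
move=> T0; case: (Req_dec u 0) => [->|u0]; last first.
  rewrite fejer_closed //; apply: Rdiv_le_0_compat; first by have := COS_bound (T * u); lra.
  by apply: Rmult_lt_0_compat => //; apply: pow2_gt_0.
apply: RInt_ge_0; [lra | by apply: ex_fejer; lra | move=> t ht].
rewrite /fejer_int Rmult_0_r cos_0 Rmult_1_r.
have : t / T <= 1; last lra.
by apply: (Rmult_le_reg_r T) => //; have -> : t / T * T = t by [field; lra]; lra.
Qed.

Lemma fejer_decay T u : 0 < T -> 0 < u -> fejer T u <= 2 / T * / u ^ 2.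
Proof.
move=> T0 u0; rewrite fejer_closed //; last lra.
have u2 : 0 < u ^ 2 by apply: pow_lt.
have -> : 2 / T * / u ^ 2 = 2 / (T * u ^ 2) by field; lra.
apply: Rmult_le_compat_r; last by have := COS_bound (T * u); lra.
by apply: Rlt_le; apply: Rinv_0_lt_compat; apply: Rmult_lt_0_compat.
Qed.

Lemma fejer_weight T t : 0 < T -> 0 <= t <= T -> 0 <= 1 - t / T <= 1.
Proof.
move=> T0 tT; have -> : 1 - t / T = (T - t) / T by field; lra.
split; first by apply: Rdiv_le_0_compat; lra.
by apply: (Rmult_le_reg_r T) => //; have -> : (T - t) / T * T = T - t by [field; lra]; lra.
Qed.

Lemma fejer_lip T u u' : 0 < T -> Rabs (fejer T u - fejer T u') <= T * (T * Rabs (u - u')).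
Proof.
move=> T0; have T1 : T <> 0 by lra.
have E : fejer T u - fejer T u' = RInt (fun t => fejer_int T u t - fejer_int T u' t) 0 T.
  by rewrite RInt_minus //; apply: ex_fejer.
rewrite E; have -> : T * (T * Rabs (u - u')) = (T - 0) * (T * Rabs (u - u')) by ring.
apply: abs_RInt_le_const; first lra.
  by apply: (ex_RInt_minus (V := R_NormedModule)); apply: ex_fejer.
move=> t tT; rewrite /fejer_int -Rmult_minus_distr_l Rabs_mult.
have w := fejer_weight T t T0 tT; rewrite (Rabs_pos_eq (1 - t / T)); last lra.
have h : Rabs (cos (t * u) - cos (t * u')) <= T * Rabs (u - u').
  apply: (Rle_trans _ (Rabs (t * u - t * u'))).
    apply: Rle_trans (Cmod_cis_diff (t * u) (t * u')); exact: (Re_Cmod (cis (t * u) - cis (t * u'))%C).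
  rewrite -Rmult_minus_distr_l Rabs_mult (Rabs_pos_eq t); last lra.
  by apply: Rmult_le_compat_r; [apply: Rabs_pos | lra].
by have := Rabs_pos (cos (t * u) - cos (t * u')); nra.
Qed.

Lemma fejer_continuous T u : 0 < T -> continuous (fejer T) u.
Proof.
move=> T0; apply/continuity_pt_filterlim => eps e0.
have p : 0 < eps / (T * T) by apply: Rdiv_lt_0_compat => //; apply: Rmult_lt_0_compat.
exists (eps / (T * T)); split=> // x [_]; rewrite /= /R_dist => hx.
apply: Rle_lt_trans (fejer_lip T x u T0) _.
have -> : eps = T * (T * (eps / (T * T))) by field; lra.
by do 2 (apply: Rmult_lt_compat_l => //).
Qed.

(** Odd, nondecreasing and nearly constant beyond the scale 1 / T: a smoothed sign function. The
    difference of two translates is a smoothed indicator of an interval. *)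
Definition Phi (T u : R) : R := RInt (fejer T) 0 u.

Lemma ex_Phi T a b : 0 < T -> ex_RInt (fejer T) a b.
Proof. by move=> T0; apply: ex_RInt_continuous => u _; apply: fejer_continuous. Qed.

Lemma Phi_diff T a b : 0 < T -> Phi T b - Phi T a = RInt (fejer T) a b.
Proof.
move=> T0; have := RInt_Chasles (fejer T) 0 a b (ex_Phi T _ _ T0) (ex_Phi T _ _ T0).
by rewrite /Phi /plus /= => <-; ring.
Qed.

Lemma Phi_mono T a b : 0 < T -> a <= b -> Phi T a <= Phi T b.
Proof.
move=> T0 ab; have : 0 <= Phi T b - Phi T a; last lra.
rewrite Phi_diff //; apply: RInt_ge_0 => // [|u _]; [exact: ex_Phi | exact: fejer_ge0].
Qed.

Lemma fejer_even T u : fejer T (- u) = fejer T u.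
Proof.
apply: RInt_ext => t _; rewrite /fejer_int; congr Rmult.
by rewrite -(cos_neg (t * u)); congr cos; ring.
Qed.

Lemma Phi_odd T u : 0 < T -> Phi T (- u) = - Phi T u.
Proof.
move=> T0; rewrite /Phi.
have := RInt_comp_lin (fejer T) (-1) 0 0 u (ex_Phi T _ _ T0).
have -> : -1 * 0 + 0 = 0 by ring.
have -> : -1 * u + 0 = - u by ring.
move=> <-; transitivity (opp (RInt (fejer T) 0 u)); last by [].
rewrite -(RInt_opp (V := R_CompleteNormedModule) (fejer T) 0 u); last exact: ex_Phi.
apply: RInt_ext => x _; rewrite -(fejer_even T x) /scal /opp /= /Hierarchy.mult /=.
have -> : -1 * x + 0 = - x by ring.
by ring.
Qed.

Lemma Phi_tail T a b : 0 < T -> 0 < a <= b -> Phi T b - Phi T a <= 2 / (T * a).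
Proof.
move=> T0 [a0 ab]; rewrite Phi_diff //.
have h : is_RInt (fun u => 2 / T * / u ^ 2) a b (minus (- (2 / T) * / b) (- (2 / T) * / a)).
  apply: (is_RInt_derive (fun u => - (2 / T) * / u)) => u; rewrite Rmin_left // Rmax_right // => hu.
    by auto_derive; [lra | rewrite /=; field; lra].
  by apply: (ex_derive_continuous (fun u => 2 / T * / u ^ 2)); auto_derive; rewrite /=; nra.
apply: (Rle_trans _ (RInt (fun u => 2 / T * / u ^ 2) a b)).
  apply: RInt_le => // [||u hu]; [exact: ex_Phi | by eexists; exact: h | by apply: fejer_decay; lra].
rewrite (is_RInt_unique _ _ _ _ h) /minus /plus /opp /=.
have ib : 0 < / b by apply: Rinv_0_lt_compat; lra.
have -> : 2 / (T * a) = 2 / T * / a by field; lra.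
by have : 0 < 2 / T by [apply: Rdiv_lt_0_compat; lra]; nra.
Qed.

Lemma fejer_0 T : 0 < T -> fejer T 0 = T / 2.
Proof.
move=> T0; have h : is_RInt (fejer_int T 0) 0 T (minus (T - T ^ 2 / (2 * T)) (0 - 0 ^ 2 / (2 * T))).
  apply: (is_RInt_derive (fun t => t - t ^ 2 / (2 * T))) => t _; last by apply: fejer_int_continuous; lra.
  by rewrite /fejer_int; auto_derive => //; rewrite Rmult_0_r cos_0; field; lra.
by rewrite /fejer (is_RInt_unique _ _ _ _ h) /minus /plus /opp /=; field; lra.
Qed.

(** Crude bounds around the limit pi / 2. The lower one uses fejer >= T/4 on [0, 1/(4 T)]; the upper
    one uses fejer <= T/2 up to 1/T and the tail 2 beyond. *)
Lemma Phi_bounds T U : 1 <= T -> 1 <= U -> 1 / 16 <= Phi T U <= 5 / 2.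
Proof.
move=> T1 U1; have T0 : 0 < T by lra.
have iT : 0 < / T <= 1 by split; [apply: Rinv_0_lt_compat | rewrite -Rinv_1; apply: Rinv_le_contravar; lra].
have P0 : Phi T 0 = 0 by rewrite /Phi RInt_point.
have fu u : 0 <= fejer T u <= T / 2.
  split; first exact: fejer_ge0.
  rewrite -fejer_0 //; apply: RInt_le; [lra | by apply: ex_fejer; lra | by apply: ex_fejer; lra | move=> t tT].
  have := fejer_weight T t T0 ltac:(lra); rewrite /fejer_int Rmult_0_r cos_0.
  by have := COS_bound (t * u); nra.
have up : Phi T (/ T) <= 1 / 2.
  have := abs_RInt_le_const (fejer T) 0 (/ T) (T / 2) ltac:(lra) (ex_Phi T _ _ T0)
    ltac:(move=> t _; rewrite Rabs_pos_eq; case: (fu t); lra).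
  rewrite -/(Phi T (/ T)); have -> : (/ T - 0) * (T / 2) = 1 / 2 by field; lra.
  by split_Rabs; lra.
have low : 1 / 16 <= Phi T (/ T).
  have i4 : 0 < / T / 4 by lra.
  apply: (Rle_trans _ (Phi T (/ T / 4))); last by apply: Phi_mono => //; lra.
  have := RInt_le (fun=> T / 4) (fejer T) 0 (/ T / 4) ltac:(lra) (ex_RInt_const _ _ _) (ex_Phi T _ _ T0).
  rewrite RInt_const /scal /= /Hierarchy.mult /= -/(Phi T (/ T / 4)).
  have -> : (/ T / 4 - 0) * (T / 4) = 1 / 16 by field; lra.
  apply=> u hu; have := fejer_lip T u 0 T0; rewrite fejer_0 // Rminus_0_r (Rabs_pos_eq u); last lra.
  have : T * (T * u) <= T / 4.
    have : T * u <= T * (/ T / 4) by apply: Rmult_le_compat_l; lra.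
    have -> : T * (/ T / 4) = / 4 by field; lra.
    nra.
  by split_Rabs; lra.
have mid : Phi T U - Phi T (/ T) <= 2.
  have := Phi_tail T (/ T) U T0 ltac:(lra).
  by have -> : 2 / (T * / T) = 2 by [field; lra].
by have := Phi_mono T (/ T) U T0 ltac:(lra); lra.
Qed.

Lemma RInt_rsum (m n : nat) (h : nat -> R -> R) a b : (forall i, ex_RInt (h i) a b) ->
  ex_RInt (fun x => \rsum_(m <= i < n) h i x) a b /\
  RInt (fun x => \rsum_(m <= i < n) h i x) a b = \rsum_(m <= i < n) RInt (h i) a b.
Proof.
move=> hh; rewrite /index_iota; elim: (iota m (n - m)) => [|i s [IH1 IH2]].
  split.
    by apply: (ex_RInt_ext (fun=> 0)) => [x _|]; [rewrite big_nil | apply: ex_RInt_const].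
  rewrite big_nil (RInt_ext _ (fun=> 0)) => [|x _]; last by rewrite big_nil.
  by rewrite RInt_const /scal /= /Hierarchy.mult /= Rmult_0_r.
have e : ex_RInt (fun x => plus (h i x) (\big[Rplus/0]_(j <- s) h j x)) a b.
  exact: (ex_RInt_plus (V := R_NormedModule)).
split.
  by apply: ex_RInt_ext e => x _; rewrite big_cons.
rewrite big_cons -IH2; transitivity (RInt (fun x => plus (h i x) (\big[Rplus/0]_(j <- s) h j x)) a b); last first.
  exact: (RInt_plus (V := R_CompleteNormedModule)).
by apply: RInt_ext => x _; rewrite big_cons.
Qed.

(** The kernel is an integral of cosines with frequencies up to T, so the weighted sum inherits a
    bound valid for the cosine sums at these frequencies. *)
Lemma fejer_sum_le (rho : nat -> R) N T W v : 0 < T -> 0 <= W ->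
  (forall t, 0 <= t <= T -> Rabs (\rsum_(1 <= n < N) (rho n * cos (t * (v - ln (INR n))))) <= W) ->
  Rabs (\rsum_(1 <= n < N) (rho n * fejer T (v - ln (INR n)))) <= T * W.
Proof.
move=> T0 W0 hW.
have ex n : ex_RInt (fun t => rho n * fejer_int T (v - ln (INR n)) t) 0 T.
  by apply: (ex_RInt_scal (V := R_NormedModule)); apply: ex_fejer; lra.
have [e1 e2] := RInt_rsum 1 N (fun n t => rho n * fejer_int T (v - ln (INR n)) t) 0 T ex.
have -> : \rsum_(1 <= n < N) (rho n * fejer T (v - ln (INR n))) =
    RInt (fun t => \rsum_(1 <= n < N) (rho n * fejer_int T (v - ln (INR n)) t)) 0 T.
  rewrite e2; apply: eq_bigr => n _.
  by symmetry; apply: (RInt_scal (V := R_CompleteNormedModule)); apply: ex_fejer; lra.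
have -> : T * W = (T - 0) * W by ring.
apply: abs_RInt_le_const => // [|t tT]; first lra.
have -> : \rsum_(1 <= n < N) (rho n * fejer_int T (v - ln (INR n)) t) =
    (1 - t / T) * \rsum_(1 <= n < N) (rho n * cos (t * (v - ln (INR n)))).
  by rewrite big_distrr /=; apply: eq_bigr => n _; rewrite /fejer_int; ring.
have w := fejer_weight T t T0 tT; rewrite Rabs_mult (Rabs_pos_eq (1 - t / T)); last lra.
by have := hW t tT; have := Rabs_pos (\rsum_(1 <= n < N) (rho n * cos (t * (v - ln (INR n))))); nra.
Qed.

Lemma Phi_sum_le (rho : nat -> R) N T W v1 v2 : 0 < T -> 0 <= W -> v1 <= v2 ->
  (forall t v, 0 <= t <= T -> Rabs (\rsum_(1 <= n < N) (rho n * cos (t * (v - ln (INR n))))) <= W) ->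
  Rabs (\rsum_(1 <= n < N) (rho n * (Phi T (v2 - ln (INR n)) - Phi T (v1 - ln (INR n))))) <= (v2 - v1) * (T * W).
Proof.
move=> T0 W0 v12 hW.
have sh n : is_RInt (fun v => rho n * fejer T (v - ln (INR n))) v1 v2
    (rho n * (Phi T (v2 - ln (INR n)) - Phi T (v1 - ln (INR n)))).
  apply: (is_RInt_scal (V := R_NormedModule)); rewrite Phi_diff //.
  set l := ln _; have E : v1 - l = 1 * v1 + - l by ring.
  have := is_RInt_comp_lin (V := R_NormedModule) (fejer T) 1 (- l) v1 v2 (RInt (fejer T) (v1 - l) (v2 - l)).
  have -> : 1 * v1 + - l = v1 - l by ring.
  have -> : 1 * v2 + - l = v2 - l by ring.
  move=> /(_ (RInt_correct _ _ _ (ex_Phi T _ _ T0))); apply: is_RInt_ext => x _.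
  rewrite /scal /= /Hierarchy.mult /= Rmult_1_l; congr fejer; ring.
have [e1 e2] := RInt_rsum 1 N _ v1 v2 (fun n => ex_intro _ _ (sh n)).
have -> : \rsum_(1 <= n < N) (rho n * (Phi T (v2 - ln (INR n)) - Phi T (v1 - ln (INR n)))) =
    RInt (fun v => \rsum_(1 <= n < N) (rho n * fejer T (v - ln (INR n)))) v1 v2.
  by rewrite e2; apply: eq_bigr => n _; rewrite (is_RInt_unique _ _ _ _ (sh n)).
by apply: abs_RInt_le_const => // v _; apply: fejer_sum_le => // t; apply: hW.
Qed.

Lemma Phi_sign T U u : 1 <= T -> 1 <= U -> Rabs u <= U ->
  Rabs (Phi T u - (if Rle_dec 0 u then Phi T U else - Phi T U)) <= 5 / (1 + T * Rabs u).
Proof.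
move=> T1 U1 uU; have T0 : 0 < T by lra.
have [c1 c2] := Phi_bounds T U T1 U1.
have P0 : Phi T 0 = 0 by rewrite /Phi RInt_point.
have key w : 0 <= w <= U -> 0 <= Phi T U - Phi T w <= 5 / (1 + T * w).
  move=> [w0 wU]; split; first by have := Phi_mono T w U T0 wU; lra.
  have Tw : 0 <= T * w by apply: Rmult_le_pos; lra.
  case: (Rle_lt_dec (T * w) 1) => h.
    have : 5 / 2 <= 5 / (1 + T * w).
      by apply: Rmult_le_compat_l; [lra | apply: Rinv_le_contravar; lra].
    by have := Phi_mono T 0 w T0 w0; lra.
  have w1 : 0 < w by nra.
  apply: Rle_trans (Phi_tail T w U T0 ltac:(lra)) _.
  apply: (Rmult_le_reg_r (T * w * (1 + T * w))); first by apply: Rmult_lt_0_compat; lra.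
  have -> : 2 / (T * w) * (T * w * (1 + T * w)) = 2 * (1 + T * w) by field; lra.
  have -> : 5 / (1 + T * w) * (T * w * (1 + T * w)) = 5 * (T * w) by field; lra.
  lra.
case: Rle_dec => u0 /=.
  have ea := Rabs_pos_eq u u0; rewrite ea in uU *.
  have [k1 k2] := key u ltac:(lra).
  by rewrite Rabs_minus_sym Rabs_pos_eq.
have un : u < 0 by lra.
have ea := Rabs_left u un; rewrite ea in uU *; clear u0; have hu : 0 <= - u <= U by split; lra.
have := key (- u) hu; rewrite /=.
rewrite Phi_odd // => -[k1 k2]; rewrite Rabs_pos_eq; last lra.
by apply: Rle_trans k2; lra.
Qed.

(** With c = [Phi T U], 2 c times the indicator of (v1, v2] is approximated by a difference of two
    translates of [Phi], with the errors of [Phi_sign] at both ends. The factor 8 bounds 1 / (2 c),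
    since c >= 1/16. *)
Lemma fejer_block (rho : nat -> R) N T W v1 v2 : 1 <= T -> 0 <= W -> v1 <= v2 ->
  (forall t v, 0 <= t <= T -> Rabs (\rsum_(1 <= n < N) (rho n * cos (t * (v - ln (INR n))))) <= W) ->
  Rabs (\rsum_(1 <= n < N) (if Rle_dec (ln (INR n)) v1 then 0 else if Rle_dec (ln (INR n)) v2 then rho n else 0)) <=
  8 * ((v2 - v1) * (T * W) + \rsum_(1 <= n < N) (Rabs (rho n) *
    (5 / (1 + T * Rabs (v1 - ln (INR n))) + 5 / (1 + T * Rabs (v2 - ln (INR n)))))).
Proof.
move=> T1 W0 v12 hW; have T0 : 0 < T by lra.
pose U := Rabs v1 + Rabs v2 + Rabs (ln (INR N)) + 1.
have U1 : 1 <= U by have := Rabs_pos v1; have := Rabs_pos v2; have := Rabs_pos (ln (INR N)); rewrite /U; lra.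
have [c1 _] := Phi_bounds T U T1 U1; set c := Phi T U in c1.
set B := bigop.body _ _ _; set E := \rsum_(1 <= n < N) (Rabs (rho n) * _).
have h1 := Phi_sum_le rho N T W v1 v2 T0 W0 v12 hW.
set S := bigop.body _ _ _ in h1.
have h2 : Rabs (2 * c * B - S) <= E.
  rewrite /B /S big_distrr /= -rsum_sub; apply: Rle_trans (rsum_abs _ _ _ _) _.
  apply: rsum_nat_le => n /andP[n0 nN].
  have l0 := ln_INR_ge0 n n0.
  have lN : ln (INR n) <= Rabs (ln (INR N)).
    rewrite Rabs_pos_eq; last by apply: ln_INR_ge0; lia.
    by apply: ln_le; [apply: INR_gt0 | apply: le_INR; lia].
  set l := ln (INR n) in l0 lN *.
  have b1 := Phi_sign T U (v1 - l) T1 U1 ltac:(rewrite /U; have := Rabs_pos v2; split_Rabs; lra).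
  have b2 := Phi_sign T U (v2 - l) T1 U1 ltac:(rewrite /U; have := Rabs_pos v1; split_Rabs; lra).
  rewrite -/c in b1 b2.
  set x1 := 5 / _ in b1 *; set x2 := 5 / _ in b2 *.
  have -> : 2 * c * (if Rle_dec l v1 then 0 else if Rle_dec l v2 then rho n else 0) -
     rho n * (Phi T (v2 - l) - Phi T (v1 - l)) =
     rho n * (2 * c * (if Rle_dec l v1 then 0 else if Rle_dec l v2 then 1 else 0) - (Phi T (v2 - l) - Phi T (v1 - l))).
    by case: (Rle_dec l v1) => ? /=; [ring | case: (Rle_dec l v2) => ? /=; ring].
  rewrite Rabs_mult; apply: Rmult_le_compat_l; first exact: Rabs_pos.
  move: b1 b2; case: (Rle_dec l v1) => a1; case: (Rle_dec l v2) => a2; case: (Rle_dec 0 (v1 - l)) => a3;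
    case: (Rle_dec 0 (v2 - l)) => a4 /=; try lra; split_Rabs; lra.
have : 2 * c * Rabs B <= E + (v2 - v1) * (T * W).
  have -> : 2 * c * Rabs B = Rabs (2 * c * B) by rewrite Rabs_mult (Rabs_pos_eq (2 * c)); lra.
  have := Rabs_triang (2 * c * B - S) S.
  have -> : 2 * c * B - S + S = 2 * c * B by ring.
  lra.
have := Rabs_pos B; nra.
Qed.

(** * Character sums over primes *)

Lemma count_interval a b N : 0 <= a <= b ->
  \rsum_(1 <= n < N) (if Rlt_dec a (INR n) then if Rlt_dec (INR n) b then 1 else 0 else 0) <= b - a + 1.
Proof.
move=> [a0 ab]; have [i [i1 i2]] := nfloor_ex a a0; have [j [j1 j2]] := nfloor_ex b ltac:(lra).
apply: (Rle_trans _ (\rsum_(1 <= n < N) (if (i < n <= j)%N then 1 else 0))).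
  apply: rsum_nat_le => n _.
  case: Rlt_dec => h1 /=; last by case: ifP => _; lra.
  case: Rlt_dec => h2 /=; last by case: ifP => _; lra.
  have e1 : (i < n)%N by have : (i < n)%coq_nat by [apply: INR_lt; lra]; lia.
  have e2 : (n <= j)%N.
    have : (n < j.+1)%coq_nat by apply: INR_lt; rewrite S_INR; lra.
    lia.
  by rewrite e1 e2 /=; lra.
apply: (Rle_trans _ (\rsum_(i.+1 <= n < j.+1) 1)); last first.
  rewrite rsum_const Rmult_1_r subSS; case: (leqP i j) => ij; last first.
    by have -> : (j - i)%N = 0%N by [lia]; rewrite /=; lra.
  rewrite -minusE minus_INR; [lra | by apply/leP].
apply: (Rle_trans _ (\rsum_(i.+1 <= n < j.+1) (if (i < n <= j)%N then 1 else 0))); last first.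
  by apply: rsum_nat_le => n _; case: ifP => _; lra.
case: (leqP i j) => ij; last first.
  rewrite [X in _ <= X]big_geq ?big1; [lra | by move=> n _; case: ifP => // h; lia | lia].
have z (n : nat) : 0 <= (if (i < n <= j)%N then 1 else 0) by case: ifP => _; lra.
apply: (Rle_trans _ (\rsum_(1 <= n < N + j.+1) (if (i < n <= j)%N then 1 else 0))).
  by apply: rsum_nat_widen => //; lia.
rewrite (@big_cat_nat _ _ _ i.+1) //=; last by lia.
rewrite (@big_cat_nat _ _ _ j.+1 i.+1) //=; last by lia.
rewrite [X in X + _]big_nat big1 => [|n hn]; last by case: ifP => // h; lia.
rewrite [X in _ + (_ + X)]big_nat [X in _ + (_ + X)]big1 => [|n hn]; last by case: ifP => // h; lia.
lra.
Qed.

Lemma near_count m N eta : (0 < m)%N -> 0 < eta <= 1 / 2 ->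
  \rsum_(1 <= n < N) (if Rlt_dec (Rabs (ln (INR m) - ln (INR n))) eta then 1 else 0) <= 4 * eta * INR m + 1.
Proof.
move=> m0 e01; have mp := INR_gt0 m m0.
have := count_interval (INR m * (1 - eta)) (INR m * (1 + 2 * eta)) N ltac:(nra).
move=> h; apply: (Rle_trans _ (INR m * (1 + 2 * eta) - INR m * (1 - eta) + 1)); last by nra.
apply: Rle_trans h; apply: rsum_nat_le => n /andP[n0 _]; have np := INR_gt0 n n0.
case: Rlt_dec => hn /=; last by case: Rlt_dec => ? /=; [case: Rlt_dec => ? /=|]; lra.
have e1 : 1 - eta < exp (- eta) by have := exp_ineq1 (- eta) ltac:(lra); lra.
have e2 : exp eta <= 1 + 2 * eta.
  have p := exp_pos eta; have : exp (- eta) * exp eta = 1 by rewrite -exp_plus Rplus_opp_l exp_0.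
  have : 1 <= (1 - eta) * (1 + 2 * eta) by nra.
  nra.
have n1 : INR m * (1 - eta) < INR n.
  rewrite -(exp_ln (INR n)) //; apply: (Rlt_le_trans _ (INR m * exp (- eta))).
    by apply: Rmult_lt_compat_l.
  rewrite -{1}(exp_ln (INR m)) // -exp_plus; apply: exp_le; move: hn; split_Rabs; lra.
have n2 : INR n < INR m * (1 + 2 * eta).
  rewrite -(exp_ln (INR n)) //; apply: (Rlt_le_trans _ (INR m * exp eta)); last by apply: Rmult_le_compat_l; lra.
  rewrite -(exp_ln (INR m)) // -exp_plus; apply: exp_increasing; move: hn; split_Rabs; lra.
by case: Rlt_dec => // ? /=; case: Rlt_dec => // ? /=; lra.
Qed.

Definition beta (sg : R) (k n : nat) : R := exp (- sg * ln (INR n)) * (vonM n * lnf k n).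

Lemma beta_ge0 sg k n : (0 < n)%N -> 0 <= beta sg k n.
Proof.
move=> n0; apply: Rmult_le_pos; first exact: Rlt_le (exp_pos _).
by apply: Rmult_le_pos; [apply: vonM_ge0 | apply: lnf_ge0].
Qed.

Lemma beta_le sg k n : 1 <= sg -> (0 < n)%N -> beta sg k n <= / INR n * (1 + ln (INR n)) ^ k.+1.
Proof.
move=> s1 n0; have l0 := ln_INR_ge0 n n0.
apply: Rmult_le_compat; [exact: Rlt_le (exp_pos _) | | exact: exp_neg_sg |].
  by apply: Rmult_le_pos; [apply: vonM_ge0 | apply: lnf_ge0].
rewrite -tech_pow_Rmult; apply: Rmult_le_compat; [exact: vonM_ge0 | exact: lnf_ge0 | |].
  by have := vonM_le_ln n n0; lra.
exact: lnf_mono.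
Qed.

(* Terms with |ln m - ln n| >= eta are small because T = eta^-2 is large; the others are few. *)
Lemma err_sum_le sg k m N eta T S : (0 < m)%N -> 1 <= sg -> 0 < eta <= 1 / 2 -> T = / eta ^ 2 ->
  \rsum_(1 <= n < N) beta sg k n <= S ->
  \rsum_(1 <= n < N) (beta sg k n * (5 / (1 + T * Rabs (ln (INR m) - ln (INR n))))) <=
  5 * eta * S + 15 * (2 + ln (INR m)) ^ k.+1 * (4 * eta + / INR m).
Proof.
move=> m0 s1 e01 TE hS; have mp := INR_gt0 m m0; have lm := ln_INR_ge0 m m0.
have T0 : 0 < T by rewrite TE; apply: Rinv_0_lt_compat; apply: pow_lt; lra.
set P := (2 + ln (INR m)) ^ k.+1; have P0 : 0 < P by apply: pow_lt; lra.
apply: (Rle_trans _ (\rsum_(1 <= n < N) (5 * eta * beta sg k n +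
    15 * P * / INR m * (if Rlt_dec (Rabs (ln (INR m) - ln (INR n))) eta then 1 else 0)))).
  apply: rsum_nat_le => n /andP[n0 _]; have b0 := beta_ge0 sg k n n0; have l0 := ln_INR_ge0 n n0.
  set d := Rabs _; have d0 : 0 <= d := Rabs_pos _.
  have Td : 0 <= T * d by apply: Rmult_le_pos; lra.
  case: Rlt_dec => hd /=.
    have f1 : 5 / (1 + T * d) <= 5.
      by rewrite -[X in _ <= X]Rmult_1_r -Rinv_1; apply: Rmult_le_compat_l; [lra | apply: Rinv_le_contravar; lra].
    have hb : beta sg k n <= 3 * / INR m * P.
      apply: Rle_trans (beta_le _ _ _ s1 n0) _.
      apply: Rmult_le_compat; [exact: Rlt_le (Rinv_0_lt_compat _ (INR_gt0 n n0)) | by apply: pow_le; lra | |].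
        rewrite -exp_neg_ln // -exp_neg_ln //.
        apply: (Rle_trans _ (exp (1 + - ln (INR m)))); first by apply: exp_le; move: hd; rewrite /d; split_Rabs; lra.
        by rewrite exp_plus; apply: Rmult_le_compat_r; [apply: Rlt_le (exp_pos _) | apply: exp_le_3].
      by apply: pow_incr; split; [lra | move: hd; rewrite /d; split_Rabs; lra].
    have : beta sg k n * (5 / (1 + T * d)) <= 3 * / INR m * P * 5.
      by apply: Rmult_le_compat => //; apply: Rlt_le; apply: Rdiv_lt_0_compat; lra.
    have : 0 <= 5 * eta * beta sg k n by apply: Rmult_le_pos; lra.
    lra.
  have f2 : 5 / (1 + T * d) <= 5 * eta.
    rewrite /Rdiv; apply: Rmult_le_compat_l; first lra.
    rewrite -[X in _ <= X]Rinv_inv; apply: Rinv_le_contravar; first by apply: Rinv_0_lt_compat; lra.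
    have : / eta <= T * d; last lra.
    have -> : / eta = T * eta by rewrite TE /=; field; lra.
    by apply: Rmult_le_compat_l; lra.
  by rewrite Rmult_0_r Rplus_0_r Rmult_comm; apply: Rmult_le_compat_r.
rewrite big_split /= -!big_distrr /=; apply: Rplus_le_compat.
  by apply: Rmult_le_compat_l; lra.
have := near_count m N eta m0 e01; set Q := bigop.body _ _ _ => hQ.
apply: (Rle_trans _ (15 * P * / INR m * (4 * eta * INR m + 1))).
  apply: Rmult_le_compat_l => //; apply: Rmult_le_pos; [lra | exact: Rlt_le (Rinv_0_lt_compat _ mp)].
by apply: Req_le; field; lra.
Qed.

Lemma tsum_trunc a M K e : absum a M -> (0 < K)%N -> (forall N, \rsum_(K <= n < N) Cmod (a n) <= e) ->
  forall N, (K <= N)%N -> Cmod (\csum_(1 <= n < N) a n)%C <= Cmod (tsum a) + e.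
Proof.
move=> aM K0 he N KN.
have h : Cmod (tsum (fun n => if (n < N)%N then RtoC 0 else a n)) <= e.
  apply: tsum_abs_le => N'; apply: Rle_trans (he N').
  have e0 : 0 <= e by have := he 0%N; rewrite big_geq.
  case: (leqP K N') => KN'; last first.
    rewrite [X in _ <= X]big_geq ?(ltnW KN') // big_nat big1; first lra.
    by move=> i hi; case: ifP => h; rewrite ?Cmod_0 //; lia.
  rewrite (@big_cat_nat _ _ _ K) //= big_nat big1 => [|i hi]; last first.
    by case: ifP => h; rewrite ?Cmod_0 //; lia.
  rewrite Rplus_0_l; apply: rsum_nat_le => i _; case: ifP => _; last lra.
  by rewrite Cmod_0; apply: Cmod_ge_0.
rewrite -(tsum_tail a M N aM) in h.
have -> : (\csum_(1 <= n < N) a n = tsum a + - (tsum a - \csum_(1 <= n < N) a n))%C by ring.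
by apply: Rle_trans (Cmod_triangle _ _) _; rewrite Cmod_opp; lra.
Qed.

Lemma cis_add a b : cis (a + b) = (cis a * cis b)%C.
Proof. by rewrite /cis cos_plus sin_plus /Cmult /=; congr pair; ring. Qed.

Lemma cis_cos th : (cis th + cis (- th))%C = RtoC (2 * cos th).
Proof. by rewrite /cis cos_neg sin_neg /Cplus /RtoC /=; congr pair; ring. Qed.

(** A cosine is half the sum of two exponentials, and the shift v contributes only phases of modulus
    1. *)
Lemma cos_sum_bound (b : nat -> C) N t v W :
  (forall s, Rabs s = Rabs t -> Cmod (\csum_(1 <= n < N) (b n * cis (s * ln (INR n))))%C <= W) ->
  Cmod (\csum_(1 <= n < N) (b n * RtoC (cos (t * (v - ln (INR n))))))%C <= W.
Proof.
move=> hW; have h1 := hW t erefl; have h2 := hW (- t) (Rabs_Ropp t).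
set S1 := bigop.body _ _ _ in h1; set S2 := bigop.body _ _ _ in h2.
have E : (\csum_(1 <= n < N) (b n * RtoC (cos (t * (v - ln (INR n))))) =
   RtoC (/ 2) * (cis (- (t * v)) * S1 + cis (t * v) * S2))%C.
  rewrite /S1 /S2 !big_distrr /= -big_split /= big_distrr /=; apply: eq_bigr => n _.
  set l := ln (INR n).
  have e1 : (cis (- (t * v)) * cis (t * l) = cis (- (t * (v - l))))%C by rewrite -cis_add; congr cis; ring.
  have e2 : (cis (t * v) * cis (- t * l) = cis (t * (v - l)))%C by rewrite -cis_add; congr cis; ring.
  have e3 := cis_cos (t * (v - l)); rewrite RtoC_mult in e3.
  have -> : (cis (- (t * v)) * (b n * cis (t * l)) + cis (t * v) * (b n * cis (- t * l)) =
     b n * (cis (t * (v - l)) + cis (- (t * (v - l)))))%C by rewrite -e1 -e2; ring.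
  rewrite e3; have : (RtoC (/ 2) * RtoC 2 = RtoC 1)%C by rewrite -RtoC_mult; congr RtoC; field.
  by move=> h; transitivity ((RtoC (/ 2) * RtoC 2) * (b n * RtoC (cos (t * (v - l)))))%C; [rewrite h|]; ring.
rewrite E Cmod_mult Cmod_R Rabs_pos_eq; last lra.
have : Cmod (cis (- (t * v)) * S1 + cis (t * v) * S2)%C <= W + W; last lra.
apply: Rle_trans (Cmod_triangle _ _) _.
by rewrite !Cmod_mult !Cmod_unit; lra.
Qed.

Lemma beta_sum_le k y N : 1 <= y ->
  \rsum_(1 <= n < N) beta (1 + / y) k n <= INR k.+1 * (3 * 2 ^ k.+1) * y ^ (k + 2).
Proof.
move=> y1; have iy : 0 < / y by apply: Rinv_0_lt_compat; lra.
have hg n : (0 < n)%N -> Cmod (RtoC (exp (- (1 + / y) * ln (INR n)))) <= exp (- (1 + / y) * ln (INR n)).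
  by move=> _; rewrite Cmod_R Rabs_pos_eq; [lra | apply: Rlt_le (exp_pos _)].
have h := absum_vonM (fun n => RtoC (exp (- (1 + / y) * ln (INR n)))) k (/ y) iy hg N.
have -> : \rsum_(1 <= n < N) beta (1 + / y) k n =
   \rsum_(1 <= n < N) Cmod (RtoC (exp (- (1 + / y) * ln (INR n))) * RtoC (vonM n * lnf k n))%C.
  apply: eq_big_nat => n /andP[n0 _]; rewrite -RtoC_mult Cmod_R Rabs_pos_eq //; exact: beta_ge0.
apply: Rle_trans h _; rewrite /Rdiv Rinv_inv Rmult_assoc; apply: Rmult_le_compat_l; first exact: pos_INR.
rewrite Rpow_mult_distr.
have yk : 0 < y ^ k.+1 by apply: pow_lt; lra.
have pk : 0 < 2 ^ k.+1 by apply: pow_lt; lra.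
have -> : (k + 2 = k.+1 + 1)%N by lia.
rewrite (pow_add y) pow_1.
have -> : 3 * 2 ^ k.+1 * (y ^ k.+1 * y) = 2 ^ k.+1 * y ^ k.+1 * (3 * y) by ring.
by apply: Rmult_le_compat_l; [apply: Rlt_le; apply: Rmult_lt_0_compat | lra].
Qed.

Definition bterm (chi : nat -> C) (sg : R) (k n : nat) : C :=
  (chi n * npow sg 0 n * RtoC (vonM n * lnf k n))%C.

Lemma Cmod_bterm chi q sg k n : dchar q chi -> (0 < n)%N -> Cmod (bterm chi sg k n) <= beta sg k n.
Proof.
move=> hc n0; have l0 := lnf_ge0 k n n0; have v0 := vonM_ge0 n.
rewrite /bterm 2!Cmod_mult Cmod_npow Cmod_R Rabs_pos_eq; last exact: Rmult_le_pos.
apply: Rmult_le_compat_r; first exact: Rmult_le_pos.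
have := dchar_le1 _ _ hc n; have := Cmod_ge_0 (chi n); have := exp_pos (- sg * ln (INR n)); nra.
Qed.

Lemma npow_cis sg t n : npow sg t n = (npow sg 0 n * cis (t * ln (INR n)))%C.
Proof.
rewrite /npow Rmult_0_l; have -> : cis 0 = RtoC 1 by rewrite /cis cos_0 sin_0 Ropp_0.
ring.
Qed.

Lemma sum_ln_range (c : nat -> R) N M m : (0 < M)%N -> (M <= m < N)%N ->
  \rsum_(1 <= n < N) (if Rle_dec (ln (INR n)) (ln (INR M)) then 0
    else if Rle_dec (ln (INR n)) (ln (INR m)) then c n else 0) = \rsum_(M.+1 <= n < m.+1) c n.
Proof.
move=> M0 /andP[Mm mN].
have lnlt i j : (0 < i)%N -> (i < j)%N -> ln (INR i) < ln (INR j).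
  by move=> i0 ij; apply: ln_increasing; [apply: INR_gt0 | apply: lt_INR; lia].
have lnle i j : (0 < i)%N -> (i <= j)%N -> ln (INR i) <= ln (INR j).
  by move=> i0 ij; apply: ln_le; [apply: INR_gt0 | apply: le_INR; lia].
rewrite (@big_cat_nat _ _ _ M.+1) //=; last by lia.
rewrite (@big_cat_nat _ _ _ m.+1 M.+1) //=.
rewrite [X in X + _]big_nat big1 => [|n hn]; last first.
  by case: Rle_dec => //= h; have := lnle n M ltac:(lia) ltac:(lia); lra.
rewrite [X in _ + (_ + X)]big_nat [X in _ + (_ + X)]big1 => [|n hn]; last first.
  have := lnlt m n ltac:(lia) ltac:(lia).
  by case: Rle_dec => //= h; case: Rle_dec => //= h' ?; lra.
rewrite Rplus_0_l Rplus_0_r; apply: eq_big_nat => n hn.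
have := lnlt M n ltac:(lia) ltac:(lia); have := lnle n m ltac:(lia) ltac:(lia).
by case: Rle_dec => //= h; [lra | case: Rle_dec => //= h' ?; lra].
Qed.

Lemma pow_le_exponent z i j : 1 <= z -> (i <= j)%N -> z ^ i <= z ^ j.
Proof. by move=> z1 ij; apply: Rle_pow => //; lia. Qed.

(* The exponent 752 + 368 A is 16 k - 16 A for k = 47 + 24 A, that is, a saving of (z^16)^A
   over the trivial bound; z^16 plays the role of ln x. *)
Lemma vonM_block A B : exists Cst z0, 0 < Cst /\ 2 <= z0 /\ forall z q chi M m, z0 <= z ->
  (0 < q)%N -> dchar q chi -> nonprincipal q chi -> INR q <= z ^ (16 * B) ->
  z ^ (32 + 16 * A) <= INR M -> (M <= m)%N -> ln (INR m) <= z ^ 16 ->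
  Cmod (\csum_(M.+1 <= n < m.+1) bterm chi (1 + / z ^ 16) (47 + 24 * A) n)%C <= Cst * z ^ (752 + 368 * A).
Proof.
set k := (47 + 24 * A)%N; set tau := (32 + 16 * A)%N.
have [C1 [z0 [C10 [z02 hV]]]] := VL_bound (16 * B + 2 * tau) k.
pose D := 16 * (C1 + 1) + 32 * (5 * (INR k.+1 * (3 * 2 ^ k.+1)) + 75 * 3 ^ k.+1).
have p3 : 0 < 3 ^ k.+1 by apply: pow_lt; lra.
have p2 : 0 < 2 ^ k.+1 by apply: pow_lt; lra.
have k1 := INR_gt0 k.+1 isT.
have D1 : 0 < INR k.+1 * (3 * 2 ^ k.+1) by apply: Rmult_lt_0_compat; lra.
exists D, z0; split; first by rewrite /D; lra.
split=> // z q chi M m zz q0 hc hn hq hM Mm lm.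
set sg := 1 + _; have z1 : 1 <= z by lra.
have zp j : 0 < z ^ j by apply: pow_lt; lra.
have zp1 j : 1 <= z ^ j by apply: pow_R1_Rle.
have M0 : (0 < M)%N by case: (M) hM => // h; have := zp tau; rewrite /= in h *; lra.
have m0 : (0 < m)%N by lia.
have y1 := zp1 16%N.
have sg1 : 1 <= sg by rewrite /sg; have := Rinv_0_lt_compat _ (zp 16%N); lra.
have sgE : sg - 1 = / z ^ 16 by rewrite /sg; ring.
(* In terms of y = z^16, eta is y^(-2 - A). It lowers the trivial bound y^(k + 2) for the sum of
   [beta] to y^(k - A). *)
pose eta := / z ^ tau; pose T := z ^ (2 * tau).
have e0 : 0 < eta by apply: Rinv_0_lt_compat.
have e2 : eta <= 1 / 2.
  rewrite /eta /Rdiv Rmult_1_l; apply: Rinv_le_contravar; first lra.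
  by apply: (Rle_trans _ (z ^ 1)); [rewrite pow_1; lra | apply: pow_le_exponent].
have TE : T = / eta ^ 2 by rewrite /T /eta pow_inv Rinv_inv -pow_mult; congr (_ ^ _); lia.
pose W := C1 * z ^ (14 * k.+1) + 1.
have W0 : 0 <= W by rewrite /W; have := zp (14 * k.+1)%N; nra.
have T1 : 1 <= T := zp1 _.
have hb n : (0 < n)%N -> Cmod (bterm chi sg k n) <= beta sg k n := Cmod_bterm chi q sg k n hc.
have hS N := beta_sum_le k (z ^ 16) N y1; rewrite -/sg in hS.
have abeta : absum (fun n => RtoC (beta sg k n)) (INR k.+1 * (3 * 2 ^ k.+1) * (z ^ 16) ^ (k + 2)).
  move=> N; apply: Rle_trans (hS N); apply: rsum_nat_le => n /andP[n0 _].
  by rewrite Cmod_R Rabs_pos_eq; [lra | apply: beta_ge0].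
(* Beyond K the majorant contributes at most 1, so sums up to N >= K obey the bound [VL_bound] of
   the full series, up to 1. *)
have [K [K0 hK]] := absum_tail_small _ _ abeta 1 Rlt_0_1.
pose N := (K + m.+1)%N; have mN : (M <= m < N)%N by rewrite /N; lia.
have hW t v : 0 <= t <= T ->
    Cmod (\csum_(1 <= n < N) (bterm chi sg k n * RtoC (cos (t * (v - ln (INR n))))))%C <= W.
  move=> tT; apply: cos_sum_bound => s st.
  have sT : Rabs s <= z ^ (16 * B + 2 * tau).
    rewrite st Rabs_pos_eq; last lra.
    by apply: Rle_trans (proj2 tT) _; apply: pow_le_exponent => //; lia.
  have qT : INR q <= z ^ (16 * B + 2 * tau) by apply: Rle_trans hq _; apply: pow_le_exponent => //; lia.
  have h1 := hV k z q chi s (leqnn _) zz q0 hc hn qT sT; rewrite -/sg in h1.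
  have E n : (chi n * npow sg s n * RtoC (vonM n * lnf k n) = bterm chi sg k n * cis (s * ln (INR n)))%C.
    by rewrite /bterm npow_cis; ring.
  under eq_bigr do rewrite -E.
  apply: Rle_trans (Rplus_le_compat_r 1 _ _ h1).
  have le n : (0 < n)%N -> Cmod (chi n * npow sg s n * RtoC (vonM n * lnf k n))%C <= Cmod (RtoC (beta sg k n)).
    move=> n0; rewrite E Cmod_mult Cmod_unit Rmult_1_r Cmod_R Rabs_pos_eq; [exact: hb | exact: beta_ge0].
  apply: (tsum_trunc _ _ K) => //; [exact: absum_le abeta | | by rewrite /N; lia].
  by move=> N'; apply: Rle_trans (hK N'); apply: rsum_nat_le => n hnn; apply: le; lia.
have vM : ln (INR M) <= ln (INR m) by apply: ln_le; [apply: INR_gt0 | apply: le_INR; lia].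
have lM0 := ln_INR_ge0 M M0.
have err j : (0 < j)%N -> (M <= j <= m)%N ->
    \rsum_(1 <= n < N) (beta sg k n * (5 / (1 + T * Rabs (ln (INR j) - ln (INR n))))) <=
    (5 * (INR k.+1 * (3 * 2 ^ k.+1)) + 75 * 3 ^ k.+1) * z ^ (752 + 368 * A).
  move=> j0 /andP[Mj jm].
  have lj : ln (INR j) <= z ^ 16.
    by apply: Rle_trans lm; apply: ln_le; [apply: INR_gt0 | apply: le_INR; lia].
  have lj0 := ln_INR_ge0 j j0.
  have ij : / INR j <= eta.
    by apply: Rinv_le_contravar => //; apply: Rle_trans hM _; apply: le_INR; lia.
  apply: Rle_trans (err_sum_le sg k j N eta T _ j0 sg1 (conj e0 e2) TE (hS N)) _.
  rewrite Rmult_plus_distr_r; apply: Rplus_le_compat.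
    apply: Req_le; transitivity (5 * (INR k.+1 * (3 * 2 ^ k.+1)) * (eta * (z ^ 16) ^ (k + 2))); first ring.
    congr (_ * _); rewrite /eta -pow_mult.
    have -> : (16 * (k + 2))%coq_nat = (tau + (752 + 368 * A))%N by rewrite /k /tau; lia.
    by rewrite (pow_add z tau); field; apply: Rgt_not_eq.
  have h1 : (2 + ln (INR j)) ^ k.+1 <= 3 ^ k.+1 * (z ^ 16) ^ k.+1.
    by rewrite -Rpow_mult_distr; apply: pow_incr; lra.
  have h2 : (z ^ 16) ^ k.+1 * eta <= z ^ (752 + 368 * A).
    rewrite /eta -pow_mult; apply: (Rle_trans _ (z ^ (tau + (752 + 368 * A)) * / z ^ tau)).
      apply: Rmult_le_compat_r; [exact: Rlt_le | apply: pow_le_exponent => //; rewrite /k /tau; lia].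
    by apply: Req_le; rewrite (pow_add z tau); field; apply: Rgt_not_eq.
  have g0 : 0 <= (2 + ln (INR j)) ^ k.+1 by apply: pow_le; lra.
  apply: (Rle_trans _ (15 * (3 ^ k.+1 * (z ^ 16) ^ k.+1) * (5 * eta))).
    apply: Rmult_le_compat; [lra | | lra | lra].
    by have := Rinv_0_lt_compat _ (INR_gt0 j j0); lra.
  have -> : 15 * (3 ^ k.+1 * (z ^ 16) ^ k.+1) * (5 * eta) = 75 * 3 ^ k.+1 * ((z ^ 16) ^ k.+1 * eta) by ring.
  by apply: Rmult_le_compat_l; lra.
have main (p : C -> R) : (forall w, Rabs (p w) <= Cmod w) -> (forall w c, p (w * RtoC c)%C = p w * c) ->
    (forall m' n' (c : nat -> C), p (\csum_(m' <= n < n') c n)%C = \rsum_(m' <= n < n') p (c n)) ->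
    Rabs (p (\csum_(M.+1 <= n < m.+1) bterm chi sg k n)%C) <= D / 2 * z ^ (752 + 368 * A).
  move=> p1 p2' p3'; rewrite p3' -(sum_ln_range _ N M m) //.
  have hWp t v : 0 <= t <= T ->
      Rabs (\rsum_(1 <= n < N) (p (bterm chi sg k n) * cos (t * (v - ln (INR n))))) <= W.
    move=> tT; under eq_bigr do rewrite -p2'.
    by rewrite -p3'; apply: Rle_trans (p1 _) (hW t v tT).
  apply: Rle_trans (fejer_block _ N T W _ _ T1 W0 vM hWp) _.
  have b1 : (ln (INR m) - ln (INR M)) * (T * W) <= (C1 + 1) * z ^ (752 + 368 * A).
    apply: (Rle_trans _ (z ^ 16 * (T * ((C1 + 1) * z ^ (14 * k.+1))))).
      apply: Rmult_le_compat; [lra | by apply: Rmult_le_pos; lra | lra | apply: Rmult_le_compat_l; first lra].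
      by rewrite /W; have := zp1 (14 * k.+1)%N; nra.
    apply: Req_le; rewrite /T.
    (* The three factors are the length of the block in ln n, the height T and the bound of
       [VL_bound]. Requiring 16 + 2 tau + 14 (k + 1) = 16 k - 16 A determines k = 47 + 24 A. *)
    have -> : (752 + 368 * A = 16 + (2 * tau + 14 * k.+1))%N by rewrite /k /tau; lia.
    by rewrite (pow_add z 16 (2 * tau + 14 * k.+1)%N) (pow_add z (2 * tau)%N (14 * k.+1)%N); ring.
  have b2 : \rsum_(1 <= n < N) (Rabs (p (bterm chi sg k n)) * (5 / (1 + T * Rabs (ln (INR M) - ln (INR n))) +
       5 / (1 + T * Rabs (ln (INR m) - ln (INR n))))) <=
      2 * ((5 * (INR k.+1 * (3 * 2 ^ k.+1)) + 75 * 3 ^ k.+1) * z ^ (752 + 368 * A)).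
    have h1 := err M M0 ltac:(lia); have h2 := err m m0 ltac:(lia).
    apply: (Rle_trans _ (\rsum_(1 <= n < N) (beta sg k n * (5 / (1 + T * Rabs (ln (INR M) - ln (INR n))))) +
       \rsum_(1 <= n < N) (beta sg k n * (5 / (1 + T * Rabs (ln (INR m) - ln (INR n))))))); last lra.
    rewrite -big_split /=; apply: rsum_nat_le => n /andP[n0 _]; rewrite -Rmult_plus_distr_l.
    apply: Rmult_le_compat_r; last exact: Rle_trans (p1 _) (hb n n0).
    have q1 c : 0 <= 5 / (1 + T * Rabs c).
      apply: Rlt_le; apply: Rdiv_lt_0_compat; first lra.
      by have : 0 <= T * Rabs c; [apply: Rmult_le_pos; [lra | apply: Rabs_pos] | lra].
    by have := q1 (ln (INR M) - ln (INR n)); have := q1 (ln (INR m) - ln (INR n)); lra.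
  rewrite /D; move: b1 b2; set u := bigop.body _ _ _; set w := z ^ (752 + _).
  by move=> b1 b2; lra.
have hRe := main Re Re_Cmod (fun w c => ltac:(rewrite /Re /Cmult /RtoC /=; ring)) (fun m' n' c => csum_Re _ _ _ _).
have hIm := main Im Im_Cmod (fun w c => ltac:(rewrite /Im /Cmult /RtoC /=; ring)) (fun m' n' c => csum_Im _ _ _ _).
by apply: Rle_trans (Cmod_ReIm _) _; lra.
Qed.

(** From u >= k on, (v/u)^k is at most exp(v - u), by 1 + x <= exp x. This makes the weights in
    [char_prime_sum] monotone. *)
Lemma exp_over_pow_mono k u v : INR k <= u -> 0 < u -> u <= v -> exp u / u ^ k <= exp v / v ^ k.
Proof.
move=> ku u0 uv; have v0 : 0 < v by lra.
have uk : 0 < u ^ k by apply: pow_lt.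
have vk : 0 < v ^ k by apply: pow_lt.
have h : (v / u) ^ k <= exp (v - u).
  apply: (Rle_trans _ (exp (v / u - 1) ^ k)).
    by apply: pow_incr; split; [apply: Rlt_le; apply: Rdiv_lt_0_compat | have := exp_ineq1_le (v / u - 1); lra].
  have -> : exp (v / u - 1) ^ k = exp (INR k * (v / u - 1)).
    elim: (k) => [|i IH]; first by rewrite /= Rmult_0_l exp_0.
    by rewrite -tech_pow_Rmult IH S_INR -exp_plus; congr exp; ring.
  apply: exp_le; have -> : v - u = u * (v / u - 1) by field; lra.
  apply: Rmult_le_compat_r => //; have -> : v / u - 1 = (v - u) * / u by field; lra.
  by apply: Rmult_le_pos; [lra | apply: Rlt_le; apply: Rinv_0_lt_compat].
rewrite {1}/Rdiv Rpow_mult_distr pow_inv in h.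
have e : exp v = exp u * exp (v - u) by rewrite -exp_plus; congr exp; ring.
apply: (Rmult_le_reg_r (u ^ k * v ^ k)); first exact: Rmult_lt_0_compat.
have -> : exp u / u ^ k * (u ^ k * v ^ k) = exp u * v ^ k by field; lra.
have -> : exp v / v ^ k * (u ^ k * v ^ k) = exp u * (exp (v - u) * u ^ k) by rewrite e; field; lra.
apply: Rmult_le_compat_l; first exact: Rlt_le (exp_pos _).
have -> : v ^ k = v ^ k / u ^ k * u ^ k by field; lra.
by apply: Rmult_le_compat_r; lra.
Qed.

Lemma pow_le_exp_half j y : 0 <= y -> y ^ j <= 2 ^ j * INR (Factorial.fact j) * exp (y / 2).
Proof.
move=> y0; have := pow_fact_le_exp (y / 2) j ltac:(lra); have f0 := INR_fact_lt_0 j.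
have p2 : 0 < 2 ^ j by apply: pow_lt; lra.
rewrite {1}/Rdiv Rpow_mult_distr pow_inv.
move=> h; apply: (Rmult_le_reg_r (/ (2 ^ j * INR (Factorial.fact j)))).
  by apply: Rinv_0_lt_compat; apply: Rmult_lt_0_compat.
have -> : 2 ^ j * INR (Factorial.fact j) * exp (y / 2) * / (2 ^ j * INR (Factorial.fact j)) = exp (y / 2) by field; lra.
by apply: Rle_trans h; apply: Req_le; field; lra.
Qed.

(** Partial summation removes the weight n^(-1 - 1/y) (ln n)^k / k! of the blocks; for n <= exp y
    the factor n^(1/y) is bounded. Block sums O(y^(k - A)) meet a factor of order exp y / y^(k + 1),
    whence the saving. The terms up to exp(y/2) are bounded trivially. *)
Lemma char_prime_sum A B : exists Cst y0, 0 < Cst /\ 1 <= y0 /\ forall y q chi M, y0 <= y -> (0 < q)%N ->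
  dchar q chi -> nonprincipal q chi -> INR q <= y ^ B -> INR M <= exp y < INR M.+1 ->
  Cmod (\csum_(1 <= n < M.+1) (chi n * RtoC (vonM n / ln (INR n))))%C <= Cst * (exp y / y ^ A).
Proof.
have [C1 [z0 [C10 [z02 hB]]]] := vonM_block A B.
have [k kE] : exists k, k = (47 + 24 * A)%N by eexists.
rewrite -kE in hB.
pose c1 := 2 ^ (3 + A) * INR (Factorial.fact (3 + A)).
pose c2 := 2 ^ A * INR (Factorial.fact A).
pose kf := INR (Factorial.fact k); have kf0 : 0 < kf := INR_fact_lt_0 k.
have c20 : 0 < c2 by apply: Rmult_lt_0_compat; [apply: pow_lt; lra | apply: INR_fact_lt_0].
have c10 : 0 < c1 by apply: Rmult_lt_0_compat; [apply: pow_lt; lra | apply: INR_fact_lt_0].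
pose D := c2 + 4 * C1 * kf * exp 2.
have D0 : 0 < D.
  have e2 := exp_pos 2; have h1 : 0 < C1 * kf by apply: Rmult_lt_0_compat.
  have h2 : 0 < C1 * kf * exp 2 by apply: Rmult_lt_0_compat.
  by rewrite /D; lra.
(* The demands are z >= z0, then y/2 >= k + 1 for the monotonicity of the weights, and exp(y/2) >= 2
   y^(2 + A) for the range of [vonM_block]. *)
pose y0 := z0 ^ 16 + 2 * INR k.+1 + 2 * c1 + 4.
have zp16 : 0 < z0 ^ 16 by apply: pow_lt; lra.
have k10 := pos_INR k.+1.
exists D, y0; split=> //; split; first by rewrite /y0; lra.
move=> y q chi M hy q0 hc hn hq [My yM].
have y4 : 4 <= y by rewrite /y0 in hy; lra.
pose z := exp (ln y / 16).
have zy : z ^ 16 = y.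
  have hE j : z ^ j = exp (INR j * (ln y / 16)).
    elim: j => [|j IH]; first by rewrite /= Rmult_0_l exp_0.
    by rewrite -tech_pow_Rmult IH S_INR /z -exp_plus; congr exp; ring.
  rewrite hE -[RHS](exp_ln y); last lra.
  by congr exp; rewrite /=; field.
have zz : z0 <= z.
  case: (Rle_lt_dec z0 z) => // h; have : z ^ 16 <= z0 ^ 16.
    by apply: pow_incr; split; [exact: Rlt_le (exp_pos _) | lra].
  by rewrite zy; rewrite /y0 in hy; lra.
have yp j : 0 < y ^ j by apply: pow_lt; lra.
have hq' : INR q <= z ^ (16 * B) by rewrite pow_mult zy.
have [M1 [m1 m2]] := nfloor_ex (exp (y / 2)) (Rlt_le _ _ (exp_pos _)).
have hM1 : z ^ (32 + 16 * A) <= INR M1.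
  have -> : (32 + 16 * A)%N = (16 * (2 + A))%N by lia.
  rewrite pow_mult zy; have := pow_le_exp_half (3 + A) y ltac:(lra); rewrite -/c1.
  have -> : y ^ (3 + A) = y * y ^ (2 + A) by [].
  have y2 : 1 <= y ^ (2 + A) by apply: pow_R1_Rle; lra.
  move=> h; have : c1 * (2 * y ^ (2 + A)) <= c1 * exp (y / 2).
    apply: Rle_trans h; rewrite -Rmult_assoc; apply: Rmult_le_compat_r; [lra | by rewrite /y0 in hy; lra].
  by move=> /Rmult_le_reg_l; lra.
have e1 : exp (y / 2) <= exp y by apply: exp_le; lra.
have M1M : (M1 <= M)%N.
  by have : (M1 < M.+1)%coq_nat by [apply: INR_lt; lra]; lia.
have M10 : (0 < M1)%N.
  case: (M1) hM1 => // h.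
  have : 0 < z ^ (32 + 16 * A) by apply: pow_lt; lra.
  by rewrite /= in h *; lra.
have lnM n : (0 < n)%N -> (n <= M)%N -> ln (INR n) <= y.
  move=> n0 nM; rewrite -[X in _ <= X]ln_exp; apply: ln_le; first exact: INR_gt0.
  by apply: Rle_trans My; apply: le_INR; lia.
rewrite (@big_cat_nat _ _ _ M1.+1) //=.
apply: Rle_trans (Cmod_triangle _ _) _.
have part1 : Cmod (\csum_(1 <= n < M1.+1) (chi n * RtoC (vonM n / ln (INR n))))%C <= c2 * (exp y / y ^ A).
  apply: (Rle_trans _ (INR M1)).
    apply: Rle_trans (csum_mod _ _ _ _) _; apply: (Rle_trans _ (\rsum_(1 <= n < M1.+1) 1)); last first.
      by rewrite rsum_const subn1 /=; lra.
    apply: rsum_nat_le => n /andP[n0 _]; rewrite Cmod_mult Cmod_R.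
    have v0 := vonM_ge0 n; have vl := vonM_le_ln n n0.
    have : Rabs (vonM n / ln (INR n)) <= 1.
      case: (Rle_lt_dec (ln (INR n)) 0) => l0.
        have -> : vonM n = 0 by lra.
        by rewrite /Rdiv Rmult_0_l Rabs_R0; lra.
      rewrite Rabs_pos_eq; last by apply: Rdiv_le_0_compat.
      by apply: (Rmult_le_reg_r (ln (INR n))) => //; rewrite /Rdiv Rmult_assoc Rinv_l; lra.
    have := dchar_le1 _ _ hc n; have := Cmod_ge_0 (chi n); have := Rabs_pos (vonM n / ln (INR n)); nra.
  apply: Rle_trans m1 _.
  have h := pow_le_exp_half A y ltac:(lra); rewrite -/c2 in h.
  apply: (Rmult_le_reg_r (y ^ A)) => //.
  have -> : c2 * (exp y / y ^ A) * y ^ A = c2 * exp (y / 2) * exp (y / 2).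
    have -> : exp y = exp (y / 2) * exp (y / 2) by rewrite -exp_plus; congr exp; field.
    by field; apply: Rgt_not_eq.
  by rewrite Rmult_comm; apply: Rmult_le_compat_r => //; apply: Rlt_le (exp_pos _).
suff part2 : Cmod (\csum_(M1.+1 <= n < M.+1) (chi n * RtoC (vonM n / ln (INR n))))%C <=
    4 * C1 * kf * exp 2 * (exp y / y ^ A).
  by rewrite /D Rmult_plus_distr_r; lra.
pose sg := 1 + / y; have iy : 0 < / y by apply: Rinv_0_lt_compat; lra.
have sg1 : 1 <= sg by rewrite /sg; lra.
(* This factor turns a term of the k-th derivative into chi(n) Lambda(n) / ln n. It increases beyond
   exp(y/2), so its variation is the difference of its end values. *)
pose om n := kf * (exp (sg * ln (INR n)) / ln (INR n) ^ k.+1).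
pose a n := if (M1 < n <= M)%N then bterm chi sg k n else RtoC 0.
have lbig n : (M1 < n)%N -> y / 2 <= ln (INR n).
  move=> h; rewrite -[X in X <= _]ln_exp; apply: ln_le; first exact: exp_pos.
  have : (M1.+1 <= n)%coq_nat by lia.
  by move/le_INR; rewrite S_INR; lra.
have om_ge0 n : (M1 < n)%N -> 0 <= om n.
  move=> h; have := lbig n h => l0; apply: Rmult_le_pos; first lra.
  by apply: Rdiv_le_0_compat; [apply: Rlt_le (exp_pos _) | apply: pow_lt; lra].
have om_mono n : (M1 < n)%N -> om n <= om n.+1.
  move=> h; have l0 := lbig n h; apply: Rmult_le_compat_l; first lra.
  have ll : ln (INR n) <= ln (INR n.+1).
    by apply: ln_le; [apply: INR_gt0; lia | apply: le_INR; lia].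
  have hm := exp_over_pow_mono k.+1 (ln (INR n)) (ln (INR n.+1)) ltac:(rewrite /y0 in hy; lra) ltac:(lra) ll.
  have E w : exp (sg * w) = exp (/ y * w) * exp w by rewrite -exp_plus; congr exp; rewrite /sg; ring.
  rewrite !E /Rdiv !Rmult_assoc; apply: Rmult_le_compat; [exact: Rlt_le (exp_pos _) | | | exact: hm].
    by apply: Rdiv_le_0_compat; [apply: Rlt_le (exp_pos _) | apply: pow_lt; lra].
  by apply: exp_le; apply: Rmult_le_compat_l; lra.
pose Q := C1 * y ^ (47 + 23 * A).
have aQ : bounded_sums a Q.
  have gen m : (M1 <= m <= M)%N -> Cmod (\csum_(0 <= n < m.+1) a n)%C <= Q.
    move=> /andP[h1 h2]; have -> : \csum_(0 <= n < m.+1) a n = \csum_(M1.+1 <= n < m.+1) bterm chi sg k n.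
      rewrite (@big_cat_nat _ _ _ M1.+1) //= big_nat big1 => [|n hnn]; last by rewrite /a; case: ifP => // h; lia.
      rewrite Cplus_0_l; apply: eq_big_nat => n hnn; rewrite /a; case: ifP => // h; lia.
    have h := hB z q chi M1 m zz q0 hc hn hq' hM1 h1.
    rewrite zy in h; apply: Rle_trans (h (lnM m ltac:(lia) h2)) _.
    have -> : (752 + 368 * A)%N = (16 * (47 + 23 * A))%N by lia.
    by rewrite pow_mult zy /Q; lra.
  move=> m; case: (leqP m M1) => hm.
    rewrite big_nat big1 => [|n hnn]; last by rewrite /a; case: ifP => // h; lia.
    by rewrite Cmod_0; apply: Rmult_le_pos; [lra | apply: Rlt_le].
  case: (leqP m M.+1) => hm2.
    by case: m hm hm2 => // m hm hm2; apply: gen; lia.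
  rewrite (@big_cat_nat _ _ _ M.+1) //=; last by lia.
  rewrite [X in Cplus _ X]big_nat [X in Cplus _ X]big1 => [|n hnn]; last by rewrite /a; case: ifP => // h; lia.
  by rewrite Cplus_0_r; apply: gen; lia.
have -> : \csum_(M1.+1 <= n < M.+1) (chi n * RtoC (vonM n / ln (INR n))) =
    \csum_(M1.+1 <= n < M.+1) (a n * RtoC (om n)).
  apply: eq_big_nat => n hnn; have l0 := lbig n ltac:(lia).
  rewrite /a; have -> : (M1 < n <= M)%N by lia.
  rewrite /bterm /npow Rmult_0_l; have -> : cis 0 = RtoC 1 by rewrite /cis cos_0 sin_0 Ropp_0.
  rewrite Cmult_1_r -!Cmult_assoc -!RtoC_mult; congr (_ * RtoC _)%C.
  rewrite /om /lnf -/kf -Ropp_mult_distr_l exp_Ropp -tech_pow_Rmult.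
  have := exp_pos (sg * ln (INR n)); have : 0 < ln (INR n) ^ k by apply: pow_lt; lra.
  move: kf0 l0; clear - y4; move: (ln (INR n) ^ k) (exp (sg * ln (INR n))) (ln (INR n)) kf => u e l g *.
  by field; repeat split; lra.
have hab := abel_bound a (fun n => RtoC (om n)) Q M1.+1 M.+1 aQ ltac:(lia).
apply: Rle_trans hab _.
have -> : \rsum_(M1.+1 <= n < M.+1) Cmod (RtoC (om n.+1) - RtoC (om n))%C = om M.+1 - om M1.+1.
  rewrite -rsum_telescope //; apply: eq_big_nat => n hnn.
  by rewrite -RtoC_minus Cmod_R Rabs_pos_eq //; have := om_mono n ltac:(lia); lra.
rewrite !Cmod_R !Rabs_pos_eq; [|by apply: om_ge0; lia..].
have Q0 : 0 < Q by apply: Rmult_lt_0_compat.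
have omM : om M.+1 <= kf * (2 * exp 2 * (exp y / y ^ k.+1)).
  apply: Rmult_le_compat_l; first lra.
  have l1 : y < ln (INR M.+1) by rewrite -[X in X < _]ln_exp; apply: ln_increasing => //; exact: exp_pos.
  have l2 : ln (INR M.+1) <= y + ln 2.
    rewrite -[X in _ <= X]ln_exp; apply: ln_le; first exact: INR_gt0.
    rewrite exp_plus exp_ln; last lra.
    by rewrite S_INR; have := exp_ineq1_le y; lra.
  have ln2 : ln 2 <= 1.
    by have := exp_ineq1_le (ln 2); rewrite exp_ln; lra.
  have h1 : exp (sg * ln (INR M.+1)) <= 2 * exp 2 * exp y.
    have -> : 2 * exp 2 * exp y = exp (y + ln 2 + 2) by rewrite !exp_plus exp_ln; [ring | lra].
    apply: exp_le; rewrite /sg Rmult_plus_distr_r Rmult_1_l; apply: Rplus_le_compat => //.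
    apply: (Rmult_le_reg_l y); first lra.
    by rewrite -Rmult_assoc Rinv_r; lra.
  have h2 : / ln (INR M.+1) ^ k.+1 <= / y ^ k.+1.
    by apply: Rinv_le_contravar => //; apply: pow_incr; lra.
  have -> : 2 * exp 2 * (exp y / y ^ k.+1) = 2 * exp 2 * exp y * / y ^ k.+1 by rewrite /Rdiv; ring.
  apply: Rmult_le_compat => //; first exact: Rlt_le (exp_pos _).
  by apply: Rlt_le; apply: Rinv_0_lt_compat; apply: pow_lt; lra.
apply: (Rle_trans _ (Q * (2 * (kf * (2 * exp 2 * (exp y / y ^ k.+1)))))).
  by apply: Rmult_le_compat_l; lra.
have -> : Q * (2 * (kf * (2 * exp 2 * (exp y / y ^ k.+1)))) =
   4 * C1 * kf * exp 2 * (exp y * (y ^ (47 + 23 * A) / y ^ k.+1)) by rewrite /Q /Rdiv; move: (y ^ _) (/ y ^ _) (exp 2) (exp y) => *; clearbody kf; ring.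
have e2 := exp_pos 2; have ey := exp_pos y.
apply: Rmult_le_compat_l.
  have h1 : 0 < C1 * kf by apply: Rmult_lt_0_compat.
  have h2 : 0 < C1 * kf * exp 2 by apply: Rmult_lt_0_compat.
  by lra.
rewrite /Rdiv; apply: Rmult_le_compat_l; first lra.
apply: (Rmult_le_reg_r (y ^ k.+1)) => //; rewrite Rmult_assoc Rinv_l; last by apply: Rgt_not_eq.
have -> : (k.+1 = A + (1 + (47 + 23 * A)))%N by lia.
rewrite (pow_add y A) -Rmult_assoc Rinv_l; last by apply: Rgt_not_eq.
rewrite Rmult_1_r Rmult_1_l; apply: pow_le_exponent; [lra | lia].
Qed.

(** * Existence of Dirichlet characters *)

Module DirichletCharacters.
From mathcomp Require Import finset fingroup morphism perm action zmodp cyclic.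
From mathcomp Require Import ssralg ssrnum finalg matrix poly vector algC cyclotomic classfun character.
Import GRing.Theory Num.Theory.

(** The root of unity exp(-2 pi i k / N), not the zeta function. *)
Definition zeta (N k : nat) : C := cis (2 * PI * INR k / INR N).

Lemma zetaD N j k : zeta N (j + k) = (zeta N j * zeta N k)%C.
Proof. by rewrite /zeta -cis_add plus_INR; congr cis; rewrite /Rdiv; ring. Qed.

Lemma zeta_mod N k : (0 < N)%N -> zeta N (k %% N) = zeta N k.
Proof.
move=> N0; rewrite {2}(divn_eq k N) zetaD.
have zN : zeta N N = RtoC 1.
  have -> : zeta N N = cis (2 * PI).
    by rewrite /zeta; congr cis; field; apply: not_0_INR; lia.
  by rewrite /cis cos_2PI sin_2PI Ropp_0.
have z0 : zeta N 0 = RtoC 1 by rewrite /zeta /= /Rdiv Rmult_0_r Rmult_0_l /cis cos_0 sin_0 Ropp_0.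
suff -> : zeta N (k %/ N * N) = RtoC 1 by rewrite Cmult_1_l.
by elim: (k %/ N)%N => [|j IH]; [rewrite mul0n | rewrite mulSn zetaD zN IH Cmult_1_l].
Qed.

Lemma zeta_neq1 N k : (0 < k < N)%N -> zeta N k <> RtoC 1.
Proof.
move=> /andP[k0 kN] [h _]; move: h.
have p0 := PI_RGT_0; have n0 := INR_gt0 N ltac:(lia); have k1 := INR_gt0 k k0.
have kn : INR k < INR N by apply: lt_INR; lia.
have -> : 2 * PI * INR k / INR N = 2 * (PI * (INR k / INR N)) by field; lra.
rewrite cos_2a_sin.
have h1 : 0 < INR k / INR N by apply: Rdiv_lt_0_compat.
have h2 : INR k / INR N < 1 by apply: (Rmult_lt_reg_r (INR N)) => //; rewrite /Rdiv Rmult_assoc Rinv_l; lra.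
have := sin_gt_0 (PI * (INR k / INR N)) ltac:(nra) ltac:(nra).
by set s := sin _ => s0; nra.
Qed.

Section Characters.
Context (q : nat) (q1 : (1 < q)%N).
Let G := units_Zp_group q.
Let N := totient q.

Let N0 : (0 < N)%N. Proof. by rewrite totient_gt0; lia. Qed.
Let cardG : #|G| = N. Proof. by rewrite card_units_Zp; lia. Qed.
Let abG : abelian G := units_Zp_abelian q.

Let w : algC := sval (C_prim_root_exists N0).
Let wP : N.-primitive_root%R w := svalP (C_prim_root_exists N0).

Let expo (z : algC) : nat := find (fun k => z == (w ^+ k)%R) (iota 0 N).
(* Irreducible characters take algebraic values; only their multiplicative structure is
   transported to [C], so orthogonality is proved again there. *)
Let emb (z : algC) : C := zeta N (expo z).

Let emb_w k : emb (w ^+ k)%R = zeta N k.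
Proof.
have hh : has (fun j => (w ^+ k)%R == (w ^+ j)%R) (iota 0 N).
  apply/hasP; exists (k %% N)%N; last by rewrite (prim_expr_mod wP).
  by rewrite mem_iota ltn_mod.
have := nth_find 0%N hh; rewrite nth_iota; last by rewrite has_find size_iota in hh.
by rewrite add0n (eq_prim_root_expr wP) => /eqP h; rewrite /emb /expo -zeta_mod // -h zeta_mod.
Qed.

Let lin (i : Iirr G) : ('chi_i)%R \is a linear_char := char_abelianP G abG i.

Let chi_root (i : Iirr G) (x : {unit 'Z_q}) : exists k, (k < N)%N /\ ('chi_i x)%R = (w ^+ k)%R.
Proof.
have h : ('chi_i x ^+ N)%R = 1%R.
  by rewrite -(lin_charX (lin i)) ?inE // -cardG expg_cardG ?inE // (lin_char1 (lin i)).
by have [j ->] := prim_rootP wP h; exists j.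
Qed.

Let ch (i : Iirr G) (x : {unit 'Z_q}) : C := emb ('chi_i x)%R.

Let embM (i j : Iirr G) x y : emb ('chi_i x * 'chi_j y)%R = (emb ('chi_i x)%R * emb ('chi_j y)%R)%C.
Proof.
have [k [_ ->]] := chi_root i x; have [l [_ ->]] := chi_root j y.
by rewrite -exprD !emb_w zetaD.
Qed.

Let emb_eq1 i x : ch i x = RtoC 1 -> ('chi_i x = 1)%R.
Proof.
rewrite /ch; have [[|k] [kN ->]] := chi_root i x; first by rewrite expr0.
by rewrite emb_w => /zeta_neq1 h; case: h; lia.
Qed.

Let ch1 i : ch i 1%g = RtoC 1.
Proof.
rewrite /ch (lin_char1 (lin i)) -(expr0 w) emb_w.
by rewrite /zeta /= /Rdiv Rmult_0_r Rmult_0_l /cis cos_0 sin_0 Ropp_0.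
Qed.

Let chM i x y : ch i (x * y)%g = (ch i x * ch i y)%C.
Proof. by rewrite /ch (lin_charM (lin i)) ?inE // embM. Qed.

(** Some ['chi_j] is not 1 at x, since otherwise the regular character would not vanish there.
    Multiplication by ['chi_j] permutes the irreducible characters, so the sum is unchanged when
    multiplied by [ch j x], which is not 1. *)
Let sum_ch x : x != 1%g -> (\big[Cplus/RtoC 0]_(i : Iirr G) ch i x)%C = RtoC 0.
Proof.
move=> x1; have [j hj] : exists j : Iirr G, ('chi_j x)%R != 1%R.
  apply/existsP; apply: contraT => /existsPn h.
  have := cfRegE G x; rewrite (negbTE x1) mulr0n cfReg_sum sum_cfunE.
  rewrite (eq_bigr (fun=> 1%R)) => [|i _].
    rewrite sumr_const card_ord NirrE => /eqP; rewrite pnatr_eq0.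
    by have := abG; rewrite card_classes_abelian => /eqP ->; rewrite cardG; case: (N) N0.
  by rewrite cfunE (lin_char1 (lin i)) mul1r; apply/eqP; have := h i; rewrite negbK.
pose s (i : Iirr G) : Iirr G := cfIirr ('chi_j * 'chi_i)%R.
have sE i : ('chi_(s i) = 'chi_j * 'chi_i)%R.
  by rewrite cfIirrE // lin_char_irr // rpredM // lin.
have s_inj : injective s.
  move=> i1 i2 /(congr1 (fun i => 'chi_i)%R); rewrite !sE => /(mulrI (lin_char_unitr (lin j))).
  exact: irr_inj.
set S := bigop.body _ _ _.
have e : S = (ch j x * S)%C.
  rewrite {1}/S (reindex_inj s_inj) /= big_distrr /=; apply: eq_bigr => i _.
  by rewrite /ch sE cfunE embM.
apply: NNPP => S0; case/negP: hj; apply/eqP; apply: emb_eq1.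
by transitivity (ch j x * S * / S)%C; [rewrite -Cmult_assoc Cinv_r // Cmult_1_r | rewrite -e Cinv_r].
Qed.

(** Non-units are sent to the default 1; [xchar] reads [un] at integers coprime to q only. *)
Let un (n : nat) : {unit 'Z_q} := insubd (1%g : {unit 'Z_q}) (n%:R : 'Z_q)%R.

Let val_un n : coprime n q -> val (un n) = (n%:R : 'Z_q)%R.
Proof. by move=> c; rewrite /un val_insubd unitZpE // coprime_sym c. Qed.

Definition xchar (i n : nat) : C :=
  if coprime n q then ch (inord i) (un n) else RtoC 0.

Lemma xcharP i : dchar q (xchar i).
Proof.
split.
- have c1 : coprime 1 q by rewrite /coprime gcd1n.
  rewrite /xchar c1; have -> : un 1 = 1%g by apply: val_inj; rewrite val_un.
  exact: ch1.
- move=> m n; rewrite /xchar coprimeMl.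
  case: (boolP (coprime m q)) => cm; last by rewrite Cmult_0_l.
  case: (boolP (coprime n q)) => cn /=; last by rewrite Cmult_0_r.
  rewrite -chM; congr ch; apply: val_inj.
  by rewrite FinRing.val_unitM !val_un ?coprimeMl ?cm // natrM.
- move=> n; have cE : coprime (n + q) q = coprime n q by rewrite -coprime_modl modnDr coprime_modl.
  rewrite /xchar cE; case: ifP => // c; congr ch.
  apply: val_inj; rewrite !val_un ?cE // natrD.
  by rewrite -{2}(Zp_cast q1) pchar_Zp // addr0.
- by move=> n /negbTE h; rewrite /xchar h.
- move=> n h; rewrite /xchar h /ch /emb; exact: Cmod_unit.
Qed.

Lemma xchar0 n : coprime n q -> xchar 0 n = RtoC 1.
Proof.
move=> c; rewrite /xchar c; have -> : inord 0 = 0%R :> Iirr G by apply: val_inj; rewrite /= inordK.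
by rewrite /ch irr0 cfun1E inE -(ch1 0%R) /ch irr0 cfun1E inE.
Qed.

Let cardI : pred_Nirr G = N.-1.
Proof.
have := NirrE G; move=> h; have := abG; rewrite card_classes_abelian cardG -h => /eqP <-.
by [].
Qed.

Lemma xchar_nonprincipal i : (0 < i < N)%N -> nonprincipal q (xchar i).
Proof.
move=> /andP[i0 iN]; apply: NNPP => h.
have hi : (i < (pred_Nirr G).+1)%N by rewrite cardI; lia.
have : (inord i : Iirr G) = 0%R.
  apply: irr_inj; rewrite irr0; apply/cfun_inP => x _; rewrite cfun1E inE.
  apply: emb_eq1; apply: NNPP => hx; apply: h.
  have xE : ((val x : nat)%:R = val x :> 'Z_q)%R by apply: natr_Zp.
  have c : coprime (val x) q by rewrite coprime_sym -unitZpE // xE; apply: (valP x).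
  exists (val x : nat); split => //; rewrite /xchar c => e; apply: hx.
  by rewrite -e; congr ch; apply: val_inj; rewrite val_un.
move/(congr1 val); rewrite /= inordK //; lia.
Qed.

Lemma sum_xchar n :
  (\csum_(0 <= i < N) xchar i n)%C = if (n %% q == 1)%N then RtoC (INR N) else RtoC 0.
Proof.
have nq : (n %% q == 1)%N = coprime n q && (un n == 1%g).
  case: (boolP (coprime n q)) => c /=; last first.
    apply/negP => /eqP h; case/negP: c.
    by rewrite -coprime_modl h /coprime gcd1n.
  rewrite -(inj_eq val_inj) val_un //.
  by rewrite -(inj_eq val_inj) /= val_Zp_nat // modn_small.
rewrite nq; case: (boolP (coprime n q)) => c /=; last first.
  by rewrite big1 // => i _; rewrite /xchar (negbTE c).
have -> : (\csum_(0 <= i < N) xchar i n)%C = (\big[Cplus/RtoC 0]_(i : Iirr G) ch i (un n))%C.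
  have -> : N = Nirr G by rewrite cardI; lia.
  rewrite big_mkord; apply: eq_bigr => i _; rewrite /xchar c; congr ch.
  by apply: val_inj; rewrite /= inordK.
case: ifP => [/eqP ->|/negbT]; last exact: sum_ch.
rewrite (eq_bigr (fun=> RtoC 1)) => [|i _]; last exact: ch1.
have -> : INR N = INR #|Iirr G| by rewrite card_ord cardI; congr INR; lia.
rewrite big_const; elim: #|_| => [|k IH] //; by rewrite iterS IH S_INR RtoC_plus Cplus_comm.
Qed.
End Characters.
End DirichletCharacters.

Lemma dirichlet_characters q : (0 < q)%N -> exists X : nat -> nat -> C,
  (forall i, dchar q (X i)) /\
  (forall i, (0 < i < totient q)%N -> nonprincipal q (X i)) /\
  (forall n, coprime n q -> X 0%N n = RtoC 1) /\
  (forall n, (\csum_(0 <= i < totient q) X i n)%C =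
     if (n == 1 %[mod q]) then RtoC (INR (totient q)) else RtoC 0).
Proof.
case: (leqP q 1) => [q1 q0|q1 _]; last first.
  exists (DirichletCharacters.xchar q q1); split; [|split; [|split]].
  - by move=> i; apply: DirichletCharacters.xcharP.
  - exact: DirichletCharacters.xchar_nonprincipal.
  - exact: DirichletCharacters.xchar0.
  - by move=> n; rewrite DirichletCharacters.sum_xchar [in RHS](modn_small q1).
(* The type ['Z_q] has at least two elements for every q, so the modulus 1 is done by hand. *)
have -> : q = 1%N by lia.
exists (fun _ _ => RtoC 1); split; [|split; [|split]] => //.
- move=> i; split=> //; [by move=> m n; ring | by move=> n; rewrite coprimen1 | by move=> n _; rewrite Cmod_1].
- by move=> [|i] //.
- by move=> n; rewrite !modn1 eqxx big_nat1.
Qed.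

(** * The Siegel-Walfisz theorem for the residue class 1 *)

Definition powerful (n : nat) : bool := all (fun p => 1 < logn p n)%N (primes n).

Lemma powerfulM p a m : prime p -> (0 < a)%N -> (0 < m)%N -> ~~ (p %| m)%N ->
  powerful (p ^ a * m) = (1 < a)%N && powerful m.
Proof.
move=> pp a0 m0 pm; have pa0 : (0 < p ^ a)%N by rewrite expn_gt0 prime_gt0.
have lp : logn p (p ^ a * m) = a.
  by rewrite lognM // pfactorK // logn_coprime ?addn0 // prime_coprime.
have lq r : r \in primes m -> logn r (p ^ a * m) = logn r m.
  rewrite mem_primes => /and3P[pr _ rm].
  rewrite lognM // lognX logn_prime //; case: eqP => [rp|_]; last by rewrite muln0.
  by move: pm; rewrite -rp rm.
apply/allP/andP => [h|[a1 /allP h] r].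
  split; first by rewrite -lp; apply: h; rewrite primesM // primesX // primes_prime // inE eqxx.
  by apply/allP => r hr; rewrite -lq //; apply: h; rewrite primesM // hr orbT.
rewrite primesM // primesX // primes_prime // inE => /orP[/eqP ->|hr]; first by rewrite lp.
by rewrite lq //; apply: h.
Qed.

Lemma powerful_sq_cube n : (0 < n)%N -> powerful n ->
  exists a b, (0 < a)%N /\ (0 < b)%N /\ n = (a ^ 2 * b ^ 3)%N.
Proof.
move: n; apply: nat_coprime_ind => [_|p k m pp k0 m0 pm IH]; first by exists 1%N, 1%N.
rewrite powerfulM // => /andP[k1 /IH [a [b [a0 [b0 ->]]]]].
have p0 := prime_gt0 pp.
(* An even exponent goes into the square; an odd one, which is at least 3, gives 3 to the cube and
   the rest to the square. *)
exists (p ^ (k./2 - odd k) * a)%N, (p ^ odd k * b)%N; rewrite !muln_gt0 !expn_gt0 p0 a0 b0; split=> //; split=> //.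
have e1 : ((k./2 - odd k) * 2 + odd k * 3 = k)%N.
  by have := odd_double_half k; rewrite -muln2; case: (odd k) k1 => /=; lia.
by rewrite -{1}e1 !expnMn -!expnM expnD; lia.
Qed.

(** Rankin's method over the pairs of [powerful_sq_cube]: at exponent 3/4 the sums over a and b have
    exponents 3/2 and 9/4, so they are at most 3 and 9/5. *)
Lemma powerful_rankin N :
  \rsum_(1 <= n < N) (if powerful n then exp (- (3 / 4) * ln (INR n)) else 0) <= 6.
Proof.
pose g n := exp (- (3 / 4) * ln (INR n)).
have g0 n : 0 < g n := exp_pos _.
apply: (Rle_trans _ (\rsum_(1 <= n < N) \rsum_(1 <= a < N) \rsum_(1 <= b < N)
    (if (n == a ^ 2 * b ^ 3)%N then g (a ^ 2 * b ^ 3)%N else 0))).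
  apply: rsum_nat_le => n /andP[n0 nN].
  have ge0 (a b : nat) : 0 <= (if (n == a ^ 2 * b ^ 3)%N then g (a ^ 2 * b ^ 3)%N else 0).
    by case: ifP => _; [apply: Rlt_le | lra].
  case: ifP => hp; last by apply: rsum_nat_ge0 => a _; apply: rsum_nat_ge0.
  have [a [b [a0 [b0 nE]]]] := powerful_sq_cube n n0 hp.
  have aN : (a < N)%N by have : (0 < b ^ 3)%N by [rewrite expn_gt0 b0]; nia.
  have bN : (b < N)%N by have : (0 < a ^ 2)%N by [rewrite expn_gt0 a0]; nia.
  rewrite (bigD1_seq a) ?mem_index_iota ?a0 ?iota_uniq //= (bigD1_seq b) ?mem_index_iota ?b0 ?iota_uniq //=.
  rewrite -nE eqxx -/(g n).
  have h1 : 0 <= \rsum_(b' <- index_iota 1 N | b' != b) (if (n == a ^ 2 * b' ^ 3)%N then g (a ^ 2 * b' ^ 3)%N else 0).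
    by apply: rsum_ge0 => i _ _; apply: ge0.
  have h2 : 0 <= \rsum_(a' <- index_iota 1 N | a' != a) \rsum_(1 <= b' < N) (if (n == a' ^ 2 * b' ^ 3)%N then g (a' ^ 2 * b' ^ 3)%N else 0).
    by apply: rsum_ge0 => i _ _; apply: rsum_nat_ge0 => j _; apply: ge0.
  by move: h1 h2; set u := bigop.body _ _ _; set v := bigop.body _ _ _; lra.
rewrite exchange_big /=; under eq_bigr do rewrite exchange_big /=.
apply: (Rle_trans _ (\rsum_(1 <= a < N) \rsum_(1 <= b < N)
   (exp (- (1 + / 2) * ln (INR a)) * exp (- (1 + 5 / 4) * ln (INR b))))).
  apply: rsum_nat_le => a /andP[a0 _]; apply: rsum_nat_le => b /andP[b0 _].
  have gE : g (a ^ 2 * b ^ 3)%N = exp (- (1 + / 2) * ln (INR a)) * exp (- (1 + 5 / 4) * ln (INR b)).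
    rewrite /g ln_INR_mul ?expn_gt0 ?a0 ?b0 // !ln_INR_exp // -exp_plus; congr exp.
    by rewrite -[INR 2]/2; have -> : INR 3 = 3 by [rewrite /=; ring]; field.
  rewrite -gE; set c := (a ^ 2 * b ^ 3)%N.
  case: (boolP (c \in index_iota 1 N)) => h.
    rewrite (bigD1_seq c) ?iota_uniq //= eqxx big1; first lra.
    by move=> i /negbTE ->.
  rewrite big_seq big1 => [|i hi]; first exact: Rlt_le.
  by case: eqP => // e; move: h; rewrite -e hi.
have -> : \rsum_(1 <= a < N) \rsum_(1 <= b < N)
   (exp (- (1 + / 2) * ln (INR a)) * exp (- (1 + 5 / 4) * ln (INR b))) =
   (\rsum_(1 <= a < N) exp (- (1 + / 2) * ln (INR a))) * (\rsum_(1 <= b < N) exp (- (1 + 5 / 4) * ln (INR b))).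
  by rewrite big_distrl /=; apply: eq_bigr => a _; rewrite big_distrr.
have h1 := zeta_partial_le (/ 2) N ltac:(lra); have h2 := zeta_partial_le (5 / 4) N ltac:(lra).
have p1 : 0 <= \rsum_(1 <= b < N) exp (- (1 + 5 / 4) * ln (INR b)).
  by apply: rsum_nat_ge0 => i _; apply: Rlt_le (exp_pos _).
have p2 : 0 <= \rsum_(1 <= b < N) exp (- (1 + / 2) * ln (INR b)).
  by apply: rsum_nat_ge0 => i _; apply: Rlt_le (exp_pos _).
move: h1 h2 p1 p2; set u := bigop.body _ _ _; set v := bigop.body _ _ _ => h1 h2 p1 p2.
by rewrite Rinv_inv in h1; have : / (5 / 4) = 4 / 5 by [field]; nra.
Qed.

Lemma powerful_count N y : 0 <= y -> INR N <= exp y ->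
  \rsum_(1 <= n < N.+1) (if powerful n then 1 else 0) <= 6 * exp (3 / 4 * y).
Proof.
move=> y0 Ny; have := powerful_rankin N.+1; have e0 := exp_pos (3 / 4 * y).
move=> h; apply: (Rle_trans _ (exp (3 / 4 * y) * \rsum_(1 <= n < N.+1) (if powerful n then exp (- (3 / 4) * ln (INR n)) else 0))).
  rewrite big_distrr /=; apply: rsum_nat_le => n /andP[n0 nN]; case: ifP => _; last lra.
  rewrite -exp_plus -[X in X <= _]exp_0; apply: exp_le.
  have : ln (INR n) <= y.
    rewrite -[X in _ <= X]ln_exp; apply: ln_le; first exact: INR_gt0.
    by apply: Rle_trans Ny; apply: le_INR; lia.
  lra.
by rewrite Rmult_comm; apply: Rmult_le_compat_r; [apply: Rlt_le|].
Qed.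

(** The two functions differ only at proper prime powers, which are powerful. *)
Lemma vonM_prime_ratio n : (1 < n)%N ->
  Rabs ((if prime n then 1 else 0) - vonM n / ln (INR n)) <= if powerful n then 1 else 0.
Proof.
move=> n1; have n0 : (0 < n)%N by lia.
have l0 : 0 < ln (INR n) by rewrite -ln_1; apply: ln_increasing; [lra | apply: (lt_INR 1); lia].
have v0 := vonM_ge0 n; have v1 := vonM_le_ln n n0.
have r0 : 0 <= vonM n / ln (INR n) by apply: Rdiv_le_0_compat.
have r1 : vonM n / ln (INR n) <= 1.
  by apply: (Rmult_le_reg_r (ln (INR n))) => //; rewrite /Rdiv Rmult_assoc Rinv_l; lra.
case: ifP => pn.
  have -> : vonM n = ln (INR n) by rewrite -{1}(expn1 n) vonM_prime_pow.
  rewrite /Rdiv Rinv_r; last lra.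
  by rewrite Rminus_diag Rabs_R0; case: ifP => _; lra.
rewrite Rminus_0_l Rabs_Ropp Rabs_pos_eq //; case: ifP => // /negP hp.
suff -> : vonM n = 0 by rewrite /Rdiv Rmult_0_l; lra.
rewrite /vonM; case E: (primes n) => [|p [|? ?]] //; case: hp.
rewrite /powerful E /= andbT ltnNge; apply/negP => hl.
have pin : p \in primes n by rewrite E inE.
have := prod_prime_decomp n0; rewrite prime_decompE E /= big_seq1 /= => nE.
move: pin; rewrite mem_primes => /and3P[pp _ pdv].
have h1 : logn p n = 1%N by have : (0 < logn p n)%N by [rewrite logn_gt0 E inE]; lia.
by move: pn; rewrite nE h1 expn1 pp.
Qed.

Lemma pow_le_exp_scale j c y : 0 < c -> 0 <= y -> y ^ j <= (/ c) ^ j * INR (Factorial.fact j) * exp (c * y).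
Proof.
move=> c0 y0; have := pow_fact_le_exp (c * y) j ltac:(nra); have f0 := INR_fact_lt_0 j.
have cj : 0 < c ^ j by apply: pow_lt.
rewrite Rpow_mult_distr pow_inv => h.
apply: (Rmult_le_reg_l (c ^ j / INR (Factorial.fact j))); first exact: Rdiv_lt_0_compat.
have -> : c ^ j / INR (Factorial.fact j) * (/ c ^ j * INR (Factorial.fact j) * exp (c * y)) = exp (c * y) by field; lra.
by apply: Rle_trans h; apply: Req_le; field; lra.
Qed.

(** The prime counting function pi(M; d, 1); for d = 1 it is pi(M). *)
Definition primes_to (d M : nat) : R :=
  \rsum_(1 <= n < M.+1) (if prime n && (n == 1 %[mod d]) then 1 else 0).

(** Orthogonality writes the class 1 as an average over characters. The principal one gives the main
    term, up to primes dividing d and powerful numbers. The others share the constant of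
    [char_prime_sum], which the average keeps. *)
Lemma siegel_walfisz A B : exists Cst y0, 0 < Cst /\ 1 <= y0 /\ forall y d M, y0 <= y ->
  (0 < d)%N -> INR d <= y ^ B -> INR M <= exp y < INR M.+1 ->
  Rabs (primes_to d M - primes_to 1 M / INR (totient d)) <= Cst * (exp y / y ^ A).
Proof.
have [C1 [y0 [C10 [y01 hC]]]] := char_prime_sum A B.
pose c2 := (/ / 4) ^ A * INR (Factorial.fact A); pose c3 := INR (Factorial.fact (A + B)).
have c20 : 0 < c2 by apply: Rmult_lt_0_compat; [apply: pow_lt; lra | apply: INR_fact_lt_0].
have c30 : 0 < c3 by apply: INR_fact_lt_0.
exists (C1 + 12 * c2 + c3), y0; split; first lra.
split=> // y d M hy d0 dy [My yM].
have yp j : 0 < y ^ j by apply: pow_lt; lra.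
have ey := exp_pos y.
have M0 : (0 < M)%N.
  by case: (M) yM => // h; have := exp_ineq1_le y; rewrite /= in h; lra.
have t0 : (0 < totient d)%N by rewrite totient_gt0.
have T0 := INR_gt0 _ t0; have T1 := INR_ge1 _ t0.
have [X [XP [Xn [X0 XS]]]] := dirichlet_characters d d0.
pose r n := vonM n / ln (INR n).
pose S1 := \rsum_(1 <= n < M.+1) (if n == 1 %[mod d] then r n else 0).
pose S0 := \rsum_(1 <= n < M.+1) (if coprime n d then r n else 0).
have id : RtoC (INR (totient d) * S1) = (\csum_(0 <= i < totient d) \csum_(1 <= n < M.+1) (X i n * RtoC (r n)))%C.
  rewrite exchange_big /= /S1 big_distrr /= -csum_RtoC; apply: eq_bigr => n _.
  by rewrite -big_distrl /= XS; case: ifP => _; rewrite -RtoC_mult ?Rmult_0_l ?Rmult_0_r.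
have main : Rabs (INR (totient d) * S1 - S0) <= INR (totient d) * (C1 * (exp y / y ^ A)).
  rewrite -Cmod_R RtoC_minus id big_ltn //.
  have -> : (\csum_(1 <= n < M.+1) (X 0%N n * RtoC (r n)) = RtoC S0)%C.
    rewrite /S0 -csum_RtoC; apply: eq_bigr => n _; case: ifP => c.
      by rewrite X0 // Cmult_1_l.
    by rewrite (dchar0 _ _ (XP 0%N)) ?c // Cmult_0_l.
  have -> : forall u v : C, (u + v - u = v)%C by move=> u v; ring.
  apply: Rle_trans (csum_mod _ _ _ _) _.
  apply: (Rle_trans _ (\rsum_(1 <= i < totient d) (C1 * (exp y / y ^ A)))).
    apply: rsum_nat_le => i hi; apply: (hC y d) => //; by apply: Xn; lia.
  rewrite rsum_const; apply: Rmult_le_compat_r; last by apply: le_INR; lia.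
  by apply: Rmult_le_pos; [lra | apply: Rlt_le; apply: Rdiv_lt_0_compat].
have pc := powerful_count M y ltac:(lra) My.
set pcM := bigop.body _ _ _ in pc.
have pow_small : exp (3 / 4 * y) <= c2 * (exp y / y ^ A).
  have h := pow_le_exp_scale A (/ 4) y ltac:(lra) ltac:(lra); rewrite -/c2 in h.
  apply: (Rmult_le_reg_r (y ^ A)) => //.
  have -> : c2 * (exp y / y ^ A) * y ^ A = c2 * exp (/ 4 * y) * exp (3 / 4 * y).
    have -> : exp y = exp (/ 4 * y) * exp (3 / 4 * y) by rewrite -exp_plus; congr exp; field.
    by field; apply: Rgt_not_eq.
  by rewrite Rmult_comm; apply: Rmult_le_compat_r => //; apply: Rlt_le (exp_pos _).
have d_small : INR d <= c3 * (exp y / y ^ A).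
  apply: Rle_trans dy _; have h := pow_fact_le_exp y (A + B) ltac:(lra); rewrite -/c3 in h.
  apply: (Rmult_le_reg_r (y ^ A)) => //.
  have -> : c3 * (exp y / y ^ A) * y ^ A = c3 * exp y by field; apply: Rgt_not_eq.
  rewrite -(pow_add y B A) Nat.add_comm; apply: (Rmult_le_reg_l (/ c3)); first exact: Rinv_0_lt_compat.
  by rewrite -Rmult_assoc Rinv_l ?Rmult_1_l; [rewrite Rmult_comm | lra].
have r1 : r 1%N = 0.
  have := vonM_ge0 1; have := vonM_le_ln 1 isT; rewrite /r /= ln_1 => h1 h2.
  have -> : vonM 1 = 0 by lra.
  by rewrite /Rdiv Rmult_0_l.
have cmp n : (0 < n)%N -> Rabs ((if prime n then 1 else 0) - r n) <= if powerful n then 1 else 0.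
  case: (leqP n 1) => hn n0; last exact: vonM_prime_ratio.
  have -> : n = 1%N by lia.
  by rewrite r1 /= Rminus_0_r Rabs_R0; lra.
have e1 : Rabs (primes_to d M - S1) <= pcM.
  rewrite /primes_to /S1 -rsum_sub; apply: Rle_trans (rsum_abs _ _ _ _) _.
  apply: rsum_nat_le => n /andP[n0 _]; have := cmp n n0; rewrite andbC.
  case: (n == 1 %[mod d]) => /= h; first exact: h.
  by rewrite Rminus_0_r Rabs_R0; case: ifP => _; lra.
have e0 : Rabs (primes_to 1 M - S0) <= pcM + INR d.
  apply: (Rle_trans _ (pcM + \rsum_(1 <= n < M.+1) (if (n %| d)%N then 1 else 0))).
    rewrite /pcM -big_split /= /primes_to /S0 -rsum_sub; apply: Rle_trans (rsum_abs _ _ _ _) _.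
    apply: rsum_nat_le => n /andP[n0 _]; have := cmp n n0; rewrite !modn1 eqxx andbT.
    case: (boolP (coprime n d)) => c h.
      by apply: Rle_trans h _; case: ((n %| d)%N); lra.
    have pw : 0 <= if powerful n then 1 else 0 by case: ifP => _; lra.
    have dv : 0 <= if (n %| d)%N then 1 else 0 by case: ifP => _; lra.
    case: (boolP (prime n)) => pn; last by rewrite Rminus_0_r Rabs_R0; lra.
    have -> : (n %| d)%N by rewrite prime_coprime // negbK in c.
    by rewrite Rminus_0_r Rabs_R1; lra.
  apply: Rplus_le_compat_l.
  apply: (Rle_trans _ (\rsum_(1 <= n < (M + d).+1) (if (n %| d)%N then 1 else 0))).
    by apply: rsum_nat_widen => // [|i _]; [lia | case: ifP => _; lra].
  rewrite (@big_cat_nat _ _ _ d.+1) //=; last by lia.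
  rewrite [X in _ + X]big_nat [X in _ + X]big1 => [|n hn]; last first.
    by case: ifP => // /(dvdn_leq d0); lia.
  rewrite Rplus_0_r; apply: (Rle_trans _ (\rsum_(1 <= n < d.+1) 1)).
    by apply: rsum_nat_le => n _; case: ifP => _; lra.
  by rewrite rsum_const subn1 /=; lra.
have key : Rabs (S1 - S0 / INR (totient d)) <= C1 * (exp y / y ^ A).
  have -> : S1 - S0 / INR (totient d) = / INR (totient d) * (INR (totient d) * S1 - S0) by field; lra.
  rewrite Rabs_mult Rabs_pos_eq; last by apply: Rlt_le; apply: Rinv_0_lt_compat.
  apply: (Rmult_le_reg_l (INR (totient d))) => //; rewrite -Rmult_assoc Rinv_r; lra.
have e0' : Rabs (primes_to 1 M / INR (totient d) - S0 / INR (totient d)) <= pcM + INR d.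
  rewrite /Rdiv -Rmult_minus_distr_r Rabs_mult (Rabs_pos_eq (/ _)); last by apply: Rlt_le; apply: Rinv_0_lt_compat.
  have i1 : / INR (totient d) <= 1 by rewrite -Rinv_1; apply: Rinv_le_contravar; lra.
  have := Rabs_pos (primes_to 1 M - S0); have := Rinv_0_lt_compat _ T0; nra.
have -> : primes_to d M - primes_to 1 M / INR (totient d) =
  (primes_to d M - S1) + (S1 - S0 / INR (totient d)) - (primes_to 1 M / INR (totient d) - S0 / INR (totient d)) by ring.
move: e1 e0' key; split_Rabs; lra.
Qed.

(** * Heights of factorization trees *)

Lemma primes_coprimeM a b : (0 < a)%N -> (0 < b)%N -> coprime a b ->
  perm_eq (primes (a * b)) (primes a ++ primes b).
Proof.
move=> a0 b0 c; apply: uniq_perm; first exact: primes_uniq.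
  rewrite cat_uniq !primes_uniq /= andbT; apply/hasPn => p; rewrite !mem_primes => /and3P[pp _ pb].
  apply/negP => /and3P[_ _ pa]; have := prime_gt1 pp.
  by have := dvdn_leq (ltn0Sn 0) (_ : (p %| 1)%N); rewrite -(eqP c) dvdn_gcd pa pb => /(_ isT); lia.
by move=> p; rewrite mem_cat primesM.
Qed.

Lemma logn_coprimeM a b p : (0 < a)%N -> (0 < b)%N -> coprime a b -> p \in primes a ->
  logn p (a * b) = logn p a.
Proof.
move=> a0 b0 c; rewrite mem_primes => /and3P[pp _ pa].
rewrite lognM // (@logn_coprime p b) ?addn0 //; exact: coprime_dvdl pa c.
Qed.

Lemma logn_small p n : (0 < n)%N -> (logn p n < n)%N.
Proof.
move=> n0; case: (posnP (logn p n)) => [-> //|]; rewrite logn_gt0 mem_primes => /and3P[pp _ _].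
have h := dvdn_leq n0 (pfactor_dvdnn p n).
exact: leq_trans (ltn_expl _ (prime_gt1 pp)) h.
Qed.

Lemma Hfuel_stable k n : (n <= k)%N -> Hfuel k n = H n.
Proof.
rewrite /H; elim/ltn_ind: n k => n IH [|k] nk; first by have -> : n = 0%N by lia.
case: n IH nk => [|[|n]] IH nk; rewrite //=.
congr (S _); apply: eq_big_seq => p hp; have := logn_small p n.+2 isT => h.
by rewrite (IH _ h k); [symmetry; apply: (IH _ h n.+1); lia | lia].
Qed.

Lemma H_rec n : (1 < n)%N -> H n = (\max_(p <- primes n) H (logn p n)).+1.
Proof.
case: n => [|[|n]] // _.
have -> : H n.+2 = (\max_(p <- primes n.+2) Hfuel n.+1 (logn p n.+2)).+1 by [].
congr (S _); apply: eq_big_seq => p _.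
by apply: Hfuel_stable; have := logn_small p n.+2 isT; lia.
Qed.

Lemma H_prime_pow p a : prime p -> (0 < a)%N -> H (p ^ a) = (H a).+1.
Proof.
move=> pp a0; rewrite H_rec; first by rewrite primesX // primes_prime // big_seq1 pfactorK.
by rewrite -(expn0 p) ltn_exp2l ?prime_gt1.
Qed.

Lemma H_coprimeM a b : (0 < a)%N -> (0 < b)%N -> coprime a b -> H (a * b) = maxn (H a) (H b).
Proof.
move=> a0 b0 c; case: (leqP a 1) => a1.
  by have -> : a = 1%N by [lia]; rewrite mul1n max0n.
case: (leqP b 1) => b1.
  by have -> : b = 1%N by [lia]; rewrite muln1 maxn0.
rewrite !H_rec //; last by nia.
rewrite (perm_big _ (primes_coprimeM a b a0 b0 c)) big_cat /= maxnSS; congr (S (maxn _ _)).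
  by apply: eq_big_seq => p hp; rewrite logn_coprimeM.
by apply: eq_big_seq => p hp; rewrite mulnC logn_coprimeM // coprime_sym.
Qed.

Lemma H_attained n : (1 < n)%N -> exists p, p \in primes n /\ H n = (H (logn p n)).+1.
Proof.
move=> n1; rewrite H_rec //.
have ne : primes n != [::] by rewrite primes_eq0; lia.
have key (s : seq nat) (G : nat -> nat) : s != [::] -> exists p, p \in s /\ \max_(q <- s) G q = G p.
  elim: s => [//|p [|q s] IH] _; first by exists p; rewrite inE big_seq1.
  have [r [rs re]] := IH isT; rewrite big_cons re.
  case: (leqP (G p) (G r)) => _; last by exists p; rewrite inE eqxx.
  by exists r; rewrite inE rs orbT.
by have [p [pn ->]] := key _ (fun p => H (logn p n)) ne; exists p.
Qed.

Lemma expn_logn_le p n : p \in primes n -> (2 ^ logn p n <= n)%N.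
Proof.
rewrite mem_primes => /and3P[pp n0 _]; apply: leq_trans (dvdn_leq n0 (pfactor_dvdnn p n)).
by case: (logn p n) => // k; rewrite leq_exp2r // prime_gt1.
Qed.

Lemma expn_H_le n : (0 < n)%N -> (2 ^ H n <= n)%N.
Proof.
elim/ltn_ind: n => n IH n0; case: (leqP n 1) => n1; first by have -> : n = 1%N by lia.
have [p [pn ->]] := H_attained n n1; apply: leq_trans (expn_logn_le p n pn).
have l0 : (0 < logn p n)%N by rewrite logn_gt0.
have h := IH _ (logn_small p n n0) l0.
by rewrite leq_exp2l //; apply: leq_trans h; apply: ltn_expl.
Qed.

(** At a prime where the maximum is attained, with exponent a, one has H n = 1 + H a, 2^a <= n and
    2^(H a) <= a. *)
Lemma expn_expn_H_le n : (0 < H n)%N -> (2 ^ 2 ^ (H n).-1 <= n)%N.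
Proof.
move=> h0; have n1 : (1 < n)%N by case: n h0 => [|[|n]].
have [p [pn ->]] := H_attained n n1; apply: leq_trans (expn_logn_le p n pn).
by rewrite leq_exp2l //; apply: expn_H_le; rewrite logn_gt0.
Qed.

Lemma mult_f m : mult (f m).
Proof.
split; first by rewrite /f.
move=> a b a0 b0 c; rewrite /f H_coprimeM // geq_max.
by case: (H a <= m)%N; case: (H b <= m)%N => /=; ring.
Qed.

Lemma mult_mu : mult mu.
Proof.
split; first by rewrite /mu /=.
move=> a b a0 b0 c; rewrite /mu muln_gt0 a0 b0 /=.
have pe := primes_coprimeM a b a0 b0 c.
have -> : squarefree (a * b) = squarefree a && squarefree b.
  rewrite /squarefree (perm_all _ pe) all_cat; congr andb; apply: eq_in_all => p hp.
    by rewrite logn_coprimeM.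
  by rewrite mulnC logn_coprimeM // coprime_sym.
rewrite (perm_size pe) size_cat.
by case: (squarefree a); case: (squarefree b) => /=; rewrite ?pow_add; ring.
Qed.

Lemma mult_F m : mult (F m).
Proof. exact: mult_conv mult_mu (mult_f m). Qed.

Lemma mu_prime_pow p a : prime p ->
  mu (p ^ a) = if a is 0 then 1 else if a is 1 then -1 else 0.
Proof.
move=> pp; case: a => [|a]; first by rewrite expn0; case: mult_mu.
rewrite /mu expn_gt0 prime_gt0 //= /squarefree primesX // primes_prime //= pfactorK // andbT.
by case: a => [|a] /=; [ring|].
Qed.

Lemma F_prime_pow m p a : prime p -> (0 < a)%N ->
  F m (p ^ a) = f m (p ^ a) - f m (p ^ a.-1).
Proof.
case: a => // a pp _; rewrite /F big_divisors_prime_pow // big_nat_recr // big_nat_recr //=.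
have p0 := prime_gt0 pp.
have dE i : (i <= a.+1)%N -> (p ^ a.+1 %/ p ^ i)%N = (p ^ (a.+1 - i))%N.
  by move=> h; rewrite -expnB // ?(ltnW (prime_gt1 pp)).
rewrite [X in X + _ + _]big_nat big1 => [|i hi]; last first.
  rewrite dE; last by lia.
  have -> : (a.+1 - i = (a - i.+1).+2)%N by lia.
  by rewrite mu_prime_pow // Rmult_0_l.
rewrite !dE // subSnn subnn !mu_prime_pow //; ring.
Qed.

Lemma sum_F m n : (0 < n)%N -> \rsum_(d <- divisors n) F m d = f m n.
Proof. by apply: (mult_telescope _ _ (mult_f m) (mult_F m)) => p k pp k0; apply: F_prime_pow. Qed.

Lemma f_cases m n : f m n = 1 \/ f m n = 0.
Proof. by rewrite /f; case: ifP; [left | right]. Qed.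

Lemma F_abs_le1 m n : (0 < n)%N -> Rabs (F m n) <= 1.
Proof.
move: n; apply: nat_coprime_ind => [|p a k pp a0 k0 pk IH]; first by case: (mult_F m) => -> _; rewrite Rabs_R1; lra.
have [_ M] := mult_F m; rewrite M ?expn_gt0 ?(prime_gt0 pp) ?coprime_pexpl ?prime_coprime //.
rewrite Rabs_mult -[X in _ <= X]Rmult_1_r; apply: Rmult_le_compat; [exact: Rabs_pos | exact: Rabs_pos | | exact: IH].
rewrite F_prime_pow //; case: (f_cases m (p ^ a)) => ->; case: (f_cases m (p ^ a.-1)) => ->; split_Rabs; lra.
Qed.

(** For 0 < k <= a < 2^m the bound 2^(H k) <= k gives H k < m, so both values of f_m in the
    difference are 1. *)
Lemma F_prime_pow_neq0 m p a : prime p -> (0 < a)%N -> (0 < m)%N -> F m (p ^ a) <> 0 -> (2 ^ m <= a)%N.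
Proof.
move=> pp a0 m0; rewrite F_prime_pow //; case: a a0 => // a _ /=.
have Hle k : (0 < k)%N -> (k <= a.+1)%N -> (a.+1 < 2 ^ m)%N -> f m (p ^ k) = 1.
  move=> k0 ka am; rewrite /f H_prime_pow //.
  suff -> : (H k < m)%N by [].
  by rewrite -(@ltn_exp2l 2) //; have := expn_H_le k k0; lia.
case: (leqP (2 ^ m) a.+1) => // am; rewrite Hle //.
by case: a Hle am => [|a] Hle am; [case: (mult_f m) => -> _; lra | rewrite Hle //; lra].
Qed.

Lemma F_support m n : (0 < m)%N -> (0 < n)%N -> F m n <> 0 ->
  powerful n /\ ((1 < n)%N -> (2 ^ 2 ^ m <= n)%N).
Proof.
move=> m0; move: n; apply: nat_coprime_ind => [_|p a k pp a0 k0 pk IH] //.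
have [_ M] := mult_F m; rewrite M ?expn_gt0 ?(prime_gt0 pp) ?coprime_pexpl ?prime_coprime // => nz.
have n1 : F m (p ^ a) <> 0 by move=> h; apply: nz; rewrite h; ring.
have n2 : F m k <> 0 by move=> h; apply: nz; rewrite h; ring.
have [pk' _] := IH n2; have ha := F_prime_pow_neq0 m p a pp a0 m0 n1.
have h2 : (2 ^ 1 <= 2 ^ m)%N by rewrite leq_exp2l.
rewrite powerfulM // pk' andbT; split=> [|_]; first by lia.
apply: (@leq_trans (p ^ a)); last by rewrite leq_pmulr.
apply: (@leq_trans (2 ^ a)); [by rewrite leq_exp2l | by rewrite leq_exp2r // prime_gt1].
Qed.

Lemma totient_prod n : (0 < n)%N ->
  INR (totient n) = INR n * \big[Rmult/1]_(p <- primes n) (1 - / INR p).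
Proof.
move: n; apply: nat_coprime_ind => [|p a m pp a0 m0 pm IH]; first by rewrite big_nil /=; ring.
have pa0 : (0 < p ^ a)%N by rewrite expn_gt0 prime_gt0.
have c : coprime (p ^ a) m by rewrite coprime_pexpl // prime_coprime.
rewrite totient_coprime // (perm_big _ (primes_coprimeM _ _ pa0 m0 c)) big_cat /=.
rewrite primesX // primes_prime // big_seq1 !mult_INR IH totient_pfactor //.
have p1 := INR_gt0 p (prime_gt0 pp).
have -> : INR (p.-1 * p ^ a.-1) = INR (p ^ a) * (1 - / INR p).
  have e : (p * p ^ a.-1 = p ^ a)%N by rewrite -expnS prednK.
  have -> : INR (p ^ a) = INR p * INR (p ^ a.-1) by rewrite -mult_INR -[(p * _)%coq_nat]/(p * p ^ a.-1)%N e.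
  have -> : INR p = INR p.-1 + 1 by rewrite -S_INR prednK // prime_gt0.
  rewrite mult_INR; field; have := pos_INR p.-1; lra.
ring.
Qed.

(** By [prod_primes_lower], n / phi(n) is at most 1 + omega(n). Since 2^omega(n) <= n and ln 2 >
    1/2, this is at most 1 + 2 ln n, hence at most 16 n^(1/8). *)
Lemma inv_totient_le n : (0 < n)%N -> / INR (totient n) <= 16 * exp (- (7 / 8) * ln (INR n)).
Proof.
move=> n0; have np := INR_gt0 n n0; have t0 := INR_gt0 _ (etrans (totient_gt0 n) n0).
have h1 := prod_primes_lower n n0; have h2 := exp2_size_primes_le n n0.
set w := size (primes n) in h1 h2.
have w0 := pos_INR w; have l2 := ln_lt_2.
have hw : INR w * ln 2 <= ln (INR n).
  rewrite -[2]/(INR 2) -ln_INR_exp //; apply: ln_le; last by apply: le_INR; lia.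
  by apply: INR_gt0; rewrite expn_gt0.
have h3 : 1 + INR w <= 16 * exp (/ 8 * ln (INR n)).
  by have := exp_ineq1_le (/ 8 * ln (INR n)); nra.
have h4 : INR n / (1 + INR w) <= INR (totient n).
  by rewrite totient_prod //; apply: Rmult_le_compat_l; lra.
have h5 : / INR (totient n) <= (1 + INR w) / INR n.
  have -> : (1 + INR w) / INR n = / (INR n / (1 + INR w)) by field; lra.
  by apply: Rinv_le_contravar => //; apply: Rdiv_lt_0_compat; lra.
apply: Rle_trans h5 _.
have -> : - (7 / 8) * ln (INR n) = / 8 * ln (INR n) + - ln (INR n) by field.
rewrite exp_plus exp_neg_ln // -Rmult_assoc; apply: Rmult_le_compat_r => //.
exact: Rlt_le (Rinv_0_lt_compat _ np).
Qed.

(** Of the exponent 7/8 in [inv_totient_le], 3/4 is left for Rankin's sum and 1/8 gives the decay in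
    D; 96 = 16 * 6. *)
Lemma powerful_totient_tail D N : (0 < D)%N ->
  \rsum_(D <= n < N) (if powerful n then / INR (totient n) else 0) <= 96 * exp (- / 8 * ln (INR D)).
Proof.
move=> D0; have e0 := exp_pos (- / 8 * ln (INR D)).
apply: (Rle_trans _ (16 * exp (- / 8 * ln (INR D)) *
   \rsum_(1 <= n < N) (if powerful n then exp (- (3 / 4) * ln (INR n)) else 0))); last first.
  by have := powerful_rankin N; nra.
have ge n : 0 <= if powerful n then exp (- (3 / 4) * ln (INR n)) else 0.
  by case: ifP => _; [apply: Rlt_le (exp_pos _) | lra].
apply: (Rle_trans _ (16 * exp (- / 8 * ln (INR D)) *
   \rsum_(D <= n < N) (if powerful n then exp (- (3 / 4) * ln (INR n)) else 0))); last first.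
  by apply: Rmult_le_compat_l; [lra | apply: rsum_nat_widen].
rewrite big_distrr /=; apply: rsum_nat_le => n /andP[Dn _]; have n0 : (0 < n)%N by lia.
case: ifP => _; last lra.
apply: Rle_trans (inv_totient_le n n0) _; rewrite Rmult_assoc -exp_plus; apply: Rmult_le_compat_l; first lra.
apply: exp_le; have : ln (INR D) <= ln (INR n) by apply: ln_le; [apply: INR_gt0 | apply: le_INR; lia].
lra.
Qed.

Lemma F_over_totient_abs m n : (0 < m)%N -> (0 < n)%N ->
  Rabs (F m n / INR (totient n)) <= if powerful n then / INR (totient n) else 0.
Proof.
move=> m0 n0; have t0 := INR_gt0 _ (etrans (totient_gt0 n) n0); have i0 := Rinv_0_lt_compat _ t0.
have h := F_abs_le1 m n n0; rewrite /Rdiv Rabs_mult (Rabs_pos_eq (/ _)); last lra.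
case: ifP => pw; first by have := Rabs_pos (F m n); nra.
have -> : F m n = 0; last by rewrite Rabs_R0; lra.
by apply: NNPP => h'; have [] := F_support m n m0 n0 h'; rewrite pw.
Qed.

Lemma ex_series_dterm_abs m : (0 < m)%N -> ex_series (fun k => Rabs (dterm m k)).
Proof.
move=> m0; apply: (ex_series_bounded _ 96) => [n|n]; first exact: Rabs_pos.
have := powerful_totient_tail 1 n.+2 isT.
rewrite -[INR 1]/1 ln_1 Rmult_0_r exp_0 Rmult_1_r; apply: Rle_trans.
apply: (Rle_trans _ (\rsum_(2 <= k < n.+2) (if powerful k then / INR (totient k) else 0))).
  by rewrite 2!big_add1 /=; apply: rsum_nat_le => i _; apply: F_over_totient_abs.
apply: rsum_nat_widen => // i hi; case: ifP => _; last lra.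
by apply: Rlt_le; apply: Rinv_0_lt_compat; apply: INR_gt0; rewrite totient_gt0; lia.
Qed.

Lemma dterm_tail m D : (0 < m)%N -> (2 <= D)%N ->
  Rabs (Series (dterm m) - \rsum_(2 <= n < D) (F m n / INR (totient n))) <= 96 * exp (- / 8 * ln (INR D)).
Proof.
move=> m0 D2; have hs := Series_correct _ (ex_series_Rabs _ (ex_series_dterm_abs m m0)).
apply: le_epsilon => eps e0; have [N hN] := proj1 (is_series_rsum _ _) hs eps e0.
have := hN (N + D)%N ltac:(lia).
have -> : \rsum_(0 <= i < N + D) dterm m i = \rsum_(2 <= n < (N + D).+2) (F m n / INR (totient n)).
  by rewrite 2!big_add1.
rewrite (@big_cat_nat _ _ _ D) //=; last by lia.
have := powerful_totient_tail D (N + D).+2 ltac:(lia).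
set T := bigop.body _ _ _; set U := \rsum_(2 <= n < D) _; set V := \rsum_(D <= n < _) _ => hT.
have hV : Rabs V <= T.
  apply: Rle_trans (rsum_abs _ _ _ _) _; apply: rsum_nat_le => n hn.
  by apply: F_over_totient_abs => //; lia.
move: hV; split_Rabs; lra.
Qed.

Lemma dcoefE m : (0 < m)%N -> dcoef m.+1 = - Series (dterm m).
Proof. by case: m. Qed.

Lemma dcoef_bound m : (0 < m)%N -> Rabs (dcoef m.+1) <= 384 * / 2 ^ m.
Proof.
move=> m0; rewrite dcoefE // Rabs_Ropp.
have two i : (0 < 2 ^ i)%N by rewrite expn_gt0.
have D2 : (2 <= 2 ^ 2 ^ m)%N by rewrite -{1}(expn1 2) leq_exp2l.
have := dterm_tail m (2 ^ 2 ^ m) m0 D2; rewrite big_nat big1 => [|n /andP[n2 nD]]; last first.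
  have -> : F m n = 0; last by rewrite /Rdiv Rmult_0_l.
  by apply: NNPP => h; have [_ hh] := F_support m n m0 ltac:(lia) h; have := hh n2; lia.
rewrite Rminus_0_r => h; apply: Rle_trans h _.
have -> : 384 = 96 * 4 by ring.
rewrite Rmult_assoc; apply: Rmult_le_compat_l; first lra.
(* F_m vanishes strictly between 1 and D = 2^(2^m), so only the tail 96 D^(-1/8) is left. This
   inequality gives D^(-1/8) <= 4 * 2^(-m), and 384 = 96 * 4. *)
have hm : (8 * m <= 2 ^ m + 16)%N.
  elim: (m) => [|[|[|[|j]]] IH] //; rewrite expnS; lia.
have l2 : 0 < ln 2 by have := ln_lt_2; lra.
have e2 k : 2 ^ k = exp (INR k * ln 2).
  elim: k => [|k IH]; first by rewrite /= Rmult_0_l exp_0.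
  rewrite -tech_pow_Rmult IH S_INR Rmult_plus_distr_r exp_plus Rmult_1_l exp_ln; lra.
have -> : 4 * / 2 ^ m = exp (INR 2 * ln 2 + - (INR m * ln 2)).
  by rewrite exp_plus exp_Ropp -!e2 /=; ring.
apply: exp_le; rewrite ln_INR_exp // -[X in INR (2 ^ _) * ln X]/2.
have : INR (8 * m) <= INR (2 ^ m + 16) by apply: le_INR; apply/leP.
rewrite mult_INR plus_INR !INR_IZR_INZ /= -!INR_IZR_INZ; nra.
Qed.

(** * The asymptotic formula *)

Lemma ex_series_dcoef : ex_series (fun k => Rabs (dcoef k.+1)).
Proof.
apply: (ex_series_le _ (fun k => 384 * (/ 2) ^ k)) => [k|]; last first.
  by apply: ex_series_scal; apply: ex_series_geom; rewrite Rabs_pos_eq; lra.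
rewrite /norm /= /abs /= Rabs_Rabsolu pow_inv.
case: k => [|k]; first by rewrite /dcoef /= Rabs_R1; lra.
exact: dcoef_bound.
Qed.

Lemma dcoef_tail M : (0 < M)%N -> Rabs (c0 - \rsum_(0 <= k < M) dcoef k.+1) <= 768 * / 2 ^ M.
Proof.
move=> M0; have hs := Series_correct _ (ex_series_Rabs _ ex_series_dcoef); rewrite -/c0 in hs.
apply: le_epsilon => eps e0; have [N hN] := proj1 (is_series_rsum _ _) hs eps e0.
have := hN (N + M)%N ltac:(lia); rewrite (@big_cat_nat _ _ _ M) //=; last by lia.
set U := \rsum_(0 <= n < M) _; set V := \rsum_(M <= n < _) _.
suff hV : Rabs V <= 768 * / 2 ^ M by move: hV; split_Rabs; lra.
apply: Rle_trans (rsum_abs _ _ _ _) _.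
apply: (Rle_trans _ (\rsum_(M <= k < N + M) (- 768 * / 2 ^ k.+1 - - 768 * / 2 ^ k))).
  apply: rsum_nat_le => k hk; apply: Rle_trans (dcoef_bound k ltac:(lia)) _.
  have p := pow_lt 2 k ltac:(lra); rewrite -tech_pow_Rmult Rinv_mult.
  by have := Rinv_0_lt_compat _ p; lra.
rewrite (rsum_telescope M (N + M) (fun k => - 768 * / 2 ^ k)); last by lia.
have p := pow_lt 2 (N + M) ltac:(lra); have := Rinv_0_lt_compat _ p; lra.
Qed.

Lemma nfloorP x : 0 <= x -> INR (nfloor x) <= x < INR (nfloor x).+1.
Proof.
move=> x0; have [h1 h2] := base_Int_part x.
have z0 : (0 <= Int_part x)%Z.
  by have : (-1 < Int_part x)%Z by [apply: lt_IZR; lra]; lia.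
have -> : INR (nfloor x).+1 = INR (nfloor x) + 1 by rewrite S_INR.
by rewrite /nfloor INR_IZR_INZ Z2Nat.id //; lra.
Qed.

Lemma sum_divisors_range (G : nat -> R) n N : (0 < n <= N)%N ->
  \rsum_(d <- divisors n) G d = \rsum_(1 <= d < N.+1) (if (d %| n)%N then G d else 0).
Proof.
move=> /andP[n0 nN]; rewrite -big_mkcond /= -[RHS]big_filter; apply: perm_big; apply: uniq_perm.
- exact: divisors_uniq.
- by apply: filter_uniq; apply: iota_uniq.
move=> d; rewrite mem_filter mem_index_iota -dvdn_divisors //.
by case dn : (d %| n)%N => //=; have := dvdn_gt0 n0 dn; have := dvdn_leq n0 dn; lia.
Qed.

(** In the divisor sum of F_m at p - 1 the term d = 1 is 1, which cancels. N may exceed M because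
    the sum is later cut at a modulus that may itself exceed M. *)
Lemma prime_sum_f m M N : (0 < m)%N -> (M <= N)%N ->
  \rsum_(1 <= p < M.+1) (if prime p then 1 - f m p.-1 else 0) =
  - \rsum_(2 <= d < N.+1) (F m d * primes_to d M).
Proof.
move=> m0 MN; rewrite -rsum_opp.
have -> : \rsum_(2 <= d < N.+1) - (F m d * primes_to d M) =
    \rsum_(2 <= d < N.+1) \rsum_(1 <= p < M.+1) (- (F m d * (if prime p && (p == 1 %[mod d]) then 1 else 0))).
  by apply: eq_bigr => d _; rewrite /primes_to big_distrr /= rsum_opp.
rewrite exchange_big /=; apply: eq_big_nat => p /andP[p0 pM].
case: (boolP (prime p)) => pp; last by rewrite big1 => // d _ /=; ring.
have p1 := prime_gt1 pp.
rewrite -(sum_F m p.-1); last by lia.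
rewrite (sum_divisors_range _ p.-1 N); last by lia.
rewrite big_ltn; last by lia.
rewrite dvd1n; have -> : F m 1 = 1 by case: (mult_F m).
have -> : forall s, 1 - (1 + s) = - s by move=> s; ring.
rewrite -rsum_opp; apply: eq_big_nat => d _.
have -> : (p == 1 %[mod d]) = (d %| p.-1)%N by rewrite eqn_mod_dvd ?subn1 //; lia.
by case: (d %| p.-1)%N => /=; ring.
Qed.

Lemma primes_to_le d M : (0 < d)%N -> 0 <= primes_to d M <= INR M / INR d.
Proof.
move=> d0; have dp := INR_gt0 d d0; split.
  by apply: rsum_nat_ge0 => i _; case: ifP => _; lra.
apply: (Rle_trans _ (\rsum_(1 <= j < M.+1) (if (d %| j)%N then 1 else 0))).
  case: M => [|M]; first by rewrite /primes_to !big_geq //; lra.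
  rewrite /primes_to big_ltn //= Rplus_0_l big_add1 [M.+2.-1]/=.
  apply: (Rle_trans _ (\rsum_(1 <= j < M.+1) (if (d %| j)%N then 1 else 0))).
    apply: rsum_nat_le => j _; rewrite eqn_mod_dvd // subn1 /=.
    by case: (prime _) => /=; case: (d %| j)%N; lra.
  by apply: rsum_nat_widen => // i _; case: ifP => _; lra.
have -> : \rsum_(1 <= j < M.+1) (if (d %| j)%N then 1 else 0) = INR (M %/ d).
  rewrite divn_count_dvd (big_morph INR plus_INR (erefl : INR 0 = 0)); apply: eq_bigr => j _.
  by case: (d %| j)%N.
apply: (Rmult_le_reg_r (INR d)) => //; have -> : INR M / INR d * INR d = INR M by field; lra.
by rewrite -mult_INR; apply: le_INR; apply/leP; apply: leq_divM.
Qed.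

Lemma truncated_height_error A : exists Cst y0, 0 < Cst /\ 1 <= y0 /\ forall y m M, y0 <= y -> (0 < m)%N ->
  INR M <= exp y < INR M.+1 ->
  Rabs (\rsum_(1 <= p < M.+1) (if prime p then 1 - f m p.-1 else 0) - dcoef m.+1 * primes_to 1 M) <=
  Cst * (exp y / y ^ A).
Proof.
(* The moduli are cut at D of order y^B, and the tail bound D^(-1/8) must be y^(-A). The
   Siegel-Walfisz bound is taken with A + B because it is summed over up to y^B moduli. *)
have [B BE] : exists B, B = (8 * A)%N by eexists.
have [C1 [y0 [C10 [y01 hSW]]]] := siegel_walfisz (A + B) B.
exists (C1 + 192), y0; split; first lra.
split=> // y m M hy m0 hM.
have yp j : 0 < y ^ j by apply: pow_lt; lra.
have ey := exp_pos y.
have [D [D1 D2]] := nfloor_ex (y ^ B) (Rlt_le _ _ (yp B)).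
have D0 : (0 < D)%N.
  case: (D) D2 => //; have : 1 <= y ^ B by apply: pow_R1_Rle; lra.
  by rewrite [INR 0]/=; lra.
have small : exp (- / 8 * ln (INR D.+1)) <= / y ^ A.
  have l1 : ln (y ^ B) <= ln (INR D.+1) by apply: ln_le => //; rewrite S_INR; lra.
  rewrite -[X in _ <= X]exp_ln; last exact: Rinv_0_lt_compat.
  apply: exp_le; rewrite ln_Rinv //.
  have lnp j : ln (y ^ j) = INR j * ln y by rewrite ln_pow //; lra.
  have : INR B = 8 * INR A by rewrite BE mult_INR; congr (_ * _); rewrite /=; ring.
  by rewrite !lnp in l1 *; nra.
rewrite (prime_sum_f m M (M + D) m0); last by lia.
rewrite dcoefE // (@big_cat_nat _ _ _ D.+1) //=; last by lia.
set S := Series _; set pi1 := primes_to 1 M.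
have [pi0 piM] := primes_to_le 1 M isT; rewrite -/pi1 -[INR 1]/1 Rdiv_1_r in pi0 piM.
have hT := dterm_tail m D.+1 m0 D0; rewrite -/S in hT.
set G := bigop.body _ _ _ in hT.
set U := bigop.body _ _ _; set V := bigop.body _ _ _.
have hV : Rabs V <= 96 * (exp y / y ^ A).
  apply: Rle_trans (rsum_abs _ _ _ _) _.
  apply: (Rle_trans _ (exp y * \rsum_(D.+1 <= n < (M + D).+1) (if powerful n then / INR (totient n) else 0))).
    rewrite big_distrr /=; apply: rsum_nat_le => n hn.
    have n0 : (0 < n)%N by lia.
    have np := INR_gt0 n n0.
    have t0 := INR_gt0 _ (etrans (totient_gt0 n) n0).
    have tn : / INR n <= / INR (totient n).
      apply: Rinv_le_contravar => //; apply: le_INR; apply/leP.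
      have -> : totient n = \sum_(0 <= d < n) coprime n d by rewrite totient_count_coprime.
      rewrite -[X in (_ <= X)%N]subn0 -[X in (_ <= X)%N]muln1 -sum_nat_const_nat.
      by apply: leq_sum => i _; case: (coprime _ _).
    have [q0 q1] := primes_to_le n M n0.
    have h := F_over_totient_abs m n m0 n0; move: h.
    rewrite /Rdiv !Rabs_mult (Rabs_pos_eq (/ _)); last by apply: Rlt_le; apply: Rinv_0_lt_compat.
    rewrite (Rabs_pos_eq (primes_to n M)) // => h.
    have h2 : primes_to n M <= exp y * / INR (totient n).
      apply: Rle_trans q1 _; apply: Rmult_le_compat; [exact: pos_INR | | lra | done].
      by apply: Rlt_le; apply: Rinv_0_lt_compat.
    apply: (Rle_trans _ (Rabs (F m n) * (exp y * / INR (totient n)))).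
      by apply: Rmult_le_compat_l => //; apply: Rabs_pos.
    by have := Rmult_le_compat_l (exp y) _ _ (Rlt_le _ _ ey) h; lra.
  have := powerful_totient_tail D.+1 (M + D).+1 isT; set T := bigop.body _ _ _ => h.
  have -> : 96 * (exp y / y ^ A) = exp y * (96 * / y ^ A) by rewrite /Rdiv; ring.
  by apply: Rmult_le_compat_l; lra.
have hU : Rabs (U - G * pi1) <= C1 * (exp y / y ^ A).
  rewrite /U /G big_distrl /= -rsum_sub; apply: Rle_trans (rsum_abs _ _ _ _) _.
  apply: (Rle_trans _ (\rsum_(2 <= d < D.+1) (C1 * (exp y / y ^ (A + B))))).
    apply: rsum_nat_le => d hd.
    have -> : F m d * primes_to d M - F m d / INR (totient d) * pi1 =
      F m d * (primes_to d M - pi1 / INR (totient d)) by rewrite /Rdiv; ring.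
    have dD : INR d <= y ^ B by apply: Rle_trans D1; apply: le_INR; lia.
    have h := hSW y d M hy ltac:(lia) dD hM; rewrite -/pi1 in h.
    rewrite Rabs_mult; have hF := F_abs_le1 m d ltac:(lia).
    have := Rabs_pos (primes_to d M - pi1 / INR (totient d)); have := Rabs_pos (F m d); nra.
  rewrite rsum_const; have hD : INR (D.+1 - 2) <= y ^ B by apply: Rle_trans D1; apply: le_INR; lia.
  have -> : C1 * (exp y / y ^ A) = y ^ B * (C1 * (exp y / y ^ (A + B))).
    rewrite (pow_add y A B); have := yp A; have := yp B; move: (y ^ A) (y ^ B) => u v *; field; lra.
  apply: Rmult_le_compat_r => //; apply: Rmult_le_pos; first lra.
  by apply: Rlt_le; apply: Rdiv_lt_0_compat.
have hS : Rabs ((S - G) * pi1) <= 96 * (exp y / y ^ A).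
  rewrite Rabs_mult (Rabs_pos_eq pi1) //.
  have -> : 96 * (exp y / y ^ A) = (96 * / y ^ A) * exp y by rewrite /Rdiv; ring.
  by apply: Rmult_le_compat; [exact: Rabs_pos | | lra | lra].
have -> : - (U + V) - - S * pi1 = - (U - G * pi1) - V + (S - G) * pi1 by ring.
move: hU hV hS; split_Rabs; lra.
Qed.

Lemma INR_H_sum n M : (H n <= M)%N -> INR (H n) = \rsum_(0 <= m < M) (1 - f m n).
Proof.
move=> hM; rewrite (@big_cat_nat _ _ _ (H n)) //=.
rewrite [X in X + _](eq_big_nat _ _ (F2 := fun=> 1)) => [|i hi]; last first.
  by rewrite /f; have -> : (H n <= i)%N = false by [lia]; ring.
rewrite [X in _ + X]big_nat [X in _ + X]big1 => [|i hi]; last first.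
  by rewrite /f; have -> : (H n <= i)%N by [lia]; ring.
by rewrite rsum_const subn0; ring.
Qed.

Lemma height_asymptotics (A : R) : 2 <= A -> exists Cst x0 : R, forall x : R, x0 <= x ->
  Rabs (Msum x - c0 * primepi x) <= Cst * (x / Rpower (ln x) A).
Proof.
move=> A2; have [An [An1 An2]] := nfloor_ex A ltac:(lra).
have [A' A'E] : exists A', A' = An.+1 by eexists.
have hA : A <= INR A' by rewrite A'E S_INR; lra.
(* The additional power of y pays for the summation over O(y) values of m. *)
have [C1 [y0 [C10 [y01 hE]]]] := truncated_height_error A'.+1.
pose c2 := INR (Factorial.fact A').
exists (3 * C1 + 769 * c2), (exp y0) => x hx.
have x0 : 0 < x by have := exp_pos y0; lra.
pose y := ln x; have xE : exp y = x by rewrite /y exp_ln.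
have hy : y0 <= y by rewrite -(ln_exp y0); apply: ln_le => //; exact: exp_pos.
have yp j : 0 < y ^ j by apply: pow_lt; lra.
have c20 : 0 < c2 := INR_fact_lt_0 _.
suff key : Rabs (Msum x - c0 * primepi x) <= (3 * C1 + 769 * c2) * (x / y ^ A').
  apply: Rle_trans key _; apply: Rmult_le_compat_l; first lra.
  rewrite /Rdiv; apply: Rmult_le_compat_l; first lra.
  apply: Rinv_le_contravar; first exact: exp_pos.
  rewrite -/y -Rpower_pow; last lra.
  apply: exp_le; apply: Rmult_le_compat_r => //; rewrite -ln_1; apply: ln_le; lra.
have hM := nfloorP x (Rlt_le _ _ x0); rewrite /Msum /primepi; set M := nfloor x in hM *.
rewrite -{1 2}xE in hM.
have range (G : nat -> R) : \big[Rplus/0]_(p <- iota 0 M.+1 | prime p) G p =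
    \rsum_(1 <= p < M.+1) (if prime p then G p else 0).
  have -> : iota 0 M.+1 = index_iota 0 M.+1 by rewrite /index_iota subn0.
  by rewrite big_mkcond big_ltn //= Rplus_0_l.
rewrite !range; clear range.
have -> : \rsum_(1 <= p < M.+1) (if prime p then 1 else 0) = primes_to 1 M.
  by apply: eq_bigr => p _; rewrite !modn1 eqxx andbT.
set pi1 := primes_to 1 M.
have [pi0 piM] := primes_to_le 1 M isT; rewrite -/pi1 -[INR 1]/1 Rdiv_1_r in pi0 piM.
(* Since ln 2 > 1/2, 2^N is at least x. Hence N bounds all heights that occur, and the tail of c0
   beyond N is O(1/x). *)
have [N0 [N1 N2]] := nfloor_ex (2 * y) ltac:(lra).
pose N := N0.+1.
have hN : exp y <= 2 ^ N.
  have e2 k : 2 ^ k = exp (INR k * ln 2).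
    elim: k => [|k IH]; first by rewrite /= Rmult_0_l exp_0.
    rewrite -tech_pow_Rmult IH S_INR Rmult_plus_distr_r exp_plus Rmult_1_l exp_ln; lra.
  rewrite e2; apply: exp_le; have := ln_lt_2; rewrite /N S_INR; nra.
have hH n : (0 < n <= M)%N -> (H n <= N)%N.
  move=> /andP[n0 nM]; rewrite -(@leq_exp2l 2) //; apply: leq_trans (expn_H_le n n0) _.
  have : INR n <= INR (2 ^ N).
    have -> : INR (2 ^ N) = 2 ^ N.
      by elim: N {hN} => [|k IH] //; rewrite expnS mult_INR IH.
    by apply: Rle_trans hN; apply: Rle_trans (proj1 hM); apply: le_INR; lia.
  by move/INR_le => h; lia.
pose E m := \rsum_(1 <= p < M.+1) (if prime p then 1 - f m p.-1 else 0).
have -> : \rsum_(1 <= p < M.+1) (if prime p then INR (H p.-1) else 0) = \rsum_(0 <= m < N) E m.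
  rewrite /E exchange_big /=; apply: eq_big_nat => p /andP[p0 pM].
  case: (boolP (prime p)) => pp; last by rewrite big1.
  by apply: INR_H_sum; apply: hH; have := prime_gt1 pp; lia.
(* The value f_0(p - 1) is 1 for p = 2 only, and d_1 = 1, so the term m = 0 is pi(x) up to 1. *)
have e0 : Rabs (E 0%N - dcoef 1 * pi1) <= 1.
  have -> : E 0%N - dcoef 1 * pi1 = - \rsum_(1 <= p < M.+1) (if prime p then f 0 p.-1 else 0).
    rewrite /dcoef /= Rmult_1_l /pi1 /primes_to /E -rsum_sub -rsum_opp; apply: eq_bigr => p _.
    by rewrite !modn1 eqxx andbT; case: (prime p); ring.
  have ge i : 0 <= (if prime i then f 0 i.-1 else 0) by case: (f_cases 0 i.-1) => ->; case: ifP => _; lra.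
  rewrite Rabs_Ropp Rabs_pos_eq; last by apply: rsum_nat_ge0 => i _.
  apply: (Rle_trans _ (\rsum_(1 <= p < M.+3) (if prime p then f 0 p.-1 else 0))).
    by apply: rsum_nat_widen => //; lia.
  rewrite big_ltn // big_ltn // big_nat big1 => [|p /andP[p3 _]].
    by rewrite /f /=; lra.
  case: ifP => // _; rewrite /f H_rec //; lia.
have eN : Rabs (\rsum_(1 <= m < N) E m - (\rsum_(1 <= m < N) dcoef m.+1) * pi1) <=
    2 * y * (C1 * (exp y / y ^ A'.+1)).
  rewrite big_distrl /= -rsum_sub; apply: Rle_trans (rsum_abs _ _ _ _) _.
  apply: (Rle_trans _ (\rsum_(1 <= m < N) (C1 * (exp y / y ^ A'.+1)))).
    by apply: rsum_nat_le => m hm; apply: hE => //; lia.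
  rewrite rsum_const subn1; apply: Rmult_le_compat_r; last by [].
  by apply: Rmult_le_pos; [lra | apply: Rlt_le; apply: Rdiv_lt_0_compat; [apply: exp_pos | apply: yp]].
have eT := dcoef_tail N isT.
rewrite big_ltn // in eT; rewrite big_ltn //.
move: eN eT; set SE := bigop.body _ _ _; set SD := bigop.body _ _ _ => eN eT.
have iN : / 2 ^ N * exp y <= 1.
  have p2 : 0 < 2 ^ N by apply: pow_lt; lra.
  by rewrite -(Rinv_l (2 ^ N)); [apply: Rmult_le_compat_l => //; apply: Rlt_le; apply: Rinv_0_lt_compat | lra].
have eT' : Rabs ((c0 - (dcoef 1 + SD)) * pi1) <= 768.
  rewrite Rabs_mult (Rabs_pos_eq pi1) //.
  apply: (Rle_trans _ (768 * / 2 ^ N * exp y)); last lra.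
  by apply: Rmult_le_compat => //; [exact: Rabs_pos | lra].
have -> : E 0%N + SE - c0 * pi1 = (E 0%N - dcoef 1 * pi1) + (SE - SD * pi1) - (c0 - (dcoef 1 + SD)) * pi1 by ring.
have big1 : 1 <= c2 * (x / y ^ A').
  have h := pow_fact_le_exp y A' ltac:(lra); rewrite xE -/c2 in h.
  apply: (Rmult_le_reg_r (y ^ A' / c2)); first exact: Rdiv_lt_0_compat.
  have -> : c2 * (x / y ^ A') * (y ^ A' / c2) = x by field; split; apply: Rgt_not_eq.
  by lra.
have eN' : 2 * y * (C1 * (exp y / y ^ A'.+1)) = 2 * C1 * (x / y ^ A').
  by rewrite xE -tech_pow_Rmult; field; split; [apply: Rgt_not_eq | lra].
rewrite eN' in eN; have xy : 0 < C1 * (x / y ^ A') by apply: Rmult_lt_0_compat => //; apply: Rdiv_lt_0_compat.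
move: e0 eN eT'; split_Rabs; lra.
Qed.

(** * Euler products of multiplicative functions *)

(** A test for powers of a prime p: the exponent of p in n > 0 is less than n, so a power of p
    divides p^n. *)
Definition ppow (p n : nat) : bool := (n %| p ^ n)%N.

Lemma ppowP p n : prime p -> (0 < n)%N -> ppow p n = (n == p ^ logn p n)%N.
Proof.
move=> pp n0; apply/idP/eqP => [/(dvdn_pfactor _ _ pp) [i _ ->]|nE]; first by rewrite pfactorK.
by rewrite /ppow {1}nE dvdn_exp2l // ltnW // logn_small.
Qed.

Definition ppow_part (p : nat) (g : nat -> R) (n : nat) : C :=
  if ppow p n then RtoC (g n) else RtoC 0.

Lemma absum_ppow_part p g K : absum (fun n => RtoC (g n)) K -> absum (ppow_part p g) K.
Proof.
by apply: absum_le => n _; rewrite /ppow_part; case: ifP => _; rewrite ?Cmod_0; [lra | apply: Cmod_ge_0].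
Qed.

(** For n = p^a m with m prime to p, only the splitting (p^a, m) can have both factors nonzero. *)
Lemma conv_ppow_sieve g p s n : mult g -> prime p -> all prime s -> p \notin s -> (0 < n)%N ->
  conv (ppow_part p g) (sieve (p :: s) (fun n => RtoC (g n))) n = sieve s (fun n => RtoC (g n)) n.
Proof.
move=> [_ gM] pp ps pns n0; set a := logn p n.
have [m cpm nE] := pfactor_coprime pp n0; rewrite -/a in nE.
have pa0 : (0 < p ^ a)%N by rewrite expn_gt0 prime_gt0.
have m0 : (0 < m)%N by case: m nE {cpm} => // nE; rewrite nE in n0.
have pan : (p ^ a %| n)%N by rewrite nE dvdn_mull.
rewrite /conv (bigD1_seq (p ^ a)%N) ?divisors_uniq -?dvdn_divisors //=.
rewrite big_seq_cond big1 => [|d]; last first.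
  rewrite -dvdn_divisors // => /andP[dn da]; rewrite /ppow_part; have d0 := dvdn_gt0 n0 dn.
  case: ifP => [|_]; last by rewrite Cmult_0_l.
  rewrite ppowP // => /eqP dE; rewrite /sieve /=.
  have la : (logn p d < a)%N.
    rewrite ltn_neqAle dvdn_leq_log // andbT; apply: contra da => /eqP h.
    by rewrite dE h.
  have -> : (p %| n %/ d)%N by have : (0 < logn p (n %/ d))%N by [rewrite logn_div // subn_gt0]; rewrite logn_gt0 mem_primes => /and3P[].
  by rewrite Cmult_0_r.
have nq : (n %/ p ^ a)%N = m by rewrite [X in (X %/ _)%N]nE mulnK.
rewrite Cplus_0_r nq /ppow_part /sieve /=.
have -> : ppow p (p ^ a) by rewrite /ppow dvdn_exp2l // ltnW // ltn_expl // prime_gt1.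
have -> : (p %| m)%N = false by apply/negbTE; rewrite -prime_coprime.
have -> : has (fun q => q %| m)%N s = has (fun q => q %| n)%N s.
  apply: eq_in_has => q qs; have pq := allP ps q qs.
  have qp : (q == p) = false by apply/eqP => e; move: pns; rewrite -e qs.
  by rewrite [in RHS]nE Euclid_dvdM // Euclid_dvdX // (dvdn_prime2 pq pp) qp /= orbF.
rewrite /=; case: (has _ s); first by rewrite Cmult_0_r.
by rewrite -RtoC_mult [in RHS]nE mulnC gM // coprimeXl.
Qed.

Definition local_factor (g : nat -> R) (p : nat) : R := Re (tsum (ppow_part p g)).

Lemma tsum_ppow_part p g : tsum (ppow_part p g) = RtoC (local_factor g p).
Proof.
have E n : ppow_part p g n = RtoC (if ppow p n then g n else 0) by rewrite /ppow_part; case: ifP.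
rewrite /local_factor (tsum_ext _ _ (fun n _ => E n)) tsum_RtoC //.
Qed.

Lemma euler_finite g s K : mult g -> absum (fun n => RtoC (g n)) K -> all prime s -> uniq s ->
  tsum (fun n => RtoC (g n)) =
  (RtoC (\big[Rmult/1]_(p <- s) local_factor g p) * tsum (sieve s (fun n => RtoC (g n))))%C.
Proof.
move=> mg hK; elim: s => [_ _|p s IH /= /andP[pp ps] /andP[pns us]].
  by rewrite big_nil Cmult_1_l; apply: tsum_ext.
rewrite IH // big_cons RtoC_mult -(tsum_ppow_part p g).
rewrite (Cmult_comm (tsum _)) -Cmult_assoc; congr (_ * _)%C.
rewrite -(tsum_conv _ _ _ _ (absum_ppow_part p _ _ hK) (absum_sieve (p :: s) _ _ hK)).
by apply: tsum_ext => n n0; rewrite conv_ppow_sieve.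
Qed.

(** The remainder t is the sum of g over the integers without prime factors below P, which tends to
    1 by [tsum_near_one]. *)
Lemma euler_product g K eps : mult g -> absum (fun n => RtoC (g n)) K -> 0 < eps ->
  exists P0, forall P, (P0 <= P)%N -> exists t, Rabs (t - 1) <= eps /\
    Series (fun k => g k.+1) = (\big[Rmult/1]_(p <- primes_below P) local_factor g p) * t.
Proof.
move=> mg hK e0.
have [P0 hP] := tsum_near_one (fun P => sieve (primes_below P) (fun n => RtoC (g n))) (fun n => RtoC (g n)) K eps hK e0
  ltac:(move=> P; rewrite /sieve; case: ifP => [/hasP[p]|_];
    [by rewrite mem_filter dvdn1 => /andP[+ _] /eqP pe; rewrite pe | by case: mg => ->])
  ltac:(by move=> P n hn; rewrite /sieve has_primes_below)
  ltac:(by move=> P n n0; rewrite /sieve; case: ifP => _; [rewrite Cmod_0; apply: Cmod_ge_0 | lra]).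
exists P0 => P /hP h.
have E n : sieve (primes_below P) (fun n => RtoC (g n)) n = RtoC (if has (fun q => q %| n)%N (primes_below P) then 0 else g n).
  by rewrite /sieve; case: ifP.
have := euler_finite g (primes_below P) K mg hK (primes_below_prime P) (primes_below_uniq P).
rewrite (tsum_ext _ _ (fun n _ => E n)) !tsum_RtoC in h * => hE.
eexists; split; first by move: h; rewrite -RtoC_minus Cmod_R; apply.
by move: hE; rewrite -RtoC_mult => -[->].
Qed.

(** The partial sum of the series over n <= p^k is the sum over the exponents a <= k. *)
Lemma local_factor_bounds g p K L lo hi : prime p -> absum (fun n => RtoC (g n)) K ->
  (forall k, (L <= k)%N -> lo <= \rsum_(0 <= a < k.+1) g (p ^ a)%N <= hi) ->
  lo <= local_factor g p <= hi.
Proof.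
move=> pp hK h.
have near eps : 0 < eps -> lo - eps <= local_factor g p <= hi + eps.
  move=> e0; have [N0 hN] := tsum_cvg _ _ (absum_ppow_part p g K hK) eps e0.
  pose k := (L + N0)%N.
  have kp : (k < p ^ k)%N by apply: ltn_expl; apply: prime_gt1.
  have := hN (p ^ k).+1 ltac:(rewrite /k in kp *; lia).
  have -> : \csum_(1 <= n < (p ^ k).+1) ppow_part p g n = RtoC (\rsum_(0 <= a < k.+1) g (p ^ a)%N).
    rewrite -(big_divisors_prime_pow _ _ _ g p k pp).
    have pk0 : (0 < p ^ k)%N by rewrite expn_gt0 prime_gt0.
    rewrite (sum_divisors_range g (p ^ k) (p ^ k)); last by rewrite pk0 leqnn.
    rewrite -csum_RtoC; apply: eq_big_nat => n /andP[n0 nk]; rewrite /ppow_part.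
    have -> : (n %| p ^ k)%N = ppow p n.
      rewrite ppowP //; apply/idP/eqP => [/(dvdn_pfactor _ _ pp) [i _ ->]|nE]; first by rewrite pfactorK.
      rewrite nE dvdn_exp2l // -(@leq_exp2l p) ?prime_gt1 // -nE; lia.
    by case: ifP.
  rewrite tsum_ppow_part -RtoC_minus Cmod_R; have := h k ltac:(rewrite /k; lia).
  by split_Rabs; lra.
split; apply: le_epsilon => eps e0; have := near eps e0; lra.
Qed.

(** * The Euler factors of F_m / phi and bounds for their product *)

Definition Fphi (m n : nat) : R := F m n / INR (totient n).
(* The sum of [Fphi m] over all positive integers, equal to [1 - dcoef m.+1]. *)
Definition euler_value (m : nat) : R := Series (fun k => Fphi m k.+1).
Definition local_F (m p : nat) : R := local_factor (Fphi m) p.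
Definition heightge (m a : nat) : R := if (m <= H a)%N then 1 else 0.

Lemma mult_Fphi m : mult (Fphi m).
Proof.
have [F1 FM] := mult_F m; split; first by rewrite /Fphi F1 /=; field.
move=> a b a0 b0 c; rewrite /Fphi FM // totient_coprime // mult_INR.
have ta := INR_gt0 _ (etrans (totient_gt0 a) a0); have tb := INR_gt0 _ (etrans (totient_gt0 b) b0).
by field; lra.
Qed.

Lemma absum_Fphi m : (0 < m)%N -> absum (fun n => RtoC (Fphi m n)) 96.
Proof.
move=> m0 N; have := powerful_totient_tail 1 N isT.
rewrite -[INR 1]/1 ln_1 Rmult_0_r exp_0 Rmult_1_r; apply: Rle_trans.
by apply: rsum_nat_le => n /andP[n0 _]; rewrite Cmod_R; apply: F_over_totient_abs.
Qed.

Lemma dcoef_euler m : (0 < m)%N -> dcoef m.+1 = 1 - euler_value m.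
Proof.
move=> m0; rewrite dcoefE // /euler_value (Series_incr_1 (fun k => Fphi m k.+1)).
  have -> : Fphi m 1 = 1 by case: (mult_Fphi m).
  by rewrite /dterm /Fphi; ring.
apply/ex_series_incr_1; exact: ex_series_Rabs (ex_series_dterm_abs m m0).
Qed.

Lemma INR_totient_pfactor p a : prime p -> INR (totient (p ^ a.+1)) = INR p ^ a * (INR p - 1).
Proof.
move=> pp; have p0 := prime_gt0 pp.
rewrite totient_pfactor //= mult_INR Rmult_comm.
have -> : INR p.-1 = INR p - 1 by rewrite -{2}(prednK p0) S_INR; ring.
by congr (_ * _); elim: a => [|a IH] //; rewrite expnS mult_INR IH.
Qed.

Lemma Fphi_partial_sum m p K : (0 < m)%N -> prime p ->
  \rsum_(0 <= a < K.+2) Fphi m (p ^ a) =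
  1 - \rsum_(1 <= a < K.+1) (heightge m a * / INR p ^ a) - heightge m K.+1 * / (INR p ^ K * (INR p - 1)).
Proof.
move=> m0 pp; have p1 : 1 < INR p by apply: (lt_INR 1); have := prime_gt1 pp; lia.
have fE a : f m (p ^ a.+1) = 1 - heightge m a.+1.
  rewrite /f /heightge H_prime_pow // ltnNge; case: (m <= H a.+1)%N => /=; ring.
have f1 : f m 1 = 1 by case: (mult_f m).
elim: K => [|K IH].
  rewrite big_nat_recr //= big_nat1 expn0 expn1 [X in _ - X - _]big_geq //.
  have -> : Fphi m 1 = 1 by case: (mult_Fphi m).
  rewrite /Fphi -{1 2}(expn1 p) F_prime_pow //= expn0 f1 fE INR_totient_pfactor //=.
  by field; lra.
rewrite big_nat_recr // IH [X in _ = _ - X - _]big_nat_recr //= /Fphi F_prime_pow // fE INR_totient_pfactor //.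
rewrite [K.+2.-1]/= fE /=; have pK : 0 < INR p ^ K by apply: pow_lt; lra.
by field; lra.
Qed.

(* By Abel summation the local factor at [p] is 1 - sum_(a | H a >= m) p^-a,
   because 1/phi(p^a) - 1/phi(p^(a+1)) = p^-a. *)
Lemma local_F_bounds m p L : (0 < m)%N -> prime p ->
  1 - \rsum_(1 <= a < L.+1) (heightge m a * / INR p ^ a) - / (INR p ^ L * (INR p - 1)) <= local_F m p <=
  1 - \rsum_(1 <= a < L.+1) (heightge m a * / INR p ^ a).
Proof.
move=> m0 pp; have p1 : 1 < INR p by apply: (lt_INR 1); have := prime_gt1 pp; lia.
have pk k : 0 < INR p ^ k by apply: pow_lt; lra.
have ipk k : 0 < / INR p ^ k by apply: Rinv_0_lt_compat.
have h01 a : 0 <= heightge m a <= 1 by rewrite /heightge; case: ifP => _; lra.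
apply: (local_factor_bounds _ _ _ L.+1 _ _ pp (absum_Fphi m m0)) => k Lk.
case: k Lk => // k Lk; rewrite Fphi_partial_sum // (@big_cat_nat _ _ _ L.+1 1 k.+1) //=.
set W := \rsum_(1 <= a < L.+1) _; set T := bigop.body _ _ _.
have T0 : 0 <= T.
  by apply: rsum_nat_ge0 => a _; apply: Rmult_le_pos; [have := h01 a; lra | apply: Rlt_le].
(* A discrete primitive of the geometric sequence: c (a + 1) - c a = p^(-a). *)
pose c j := - / (INR p ^ j * (INR p - 1)) * INR p.
have T1 : T <= / (INR p ^ L * (INR p - 1)) - / (INR p ^ k * (INR p - 1)).
  apply: (Rle_trans _ (\rsum_(L.+1 <= a < k.+1) (c a.+1 - c a))).
    rewrite /T. apply: rsum_nat_le => a _; have := h01 a; have := ipk a => ha hh.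
    have -> : c a.+1 - c a = / INR p ^ a by rewrite /c -tech_pow_Rmult; field; have := pk a; lra.
    nra.
  rewrite rsum_telescope // /c -!tech_pow_Rmult; apply: Req_le.
  by field; have := pk L; have := pk k; lra.
have i0 : 0 < / (INR p ^ k * (INR p - 1)) by apply: Rinv_0_lt_compat; apply: Rmult_lt_0_compat; [|lra].
by have := h01 k.+1; nra.
Qed.

Lemma local_F_low m p A : (0 < m)%N -> prime p -> (forall a, (0 < a <= A)%N -> (H a < m)%N) ->
  1 - / (INR p ^ A * (INR p - 1)) <= local_F m p.
Proof.
move=> m0 pp hA; have [h _] := local_F_bounds m p A m0 pp.
move: h; rewrite big_nat big1 => [|a ha]; first lra.
by rewrite /heightge leqNgt hA //= Rmult_0_l.
Qed.

Lemma local_F_01 m p : (0 < m)%N -> prime p -> 0 <= local_F m p <= 1.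
Proof.
move=> m0 pp; have p2 : 2 <= INR p by apply: (le_INR 2); have := prime_gt1 pp; lia.
have h := local_F_low m p 1 m0 pp ltac:(by case=> [|[|a]]).
have [_ h2] := local_F_bounds m p 0 m0 pp; rewrite big_geq // in h2.
have : / (INR p ^ 1 * (INR p - 1)) <= / 1 by apply: Rinv_le_contravar; [lra | rewrite pow_1; nra].
by rewrite Rinv_1; lra.
Qed.

(** H a >= 1 means a >= 2, so the factor is 1 minus the geometric sum of p^(-a) over a >= 2. *)
Lemma local_F1 p : prime p -> local_F 1 p = 1 - / (INR p * (INR p - 1)).
Proof.
move=> pp; have p2 : 2 <= INR p by apply: (le_INR 2); have := prime_gt1 pp; lia.
apply: Rle_antisym; last first.
  by have := local_F_low 1 p 1 isT pp ltac:(by case=> [|[|a]]); rewrite pow_1.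
apply: le_epsilon => eps e0.
have [L hL] := pow_lt_1_zero (/ INR p) ltac:(rewrite Rabs_pos_eq; [| by apply: Rlt_le; apply: Rinv_0_lt_compat; lra];
   rewrite -Rinv_1; apply: Rinv_lt_contravar; lra) eps e0.
have [_ h] := local_F_bounds 1 p L.+1 isT pp; apply: Rle_trans h _.
have pk k : 0 < INR p ^ k by apply: pow_lt; lra.
pose c j := - / (INR p ^ j * (INR p - 1)) * INR p.
have -> : \rsum_(1 <= a < L.+2) (heightge 1 a * / INR p ^ a) = \rsum_(2 <= a < L.+2) (c a.+1 - c a).
  rewrite big_ltn // [heightge 1 1]/= Rmult_0_l Rplus_0_l; apply: eq_big_nat => a /andP[a2 _].
  have -> : heightge 1 a = 1 by rewrite /heightge H_rec.
  by rewrite /c -tech_pow_Rmult; field; have := pk a; lra.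
rewrite rsum_telescope //; have := hL L (le_n L); rewrite pow_inv Rabs_pos_eq; last by apply: Rlt_le; apply: Rinv_0_lt_compat.
have -> : c L.+2 - c 2%N = / (INR p * (INR p - 1)) - / INR p ^ L * / (INR p * (INR p - 1)).
  by rewrite /c -!tech_pow_Rmult /=; field; have := pk L; lra.
have i1 : / (INR p * (INR p - 1)) <= / 1 by apply: Rinv_le_contravar; nra.
have i2 : 0 < / INR p ^ L by apply: Rinv_0_lt_compat.
rewrite Rinv_1 in i1; nra.
Qed.

(** The increments of u majorize 1 - [local_F m p] over the primes from X on, and a product of
    factors 1 - x in [0, 1] is at least 1 minus the sum of the x. *)
Lemma euler_value_bounds m X (u : nat -> R) : (0 < m)%N -> (forall n, (X <= n)%N -> 0 <= u n.+1 <= u n) -> u X <= 1 ->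
  (forall p, prime p -> (X <= p)%N -> 1 - local_F m p <= u p - u p.+1) ->
  (\big[Rmult/1]_(p <- primes_below X) local_F m p) * (1 - u X) <= euler_value m <=
  \big[Rmult/1]_(p <- primes_below X) local_F m p.
Proof.
move=> m0 hu uX hE; set Q := bigop.body _ _ _.
have Q01 : 0 <= Q <= 1.
  rewrite /Q big_seq; elim/big_ind: _ => [|x y hx hy|p]; [lra | nra |].
  by move=> /(allP (primes_below_prime X)); apply: local_F_01.
have tail j : u X - u (X + j)%N >= 0 /\ 1 - (u X - u (X + j)%N) <= \big[Rmult/1]_(p <- iota X j | prime p) local_F m p <= 1.
  elim: j => [|j [IH0 IH]]; first by rewrite addn0 big_nil; lra.
  have h := hu (X + j)%N ltac:(lia); rewrite addnS.
  have -> : iota X j.+1 = iota X j ++ [:: (X + j)%N] by rewrite -addn1 iotaD.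
  rewrite big_cat /= big_cons big_nil; set V := bigop.body _ _ _ in IH *.
  split; first lra.
  case: ifP => pp; last by rewrite Rmult_1_r; lra.
  have := hE _ pp ltac:(lia); have := local_F_01 m _ m0 pp; rewrite Rmult_1_r.
  have u1 : u (X + j)%N <= 1 by lra.
  have u0 : 0 <= u (X + j)%N by lra.
  nra.
have key eps : 0 < eps -> Q * (1 - u X) - eps <= euler_value m <= Q + eps.
  move=> e0; have [P0 hP] := euler_product (Fphi m) 96 eps (mult_Fphi m) (absum_Fphi m m0) e0.
  have [t [ht]] := hP (X + P0)%N ltac:(lia); rewrite -/(euler_value m) => ->.
  have -> : \big[Rmult/1]_(p <- primes_below (X + P0)) local_factor (Fphi m) p =
      Q * \big[Rmult/1]_(p <- iota X P0 | prime p) local_F m p.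
    by rewrite /primes_below big_filter iotaD big_cat add0n /= /Q /primes_below big_filter.
  have [h0 h1] := tail P0; set V := bigop.body _ _ _ in h1 *.
  have uP : 0 <= u (X + P0)%N.
    case: (P0) => [|j]; last by rewrite addnS; have := hu (X + j)%N ltac:(lia); lra.
    by rewrite addn0; have := hu X (leqnn _); lra.
  have V0 : 0 <= V by lra.
  have QV : 0 <= Q * V <= Q by nra.
  have : Q * V * t = Q * V + Q * V * (t - 1) by ring.
  have : Rabs (Q * V * (t - 1)) <= eps.
    by rewrite Rabs_mult (Rabs_pos_eq (Q * V)); [have := Rabs_pos (t - 1); nra | lra].
  have : Q * (1 - u X) <= Q * V by apply: Rmult_le_compat_l; lra.
  by split_Rabs; lra.
split; apply: le_epsilon => eps e0; have := key eps e0; lra.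
Qed.

(** * The numerical value *)

(* Fixed-point enclosures, in multiples of 1 / scale, of finite Euler products. *)
Definition scale : Z := (2 ^ 40)%Z.
Definition trial_primes : seq nat :=
  [:: 2; 3; 5; 7; 11; 13; 17; 19; 23; 29; 31; 37; 41; 43; 47; 53; 59; 61; 67; 71]%N.
(** The list contains all primes below 73, so trial division decides primality for 1 < n < 73^2 =
    5329. *)
Definition primeZ (n : Z) : bool :=
  all (fun p => (n <? Z.of_nat p * Z.of_nat p)%Z || ~~ (n mod Z.of_nat p =? 0)%Z) trial_primes.

(** The products are rounded down in [lo] and up in [hi]. The lower factor is clipped at 0, so that
    the inequalities can be multiplied even if its enclosure is negative. *)
Fixpoint euler_loop (flo fhi : Z -> Z) (k : nat) (n lo hi : Z) : Z * Z :=
  match k with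
  | 0 => (lo, hi)
  | k'.+1 =>
    if primeZ n
    then euler_loop flo fhi k' (n + 1)%Z (lo * Z.max 0 (flo n) / scale)%Z (hi * fhi n / scale + 1)%Z
    else euler_loop flo fhi k' (n + 1)%Z lo hi
  end.

Lemma dvdnZ p n : (0 < p)%N -> (Z.of_nat n mod Z.of_nat p =? 0)%Z = (p %| n)%N.
Proof.
move=> p0; apply/idP/idP => [/Z.eqb_eq h|/dvdnP[k ->]].
  have e := Z.div_mod (Z.of_nat n) (Z.of_nat p) ltac:(lia).
  have q0 : (0 <= Z.of_nat n / Z.of_nat p)%Z by apply: Z.div_pos; lia.
  by apply/dvdnP; exists (Z.to_nat (Z.of_nat n / Z.of_nat p)); nia.
by apply/Z.eqb_eq; have -> : Z.of_nat (k * p) = (Z.of_nat k * Z.of_nat p)%Z by [lia]; apply: Z_mod_mult.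
Qed.

Lemma primeZ_correct n : (1 < n)%N -> (n < 73 * 73)%N -> primeZ (Z.of_nat n) = prime n.
Proof.
move=> n1 n73.
have tp : all prime trial_primes by [].
have tpc : all (fun p => prime p ==> (p \in trial_primes)) (iota 0 73) by [].
have E p : p \in trial_primes -> (Z.of_nat n <? Z.of_nat p * Z.of_nat p)%Z || ~~ (Z.of_nat n mod Z.of_nat p =? 0)%Z =
    ((n < p * p)%N || ~~ (p %| n)%N).
  move=> pt; rewrite dvdnZ; last by apply: prime_gt0; apply: (allP tp).
  by congr orb; apply/idP/idP => [/Z.ltb_lt|h]; [nia | apply/Z.ltb_lt; nia].
rewrite /primeZ (eq_in_all E); apply/idP/idP => [/allP h|pn].
  apply: contraT => /primePns[|[p [pp p2 pn]]]; first by lia.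
  have p73 : (p < 73)%N by rewrite -(@ltn_sqr p 73); apply: leq_ltn_trans p2 _.
  have pt : p \in trial_primes by have := allP tpc p ltac:(rewrite mem_iota; lia); rewrite pp.
  by have := h p pt; rewrite pn orbF; rewrite -mulnn in p2; lia.
apply/allP => p pt; rewrite -implyNb; apply/implyP; rewrite -leqNgt => hp; apply/negP => pd.
have pp := allP tp p pt; move: pd; rewrite dvdn_prime2 // => /eqP e.
by have := prime_gt1 pp; nia.
Qed.

Lemma IZR_div_bounds a b : (0 < b)%Z -> IZR (a / b) <= IZR a / IZR b < IZR (a / b) + 1.
Proof.
move=> b0; have bp : 0 < IZR b by apply: IZR_lt.
have e := Z.div_mod a b ltac:(lia); have m := Z.mod_pos_bound a b b0.
have E : IZR a / IZR b = IZR (a / b) + IZR (a mod b) / IZR b by rewrite {1}e plus_IZR mult_IZR; field; lra.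
have h0 : 0 <= IZR (a mod b) by apply: IZR_le; lia.
have h1 : IZR (a mod b) < IZR b by apply: IZR_lt; lia.
rewrite E; split.
  by have := Rdiv_le_0_compat _ _ h0 bp; lra.
apply: Rplus_lt_compat_l; apply: (Rmult_lt_reg_r (IZR b)) => //.
by rewrite /Rdiv Rmult_assoc Rinv_l; lra.
Qed.

Lemma euler_loopP (E : nat -> R) flo fhi k n lo hi Q :
  (forall p, prime p -> 0 <= E p /\ IZR (flo (Z.of_nat p)) <= IZR scale * E p <= IZR (fhi (Z.of_nat p))) ->
  (1 < n)%N -> (n + k <= 73 * 73)%N -> 0 <= Q -> (0 <= lo)%Z -> IZR lo <= IZR scale * Q <= IZR hi ->
  IZR (euler_loop flo fhi k (Z.of_nat n) lo hi).1 <=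
    IZR scale * (Q * \big[Rmult/1]_(p <- iota n k | prime p) E p) <=
  IZR (euler_loop flo fhi k (Z.of_nat n) lo hi).2.
Proof.
move=> hE; have sp : 0 < IZR scale by apply: IZR_lt.
elim: k n lo hi Q => [|k IH] n lo hi Q n1 nk Q0 lo0 h; first by rewrite /= big_nil Rmult_1_r.
rewrite [euler_loop _ _ _ _ _ _]/= primeZ_correct //; last by lia.
have -> : (Z.of_nat n + 1 = Z.of_nat n.+1)%Z by lia.
rewrite [iota _ _]/= big_cons; case: (boolP (prime n)) => pn; last by apply: IH => //; lia.
have [E0 [E1 E2]] := hE n pn.
rewrite -(Rmult_assoc Q); apply: IH; [lia | lia | exact: Rmult_le_pos | |].
  by apply: Z.div_pos => //; apply: Z.mul_nonneg_nonneg => //; lia.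
have [d1 _] := IZR_div_bounds (lo * Z.max 0 (flo (Z.of_nat n))) scale ltac:(done).
have [_ d2] := IZR_div_bounds (hi * fhi (Z.of_nat n)) scale ltac:(done).
have m1 : 0 <= IZR (Z.max 0 (flo (Z.of_nat n))) <= IZR scale * E n.
  split; first by apply: IZR_le; lia.
  by case: (Z.max_spec 0 (flo (Z.of_nat n))) => -[_ ->] //; apply: Rmult_le_pos; lra.
rewrite mult_IZR in d1; rewrite mult_IZR in d2; rewrite plus_IZR.
have l0 : 0 <= IZR lo by apply: IZR_le.
have g1 : IZR lo * IZR (Z.max 0 (flo (Z.of_nat n))) <= (IZR scale * Q) * (IZR scale * E n).
  by apply: Rmult_le_compat; lra.
have g2 : (IZR scale * Q) * (IZR scale * E n) <= IZR hi * IZR (fhi (Z.of_nat n)).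
  by apply: Rmult_le_compat; nra.
have e : IZR scale * (Q * E n) = (IZR scale * Q) * (IZR scale * E n) / IZR scale by field; lra.
split.
  apply: Rle_trans d1 _; rewrite e; apply: Rmult_le_compat_r => //.
  by apply: Rlt_le; apply: Rinv_0_lt_compat.
apply: Rle_trans (Rlt_le _ _ d2); rewrite e; apply: Rmult_le_compat_r => //.
by apply: Rlt_le; apply: Rinv_0_lt_compat.
Qed.

Lemma euler_prefix (E : nat -> R) flo fhi k lo hi :
  (forall p, prime p -> 0 <= E p /\ IZR (flo (Z.of_nat p)) <= IZR scale * E p <= IZR (fhi (Z.of_nat p))) ->
  (2 + k <= 73 * 73)%N -> euler_loop flo fhi k 2 scale scale = (lo, hi) ->
  IZR lo <= IZR scale * \big[Rmult/1]_(p <- primes_below (2 + k)) E p <= IZR hi.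
Proof.
move=> hE hk hr.
have := euler_loopP E flo fhi k 2 scale scale 1 hE isT hk Rle_0_1 ltac:(by rewrite /scale; lia) ltac:(lra).
rewrite -[Z.of_nat 2]/2%Z hr Rmult_1_l /primes_below big_filter iotaD add0n big_cat.
by rewrite [X in _ * (Rmult X _)]big_cons [X in _ * (Rmult X _)]big_cons big_nil Rmult_1_l.
Qed.

Lemma IZR_nat n : IZR (Z.of_nat n) = INR n.
Proof. by rewrite INR_IZR_INZ. Qed.

Definition lo1 (n : Z) : Z := (scale - scale / (n * (n - 1)) - 1)%Z.
Definition hi1 (n : Z) : Z := (scale - scale / (n * (n - 1)))%Z.

Lemma local_F1_scaled p : prime p ->
  0 <= local_F 1 p /\ IZR (lo1 (Z.of_nat p)) <= IZR scale * local_F 1 p <= IZR (hi1 (Z.of_nat p)).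
Proof.
move=> pp; have [p0 _] := local_F_01 1 p isT pp; split=> //.
have p1 := prime_gt1 pp.
have p2 : 2 <= INR p by apply: (le_INR 2); lia.
have := IZR_div_bounds scale (Z.of_nat p * (Z.of_nat p - 1)) ltac:(nia).
rewrite local_F1 // /lo1 /hi1 !minus_IZR mult_IZR minus_IZR IZR_nat.
have -> : IZR scale * (1 - / (INR p * (INR p - 1))) = IZR scale - IZR scale / (INR p * (INR p - 1)) by rewrite /Rdiv; ring.
lra.
Qed.

(* The exponents a <= 20 with H a >= 2. *)
Definition exps2 : seq nat := [:: 4; 8; 9; 12; 16; 18; 20]%N.
Definition hi2 (n : Z) : Z :=
  foldr (fun a s => s - scale / n ^ Z.of_nat a)%Z scale exps2.
(** The quotients are rounded up, and the term with n^20 (n - 1) bounds all exponents beyond 20. *)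
Definition lo2 (n : Z) : Z :=
  foldr (fun a s => s - (scale / n ^ Z.of_nat a + 1))%Z (scale - (scale / (n ^ 20 * (n - 1)) + 1))%Z exps2.

Lemma height_ge2 a : (1 < H a)%N = has (fun p => 1 < logn p a)%N (primes a).
Proof.
have Hgt0 n : (0 < H n)%N = (1 < n)%N.
  by case: (leqP n 1) => hn; [case: n hn => [|[|n]] | rewrite H_rec].
case: (leqP a 1) => a1; first by case: a a1 => [|[|a]].
apply/idP/hasP => [|[p pa la]].
  have [p [pa ->]] := H_attained a a1; rewrite ltnS Hgt0 => la; by exists p.
rewrite H_rec // ltnS; apply: (@leq_trans (H (logn p a))); first by rewrite Hgt0.
exact: leq_bigmax_seq.
Qed.

Lemma local_F2_scaled p : prime p ->
  0 <= local_F 2 p /\ IZR (lo2 (Z.of_nat p)) <= IZR scale * local_F 2 p <= IZR (hi2 (Z.of_nat p)).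
Proof.
move=> pp; have [p0 _] := local_F_01 2 p isT pp; split=> //.
have p1 := prime_gt1 pp; have p2 : 2 <= INR p by apply: (le_INR 2); lia.
have sp : 0 < IZR scale by apply: IZR_lt.
have [b1 b2] := local_F_bounds 2 p 20 isT pp.
have e : \rsum_(1 <= a < 21) (heightge 2 a * / INR p ^ a) = \rsum_(a <- exps2) / INR p ^ a.
  have -> : exps2 = [seq a <- index_iota 1 21 | (2 <= H a)%N].
    by rewrite (eq_filter height_ge2).
  rewrite big_filter [RHS]big_mkcond; apply: eq_bigr => a _.
  by rewrite /heightge; case: ifP => _; ring.
rewrite e in b1 b2.
have pw a : IZR (Z.of_nat p ^ Z.of_nat a) = INR p ^ a by rewrite -pow_IZR IZR_nat.
have pz a : (0 < Z.of_nat p ^ Z.of_nat a)%Z by apply: Z.pow_pos_nonneg; lia.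
have dv a := IZR_div_bounds scale (Z.of_nat p ^ Z.of_nat a) (pz a).
have dv20 := IZR_div_bounds scale (Z.of_nat p ^ 20 * (Z.of_nat p - 1)) ltac:(apply: Z.mul_pos_pos; [exact: (pz 20%N) | lia]).
rewrite mult_IZR minus_IZR IZR_nat (pw 20%N) in dv20.
have hlo (s : seq nat) c x : IZR c <= x ->
   IZR (foldr (fun a s => s - (scale / Z.of_nat p ^ Z.of_nat a + 1))%Z c s) <= x - IZR scale * \rsum_(a <- s) / INR p ^ a.
  move=> hx; elim: s => [|a s IH] /=; first by rewrite big_nil; lra.
  by rewrite big_cons minus_IZR plus_IZR; have := dv a; rewrite pw /Rdiv; lra.
have hhi (s : seq nat) c x : x <= IZR c -> x - IZR scale * (\rsum_(a <- s) / INR p ^ a) <=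
   IZR (foldr (fun a s => s - scale / Z.of_nat p ^ Z.of_nat a)%Z c s).
  move=> hx; elim: s => [|a s IH] /=; first by rewrite big_nil; lra.
  by rewrite big_cons minus_IZR; have := dv a; rewrite pw /Rdiv; lra.
move: b1 b2; set W := bigop.body _ _ _ => b1 b2; split.
  apply: (Rle_trans _ (IZR scale - IZR scale * / (INR p ^ 20 * (INR p - 1)) - IZR scale * W)).
    by apply: hlo; rewrite minus_IZR plus_IZR; move: dv20; rewrite /Rdiv; lra.
  by have := Rmult_le_compat_l _ _ _ (Rlt_le _ _ sp) b1; lra.
apply: (Rle_trans _ (IZR scale - IZR scale * W)); last exact: hhi (Rle_refl _).
by have := Rmult_le_compat_l _ _ _ (Rlt_le _ _ sp) b2; lra.
Qed.

Lemma H_lt_of_lt m a : (0 < m)%N -> (a < 2 ^ 2 ^ m.-1)%N -> (H a < m)%N.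
Proof.
move=> m0 h; case: (leqP m (H a)) => // hm.
have := expn_expn_H_le a ltac:(lia); have : (2 ^ 2 ^ m.-1 <= 2 ^ 2 ^ (H a).-1)%N.
  by rewrite !leq_exp2l //; lia.
lia.
Qed.

(** By [local_F1] this is Artin's constant, the product of 1 - 1/(p (p - 1)) over all primes. *)
Lemma euler_value1_bounds : 373926287 / 1000000000 <= euler_value 1 <= 373963701 / 1000000000.
Proof.
have hloop : euler_loop lo1 hi1 (49 * 102)%N 2 scale scale = (411177435734, 411177436662)%Z by vm_compute.
have := euler_prefix (local_F 1) lo1 hi1 (49 * 102)%N _ _ local_F1_scaled ltac:(lia) hloop; clear hloop.
(* As a function of the half of n, u decreases only from an odd n to n + 1, that is, where primes
   can lie. This halves the tail bound, to 1/9996 at n = 5000. *)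
pose u n := / (4 * (INR n./2 - 1)).
have hk n : (2 + 49 * 102 <= n)%N -> 2500 <= INR n./2.
  by move=> h; rewrite INR_IZR_INZ; apply: IZR_le; have := odd_double_half n; rewrite -muln2; case: (odd n) => /=; lia.
have [||p pp hp|] := euler_value_bounds 1 (2 + 49 * 102) u isT.
- move=> n hn; have h1 := hk n hn; have h2 := hk n.+1 ltac:(lia).
  have : INR n./2 <= INR n.+1./2 by apply: le_INR; have := half_leq (leqnSn n); lia.
  split; first by apply: Rlt_le; apply: Rinv_0_lt_compat; lra.
  by apply: Rinv_le_contravar; lra.
- have h := hk (2 + 49 * 102)%N (leqnn _).
  by rewrite /u -[X in _ <= X]Rinv_1; apply: Rinv_le_contravar; lra.
- rewrite local_F1 //; have h := hk p hp.
  have op : odd p by have := even_prime pp => -[pe|//]; move: hp; rewrite pe.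
  have e1 : p = (p./2).*2.+1 by have := odd_double_half p; rewrite op; lia.
  have e2 : p.+1./2 = p./2.+1 by rewrite e1 /= doubleK uphalf_double.
  rewrite /u e2 S_INR; have -> : INR p = 2 * INR p./2 + 1.
    by rewrite {1}e1 S_INR -muln2 mult_INR -[INR 2]/2; ring.
  set k := INR p./2 in h *.
  have -> : / (4 * (k - 1)) - / (4 * (k + 1 - 1)) = / (4 * k * (k - 1)) by field; lra.
  have -> : 1 - (1 - / ((2 * k + 1) * (2 * k + 1 - 1))) = / ((2 * k + 1) * (2 * k)) by field; lra.
  by apply: Rinv_le_contravar; nra.
set Q := bigop.body _ _ _ => l1 l2 [h1 h2].
have uX : u (2 + 49 * 102)%N <= / 9996.
  by apply: Rinv_le_contravar; [lra | have := hk (2 + 49 * 102)%N (leqnn _); lra].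
rewrite -[IZR scale]/(IZR (2 ^ 40)%Z) [(2 ^ 40)%Z]/= in h1 h2.
have q1 : Q * (1 - / 9996) <= Q * (1 - u (2 + 49 * 102)%N) by apply: Rmult_le_compat_l; lra.
lra.
Qed.

Lemma euler_value2_bounds : 917707982 / 1000000000 <= euler_value 2 <= 917709851 / 1000000000.
Proof.
have hloop : euler_loop lo2 hi2 98 2 scale scale = (1009031617729, 1009032651274)%Z by vm_compute.
have := euler_prefix (local_F 2) lo2 hi2 98 _ _ local_F2_scaled isT hloop; clear hloop.
(* H a >= 2 forces a >= 4, so the defect of the local factor is at most 1 / (p^3 (p - 1)). For p >=
   100 this is at most 1 / (10000 p (p - 1)), which telescopes. *)
pose u n := / (10000 * (INR n - 1)).
have hn n : (2 + 98 <= n)%N -> 100 <= INR n.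
  by move=> h; rewrite INR_IZR_INZ; apply: IZR_le; lia.
have [||p pp hp|] := euler_value_bounds 2 (2 + 98) u isT.
- move=> n h; have h1 := hn n h; have h2 := hn n.+1 ltac:(lia); rewrite /u S_INR.
  split; first by apply: Rlt_le; apply: Rinv_0_lt_compat; lra.
  by apply: Rinv_le_contravar; lra.
- have h := hn (2 + 98)%N (leqnn _).
  by rewrite /u -[X in _ <= X]Rinv_1; apply: Rinv_le_contravar; lra.
- have h := hn p hp.
  have := local_F_low 2 p 3 isT pp (fun a ha => H_lt_of_lt 2 a isT ltac:(have -> : (2 ^ 2 ^ 2.-1 = 4)%N by []; lia)).
  rewrite /u S_INR; set x := INR p in h * => h1.
  have -> : / (10000 * (x - 1)) - / (10000 * (x + 1 - 1)) = / (10000 * x * (x - 1)) by field; lra.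
  have : / (x ^ 3 * (x - 1)) <= / (10000 * x * (x - 1)); last lra.
  apply: Rinv_le_contravar; first by apply: Rmult_lt_0_compat; lra.
  apply: Rmult_le_compat_r; first lra.
  have -> : x ^ 3 = x * x * x by ring.
  by apply: Rmult_le_compat_r; nra.
set Q := bigop.body _ _ _ => l1 l2 [h1 h2].
have uX : u (2 + 98)%N <= / 990000.
  by apply: Rinv_le_contravar; [lra | have := hn (2 + 98)%N (leqnn _); lra].
rewrite -[IZR scale]/(IZR (2 ^ 40)%Z) [(2 ^ 40)%Z]/= in h1 h2.
have q1 : Q * (1 - / 990000) <= Q * (1 - u (2 + 98)%N) by apply: Rmult_le_compat_l; lra.
lra.
Qed.

Lemma euler_value_near1 m A : (0 < m)%N -> (0 < A)%N -> (forall a, (0 < a <= A)%N -> (H a < m)%N) ->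
  0 <= 1 - euler_value m <= / 2 ^ A + / 3 ^ A.-1 / 2.
Proof.
move=> m0 A0 hA; have p2 : 0 < / 2 ^ A by apply: Rinv_0_lt_compat; apply: pow_lt; lra.
have p3 : 0 < / 3 ^ A.-1 by apply: Rinv_0_lt_compat; apply: pow_lt; lra.
(* The prime 2 contributes at most 2^(-A). For p >= 3 the defect p^(-A) / (p - 1) is at most 3^(-(A
   - 1)) / (p (p - 1)), which telescopes from 3 on to half of 3^(-(A - 1)). *)
pose u n := if (n <= 2)%N then / 2 ^ A + / 3 ^ A.-1 / 2 else / 3 ^ A.-1 / (INR n - 1).
have hn n : (2 < n)%N -> 3 <= INR n by move=> h; rewrite INR_IZR_INZ; apply: IZR_le; lia.
have i2 : / 2 ^ A <= / 2.
  apply: Rinv_le_contravar; first lra.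
  by rewrite -{1}(pow_1 2); apply: Rle_pow; [lra | lia].
have i3 : / 3 ^ A.-1 <= / 1 by apply: Rinv_le_contravar; [lra | apply: pow_R1_Rle; lra].
have [|||] := euler_value_bounds m 2 u m0.
- move=> n n2; rewrite /u; case: (leqP n 2) => h.
    have -> : (n.+1 <= 2)%N = false by lia.
    have -> : n = 2%N by lia.
    have e3 : INR 3 = 3 by rewrite INR_IZR_INZ.
    by rewrite e3; have -> : 3 - 1 = 2 by [ring]; rewrite /Rdiv; lra.
  have -> : (n.+1 <= 2)%N = false by lia.
  have h3 := hn n h; rewrite S_INR; split.
    by apply: Rlt_le; apply: Rdiv_lt_0_compat; lra.
  by apply: Rmult_le_compat_l; [lra | apply: Rinv_le_contravar; lra].
- by rewrite /u /=; lra.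
- move=> p pp p2'; have := local_F_low m p A m0 pp hA; rewrite /u.
  case: (leqP p 2) => h.
    have -> : p = 2%N by lia.
    have e3 : INR 3 = 3 by rewrite INR_IZR_INZ.
    have e2 : INR 2 = 2 by rewrite INR_IZR_INZ.
    rewrite e2 e3; have -> : 2 - 1 = 1 by ring.
    rewrite Rmult_1_r; have -> : 3 - 1 = 2 by ring.
    by rewrite ltnn; lra.
  have -> : (p.+1 <= 2)%N = false by lia.
  have h3 := hn p h; rewrite S_INR; set x := INR p in h3 * => h1.
  have e : / 3 ^ A.-1 / (x - 1) - / 3 ^ A.-1 / (x + 1 - 1) = / 3 ^ A.-1 * / (x * (x - 1)).
    by rewrite /Rdiv; move: (/ 3 ^ A.-1) => c; field; lra.
  rewrite e; have : / (x ^ A * (x - 1)) <= / 3 ^ A.-1 * / (x * (x - 1)); last lra.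
  have q3 : 0 < 3 ^ A.-1 by apply: pow_lt; lra.
  rewrite -Rinv_mult; apply: Rinv_le_contravar.
    by apply: Rmult_lt_0_compat => //; nra.
  have -> : x ^ A = x ^ A.-1 * x by rewrite -{1}(prednK A0) -tech_pow_Rmult; ring.
  rewrite Rmult_assoc; apply: Rmult_le_compat_r; first nra.
  by apply: pow_incr; lra.
have -> : primes_below 2 = [::] by [].
by rewrite big_nil /u /=; lra.
Qed.

Lemma c0_bounds : 17083 / 10000 <= c0 < 17084 / 10000.
Proof.
have h1 := euler_value1_bounds; have h2 := euler_value2_bounds.
(* Height 3 first occurs at 2^(2^2) = 16, hence 15. Heights m >= 4 need an exponent of at least
   2^(2^3) = 256, of which the bound 63 below makes partial use. *)
have h3 := euler_value_near1 3 15 isT isT (fun a ha => H_lt_of_lt 3 a isT ltac:(have -> : (2 ^ 2 ^ 3.-1 = 16)%N by []; lia)).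
have h4 m : (4 <= m)%N -> 0 <= 1 - euler_value m <= / 2 ^ 63 + / 3 ^ 62 / 2.
  move=> m4; apply: (euler_value_near1 m 63) => [||a ha]; [lia | by [] |].
  apply: H_lt_of_lt; first by lia.
  apply: (@leq_trans (2 ^ 2 ^ 3)); first by have -> : (2 ^ 2 ^ 3 = 256)%N by [lia]; lia.
  by rewrite !leq_exp2l //; lia.
have ht := dcoef_tail 40 isT.
rewrite big_ltn // big_ltn // big_ltn // big_ltn // in ht.
rewrite (dcoef_euler 1 isT) (dcoef_euler 2 isT) (dcoef_euler 3 isT) in ht.
have hr : 0 <= \rsum_(4 <= k < 40) dcoef k.+1 <= 36 * (/ 2 ^ 63 + / 3 ^ 62 / 2).
  split; first by apply: rsum_nat_ge0 => k hk; rewrite dcoef_euler; [have := h4 k; move=> /(_ ltac:(lia)); lra | lia].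
  have -> : 36 = INR (40 - 4) by rewrite INR_IZR_INZ.
  rewrite -rsum_const; apply: rsum_nat_le => k hk; rewrite dcoef_euler; last by lia.
  by have := h4 k; move=> /(_ ltac:(lia)); lra.
have hd : dcoef 1 = 1 by [].
rewrite hd in ht; move: hr ht; set T := bigop.body _ _ _ => hr ht.
clear h4.
have b63 : / 2 ^ 63 <= / 1000000000000000000.
  by apply: Rinv_le_contravar; lra.
have b62 : / 3 ^ 62 <= / 1000000000000000000.
  by apply: Rinv_le_contravar; lra.
have b40 : / 2 ^ 40 <= / 1000000000000 by apply: Rinv_le_contravar; lra.
have b15 : / 2 ^ 15 = / 32768 by congr (/ _); ring.
have b14 : / 3 ^ 15.-1 = / 4782969 by congr (/ _); rewrite /=; ring.
rewrite b15 b14 in h3.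
by move: ht; split_Rabs; lra.
Qed.

(** [Series] has a value even when the series diverges, so the convergence of the series behind d_m
    and c_0 is asserted along with the formula and the numerical value. *)
Theorem theorem1 :
  (* the series defining d_m (m >= 2) and c_0 converge *)
  (forall m : nat, (2 <= m)%N -> ex_series (dterm m.-1)) /\
  is_series (fun k => dcoef k.+1) c0 /\
  (* asymptotic formula, for every fixed A >= 2 *)
  (forall A : R, (2 <= A)%R ->
     exists C x0 : R, forall x : R, (x0 <= x)%R ->
       (Rabs (Msum x - c0 * primepi x) <= C * (x / Rpower (ln x) A))%R) /\
  (* numerical value c_0 = 1.7083... *)
  (17083 / 10000 <= c0 < 17084 / 10000)%R.
Proof.
split; [|split; [|split]].
- by move=> m m2; apply: ex_series_Rabs; apply: ex_series_dterm_abs; lia.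
- exact: Series_correct _ (ex_series_Rabs _ ex_series_dcoef).
- exact: height_asymptotics.
- exact: c0_bounds.
Qed.
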